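(* Let $D_1,D_2\ge1$ be square-free and co-prime, and let $\chi_1,\chi_2$ be primitive Dirichlet characters modulo $D_1,D_2$ respectively. Let $c\ge1$ and $a$ be integers with $(a,c)=1$. For $j=1,2$ write $D_j=D_j'(c,D_j)$ and factor $\chi_j=\chi_j'\chi_j''$ with $\chi_j'$ primitive modulo $D_j'$ and $\chi_j''$ primitive modulo $(c,D_j)$. Then for every smooth function $g$ compactly supported in $(0,\infty)$, \begin{align*} \sum_{n\ge1}(\chi_1*\chi_2)(n)e\Big(\frac{an}{c}\Big)g(n)&=\mathds{1}_{D_1\mid c}\frac{\sqrt{D_1}\epsilon(\chi_1)\overline{\chi_1}(a)\chi_2(c\overline{D_1})}{c}L(1,\overline{\chi_1}\chi_2)\int_0^\infty g(x)\,dx\\ &\quad+\mathds{1}_{D_2\mid c}\frac{\sqrt{D_2}\epsilon(\chi_2)\chi_1(c\overline{D_2})\chi_2(\overline a)}{c}L(1,\chi_1\overline{\chi_2})\int_0^\infty g(x)\,dx\\ &\quad+\frac{\epsilon(\chi_1')\epsilon(\chi_2')\chi_1'\chi_2'(c)\chi_1''(-\overline{aD_2'})\chi_2''(-\overline{aD_1'})}{c\sqrt{D_1'D_2'}}T_{D_1,D_2}(a,c), \end{align*} where, with $\rho=\overline{\chi_1'}\chi_2''*\chi_1''\overline{\chi_2'}$ and $Z_n(x)=\frac{4\pi\sqrt{nx}}{c\sqrt{D_1'D_2'}}$, \begin{align*} T_{D_1,D_2}(a,c)&=-\big(1+\chi_1\chi_2(-1)\big)\pi\sum_{n\ge1}\rho(n)e\Big(-\frac{\overline{aD_1'D_2'}\,n}{c}\Big)\int_0^\infty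 g(x)Y_0(Z_n(x))\,dx\\ &\quad-\big(1-\chi_1\chi_2(-1)\big)i\pi\sum_{n\ge1}\rho(n)e\Big(-\frac{\overline{aD_1'D_2'}\,n}{c}\Big)\int_0^\infty g(x)J_0(Z_n(x))\,dx\\ &\quad+2\big(\overline{\chi_1'}\chi_2''(-1)+\chi_1''\overline{\chi_2'}(-1)\big)\sum_{n\ge1}\rho(n)e\Big(\frac{\overline{aD_1'D_2'}\,n}{c}\Big)\int_0^\infty g(x)K_0(Z_n(x))\,dx. \end{align*}
   Context: $e(x)=e^{2\pi ix}$; $*$ is Dirichlet convolution; $\mathds{1}_{P}$ is the indicator of the condition $P$. For a primitive character $\psi$ modulo $m$, $\epsilon(\psi)=\tau(\psi)/\sqrt m$ with $\tau(\psi)=\sum_{x\bmod m}\psi(x)e(x/m)$. In $\chi_2(c\overline{D_1})$, $\overline{D_1}$ is the inverse of $D_1$ modulo $D_2$; in $\chi_1(c\overline{D_2})$, $\overline{D_2}$ is the inverse modulo $D_1$; $\overline a$ in $\chi_2(\overline a)$ is the inverse of $a$ modulo $D_2$; $\overline{aD_2'}$ in $\chi_1''$ is an inverse modulo $(c,D_1)$, $\overline{aD_1'}$ in $\chi_2''$ an inverse modulo $(c,D_2)$; and $\overline{aD_1'D_2'}$ in the exponentials is the inverse modulo $c$. $J_0,Y_0,K_0$ are the standard Bessel functions. $L(s,\cdot)$ is the Dirichlet $L$-function.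
   Formalization: The case D_1 = D_2 = 1 is excluded (D_1D_2 > 1 is assumed), because there both characters are trivial and L(1, ·) is the divergent value ζ(1), so the formula is undefined. *)

(* Defs.v *)
From Stdlib Require Import Reals ZArith List Lra.
From Coquelicot Require Import Coquelicot.
Import ListNotations.

Definition e (x : R) : C := (cos (2 * PI * x), sin (2 * PI * x)).

Fixpoint csum (f : nat -> C) (n : nat) : C :=
  match n with O => RtoC 0 | S k => Cplus (csum f k) (f k) end.

Definition CSeries1 (u : nat -> C) : C :=
  (real (Lim_seq (fun N => fst (csum (fun k => u (S k)) N))),
   real (Lim_seq (fun N => snd (csum (fun k => u (S k)) N)))).

Definition Rint0oo (f : R -> R) : R := real (Lim_seq (fun N => RInt f 0 (INR N))).
Definition Cint0oo (f : R -> C) : C :=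
  (Rint0oo (fun x => fst (f x)), Rint0oo (fun x => snd (f x))).

Definition squarefree (D : Z) : Prop :=
  forall k : Z, (k * k | D)%Z -> (k * k = 1)%Z.

(* an inverse of a modulo m (the least nonnegative one; 0 if none exists) *)
Definition invmod (a m : Z) : Z :=
  match find (fun b => Z.eqb ((a * b) mod m) (1 mod m))
             (map Z.of_nat (seq 0 (Z.to_nat m))) with
  | Some b => b | None => 0%Z end.

Record dirichlet_char (m : Z) (chi : Z -> C) : Prop := {
  dc_pos : (0 < m)%Z;
  dc_one : chi 1%Z = RtoC 1;
  dc_mul : forall x y : Z, chi (x * y)%Z = Cmult (chi x) (chi y);
  dc_per : forall x : Z, chi (x + m)%Z = chi x;
  dc_zero : forall x : Z, Z.gcd x m <> 1%Z -> chi x = RtoC 0 }.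

(* primitive: not induced by a character of any proper divisor d of m, i.e.
   for each proper divisor d there are units x = y mod d with chi x <> chi y *)
Definition primitive_char (m : Z) (chi : Z -> C) : Prop :=
  dirichlet_char m chi /\
  forall d : Z, (0 < d < m)%Z -> (d | m)%Z ->
    exists x y : Z, Z.gcd x m = 1%Z /\ Z.gcd y m = 1%Z /\
      (x mod d = y mod d)%Z /\ chi x <> chi y.

Definition cconj_fun (chi : Z -> C) : Z -> C := fun x => Cconj (chi x).
Definition cmul_fun (f g : Z -> C) : Z -> C := fun x => Cmult (f x) (g x).

Definition gauss_sum (m : Z) (psi : Z -> C) : C :=
  csum (fun k => Cmult (psi (Z.of_nat k)) (e (INR k / IZR m))) (Z.to_nat m).
Definition eps (m : Z) (psi : Z -> C) : C :=
  Cmult (gauss_sum m psi) (RtoC (/ sqrt (IZR m))).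

Definition dconv (f g : Z -> C) (n : nat) : C :=
  csum (fun k => let d := S k in
          if Nat.eqb (n mod d) 0
          then Cmult (f (Z.of_nat d)) (g (Z.of_nat (n / d)))
          else RtoC 0) n.

Definition L1 (psi : Z -> C) : C :=
  CSeries1 (fun n => Cmult (psi (Z.of_nat n)) (RtoC (/ INR n))).

(* ---------- Bessel functions (DLMF 10.2.2, 10.8.2, 10.25.2, 10.31.2) ---------- *)

Fixpoint harmonic (k : nat) : R :=
  match k with O => 0 | S j => harmonic j + / INR (S j) end.

Definition euler_gamma : R := real (Lim_seq (fun n => harmonic n - ln (INR n))).

Definition BesselJ0 (x : R) : R :=
  Series (fun k => (-1) ^ k * (x * x / 4) ^ k / (INR (fact k)) ^ 2).

Definition BesselI0 (x : R) : R :=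
  Series (fun k => (x * x / 4) ^ k / (INR (fact k)) ^ 2).

Definition BesselY0 (x : R) : R :=
  2 / PI * (ln (x / 2) + euler_gamma) * BesselJ0 x
  + 2 / PI * Series (fun k => (-1) ^ (S k) * harmonic k * (x * x / 4) ^ k
                               / (INR (fact k)) ^ 2).

Definition BesselK0 (x : R) : R :=
  - (ln (x / 2) + euler_gamma) * BesselI0 x
  + Series (fun k => harmonic k * (x * x / 4) ^ k / (INR (fact k)) ^ 2).

Definition smooth_C (g : R -> C) : Prop :=
  forall (n : nat) (x : R),
    ex_derive_n (fun t => fst (g t)) n x /\ ex_derive_n (fun t => snd (g t)) n x.

Definition compact_supp_pos (g : R -> C) : Prop :=
  exists A B : R, 0 < A /\ A <= B /\
    forall x : R, (x < A \/ B < x) -> g x = RtoC 0.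

Definition indic (b : bool) : C := if b then RtoC 1 else RtoC 0.

(* Main.v *)
Require Import Defs.
From Stdlib Require Import Reals ZArith Znumtheory List Permutation Lra Lia Psatz.
From Coquelicot Require Import Coquelicot.
Open Scope R_scope.

(** The left side is the sum over [m, l >= 1] of [chi1(m) chi2(l) e(a m l / c) g(m l)]. Damp it by
    [exp (- eps (m + l))] and apply Poisson summation to [m] modulo [c D1'] and then to [l] modulo
    [c D2']. The double discrete Fourier transform of [chi1(m) chi2(l) e(a m l / c)] at [(p, k)] is a
    product of two Gauss sums, of values of the characters at [p] and [k], and of [e(- inv p k / c)].
    The integral at the frequency [(p, k)] is the integral of [g t] against
    [Jint 1 al (t be)], the integral of [exp (- al y - t be / y) / y] over [y > 0], where [al] and
    [be] have real part [eps] and imaginary parts proportional to [k] and [p]. It satisfies Bessel's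
    equation in [t]; its expansion at [0] identifies its limit as [eps -> 0] with [Y0] and [J0] when
    [p k > 0] and with [K0] when [p k < 0]. Moving the Bessel operator onto the smooth function [g]
    bounds these terms by [|p k|^-3] uniformly in [eps], so the limit may be taken term by term. The
    frequencies [p = 0] and [k = 0] give, by Abel summation, the two terms with [L(1, .)]. *)

(** The left side is a finite sum, but after Poisson summation in [m] the terms in general decay
    only like [1 / l] at every frequency, so the second summation is not absolutely convergent. With
    the damping the transform in [m] has the form [exp(- eps l - t (eps + i x) / l) / l], which is
    flat at [l = 0] and integrable together with its derivatives. Only the frequencies with
    [p k <> 0] are kept in dual form: the row [p = 0] is left after one summation, and the column
    [k = 0] is summed back by Poisson summation in [m], so that both become series whose weights
    have variation bounded uniformly in [eps]. All errors are rates [K / N] with [K] independent of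
    [eps]; thus [eps] tends to [0] at a fixed truncation [N], and [N] to infinity afterwards. The
    condition [1 < D1 * D2] kills the frequency [(0, 0)], where both [L]-series would diverge. As
    the Bessel functions are given by power series with a logarithm and Euler's constant, [Jint] is
    identified by its behaviour at [0] and uniqueness for the differential equation;
    [log al + euler_gamma] arises as a constant of the exponential integral. *)

Lemma C_ext (z w : C) : fst z = fst w -> snd z = snd w -> z = w.
Proof. apply injective_projections. Qed.

Lemma Cmod_fst (z : C) : Rabs (fst z) <= Cmod z.
Proof. apply Rle_trans with (2 := Rmax_Cmod z), Rmax_l. Qed.

Lemma Cmod_snd (z : C) : Rabs (snd z) <= Cmod z.
Proof. apply Rle_trans with (2 := Rmax_Cmod z), Rmax_r. Qed.

Lemma Cmod_le_components (z : C) : Cmod z <= Rabs (fst z) + Rabs (snd z).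
Proof.
  replace z with (RtoC (fst z) + Ci * RtoC (snd z))%C at 1
    by (apply C_ext; simpl; ring).
  eapply Rle_trans; [apply Cmod_triangle|].
  rewrite Cmod_mult, Cmod_Ci, !Cmod_R. lra.
Qed.

Lemma Cmod_RtoC_mult (r : R) (z : C) : 0 <= r -> Cmod (RtoC r * z) = r * Cmod z.
Proof. intros H. rewrite Cmod_mult, Cmod_R, Rabs_pos_eq; auto. Qed.

Lemma Cmod_minus_sym (z w : C) : Cmod (z - w) = Cmod (w - z).
Proof. rewrite <- Cmod_opp. f_equal. ring. Qed.

Lemma Cmod_minus_triangle (z w v : C) : Cmod (z - v) <= Cmod (z - w) + Cmod (w - v).
Proof. replace (z - v)%C with ((z - w) + (w - v))%C by ring. apply Cmod_triangle. Qed.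

Lemma Cmod_minus_le (z w : C) : Cmod (z - w) <= Cmod z + Cmod w.
Proof.
  replace (z - w)%C with (z + - w)%C by ring.
  eapply Rle_trans; [apply Cmod_triangle|]. rewrite Cmod_opp. lra.
Qed.

Lemma exp_le (x y : R) : x <= y -> exp x <= exp y.
Proof.
  intros [H| ->]; [left; apply exp_increasing; assumption|apply Rle_refl].
Qed.

(** * The complex exponential and the additive character [e] *)

Definition cexp (z : C) : C := (exp (fst z) * cos (snd z), exp (fst z) * sin (snd z)).

Lemma cexp_plus (z w : C) : cexp (z + w) = (cexp z * cexp w)%C.
Proof.
  apply C_ext; simpl; rewrite exp_plus, ?cos_plus, ?sin_plus; ring.
Qed.

Lemma cexp_0 : cexp 0 = RtoC 1.
Proof. apply C_ext; simpl; rewrite exp_0, ?cos_0, ?sin_0; ring. Qed.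

Lemma Cmod_cexp (z : C) : Cmod (cexp z) = exp (fst z).
Proof.
  unfold Cmod, cexp; simpl.
  replace (_ + _) with (Rsqr (exp (fst z))).
  - rewrite sqrt_Rsqr; [reflexivity|left; apply exp_pos].
  - unfold Rsqr. pose proof (sin2_cos2 (snd z)) as H. unfold Rsqr in H.
    replace (_ + _) with (exp (fst z) * exp (fst z) *
      (sin (snd z) * sin (snd z) + cos (snd z) * cos (snd z))) by ring.
    rewrite H; ring.
Qed.

Lemma e_cexp (x : R) : e x = cexp (0, 2 * PI * x).
Proof. apply C_ext; simpl; rewrite exp_0; ring. Qed.

Lemma e_plus (x y : R) : e (x + y) = (e x * e y)%C.
Proof.
  rewrite !e_cexp, <- cexp_plus. f_equal. apply C_ext; simpl; ring.
Qed.

Lemma e_0 : e 0 = RtoC 1.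
Proof. unfold e. rewrite Rmult_0_r, cos_0, sin_0. reflexivity. Qed.

Lemma e_1 : e 1 = RtoC 1.
Proof. unfold e. rewrite Rmult_1_r, cos_2PI, sin_2PI. reflexivity. Qed.

Lemma e_INR (n : nat) : e (INR n) = RtoC 1.
Proof.
  induction n as [|n IH]; [apply e_0|].
  rewrite S_INR, e_plus, IH, e_1. ring.
Qed.

Lemma e_opp (x : R) : (e (- x) * e x)%C = RtoC 1.
Proof. rewrite <- e_plus, Rplus_opp_l. apply e_0. Qed.

Lemma e_IZR (k : Z) : e (IZR k) = RtoC 1.
Proof.
  destruct (Z_le_gt_dec 0 k) as [H|H].
  - rewrite <- (Z2Nat.id k H), <- INR_IZR_INZ. apply e_INR.
  - pose proof (e_opp (IZR k)) as E.
    rewrite <- opp_IZR, <- (Z2Nat.id (- k)) in E by lia.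
    rewrite <- INR_IZR_INZ, e_INR in E. rewrite <- E. ring.
Qed.

Lemma Cmod_e (x : R) : Cmod (e x) = 1.
Proof. rewrite e_cexp, Cmod_cexp. apply exp_0. Qed.

(** * Calculus of complex-valued functions of a real variable *)

(** Continuity, derivatives and integrals are taken componentwise, so that each fact reduces to two
    real ones; the price is a factor 2 in the norm estimates. *)
Definition Cct (f : R -> C) (x : R) : Prop :=
  continuous (fun t => fst (f t)) x /\ continuous (fun t => snd (f t)) x.

Definition Cder (f : R -> C) (x : R) (l : C) : Prop :=
  is_derive (fun t => fst (f t)) x (fst l) /\ is_derive (fun t => snd (f t)) x (snd l).

Definition CInt (f : R -> C) (a b : R) : C :=
  (RInt (fun t => fst (f t)) a b, RInt (fun t => snd (f t)) a b).

Lemma Cct_const (c : C) (x : R) : Cct (fun _ => c) x.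
Proof. split; apply continuous_const. Qed.

Lemma Cct_plus (f g : R -> C) (x : R) : Cct f x -> Cct g x -> Cct (fun t => f t + g t)%C x.
Proof. intros [H1 H2] [H3 H4]; split; apply @continuous_plus; assumption. Qed.

Lemma Cct_minus (f g : R -> C) (x : R) : Cct f x -> Cct g x -> Cct (fun t => f t - g t)%C x.
Proof.
  intros [H1 H2] [H3 H4]; split.
  - apply (continuous_minus (fun t => fst (f t)) (fun t => fst (g t))); assumption.
  - apply (continuous_minus (fun t => snd (f t)) (fun t => snd (g t))); assumption.
Qed.

Lemma Cct_opp (f : R -> C) (x : R) : Cct f x -> Cct (fun t => - f t)%C x.
Proof. intros [H1 H2]; split; apply @continuous_opp; assumption. Qed.

Lemma continuous_Rmult (f g : R -> R) (x : R) :
  continuous f x -> continuous g x -> continuous (fun t => f t * g t) x.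
Proof. intros. apply (continuous_mult (K := R_AbsRing)); assumption. Qed.

Lemma continuous_Rminus (f g : R -> R) (x : R) :
  continuous f x -> continuous g x -> continuous (fun t => f t - g t) x.
Proof. intros. apply (continuous_minus f g); assumption. Qed.

Lemma continuous_Rplus (f g : R -> R) (x : R) :
  continuous f x -> continuous g x -> continuous (fun t => f t + g t) x.
Proof. intros. apply (continuous_plus f g); assumption. Qed.

Lemma Cct_mult (f g : R -> C) (x : R) : Cct f x -> Cct g x -> Cct (fun t => f t * g t)%C x.
Proof.
  intros [H1 H2] [H3 H4]; split; simpl.
  - apply continuous_Rminus; apply continuous_Rmult; assumption.
  - apply continuous_Rplus; apply continuous_Rmult; assumption.
Qed.

Lemma Cct_RtoC (f : R -> R) (x : R) : continuous f x -> Cct (fun t => RtoC (f t)) x.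
Proof. intros H; split; [exact H|apply continuous_const]. Qed.

Lemma Cct_cexp (f : R -> C) (x : R) : Cct f x -> Cct (fun t => cexp (f t)) x.
Proof.
  intros [H1 H2]; split; simpl; apply continuous_Rmult.
  1,3: apply (continuous_comp (fun t => fst (f t)) exp); [assumption|].
  1,2: apply continuity_pt_filterlim, derivable_continuous, derivable_exp.
  - apply (continuous_comp (fun t => snd (f t)) cos); [assumption|].
    apply continuity_pt_filterlim, continuity_cos.
  - apply (continuous_comp (fun t => snd (f t)) sin); [assumption|].
    apply continuity_pt_filterlim, continuity_sin.
Qed.

Lemma Cct_ext_loc (f g : R -> C) (x : R) :
  locally x (fun t => f t = g t) -> Cct f x -> Cct g x.
Proof.
  intros H [H1 H2]; split.
  - apply continuous_ext_loc with (2 := H1).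
    apply filter_imp with (2 := H). intros t Ht; now rewrite Ht.
  - apply continuous_ext_loc with (2 := H2).
    apply filter_imp with (2 := H). intros t Ht; now rewrite Ht.
Qed.

Lemma Cct_ext (f g : R -> C) (x : R) : (forall t, f t = g t) -> Cct f x -> Cct g x.
Proof. intros H. apply Cct_ext_loc, filter_forall; auto. Qed.

Lemma Cct_comp (f : R -> C) (h : R -> R) (x : R) :
  continuous h x -> Cct f (h x) -> Cct (fun t => f (h t)) x.
Proof.
  intros H [H1 H2]; split.
  - apply (continuous_comp h (fun t => fst (f t))); assumption.
  - apply (continuous_comp h (fun t => snd (f t))); assumption.
Qed.

Lemma continuous_derive (f : R -> R) (x l : R) : is_derive f x l -> continuous f x.
Proof. intros H. apply (ex_derive_continuous (V := R_NormedModule)). now exists l. Qed.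

Lemma Cder_Cct (f : R -> C) (x : R) (l : C) : Cder f x l -> Cct f x.
Proof. intros [H1 H2]; split; eapply continuous_derive; eassumption. Qed.

Lemma Cder_const (c : C) (x : R) : Cder (fun _ => c) x 0%C.
Proof. split; apply (is_derive_const (V := R_NormedModule)). Qed.

Lemma Cder_plus (f g : R -> C) (x : R) (a b : C) :
  Cder f x a -> Cder g x b -> Cder (fun t => f t + g t)%C x (a + b)%C.
Proof.
  intros [H1 H2] [H3 H4]; split; apply (is_derive_plus (V := R_NormedModule)); assumption.
Qed.

Lemma Cder_minus (f g : R -> C) (x : R) (a b : C) :
  Cder f x a -> Cder g x b -> Cder (fun t => f t - g t)%C x (a - b)%C.
Proof.
  intros [H1 H2] [H3 H4]; split.
  - apply (is_derive_minus (V := R_NormedModule) (fun t => fst (f t)) (fun t => fst (g t)));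
      assumption.
  - apply (is_derive_minus (V := R_NormedModule) (fun t => snd (f t)) (fun t => snd (g t)));
      assumption.
Qed.

Lemma is_derive_Rmult (f g : R -> R) (x a b : R) :
  is_derive f x a -> is_derive g x b -> is_derive (fun t => f t * g t) x (a * g x + f x * b).
Proof. intros. apply (is_derive_mult f g); auto. intros; apply Rmult_comm. Qed.

Lemma Cder_mult (f g : R -> C) (x : R) (a b : C) :
  Cder f x a -> Cder g x b -> Cder (fun t => f t * g t)%C x (a * g x + f x * b)%C.
Proof.
  intros [H1 H2] [H3 H4]; split; simpl.
  - replace (_ + _) with ((fst a * fst (g x) + fst (f x) * fst b)
      - (snd a * snd (g x) + snd (f x) * snd b)) by ring.
    apply (is_derive_minus (V := R_NormedModule) (fun t => fst (f t) * fst (g t))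
      (fun t => snd (f t) * snd (g t))); apply is_derive_Rmult; assumption.
  - replace (_ + _) with ((fst a * snd (g x) + fst (f x) * snd b)
      + (snd a * fst (g x) + snd (f x) * fst b)) by ring.
    apply (is_derive_plus (V := R_NormedModule) (fun t => fst (f t) * snd (g t))
      (fun t => snd (f t) * fst (g t))); apply is_derive_Rmult; assumption.
Qed.

Lemma Cder_RtoC (f : R -> R) (x l : R) : is_derive f x l -> Cder (fun t => RtoC (f t)) x (RtoC l).
Proof. intros H; split; [exact H|apply (is_derive_const (K := R_AbsRing) (V := R_NormedModule) 0)]. Qed.

Lemma Cder_eq (f : R -> C) (x : R) (a b : C) : a = b -> Cder f x a -> Cder f x b.
Proof. now intros ->. Qed.

Lemma Cder_scal (c : C) (f : R -> C) (x : R) (a : C) :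
  Cder f x a -> Cder (fun t => c * f t)%C x (c * a)%C.
Proof.
  intros H. eapply Cder_eq; [|apply Cder_mult; [apply Cder_const|exact H]]. simpl. ring.
Qed.

Lemma is_derive_Rcomp (f g : R -> R) (x a b : R) :
  is_derive f (g x) a -> is_derive g x b -> is_derive (fun t => f (g t)) x (b * a).
Proof. intros. apply (is_derive_comp f g); assumption. Qed.

Lemma Cder_cexp (f : R -> C) (x : R) (a : C) :
  Cder f x a -> Cder (fun t => cexp (f t)) x (a * cexp (f x))%C.
Proof.
  intros [H1 H2].
  assert (He : is_derive (fun t => exp (fst (f t))) x (fst a * exp (fst (f x)))).
  { apply (is_derive_Rcomp exp (fun t => fst (f t))); [apply is_derive_exp|exact H1]. }
  split; simpl.
  - replace (_ - _) with (fst a * exp (fst (f x)) * cos (snd (f x))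
      + exp (fst (f x)) * (snd a * - sin (snd (f x)))) by ring.
    apply (is_derive_Rmult _ (fun t => cos (snd (f t))) x _ _ He).
    apply (is_derive_Rcomp cos (fun t => snd (f t)) x (- sin (snd (f x))) (snd a)); [|exact H2].
    apply is_derive_cos.
  - replace (_ + _) with (fst a * exp (fst (f x)) * sin (snd (f x))
      + exp (fst (f x)) * (snd a * cos (snd (f x)))) by ring.
    apply (is_derive_Rmult _ (fun t => sin (snd (f t))) x _ _ He).
    apply (is_derive_Rcomp sin (fun t => snd (f t)) x (cos (snd (f x))) (snd a)); [|exact H2].
    apply is_derive_sin.
Qed.

Lemma Cder_ext_loc (f g : R -> C) (x : R) (l : C) :
  locally x (fun t => f t = g t) -> Cder f x l -> Cder g x l.
Proof.
  intros H [H1 H2]; split.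
  - apply is_derive_ext_loc with (2 := H1).
    apply filter_imp with (2 := H). intros t Ht; now rewrite Ht.
  - apply is_derive_ext_loc with (2 := H2).
    apply filter_imp with (2 := H). intros t Ht; now rewrite Ht.
Qed.

Lemma Cder_ext (f g : R -> C) (x : R) (l : C) :
  (forall t, f t = g t) -> Cder f x l -> Cder g x l.
Proof. intros H. apply Cder_ext_loc, filter_forall; auto. Qed.

Lemma Cder_comp (f : R -> C) (h : R -> R) (x b : R) (a : C) :
  Cder f (h x) a -> is_derive h x b -> Cder (fun t => f (h t)) x (RtoC b * a)%C.
Proof.
  intros [H1 H2] H; split; simpl.
  - replace (_ - _) with (b * fst a) by ring.
    apply (is_derive_Rcomp (fun t => fst (f t)) h); assumption.
  - replace (_ + _) with (b * snd a) by ring.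
    apply (is_derive_Rcomp (fun t => snd (f t)) h); assumption.
Qed.

(** An [O(h^2)] remainder is stronger than differentiability, but it is the form that survives
    integration: a pointwise Taylor remainder below an integrable multiple of [h^2] yields the
    derivative of an integral without any convergence theorem. *)
Lemma Cder_quadratic (f : R -> C) (x : R) (l : C) (K eta : R) :
  0 < eta ->
  (forall h, Rabs h <= eta -> Cmod (f (x + h) - f x - RtoC h * l) <= K * h ^ 2) ->
  Cder f x l.
Proof.
  intros Heta H.
  assert (HK : 0 <= K).
  { specialize (H eta). rewrite Rabs_pos_eq in H by lra.
    specialize (H (Rle_refl _)). pose proof (Cmod_ge_0 (f (x + eta) - f x - RtoC eta * l)).
    assert (0 < eta ^ 2) by nra. nra. }
  assert (G : forall (u : R -> R) (m : R),
    (forall h, Rabs h <= eta -> Rabs (u (x + h) - u x - h * m) <= K * h ^ 2) ->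
    is_derive u x m).
  { intros u m Hu. apply is_derive_Reals. intros eps Heps.
    (* [K + 1] replaces [K], which may be [0]. *)
    assert (Hd : 0 < Rmin eta (eps / (K + 1))).
    { apply Rmin_pos; [assumption|apply Rdiv_lt_0_compat; lra]. }
    exists (mkposreal _ Hd). simpl. intros h Hh0 Hh.
    assert (h1 : Rabs h <= eta).
    { left. eapply Rlt_le_trans; [exact Hh|apply Rmin_l]. }
    assert (h2 : Rabs h < eps / (K + 1)).
    { eapply Rlt_le_trans; [exact Hh|apply Rmin_r]. }
    specialize (Hu h h1).
    replace ((u (x + h) - u x) / h - m) with ((u (x + h) - u x - h * m) / h) by (field; auto).
    unfold Rdiv. rewrite Rabs_mult, Rabs_inv.
    assert (Hp : 0 < Rabs h) by (apply Rabs_pos_lt; auto).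
    apply Rmult_lt_reg_r with (Rabs h); [assumption|].
    rewrite Rmult_assoc, Rinv_l, Rmult_1_r by lra.
    rewrite <- Rsqr_pow2, Rsqr_abs in Hu. unfold Rsqr in Hu.
    assert (h3 : (K + 1) * Rabs h < eps).
    { apply Rmult_lt_reg_r with (/ (K + 1)); [apply Rinv_0_lt_compat; lra|].
      replace ((K + 1) * Rabs h * / (K + 1)) with (Rabs h) by (field; lra). exact h2. }
    nra. }
  split; apply G; intros h Hh; eapply Rle_trans; [|apply (H h Hh)| |apply (H h Hh)].
  - eapply Rle_trans; [|apply Cmod_fst]. right; f_equal; simpl; ring.
  - eapply Rle_trans; [|apply Cmod_snd]. right; f_equal; simpl; ring.
Qed.

(** The mean value theorem applies to [p - f] and [p + f], whose derivatives are nonnegative. A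
    variable majorant [p'] given with its primitive [p] does the work of integrating the bound. *)
Lemma Rmvt_bound (f f' p p' : R -> R) (a b : R) :
  a <= b ->
  (forall x, a <= x <= b -> is_derive f x (f' x)) ->
  (forall x, a <= x <= b -> is_derive p x (p' x)) ->
  (forall x, a <= x <= b -> Rabs (f' x) <= p' x) ->
  Rabs (f b - f a) <= p b - p a.
Proof.
  intros Hab Hf Hp Hb.
  assert (G : forall s : R, s = 1 \/ s = -1 -> s * (f b - f a) <= p b - p a).
  { intros s Hs.
    destruct (MVT_gen (fun x => p x - s * f x) a b (fun x => p' x - s * f' x)) as (c & Hc & E).
    - intros x Hx. rewrite Rmin_left, Rmax_right in Hx by lra.
      apply (is_derive_minus (V := R_NormedModule) p (fun t => s * f t)).
      + apply Hp; lra.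
      + apply (is_derive_scal f x s), Hf; lra.
    - intros x Hx. rewrite Rmin_left, Rmax_right in Hx by lra.
      apply continuity_pt_filterlim. apply (continuous_Rminus p (fun x => s * f x)).
      + apply (continuous_derive p x (p' x)), Hp; lra.
      + apply (continuous_Rmult (fun _ => s) f); [apply continuous_const|].
        apply (continuous_derive f x (f' x)), Hf; lra.
    - rewrite Rmin_left, Rmax_right in Hc by lra.
      specialize (Hb c Hc). apply Rabs_le_between in Hb.
      assert (0 <= (p' c - s * f' c) * (b - a)).
      { apply Rmult_le_pos; [|lra]. destruct Hs; subst; lra. }
      lra. }
  apply Rabs_le. pose proof (G 1 (or_introl eq_refl)). pose proof (G (-1) (or_intror eq_refl)). lra.
Qed.

Lemma Cmvt_bound (f f' : R -> C) (p p' : R -> R) (a b : R) :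
  a <= b ->
  (forall x, a <= x <= b -> Cder f x (f' x)) ->
  (forall x, a <= x <= b -> is_derive p x (p' x)) ->
  (forall x, a <= x <= b -> Cmod (f' x) <= p' x) ->
  Cmod (f b - f a) <= 2 * (p b - p a).
Proof.
  intros Hab Hf Hp Hb.
  eapply Rle_trans; [apply Cmod_le_components|].
  assert (Rabs (fst (f b - f a)%C) <= p b - p a).
  { apply (Rmvt_bound (fun t => fst (f t)) (fun t => fst (f' t)) p p'); auto.
    - intros x Hx; apply Hf; auto.
    - intros x Hx. eapply Rle_trans; [apply Cmod_fst|auto]. }
  assert (Rabs (snd (f b - f a)%C) <= p b - p a).
  { apply (Rmvt_bound (fun t => snd (f t)) (fun t => snd (f' t)) p p'); auto.
    - intros x Hx; apply Hf; auto.
    - intros x Hx. eapply Rle_trans; [apply Cmod_snd|auto]. }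
  lra.
Qed.

Lemma Cmvt_bound_const (f f' : R -> C) (a b K : R) :
  a <= b ->
  (forall x, a <= x <= b -> Cder f x (f' x)) ->
  (forall x, a <= x <= b -> Cmod (f' x) <= K) ->
  Cmod (f b - f a) <= 2 * K * (b - a).
Proof.
  intros Hab Hf Hb.
  replace (2 * K * (b - a)) with (2 * (K * b - K * a)) by ring.
  apply (Cmvt_bound f f' (fun x => K * x) (fun _ => K)); auto.
  intros x _. auto_derive; auto; ring.
Qed.

Lemma RInt_FTC (f F : R -> R) (a b : R) :
  a <= b -> (forall x, a <= x <= b -> is_derive F x (f x)) ->
  (forall x, a <= x <= b -> continuous f x) -> RInt f a b = F b - F a.
Proof.
  intros Hab HF Hf. apply is_RInt_unique.
  apply (is_RInt_derive F f); intros x Hx; rewrite Rmin_left, Rmax_right in Hx by lra; auto.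
Qed.

Lemma ex_RInt_cont (f : R -> R) (a b : R) :
  a <= b -> (forall x, a <= x <= b -> continuous f x) -> ex_RInt f a b.
Proof.
  intros Hab H. apply (ex_RInt_continuous (V := R_CompleteNormedModule)).
  intros x Hx. rewrite Rmin_left, Rmax_right in Hx by lra. auto.
Qed.

Lemma CInt_FTC (f F : R -> C) (a b : R) :
  a <= b -> (forall x, a <= x <= b -> Cder F x (f x)) ->
  (forall x, a <= x <= b -> Cct f x) -> CInt f a b = (F b - F a)%C.
Proof.
  intros Hab HF Hf. apply C_ext; simpl.
  - apply (RInt_FTC (fun t => fst (f t)) (fun t => fst (F t)));
      [lra|intros; apply HF; auto|intros; apply Hf; auto].
  - apply (RInt_FTC (fun t => snd (f t)) (fun t => snd (F t)));
      [lra|intros; apply HF; auto|intros; apply Hf; auto].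
Qed.

Lemma CInt_ext (f g : R -> C) (a b : R) :
  a <= b -> (forall x, a <= x <= b -> f x = g x) -> CInt f a b = CInt g a b.
Proof.
  intros Hab H. unfold CInt; f_equal; apply RInt_ext; intros x Hx;
    rewrite Rmin_left, Rmax_right in Hx by lra; rewrite H; auto; lra.
Qed.

Lemma CInt_plus (f g : R -> C) (a b : R) :
  a <= b -> (forall x, a <= x <= b -> Cct f x) -> (forall x, a <= x <= b -> Cct g x) ->
  CInt (fun x => f x + g x)%C a b = (CInt f a b + CInt g a b)%C.
Proof.
  intros Hab Hf Hg. apply C_ext; simpl.
  - apply (RInt_plus (V := R_CompleteNormedModule)); apply ex_RInt_cont; auto;
      intros; [apply Hf|apply Hg]; auto.
  - apply (RInt_plus (V := R_CompleteNormedModule)); apply ex_RInt_cont; auto;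
      intros; [apply Hf|apply Hg]; auto.
Qed.

Lemma RInt_lincomb (f g : R -> R) (u v a b : R) :
  a <= b -> (forall x, a <= x <= b -> continuous f x) ->
  (forall x, a <= x <= b -> continuous g x) ->
  RInt (fun x => u * f x + v * g x) a b = u * RInt f a b + v * RInt g a b.
Proof.
  intros Hab Hf Hg.
  pose proof (ex_RInt_cont f a b Hab Hf) as Ef. pose proof (ex_RInt_cont g a b Hab Hg) as Eg.
  rewrite (RInt_plus (V := R_CompleteNormedModule) (fun x => u * f x) (fun x => v * g x)).
  - rewrite (RInt_scal (V := R_CompleteNormedModule) f), (RInt_scal (V := R_CompleteNormedModule) g);
      auto.
  - apply (ex_RInt_scal (V := R_NormedModule) f); auto.
  - apply (ex_RInt_scal (V := R_NormedModule) g); auto.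
Qed.

Lemma CInt_scal (c : C) (f : R -> C) (a b : R) :
  a <= b -> (forall x, a <= x <= b -> Cct f x) ->
  CInt (fun x => c * f x)%C a b = (c * CInt f a b)%C.
Proof.
  intros Hab Hf. apply C_ext; simpl.
  - transitivity (RInt (fun x => fst c * fst (f x) + (- snd c) * snd (f x)) a b).
    + apply RInt_ext; intros; simpl; ring.
    + rewrite (RInt_lincomb (fun x => fst (f x)) (fun x => snd (f x)));
        try (intros; apply Hf); auto. ring.
  - transitivity (RInt (fun x => fst c * snd (f x) + snd c * fst (f x)) a b).
    + apply RInt_ext; intros; simpl; ring.
    + rewrite (RInt_lincomb (fun x => snd (f x)) (fun x => fst (f x)));
        try (intros; apply Hf); auto.
Qed.

Lemma CInt_minus (f g : R -> C) (a b : R) :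
  a <= b -> (forall x, a <= x <= b -> Cct f x) -> (forall x, a <= x <= b -> Cct g x) ->
  CInt (fun x => f x - g x)%C a b = (CInt f a b - CInt g a b)%C.
Proof.
  intros Hab Hf Hg.
  rewrite (CInt_ext _ (fun x => f x + RtoC (-1) * g x)%C) by (auto; intros; ring).
  rewrite CInt_plus, CInt_scal; auto.
  - ring.
  - intros x Hx. apply Cct_mult; [apply Cct_const|auto].
Qed.

Lemma CInt_Chasles (f : R -> C) (a b c : R) :
  a <= b <= c -> (forall x, a <= x <= c -> Cct f x) ->
  (CInt f a b + CInt f b c)%C = CInt f a c.
Proof.
  intros Hab Hf. apply C_ext; simpl.
  - apply (RInt_Chasles (V := R_CompleteNormedModule) (fun t => fst (f t)));
      apply ex_RInt_cont; try lra; intros; apply Hf; lra.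
  - apply (RInt_Chasles (V := R_CompleteNormedModule) (fun t => snd (f t)));
      apply ex_RInt_cont; try lra; intros; apply Hf; lra.
Qed.

(** The majorant comes with its primitive, so that the integral estimates below end in closed
    forms. *)
Lemma CInt_bound (f : R -> C) (p p' : R -> R) (a b : R) :
  a <= b -> (forall x, a <= x <= b -> Cct f x) ->
  (forall x, a <= x <= b -> is_derive p x (p' x)) ->
  (forall x, a <= x <= b -> continuous p' x) ->
  (forall x, a <= x <= b -> Cmod (f x) <= p' x) ->
  Cmod (CInt f a b) <= 2 * (p b - p a).
Proof.
  intros Hab Hf Hp Hc Hb.
  assert (E : RInt p' a b = p b - p a) by (apply RInt_FTC; auto).
  assert (G : forall u : R -> R, (forall x, a <= x <= b -> continuous u x) ->
    (forall x, a <= x <= b -> Rabs (u x) <= p' x) -> Rabs (RInt u a b) <= p b - p a).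
  { intros u Hu Hub. rewrite <- E.
    apply Rle_trans with (RInt (fun x => Rabs (u x)) a b).
    - apply abs_RInt_le; auto. apply ex_RInt_cont; auto.
    - apply RInt_le; auto.
      + apply ex_RInt_cont; auto. intros x Hx.
        apply (continuous_comp u Rabs); auto. apply continuity_pt_filterlim, Rcontinuity_abs.
      + apply ex_RInt_cont; auto.
      + intros; apply Hub; lra. }
  eapply Rle_trans; [apply Cmod_le_components|]. simpl.
  assert (Rabs (RInt (fun t => fst (f t)) a b) <= p b - p a).
  { apply G; [intros; apply Hf; auto|]. intros; eapply Rle_trans; [apply Cmod_fst|auto]. }
  assert (Rabs (RInt (fun t => snd (f t)) a b) <= p b - p a).
  { apply G; [intros; apply Hf; auto|]. intros; eapply Rle_trans; [apply Cmod_snd|auto]. }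
  lra.
Qed.

Lemma CInt_bound_const (f : R -> C) (a b K : R) :
  a <= b -> (forall x, a <= x <= b -> Cct f x) ->
  (forall x, a <= x <= b -> Cmod (f x) <= K) ->
  Cmod (CInt f a b) <= 2 * K * (b - a).
Proof.
  intros Hab Hf Hb.
  replace (2 * K * (b - a)) with (2 * (K * b - K * a)) by ring.
  apply (CInt_bound f (fun x => K * x) (fun _ => K)); auto.
  - intros x _. auto_derive; auto; ring.
  - intros; apply continuous_const.
Qed.

Lemma CInt_point (f : R -> C) (a : R) : CInt f a a = RtoC 0.
Proof. apply C_ext; simpl; apply (RInt_point (V := R_CompleteNormedModule)). Qed.

(** Mean value inequality along the segment from [0] to [z], on which the exponential is at most
    [exp (Cmod z)]. *)
Lemma cexp_minus_1_bound (z : C) : Cmod (cexp z - 1) <= 2 * Cmod z * exp (Cmod z).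
Proof.
  pose proof (Cmvt_bound_const (fun t => cexp (RtoC t * z)) (fun t => z * cexp (RtoC t * z))%C
    0 1 (Cmod z * exp (Cmod z))) as H.
  cbv beta in H.
  replace (cexp (RtoC 1 * z)) with (cexp z) in H by (f_equal; ring).
  replace (RtoC 0 * z)%C with (RtoC 0) in H by ring. rewrite cexp_0 in H.
  eapply Rle_trans; [apply H|]; [lra| | |lra].
  - intros x _. apply (Cder_cexp (fun t => RtoC t * z)%C).
    eapply Cder_eq; [|apply Cder_mult; [apply Cder_RtoC, (is_derive_id (K := R_AbsRing))|apply Cder_const]].
    simpl. change (@one R_AbsRing) with 1. ring.
  - intros x Hx. rewrite Cmod_mult. apply Rmult_le_compat_l; [apply Cmod_ge_0|].
    rewrite Cmod_cexp. apply exp_le. simpl.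
    eapply Rle_trans; [apply Rle_abs|].
    replace (x * fst z - 0 * snd z) with (x * fst z) by ring.
    rewrite Rabs_mult, Rabs_pos_eq by lra.
    pose proof (Cmod_fst z). pose proof (Rabs_pos (fst z)). nra.
Qed.

(** One more integration along the segment: [exp(t z) - t z] has derivative [z (exp(t z) - 1)],
    bounded by the preceding lemma. *)
Lemma cexp_taylor_2 (z : C) : Cmod (cexp z - 1 - z) <= 4 * Cmod z ^ 2 * exp (Cmod z).
Proof.
  pose proof (Cmvt_bound_const (fun t => cexp (RtoC t * z) - RtoC t * z)%C
    (fun t => z * (cexp (RtoC t * z) - 1))%C
    0 1 (Cmod z * (2 * Cmod z * exp (Cmod z)))) as H.
  cbv beta in H.
  replace (cexp (RtoC 1 * z)) with (cexp z) in H by (f_equal; ring).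
  replace (RtoC 0 * z)%C with (RtoC 0) in H by ring. rewrite cexp_0 in H.
  replace (cexp z - 1 - z)%C with (cexp z - RtoC 1 * z - (1 - 0))%C by ring.
  eapply Rle_trans; [apply H|]; [lra| | |right; ring].
  - intros x _.
    assert (D : Cder (fun t => RtoC t * z)%C x z).
    { eapply Cder_eq; [|apply Cder_mult; [apply Cder_RtoC, (is_derive_id (K := R_AbsRing))|apply Cder_const]].
      simpl. change (@one R_AbsRing) with 1. ring. }
    eapply Cder_eq; [|apply Cder_minus; [apply (Cder_cexp (fun t => RtoC t * z)%C), D|apply D]].
    ring.
  - intros x Hx. rewrite Cmod_mult. apply Rmult_le_compat_l; [apply Cmod_ge_0|].
    eapply Rle_trans; [apply cexp_minus_1_bound|].
    rewrite Cmod_RtoC_mult by lra.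
    pose proof (Cmod_ge_0 z).
    assert (x * Cmod z <= Cmod z) by nra.
    apply Rmult_le_compat; try lra.
    + nra.
    + left; apply exp_pos.
    + apply exp_le; auto.
Qed.

(** In the closed left half-plane the exponential along the segment is at most [1], so the bound
    stays linear even for large [z]. *)
Lemma cexp_minus_1_left (z : C) : fst z <= 0 -> Cmod (cexp z - 1) <= 2 * Cmod z.
Proof.
  intros Hz.
  pose proof (Cmvt_bound_const (fun t => cexp (RtoC t * z)) (fun t => z * cexp (RtoC t * z))%C
    0 1 (Cmod z)) as H.
  cbv beta in H.
  replace (cexp (RtoC 1 * z)) with (cexp z) in H by (f_equal; ring).
  replace (RtoC 0 * z)%C with (RtoC 0) in H by ring. rewrite cexp_0 in H.
  eapply Rle_trans; [apply H|]; [lra| | |lra].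
  - intros x _. apply (Cder_cexp (fun t => RtoC t * z)%C).
    eapply Cder_eq; [|apply Cder_mult; [apply Cder_RtoC, (is_derive_id (K := R_AbsRing))|apply Cder_const]].
    simpl. change (@one R_AbsRing) with 1. ring.
  - intros x Hx. rewrite Cmod_mult, Cmod_cexp.
    rewrite <- (Rmult_1_r (Cmod z)) at 2. apply Rmult_le_compat_l; [apply Cmod_ge_0|].
    rewrite <- exp_0. apply exp_le. simpl. nra.
Qed.

(** * Finite sums *)

Fixpoint rsum (f : nat -> R) (n : nat) : R :=
  match n with O => 0 | S k => rsum f k + f k end.

Lemma csum_ext (f g : nat -> C) (n : nat) :
  (forall k, (k < n)%nat -> f k = g k) -> csum f n = csum g n.
Proof.
  induction n as [|n IH]; intros H; simpl; [reflexivity|].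
  rewrite IH, H by auto. reflexivity.
Qed.

Lemma csum_plus (f g : nat -> C) (n : nat) :
  csum (fun k => f k + g k)%C n = (csum f n + csum g n)%C.
Proof. induction n as [|n IH]; simpl; [|rewrite IH]; ring. Qed.

Lemma csum_minus (f g : nat -> C) (n : nat) :
  csum (fun k => f k - g k)%C n = (csum f n - csum g n)%C.
Proof. induction n as [|n IH]; simpl; [|rewrite IH]; ring. Qed.

Lemma csum_scal (c : C) (f : nat -> C) (n : nat) :
  csum (fun k => c * f k)%C n = (c * csum f n)%C.
Proof. induction n as [|n IH]; simpl; [|rewrite IH]; ring. Qed.

Lemma csum_zero (f : nat -> C) (n : nat) :
  (forall k, (k < n)%nat -> f k = RtoC 0) -> csum f n = RtoC 0.
Proof.
  induction n as [|n IH]; intros H; simpl; [reflexivity|].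
  rewrite IH, H by auto. ring.
Qed.

Lemma csum_add (f : nat -> C) (n m : nat) :
  csum f (n + m) = (csum f n + csum (fun k => f (n + k)%nat) m)%C.
Proof.
  induction m as [|m IH]; simpl.
  - rewrite Nat.add_0_r. ring.
  - rewrite Nat.add_succ_r. simpl. rewrite IH. ring.
Qed.

Lemma csum_swap (f : nat -> nat -> C) (n m : nat) :
  csum (fun i => csum (f i) m) n = csum (fun j => csum (fun i => f i j) n) m.
Proof.
  induction n as [|n IH]; simpl.
  - symmetry. apply csum_zero. auto.
  - rewrite IH, <- csum_plus. reflexivity.
Qed.

Lemma csum_bound (f : nat -> C) (g : nat -> R) (n : nat) :
  (forall k, (k < n)%nat -> Cmod (f k) <= g k) -> Cmod (csum f n) <= rsum g n.
Proof.
  induction n as [|n IH]; intros H; simpl.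
  - rewrite Cmod_0. lra.
  - eapply Rle_trans; [apply Cmod_triangle|]. apply Rplus_le_compat; auto.
Qed.

Lemma rsum_le (f g : nat -> R) (n : nat) :
  (forall k, (k < n)%nat -> f k <= g k) -> rsum f n <= rsum g n.
Proof.
  induction n as [|n IH]; intros H; simpl; [lra|]. apply Rplus_le_compat; auto.
Qed.

Lemma rsum_scal (c : R) (f : nat -> R) (n : nat) : rsum (fun k => c * f k) n = c * rsum f n.
Proof. induction n as [|n IH]; simpl; [|rewrite IH]; ring. Qed.

Lemma rsum_telescope (f : nat -> R) (n : nat) : rsum (fun k => f (S k) - f k) n = f n - f O.
Proof. induction n as [|n IH]; simpl; [|rewrite IH]; ring. Qed.

Lemma rsum_const (c : R) (n : nat) : rsum (fun _ => c) n = INR n * c.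
Proof. induction n as [|n IH]; [simpl; ring|]. rewrite S_INR. simpl. rewrite IH. ring. Qed.

Lemma Cct_csum (f : nat -> R -> C) (n : nat) (x : R) :
  (forall k, (k < n)%nat -> Cct (f k) x) -> Cct (fun t => csum (fun k => f k t) n) x.
Proof.
  induction n as [|n IH]; intros H; simpl; [apply Cct_const|].
  apply Cct_plus; auto.
Qed.

Lemma CInt_csum (f : nat -> R -> C) (n : nat) (a b : R) :
  a <= b -> (forall k x, (k < n)%nat -> a <= x <= b -> Cct (f k) x) ->
  CInt (fun t => csum (fun k => f k t) n) a b = csum (fun k => CInt (f k) a b) n.
Proof.
  intros Hab. induction n as [|n IH]; intros H; simpl.
  - apply C_ext; simpl; rewrite (RInt_const (V := R_CompleteNormedModule)); apply Rmult_0_r.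
  - rewrite CInt_plus; auto.
    + rewrite IH; auto.
    + intros x Hx. apply Cct_csum. auto.
Qed.

(** * Limits of complex sequences *)

Definition Clim (u : nat -> C) (l : C) : Prop := is_lim_seq (fun n => Cmod (u n - l)) 0.

Lemma Clim_squeeze (u : nat -> C) (l : C) (v : nat -> R) :
  (forall n, Cmod (u n - l) <= v n) -> is_lim_seq v 0 -> Clim u l.
Proof.
  intros H Hv. apply is_lim_seq_le_le with (fun _ => 0) v; auto.
  - intros n; split; [apply Cmod_ge_0|auto].
  - apply is_lim_seq_const.
Qed.

Lemma is_lim_seq_minus_0 (u : nat -> R) (l : R) :
  is_lim_seq (fun n => Rabs (u n - l)) 0 -> is_lim_seq u l.
Proof.
  intros H. apply is_lim_seq_abs_0 in H.
  apply is_lim_seq_ext with (fun n => (u n - l) + l); [intros; ring|].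
  replace (Finite l) with (Finite (0 + l)) by (f_equal; ring).
  apply is_lim_seq_plus'; [exact H|apply is_lim_seq_const].
Qed.

Lemma Clim_fst (u : nat -> C) (l : C) : Clim u l -> is_lim_seq (fun n => fst (u n)) (fst l).
Proof.
  intros H. apply is_lim_seq_minus_0.
  apply is_lim_seq_le_le with (fun _ => 0) (fun n => Cmod (u n - l)); auto.
  - intros n; split; [apply Rabs_pos|apply (Cmod_fst (u n - l))].
  - apply is_lim_seq_const.
Qed.

Lemma Clim_snd (u : nat -> C) (l : C) : Clim u l -> is_lim_seq (fun n => snd (u n)) (snd l).
Proof.
  intros H. apply is_lim_seq_minus_0.
  apply is_lim_seq_le_le with (fun _ => 0) (fun n => Cmod (u n - l)); auto.
  - intros n; split; [apply Rabs_pos|apply (Cmod_snd (u n - l))].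
  - apply is_lim_seq_const.
Qed.

Lemma is_lim_seq_Rabs_minus (u : nat -> R) (l : R) :
  is_lim_seq u l -> is_lim_seq (fun n => Rabs (u n - l)) 0.
Proof.
  intros H. rewrite <- Rabs_R0. apply (is_lim_seq_abs _ 0).
  replace 0 with (l - l) by ring. apply is_lim_seq_minus'; [exact H|apply is_lim_seq_const].
Qed.

Lemma Clim_components (u : nat -> C) (l : C) :
  is_lim_seq (fun n => fst (u n)) (fst l) -> is_lim_seq (fun n => snd (u n)) (snd l) -> Clim u l.
Proof.
  intros H1 H2.
  apply Clim_squeeze with (fun n => Rabs (fst (u n) - fst l) + Rabs (snd (u n) - snd l)).
  - intros n. apply Cmod_le_components.
  - replace 0 with (0 + 0) by ring.
    apply is_lim_seq_plus'; apply is_lim_seq_Rabs_minus; assumption.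
Qed.

Lemma Clim_plus (u v : nat -> C) (l m : C) :
  Clim u l -> Clim v m -> Clim (fun n => u n + v n)%C (l + m)%C.
Proof.
  intros Hu Hv. apply Clim_squeeze with (fun n => Cmod (u n - l) + Cmod (v n - m)).
  - intros n. replace (u n + v n - (l + m))%C with ((u n - l) + (v n - m))%C by ring.
    apply Cmod_triangle.
  - replace 0 with (0 + 0) by ring. apply is_lim_seq_plus'; assumption.
Qed.

Lemma Clim_const (c : C) : Clim (fun _ => c) c.
Proof.
  apply Clim_squeeze with (fun _ => 0); [|apply is_lim_seq_const].
  intros. replace (c - c)%C with (RtoC 0) by ring. rewrite Cmod_0. lra.
Qed.

Lemma Clim_scal (c : C) (u : nat -> C) (l : C) : Clim u l -> Clim (fun n => c * u n)%C (c * l)%C.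
Proof.
  intros Hu. apply Clim_squeeze with (fun n => Cmod c * Cmod (u n - l)).
  - intros n. replace (c * u n - c * l)%C with (c * (u n - l))%C by ring.
    rewrite Cmod_mult. lra.
  - replace 0 with (Cmod c * 0) by ring. apply (is_lim_seq_scal_l _ (Cmod c) 0), Hu.
Qed.

Lemma Clim_minus (u v : nat -> C) (l m : C) :
  Clim u l -> Clim v m -> Clim (fun n => u n - v n)%C (l - m)%C.
Proof.
  intros Hu Hv. apply Clim_squeeze with (fun n => Cmod (u n - l) + Cmod (v n - m)).
  - intros n. replace (u n - v n - (l - m))%C with ((u n - l) - (v n - m))%C by ring.
    apply Cmod_minus_le.
  - replace 0 with (0 + 0) by ring. apply is_lim_seq_plus'; assumption.
Qed.

Lemma Clim_mult (u v : nat -> C) (l m : C) :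
  Clim u l -> Clim v m -> Clim (fun n => u n * v n)%C (l * m)%C.
Proof.
  intros Hu Hv.
  pose proof (Clim_fst _ _ Hu). pose proof (Clim_snd _ _ Hu).
  pose proof (Clim_fst _ _ Hv). pose proof (Clim_snd _ _ Hv).
  apply Clim_components; simpl.
  - apply is_lim_seq_minus'; apply is_lim_seq_mult'; assumption.
  - apply is_lim_seq_plus'; apply is_lim_seq_mult'; assumption.
Qed.

Lemma Clim_ext (u v : nat -> C) (l : C) : (forall n, u n = v n) -> Clim u l -> Clim v l.
Proof. intros H. apply is_lim_seq_ext. intros n; now rewrite H. Qed.

Lemma Clim_csum (u : nat -> nat -> C) (l : nat -> C) (n : nat) :
  (forall k, (k < n)%nat -> Clim (fun j => u j k) (l k)) ->
  Clim (fun j => csum (u j) n) (csum l n).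
Proof.
  induction n as [|n IH]; intros H; simpl; [apply Clim_const|].
  apply Clim_plus; auto.
Qed.

Lemma Clim_unique (u : nat -> C) (l m : C) : Clim u l -> Clim u m -> l = m.
Proof.
  intros H1 H2. apply C_ext.
  - pose proof (is_lim_seq_unique _ _ (Clim_fst _ _ H1)) as E1.
    rewrite (is_lim_seq_unique _ _ (Clim_fst _ _ H2)) in E1. now injection E1.
  - pose proof (is_lim_seq_unique _ _ (Clim_snd _ _ H1)) as E1.
    rewrite (is_lim_seq_unique _ _ (Clim_snd _ _ H2)) in E1. now injection E1.
Qed.

(** Transfers an estimate to the limit; the bound [K n] may itself contain an error that tends to
    [0]. *)
Lemma Clim_Cmod_le (u : nat -> C) (l z : C) (K : nat -> R) (k : R) :
  Clim u l -> is_lim_seq K k -> (forall n, Cmod (u n - z) <= K n) -> Cmod (l - z) <= k.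
Proof.
  intros Hu HK H.
  apply (is_lim_seq_le (fun n => Cmod (l - z)) (fun n => Cmod (u n - l) + K n)
    (Cmod (l - z)) k).
  - intros n. rewrite (Cmod_minus_sym (u n)).
    eapply Rle_trans; [apply (Cmod_minus_triangle l (u n) z)|]. specialize (H n). lra.
  - apply is_lim_seq_const.
  - replace k with (0 + k) by ring. apply is_lim_seq_plus'; assumption.
Qed.

Lemma is_lim_seq_eventually_le (u v : nat -> R) (l m : R) (N : nat) :
  is_lim_seq u l -> is_lim_seq v m -> (forall n, (N <= n)%nat -> u n <= v n) -> l <= m.
Proof.
  intros Hu Hv H.
  apply (is_lim_seq_le (fun n => u (n + N)%nat) (fun n => v (n + N)%nat) l m).
  - intros n; apply H; lia.
  - apply -> (is_lim_seq_incr_n u N l); assumption.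
  - apply -> (is_lim_seq_incr_n v N m); assumption.
Qed.

Lemma is_lim_seq_inv_S : is_lim_seq (fun n => / INR (S n)) 0.
Proof.
  apply is_lim_seq_incr_1 with (u := fun n => / INR n).
  apply (is_lim_seq_inv INR p_infty); [apply is_lim_seq_INR|discriminate].
Qed.

Lemma is_lim_seq_scal_inv_S (K : R) : is_lim_seq (fun n => K / INR (S n)) 0.
Proof.
  replace 0 with (K * 0) by ring.
  apply (is_lim_seq_scal_l _ K 0), is_lim_seq_inv_S.
Qed.

(** The Cauchy rate is inherited as a rate of convergence by letting the larger index tend to
    infinity. *)
Lemma Clim_Cauchy (u : nat -> C) (K : R) :
  (forall n m, (n <= m)%nat -> Cmod (u m - u n) <= K / INR (S n)) ->
  exists l, Clim u l /\ forall n, Cmod (u n - l) <= K / INR (S n).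
Proof.
  intros H.
  assert (G : forall p : C -> R, (forall z w, Rabs (p z - p w) <= Cmod (z - w)) ->
    ex_finite_lim_seq (fun n => p (u n))).
  { intros p Hp. apply ex_lim_seq_cauchy_corr. intros eps.
    destruct (is_lim_seq_scal_inv_S K (ball 0 eps)) as [N HN].
    { exists eps; auto. }
    exists N. intros n m Hn Hm.
    assert (S : forall i j, (N <= i)%nat -> (i <= j)%nat -> Rabs (p (u j) - p (u i)) < eps).
    { intros i j Hi Hij. eapply Rle_lt_trans; [apply Hp|].
      eapply Rle_lt_trans; [apply H; auto|].
      specialize (HN i Hi). unfold ball in HN; simpl in HN.
      unfold AbsRing_ball, abs, minus, plus, opp in HN; simpl in HN.
      rewrite Ropp_0, Rplus_0_r in HN. eapply Rle_lt_trans; [apply Rle_abs|exact HN]. }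
    destruct (Nat.le_ge_cases n m) as [Hnm|Hnm].
    - rewrite Rabs_minus_sym. auto.
    - auto. }
  destruct (G fst) as [l1 Hl1].
  { intros z w. apply (Cmod_fst (z - w)). }
  destruct (G snd) as [l2 Hl2].
  { intros z w. apply (Cmod_snd (z - w)). }
  exists (l1, l2).
  assert (L : Clim u (l1, l2)) by (apply Clim_components; assumption).
  split; [exact L|]. intros n.
  rewrite Cmod_minus_sym.
  rewrite <- (Rplus_0_l (K / INR (S n))).
  apply (is_lim_seq_eventually_le (fun m => Cmod ((l1, l2) - u n))
    (fun m => Cmod (u m - (l1, l2)) + K / INR (S n)) _ _ n).
  - apply is_lim_seq_const.
  - apply is_lim_seq_plus'; [exact L|apply is_lim_seq_const].
  - intros m Hm. eapply Rle_trans; [apply (Cmod_minus_triangle _ (u m))|].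
    rewrite (Cmod_minus_sym (l1, l2)). specialize (H n m Hm). lra.
Qed.

(** [CSeries1] is built on the total operator [Lim_seq], so its value means something only once
    convergence is known; this is where a proved limit becomes the value of a series. *)
Lemma Clim_CSeries1 (u : nat -> C) (l : C) :
  Clim (fun N => csum (fun k => u (S k)) N) l -> CSeries1 u = l.
Proof.
  intros H. unfold CSeries1.
  rewrite (is_lim_seq_unique _ _ (Clim_fst _ _ H)), (is_lim_seq_unique _ _ (Clim_snd _ _ H)).
  symmetry; apply surjective_pairing.
Qed.

Lemma Clim_Cint0oo (f : R -> C) (l : C) :
  Clim (fun N => CInt f 0 (INR N)) l -> Cint0oo f = l.
Proof.
  intros H. unfold Cint0oo, Rint0oo.
  pose proof (is_lim_seq_unique _ _ (Clim_fst _ _ H)) as E1.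
  pose proof (is_lim_seq_unique _ _ (Clim_snd _ _ H)) as E2.
  simpl in E1, E2. rewrite E1, E2.
  symmetry; apply surjective_pairing.
Qed.

Lemma is_derive_Rext (f g : R -> R) (x l : R) :
  (forall t, f t = g t) -> is_derive f x l -> is_derive g x l.
Proof. apply is_derive_ext. Qed.

(** * Improper integrals over the half-line *)

(** The majorant [1 / (1 + x)^2] has the elementary primitive [- 1 / (1 + x)], which gives explicit
    tails [2 M / (1 + X)]. Continuity is asked for on the whole line, so that no end point needs
    separate treatment. *)
Definition dominated (f : R -> C) (M : R) : Prop :=
  (forall x, Cct f x) /\ (forall x, 0 <= x -> Cmod (f x) <= M / (1 + x) ^ 2).

Lemma dominated_ge_0 (f : R -> C) (M : R) : dominated f M -> 0 <= M.
Proof.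
  intros [_ H]. specialize (H 0 (Rle_refl _)).
  replace (M / (1 + 0) ^ 2) with M in H by field.
  eapply Rle_trans; [apply Cmod_ge_0|exact H].
Qed.

Lemma continuous_inv_sqr (M x : R) : 0 <= x -> continuous (fun t => M / (1 + t) ^ 2) x.
Proof.
  intros Hx. apply (ex_derive_continuous (V := R_NormedModule)).
  auto_derive. apply Rgt_not_eq. apply pow_lt with (n := 2%nat). lra.
Qed.

Lemma dominated_CInt (f : R -> C) (M a b : R) :
  dominated f M -> 0 <= a <= b -> Cmod (CInt f a b) <= 2 * (M / (1 + a) - M / (1 + b)).
Proof.
  intros [Hc Hb] Hab.
  replace (M / (1 + a) - M / (1 + b)) with (- (M / (1 + b)) - - (M / (1 + a))) by ring.
  apply (CInt_bound f (fun x => - (M / (1 + x))) (fun x => M / (1 + x) ^ 2)).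
  - lra.
  - auto.
  - intros x Hx. auto_derive; [lra|]. field. lra.
  - intros x Hx. apply continuous_inv_sqr; lra.
  - intros x Hx. apply Hb; lra.
Qed.

Lemma dominated_Clim (f : R -> C) (M : R) :
  dominated f M ->
  Clim (fun N => CInt f 0 (INR N)) (Cint0oo f) /\
  forall N, Cmod (CInt f 0 (INR N) - Cint0oo f) <= 2 * M / INR (S N).
Proof.
  intros Hd. pose proof (dominated_ge_0 f M Hd) as HM.
  destruct (Clim_Cauchy (fun N => CInt f 0 (INR N)) (2 * M)) as [l [Hl Hb]].
  - intros n m Hnm. apply le_INR in Hnm. pose proof (pos_INR n) as Hn.
    replace (CInt f 0 (INR m) - CInt f 0 (INR n))%C with (CInt f (INR n) (INR m)).
    + eapply Rle_trans; [apply (dominated_CInt f M); [assumption|lra]|].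
      rewrite S_INR.
      assert (0 <= M / (1 + INR m)) by (apply Rdiv_le_0_compat; lra).
      replace (INR n + 1) with (1 + INR n) by ring.
      unfold Rdiv in *. lra.
    + rewrite <- (CInt_Chasles f 0 (INR n) (INR m)); [ring|lra|]. intros; apply Hd.
  - rewrite (Clim_Cint0oo f l Hl). auto.
Qed.

Lemma Cint0oo_tail (f : R -> C) (M X : R) :
  dominated f M -> 0 <= X -> Cmod (CInt f 0 X - Cint0oo f) <= 2 * M / (1 + X).
Proof.
  intros Hd HX. pose proof (dominated_ge_0 f M Hd) as HM.
  destruct (dominated_Clim f M Hd) as [L _].
  rewrite Cmod_minus_sym. rewrite <- (Rplus_0_l (2 * M / (1 + X))).
  destruct (INR_unbounded X) as [N0 HN0].
  apply (is_lim_seq_eventually_le (fun n => Cmod (Cint0oo f - CInt f 0 X))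
    (fun n => Cmod (CInt f 0 (INR n) - Cint0oo f) + 2 * M / (1 + X)) _ _ N0).
  - apply is_lim_seq_const.
  - apply is_lim_seq_plus'; [exact L|apply is_lim_seq_const].
  - intros n Hn. apply le_INR in Hn.
    eapply Rle_trans; [apply (Cmod_minus_triangle _ (CInt f 0 (INR n)))|].
    rewrite (Cmod_minus_sym (Cint0oo f)). apply Rplus_le_compat_l.
    rewrite <- (CInt_Chasles f 0 X (INR n)); [|lra|intros; apply Hd].
    replace (CInt f 0 X + CInt f X (INR n) - CInt f 0 X)%C with (CInt f X (INR n)) by ring.
    eapply Rle_trans; [apply (dominated_CInt f M); [assumption|lra]|].
    assert (0 <= M / (1 + INR n)) by (apply Rdiv_le_0_compat; lra).
    unfold Rdiv in *. lra.
Qed.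

Lemma Cint0oo_bound (f : R -> C) (M : R) : dominated f M -> Cmod (Cint0oo f) <= 2 * M.
Proof.
  intros Hd. pose proof (Cint0oo_tail f M 0 Hd (Rle_refl _)) as H.
  rewrite CInt_point, Cmod_minus_sym in H.
  replace (Cint0oo f - 0)%C with (Cint0oo f) in H by ring.
  replace (2 * M) with (2 * M / (1 + 0)) by field. exact H.
Qed.

Lemma Cint0oo_limit (f : R -> C) (M : R) (X : nat -> R) :
  dominated f M -> (forall n, INR n <= X n) -> Clim (fun n => CInt f 0 (X n)) (Cint0oo f).
Proof.
  intros Hd HX. pose proof (dominated_ge_0 f M Hd) as HM.
  apply Clim_squeeze with (fun n => 2 * M / INR (S n)); [|apply is_lim_seq_scal_inv_S].
  intros n. specialize (HX n). pose proof (pos_INR n).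
  eapply Rle_trans; [apply (Cint0oo_tail f M); [assumption|lra]|].
  apply Rmult_le_compat_l; [lra|]. rewrite S_INR. apply Rinv_le_contravar; lra.
Qed.

Lemma Cint0oo_ext (f g : R -> C) : (forall x, 0 <= x -> f x = g x) -> Cint0oo f = Cint0oo g.
Proof.
  intros H. unfold Cint0oo, Rint0oo. f_equal; f_equal; apply Lim_seq_ext; intros n;
    apply RInt_ext; intros x Hx; pose proof (pos_INR n);
    rewrite Rmin_left in Hx by lra; rewrite H; auto; lra.
Qed.

Lemma dominated_scal (c : C) (f : R -> C) (M : R) :
  dominated f M -> dominated (fun x => c * f x)%C (Cmod c * M).
Proof.
  intros [H1 H2]; split.
  - intros x. apply Cct_mult; [apply Cct_const|auto].
  - intros x Hx. rewrite Cmod_mult. unfold Rdiv. rewrite Rmult_assoc.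
    apply Rmult_le_compat_l; [apply Cmod_ge_0|]. apply H2; auto.
Qed.

Lemma dominated_plus (f g : R -> C) (M N : R) :
  dominated f M -> dominated g N -> dominated (fun x => f x + g x)%C (M + N).
Proof.
  intros [H1 H2] [H3 H4]; split.
  - intros x. apply Cct_plus; auto.
  - intros x Hx. eapply Rle_trans; [apply Cmod_triangle|].
    unfold Rdiv. rewrite Rmult_plus_distr_r. apply Rplus_le_compat; [apply H2|apply H4]; auto.
Qed.

Lemma dominated_mult_e (f : R -> C) (M u : R) :
  dominated f M -> dominated (fun x => f x * e (u * x))%C M.
Proof.
  intros [H1 H2]; split.
  - intros x. apply Cct_mult; auto.
    apply Cct_ext with (fun t => cexp (0, 2 * PI * (u * t))); [intros; symmetry; apply e_cexp|].
    apply Cct_cexp. split; simpl; [apply continuous_const|].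
    apply (continuous_derive _ _ (2 * PI * u)). auto_derive; auto; ring.
  - intros x Hx. rewrite Cmod_mult, Cmod_e, Rmult_1_r. auto.
Qed.

Lemma Cint0oo_plus (f g : R -> C) (M N : R) :
  dominated f M -> dominated g N ->
  Cint0oo (fun x => f x + g x)%C = (Cint0oo f + Cint0oo g)%C.
Proof.
  intros Hf Hg. apply Clim_Cint0oo.
  eapply Clim_ext; [|apply Clim_plus; [apply (dominated_Clim f M Hf)|apply (dominated_Clim g N Hg)]].
  intros n; simpl. symmetry. apply CInt_plus; [apply pos_INR|intros; apply Hf|intros; apply Hg].
Qed.

Lemma Cint0oo_scal (c : C) (f : R -> C) (M : R) :
  dominated f M -> Cint0oo (fun x => c * f x)%C = (c * Cint0oo f)%C.
Proof.
  intros Hf. apply Clim_Cint0oo.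
  eapply Clim_ext; [|apply Clim_scal; apply (dominated_Clim f M Hf)].
  intros n; simpl. symmetry. apply CInt_scal; [apply pos_INR|intros; apply Hf].
Qed.

(** Domination of the primitive [F] makes it vanish at infinity, so only the end point [0]
    contributes. *)
Lemma Cint0oo_derivative (F f : R -> C) (M N : R) :
  dominated F N -> dominated f M -> (forall x, Cder F x (f x)) -> Cint0oo f = (- F 0)%C.
Proof.
  intros HF Hf HD. apply Clim_Cint0oo.
  apply Clim_squeeze with (fun n => N / INR (S n)); [|apply is_lim_seq_scal_inv_S].
  intros n. pose proof (pos_INR n). pose proof (dominated_ge_0 F N HF).
  rewrite (CInt_FTC f F); [|lra|intros; apply HD|intros; apply Hf].
  replace (F (INR n) - F 0 - - F 0)%C with (F (INR n)) by ring.
  eapply Rle_trans; [apply HF; assumption|].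
  apply Rmult_le_compat_l; [assumption|]. rewrite S_INR.
  apply Rinv_le_contravar; [lra|]. nra.
Qed.

(** Differentiation under the integral sign: the pointwise remainder integrates to at most
    [2 K h^2], and [Cder_quadratic] concludes. *)
Lemma Cder_Cint0oo (F : R -> R -> C) (Psi : R -> C) (s eta K M : R) (Mh : R -> R) :
  0 < eta ->
  (forall h, Rabs h <= eta -> dominated (F (s + h)) (Mh h)) -> dominated Psi M ->
  (forall h y, Rabs h <= eta -> 0 <= y ->
     Cmod (F (s + h)%R y - F s y - RtoC h * Psi y) <= K * h ^ 2 / (1 + y) ^ 2) ->
  Cder (fun t => Cint0oo (F t)) s (Cint0oo Psi).
Proof.
  intros Heta HF HPsi HK.
  assert (H0 : dominated (F s) (Mh 0)).
  { rewrite <- (Rplus_0_r s) at 1. apply HF. rewrite Rabs_R0; lra. }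
  apply Cder_quadratic with (2 * K) eta; [assumption|].
  intros h Hh.
  replace (Cint0oo (F (s + h)%R) - Cint0oo (F s) - RtoC h * Cint0oo Psi)%C with
    (Cint0oo (fun y => F (s + h)%R y + (RtoC (-1) * F s y + - RtoC h * Psi y))%C).
  - rewrite Rmult_assoc. apply Cint0oo_bound. split.
    + intros x. repeat apply Cct_plus; [apply HF; auto| |];
        (apply Cct_mult; [apply Cct_const|]); [apply H0|apply HPsi].
    + intros x Hx. replace (_ + _)%C with (F (s + h)%R x - F s x - RtoC h * Psi x)%C by ring. auto.
  - erewrite Cint0oo_plus; [|apply HF; auto|].
    + erewrite Cint0oo_plus; [|apply dominated_scal, H0|apply dominated_scal, HPsi].
      erewrite Cint0oo_scal, Cint0oo_scal; [|apply HPsi|apply H0]. ring.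
    + apply dominated_plus; apply dominated_scal; [apply H0|apply HPsi].
Qed.

(** * Poisson summation *)

(** Fourier partial sum of [x^2 - x] on [[0, 1]]: the series of the second Bernoulli polynomial,
    with the constant adjusted so that the sum vanishes at the integers. *)
Definition bern_partial (K : nat) (x : R) : R :=
  rsum (fun k => (cos (2 * PI * INR (S k) * x) - 1) / (PI ^ 2 * INR (S k) ^ 2)) K.

(** It is half the second derivative of [x^2 - x - bern_partial K x], and also the sum of [e(k x)]
    over [|k| <= K]. *)
Definition dirichlet_kernel (K : nat) (x : R) : R :=
  1 + 2 * rsum (fun k => cos (2 * PI * INR (S k) * x)) K.

(** For [x >= 1] one has [1 / x^2 <= 2 / (x (x + 1))], which telescopes. *)
Lemma rsum_inv_sqr (n m : nat) : rsum (fun k => / INR (S (n + k)) ^ 2) m <= 2 / INR (S n).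
Proof.
  apply Rle_trans with (rsum (fun k => - (2 / INR (S (n + S k))) - - (2 / INR (S (n + k)))) m).
  - apply rsum_le. intros k _. rewrite Nat.add_succ_r, !(S_INR (S _)).
    pose proof (lt_0_INR (S (n + k)) ltac:(lia)) as H. set (x := INR (S (n + k))) in *.
    assert (1 <= x) by (unfold x; apply (le_INR 1); lia).
    replace (- (2 / (x + 1)) - - (2 / x)) with (2 / (x * (x + 1))) by (field; lra).
    apply Rmult_le_reg_r with (x ^ 2 * (x + 1)); [nra|].
    replace (/ x ^ 2 * (x ^ 2 * (x + 1))) with (x + 1) by (field; lra).
    replace (2 / (x * (x + 1)) * (x ^ 2 * (x + 1))) with (2 * x) by (field; lra). lra.
  - rewrite (rsum_telescope (fun k => - (2 / INR (S (n + k))))), Nat.add_0_r.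
    assert (0 <= 2 / INR (S (n + m))); [|lra].
    apply Rdiv_le_0_compat; [lra|apply lt_0_INR; lia].
Qed.

Lemma rsum_add (f : nat -> R) (n m : nat) :
  rsum f (n + m) = rsum f n + rsum (fun k => f (n + k)%nat) m.
Proof.
  induction m as [|m IH]; simpl.
  - rewrite Nat.add_0_r. ring.
  - rewrite Nat.add_succ_r. simpl. rewrite IH. ring.
Qed.

Lemma rsum_abs (f : nat -> R) (n : nat) : Rabs (rsum f n) <= rsum (fun k => Rabs (f k)) n.
Proof.
  induction n as [|n IH]; simpl; [rewrite Rabs_R0; lra|].
  eapply Rle_trans; [apply Rabs_triang|]. lra.
Qed.

Lemma PI2_ge_4 : 4 <= PI ^ 2.
Proof. pose proof PI2_1. nra. Qed.

Lemma bern_partial_Cauchy (K m : nat) (x : R) :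
  Rabs (bern_partial (K + m) x - bern_partial K x) <= / INR (S K).
Proof.
  unfold bern_partial. rewrite rsum_add.
  replace (_ + _ - _) with (rsum (fun k => (cos (2 * PI * INR (S (K + k)) * x) - 1) /
    (PI ^ 2 * INR (S (K + k)) ^ 2)) m) by ring.
  eapply Rle_trans; [apply rsum_abs|].
  apply Rle_trans with (rsum (fun k => /2 * / INR (S (K + k)) ^ 2) m).
  - apply rsum_le. intros k _. pose proof (lt_0_INR (S (K + k)) ltac:(lia)) as H.
    pose proof PI2_ge_4 as Hp.
    unfold Rdiv. rewrite Rabs_mult, Rinv_mult, Rabs_mult, !Rabs_inv.
    rewrite (Rabs_pos_eq (PI ^ 2)), (Rabs_pos_eq (INR _ ^ 2)) by nra.
    rewrite <- Rmult_assoc.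
    apply Rmult_le_compat_r; [left; apply Rinv_0_lt_compat; nra|].
    pose proof (COS_bound (2 * PI * INR (S (K + k)) * x)).
    (* The numerator is at most [2] in absolute value, and [PI^2 >= 4]. *)
    apply Rle_trans with (2 * / 4); [|lra].
    apply Rmult_le_compat; [apply Rabs_pos| |apply Rabs_le; lra|].
    + left; apply Rinv_0_lt_compat; lra.
    + apply Rinv_le_contravar; lra.
  - rewrite rsum_scal. pose proof (rsum_inv_sqr K m). unfold Rdiv in *. lra.
Qed.

(** Each new cosine times [2 sin(PI x)] is a difference of two sines, so the product telescopes. *)
Lemma dirichlet_kernel_sin (K : nat) (x : R) :
  dirichlet_kernel K x * sin (PI * x) = sin ((2 * INR K + 1) * (PI * x)).
Proof.
  unfold dirichlet_kernel. induction K as [|K IH].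
  - cbn [rsum]. simpl INR. rewrite Rmult_0_r, Rplus_0_r, Rmult_1_l. f_equal. ring.
  - transitivity ((1 + 2 * rsum (fun k => cos (2 * PI * INR (S k) * x)) K) * sin (PI * x)
      + 2 * cos (2 * PI * INR (S K) * x) * sin (PI * x)); [cbn [rsum]; ring|].
    rewrite IH, S_INR.
    replace (2 * PI * (INR K + 1) * x) with ((2 * (INR K + 1)) * (PI * x)) by ring.
    set (u := 2 * (INR K + 1)). set (y := PI * x).
    replace ((2 * INR K + 1) * y) with (u * y - y) by (unfold u; ring).
    replace ((u + 1) * y) with (u * y + y) by ring.
    rewrite sin_plus, sin_minus. ring.
Qed.

Lemma bern_partial_derive (K : nat) (x : R) :
  is_derive (fun t => t ^ 2 - t - bern_partial K t) x
    (2 * x - 1 + 2 * rsum (fun k => sin (2 * PI * INR (S k) * x) / (PI * INR (S k))) K).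
Proof.
  pose proof PI_RGT_0.
  induction K as [|K IH].
  - unfold bern_partial; simpl. auto_derive; auto. ring.
  - apply is_derive_Rext with (fun t => (t ^ 2 - t - bern_partial K t)
      - (cos (2 * PI * INR (S K) * t) - 1) / (PI ^ 2 * INR (S K) ^ 2)).
    { intros t. unfold bern_partial; cbn [rsum]. ring. }
    pose proof (lt_0_INR (S K) ltac:(lia)).
    replace (2 * x - 1 + _) with
      ((2 * x - 1 + 2 * rsum (fun k => sin (2 * PI * INR (S k) * x) / (PI * INR (S k))) K)
       - (- (2 / (PI * INR (S K)) * sin (2 * PI * INR (S K) * x)))).
    2:{ cbn [rsum]. field. split; lra. }
    apply (is_derive_minus (V := R_NormedModule) (fun t => t ^ 2 - t - bern_partial K t)
      (fun t => (cos (2 * PI * INR (S K) * t) - 1) / (PI ^ 2 * INR (S K) ^ 2))); [exact IH|].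
    set (c := INR (S K)) in *. auto_derive; auto. field. split; lra.
Qed.

Lemma bern_partial_derive2 (K : nat) (x : R) :
  is_derive (fun t => 2 * t - 1 +
      2 * rsum (fun k => sin (2 * PI * INR (S k) * t) / (PI * INR (S k))) K) x
    (2 * dirichlet_kernel K x).
Proof.
  pose proof PI_RGT_0. unfold dirichlet_kernel.
  induction K as [|K IH].
  - simpl. auto_derive; [exact I|ring].
  - apply is_derive_Rext with (fun t => (2 * t - 1 +
      2 * rsum (fun k => sin (2 * PI * INR (S k) * t) / (PI * INR (S k))) K)
      + 2 * (sin (2 * PI * INR (S K) * t) / (PI * INR (S K)))).
    { intros t. cbn [rsum]. ring. }
    pose proof (lt_0_INR (S K) ltac:(lia)).
    replace (2 * (1 + _)) with
      (2 * (1 + 2 * rsum (fun k => cos (2 * PI * INR (S k) * x)) K)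
       + 4 * cos (2 * PI * INR (S K) * x)).
    2:{ cbn [rsum]. ring. }
    apply (is_derive_plus (V := R_NormedModule) _
      (fun t => 2 * (sin (2 * PI * INR (S K) * t) / (PI * INR (S K))))); [exact IH|].
    set (c := INR (S K)) in *. auto_derive; auto. field. split; lra.
Qed.

Lemma sin_INR_PI (k : nat) : sin (INR k * PI) = 0.
Proof. apply sin_eq_0_1. exists (Z.of_nat k). now rewrite <- INR_IZR_INZ. Qed.

Lemma sin_2PI_INR (k n : nat) : sin (2 * PI * INR k * INR n) = 0.
Proof.
  replace (2 * PI * INR k * INR n) with (INR (2 * k * n) * PI)
    by (rewrite !mult_INR; simpl; ring).
  apply sin_INR_PI.
Qed.

Lemma cos_2PI_INR (k n : nat) : cos (2 * PI * INR k * INR n) = 1.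
Proof.
  rewrite Rmult_assoc, <- mult_INR.
  pose proof (f_equal fst (e_INR (k * n))) as H. exact H.
Qed.

(** The expression has derivative [2 sin(m PI t) / sin(PI t)] with [m = 2 K + 1]. Integration by
    parts between [x] and [1/2] gains the factor [1 / m]; at [1/2] everything vanishes because [m]
    is odd. *)
Lemma bern_derivative_bound (K : nat) (d x : R) :
  0 < d -> d <= x <= / 2 ->
  Rabs (2 * x - 1 + 2 * rsum (fun k => sin (2 * PI * INR (S k) * x) / (PI * INR (S k))) K)
  <= 3 / sin (PI * d) ^ 2 / INR (S K).
Proof.
  intros Hd Hx. pose proof PI_RGT_0 as Hpi. pose proof PI2_1 as Hpi2.
  set (m := 2 * INR K + 1).
  assert (Hm : 0 < m) by (unfold m; pose proof (pos_INR K); lra).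
  assert (HmK : INR (S K) <= m) by (unfold m; rewrite S_INR; pose proof (pos_INR K); lra).
  assert (HSK : 0 < INR (S K)) by (apply lt_0_INR; lia).
  set (s := sin (PI * d)).
  assert (Hs : 0 < s) by (apply sin_gt_0; nra).
  assert (Hs1 : s <= 1) by apply SIN_bound.
  assert (Hms : 0 < m * s ^ 2) by (apply Rmult_lt_0_compat; [|apply pow_lt]; assumption).
  assert (Hsx : forall t, x <= t <= / 2 -> s <= sin (PI * t)).
  { intros t Ht. apply sin_incr_1; nra. }
  set (r1 := fun t => 2 * t - 1 +
    2 * rsum (fun k => sin (2 * PI * INR (S k) * t) / (PI * INR (S k))) K).
  fold (r1 x).
  (* The added term is the boundary term of the integration by parts. It cancels the derivative
     [2 sin(m PI t) / sin(PI t)] of [r1] and leaves one of size [O(1 / (m s^2))]. *)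
  pose proof (Rmvt_bound (fun t => r1 t + 2 * cos (m * (PI * t)) / (m * PI * sin (PI * t)))
    (fun t => - 2 * cos (m * (PI * t)) * cos (PI * t) / (m * sin (PI * t) ^ 2))
    (fun t => 2 / (m * s ^ 2) * t) (fun _ => 2 / (m * s ^ 2)) x (/ 2)) as H.
  cbv beta in H.
  assert (E1 : r1 (/ 2) = 0).
  { unfold r1. replace (2 * / 2 - 1) with 0 by field.
    replace (rsum _ K) with (rsum (fun _ => 0) K); [rewrite rsum_const; ring|].
    clear. induction K as [|K IH]; [reflexivity|]. cbn [rsum]. rewrite IH.
    replace (2 * PI * INR (S K) * / 2) with (INR (S K) * PI) by field.
    rewrite sin_INR_PI. unfold Rdiv. ring. }
  assert (E2 : cos (m * (PI * / 2)) = 0).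
  { apply cos_eq_0_1. exists (Z.of_nat K). rewrite <- INR_IZR_INZ. unfold m. field. }
  rewrite E1, E2 in H.
  assert (H' : Rabs (r1 x + 2 * cos (m * (PI * x)) / (m * PI * sin (PI * x))) <=
    2 / (m * s ^ 2) * / 2 - 2 / (m * s ^ 2) * x).
  { rewrite <- Rabs_Ropp.
    replace (- (_ + _)) with (0 + 2 * 0 / (m * PI * sin (PI * / 2)) -
      (r1 x + 2 * cos (m * (PI * x)) / (m * PI * sin (PI * x)))) by (unfold Rdiv; ring).
    apply H.
    - lra.
    - intros t Ht. specialize (Hsx t Ht).
      replace (-2 * cos (m * (PI * t)) * cos (PI * t) / (m * sin (PI * t) ^ 2)) with
        (2 * dirichlet_kernel K t + (-2 * sin (m * (PI * t)) / sin (PI * t)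
          -2 * cos (m * (PI * t)) * cos (PI * t) / (m * sin (PI * t) ^ 2))).
      + apply (is_derive_plus (V := R_NormedModule) r1
          (fun t => 2 * cos (m * (PI * t)) / (m * PI * sin (PI * t)))).
        * apply bern_partial_derive2.
        * auto_derive; [|field; repeat split; lra].
          apply Rgt_not_eq. apply Rmult_lt_0_compat; [apply Rmult_lt_0_compat|]; lra.
      + assert (E : sin (m * (PI * t)) = dirichlet_kernel K t * sin (PI * t))
          by (symmetry; apply dirichlet_kernel_sin).
        rewrite E. clearbody m. field. lra.
    - generalize (2 / (m * s ^ 2)). intros c t _. auto_derive; [exact I|ring].
    - intros t Ht. specialize (Hsx t Ht).
      unfold Rdiv. rewrite !Rabs_mult, Rabs_inv.
      rewrite (Rabs_pos_eq (m * sin (PI * t) ^ 2)) by (apply Rmult_le_pos; nra).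
      replace (Rabs (-2)) with 2 by (rewrite Rabs_left; lra).
      apply Rmult_le_compat.
      + apply Rmult_le_pos; [apply Rmult_le_pos; [lra|apply Rabs_pos]|apply Rabs_pos].
      + left; apply Rinv_0_lt_compat. apply Rmult_lt_0_compat; nra.
      + pose proof (COS_bound (m * (PI * t))). pose proof (COS_bound (PI * t)).
        assert (Rabs (cos (m * (PI * t))) <= 1) by (apply Rabs_le; lra).
        assert (Rabs (cos (PI * t)) <= 1) by (apply Rabs_le; lra).
        pose proof (Rabs_pos (cos (m * (PI * t)))). pose proof (Rabs_pos (cos (PI * t))). nra.
      + apply Rinv_le_contravar; [assumption|].
        apply Rmult_le_compat_l; [lra|]. nra. }
  assert (Hsx' := Hsx x ltac:(lra)).
  assert (Hq : Rabs (2 * cos (m * (PI * x)) / (m * PI * sin (PI * x))) <= 2 / (m * s ^ 2)).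
  { unfold Rdiv. rewrite !Rabs_mult, Rabs_inv.
    rewrite (Rabs_pos_eq 2) by lra.
    rewrite (Rabs_pos_eq (m * PI * sin (PI * x)))
      by (apply Rmult_le_pos; [apply Rmult_le_pos|]; lra).
    apply Rmult_le_compat.
    - apply Rmult_le_pos; [lra|apply Rabs_pos].
    - left; apply Rinv_0_lt_compat. apply Rmult_lt_0_compat; [apply Rmult_lt_0_compat|]; lra.
    - pose proof (COS_bound (m * (PI * x))).
      assert (Rabs (cos (m * (PI * x))) <= 1) by (apply Rabs_le; lra). lra.
    - apply Rinv_le_contravar; [assumption|].
      rewrite Rmult_assoc. apply Rmult_le_compat_l; [lra|]. 
      assert (s ^ 2 <= s) by (simpl; nra).
      assert (sin (PI * x) <= PI * sin (PI * x)) by nra. lra. }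
  (* In the constant [3], one unit comes from the mean value inequality over a length at most [1/2],
     two from the boundary term. *)
  assert (Hle : 3 / (m * s ^ 2) <= 3 / s ^ 2 / INR (S K)).
  { unfold Rdiv. rewrite Rmult_assoc. apply Rmult_le_compat_l; [lra|].
    rewrite <- Rinv_mult. apply Rinv_le_contravar; [|clearbody s m; nra].
    apply Rmult_lt_0_compat; [apply pow_lt|]; assumption. }
  eapply Rle_trans; [|exact Hle].
  replace (r1 x) with ((r1 x + 2 * cos (m * (PI * x)) / (m * PI * sin (PI * x)))
    - 2 * cos (m * (PI * x)) / (m * PI * sin (PI * x))) by ring.
  eapply Rle_trans; [apply Rabs_triang|]. rewrite Rabs_Ropp.
  assert (0 < 2 / (m * s ^ 2)).
  { apply Rdiv_lt_0_compat; [lra|assumption]. }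
  replace (3 / (m * s ^ 2)) with (2 / (m * s ^ 2) * / 2 + 2 / (m * s ^ 2)).
  - nra.
  - field. split; apply Rgt_not_eq; [exact Hs|exact Hm].
Qed.

Lemma one_minus_cos_bound (y : R) : Rabs (cos y - 1) <= y ^ 2.
Proof.
  replace y with (2 * (y / 2)) at 1 by field. rewrite cos_2a_sin.
  replace (1 - 2 * sin (y / 2) * sin (y / 2) - 1) with (- (2 * sin (y / 2) ^ 2)) by ring.
  rewrite Rabs_Ropp, Rabs_pos_eq by nra.
  assert (H : Rabs (sin (y / 2)) <= Rabs (y / 2)).
  { pose proof (Rmvt_bound sin cos (fun x => x) (fun _ => 1)) as M.
    assert (D : forall a b, a <= b -> Rabs (sin b - sin a) <= b - a).
    { intros a b Hab. apply M; auto.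
      - intros x _. apply is_derive_sin.
      - intros x _. apply (is_derive_id (K := R_AbsRing)).
      - intros x _. apply Rabs_le. pose proof (COS_bound x). lra. }
    destruct (Rle_dec 0 (y / 2)) as [Hy|Hy].
    - specialize (D 0 (y / 2) Hy). rewrite sin_0, !Rminus_0_r in D.
      now rewrite (Rabs_pos_eq (y / 2)).
    - specialize (D (y / 2) 0 ltac:(lra)). rewrite sin_0 in D.
      rewrite Rminus_0_l, Rabs_Ropp in D. rewrite (Rabs_left1 (y / 2)); lra. }
  apply Rsqr_le_abs_1 in H. unfold Rsqr in H. simpl. nra.
Qed.

(** The first [J] terms are at most [4 / (J + 1)^2] each, since [|cos y - 1| <= y^2]; the later ones
    are covered by the Cauchy estimate. The bound is uniform in [K]. *)
Lemma bern_partial_small (K J : nat) :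
  Rabs (bern_partial K (/ INR (S J))) <= 5 / INR (S J).
Proof.
  pose proof (lt_0_INR (S J) ltac:(lia)) as HJ.
  assert (G : forall n, (n <= J)%nat -> Rabs (bern_partial n (/ INR (S J))) <= 4 / INR (S J)).
  { intros n Hn. unfold bern_partial. eapply Rle_trans; [apply rsum_abs|].
    apply Rle_trans with (rsum (fun _ => 4 * / INR (S J) ^ 2) n).
    - apply rsum_le. intros k _.
      pose proof (lt_0_INR (S k) ltac:(lia)) as Hk. pose proof PI_RGT_0 as Hp.
      unfold Rdiv. rewrite Rabs_mult, Rabs_inv, (Rabs_pos_eq (_ * _)) by (apply Rmult_le_pos; nra).
      apply Rmult_le_reg_r with (PI ^ 2 * INR (S k) ^ 2); [apply Rmult_lt_0_compat; nra|].
      rewrite Rmult_assoc, Rinv_l, Rmult_1_r.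
      + eapply Rle_trans; [apply one_minus_cos_bound|]. right. field. lra.
      + apply Rgt_not_eq. apply Rmult_lt_0_compat; nra.
    - rewrite rsum_const.
      apply Rmult_le_reg_r with (INR (S J) ^ 2); [nra|].
      replace (INR n * (4 * / INR (S J) ^ 2) * INR (S J) ^ 2) with (4 * INR n) by (field; lra).
      replace (4 / INR (S J) * INR (S J) ^ 2) with (4 * INR (S J)) by (field; lra).
      apply Rmult_le_compat_l; [lra|]. apply le_INR. lia. }
  destruct (Nat.le_ge_cases K J) as [H|H].
  - eapply Rle_trans; [apply G; auto|]. apply Rmult_le_compat_r; [|lra].
    left; apply Rinv_0_lt_compat; auto.
  - pose proof (bern_partial_Cauchy J (K - J) (/ INR (S J))) as C.
    replace (J + (K - J))%nat with K in C by lia.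
    specialize (G J (le_n _)).
    replace (bern_partial K (/ INR (S J))) with ((bern_partial K (/ INR (S J)) -
      bern_partial J (/ INR (S J))) + bern_partial J (/ INR (S J))) by ring.
    eapply Rle_trans; [apply Rabs_triang|]. unfold Rdiv in *. lra.
Qed.

(* The partial sums have derivatives of size O(1/K) away from 0, and are uniformly small near 0;
   hence x^2 - x - bern_partial K x, which vanishes at 0, tends to 0. *)
Lemma bern_approx_half (K : nat) (x : R) :
  0 < x <= / 2 -> Rabs (x ^ 2 - x - bern_partial K x) <= / INR (S K).
Proof.
  intros Hx.
  destruct (INR_unbounded (/ x)) as [J0 HJ0].
  assert (HJ : forall J, (J0 <= J)%nat -> / INR (S J) < x).
  { intros J H. rewrite <- (Rinv_inv x). apply Rinv_lt_contravar.
    - apply Rmult_lt_0_compat; [apply Rinv_0_lt_compat; lra|apply lt_0_INR; lia].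
    - apply Rlt_le_trans with (INR J0); [lra|apply le_INR; lia]. }
  (* Comparison with the point [d = 1 / (J + 1)] to the left of [x]. In [S2] the index [m] tends to
     infinity, which removes the derivative term; finally [J] tends to infinity. *)
  assert (S1 : forall J, (J0 <= J)%nat -> forall m,
    Rabs (x ^ 2 - x - bern_partial (K + m) x) <= 6 / INR (S J) +
      3 / sin (PI * / INR (S J)) ^ 2 / INR (S (K + m))).
  { intros J H m. specialize (HJ J H). set (d := / INR (S J)) in *.
    assert (Hd : 0 < d) by (apply Rinv_0_lt_compat, lt_0_INR; lia).
    pose proof (bern_partial_small (K + m) J) as Bs. fold d in Bs.
    set (L := 3 / sin (PI * d) ^ 2 / INR (S (K + m))).
    pose proof (Rmvt_bound (fun t => t ^ 2 - t - bern_partial (K + m) t)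
      (fun t => 2 * t - 1 + 2 * rsum (fun k => sin (2 * PI * INR (S k) * t) / (PI * INR (S k))) (K + m))
      (fun t => L * t) (fun _ => L) d x ltac:(lra)) as M.
    cbv beta in M.
    assert (M' : Rabs (x ^ 2 - x - bern_partial (K + m) x -
      (d ^ 2 - d - bern_partial (K + m) d)) <= L * x - L * d).
    { apply M.
      - intros t _. apply bern_partial_derive.
      - intros t _. auto_derive; [exact I|ring].
      - intros t Ht. apply bern_derivative_bound; lra. }
    assert (HL : 0 <= L).
    { assert (0 < sin (PI * d)) by (apply sin_gt_0; pose proof PI_RGT_0; nra).
      apply Rdiv_le_0_compat; [|apply lt_0_INR; lia]. apply Rdiv_le_0_compat; [lra|].
      apply pow_lt; auto. }
    assert (Hb : Rabs (d ^ 2 - d) <= d) by (apply Rabs_le; simpl; nra).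
    replace (x ^ 2 - x - bern_partial (K + m) x) with
      ((x ^ 2 - x - bern_partial (K + m) x - (d ^ 2 - d - bern_partial (K + m) d)) +
       ((d ^ 2 - d) + - bern_partial (K + m) d)) by ring.
    eapply Rle_trans; [apply Rabs_triang|].
    pose proof (Rabs_triang (d ^ 2 - d) (- bern_partial (K + m) d)) as T.
    rewrite Rabs_Ropp in T. unfold Rdiv in *. fold d in Bs. fold d. nra. }
  assert (S2 : forall J, (J0 <= J)%nat ->
    Rabs (x ^ 2 - x - bern_partial K x) <= 6 / INR (S J) + / INR (S K)).
  { intros J H.
    set (c := 3 / sin (PI * / INR (S J)) ^ 2).
    apply (is_lim_seq_le (fun _ => Rabs (x ^ 2 - x - bern_partial K x))
      (fun m => (6 / INR (S J) + / INR (S K)) + c / INR (S (m + K)))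
      (Rabs (x ^ 2 - x - bern_partial K x)) (6 / INR (S J) + / INR (S K))).
    - intros m. specialize (S1 J H m). rewrite (Nat.add_comm m).
      pose proof (bern_partial_Cauchy K m x) as C.
      replace (x ^ 2 - x - bern_partial K x) with ((x ^ 2 - x - bern_partial (K + m) x) +
        (bern_partial (K + m) x - bern_partial K x)) by ring.
      eapply Rle_trans; [apply Rabs_triang|]. fold c in S1. lra.
    - apply is_lim_seq_const.
    - rewrite <- (Rplus_0_r (6 / INR (S J) + / INR (S K))) at 1.
      apply is_lim_seq_plus'; [apply is_lim_seq_const|].
      apply (is_lim_seq_incr_n (fun n => c / INR (S n)) K 0), is_lim_seq_scal_inv_S. }
  apply (is_lim_seq_eventually_le (fun _ => Rabs (x ^ 2 - x - bern_partial K x))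
    (fun J => 6 / INR (S J) + / INR (S K)) _ _ J0).
  - apply is_lim_seq_const.
  - rewrite <- (Rplus_0_l (/ INR (S K))) at 1.
    apply is_lim_seq_plus'; [apply is_lim_seq_scal_inv_S|apply is_lim_seq_const].
  - auto.
Qed.

Lemma rsum_ext (f g : nat -> R) (n : nat) :
  (forall k, (k < n)%nat -> f k = g k) -> rsum f n = rsum g n.
Proof.
  induction n as [|n IH]; intros H; simpl; [reflexivity|]. rewrite IH, H by auto. reflexivity.
Qed.

(** The right half of the interval follows from the symmetry [x -> 1 - x]; at [0] both [x^2 - x] and
    the partial sum vanish. *)
Lemma bern_approx (K : nat) (x : R) :
  0 <= x <= 1 -> Rabs (x ^ 2 - x - bern_partial K x) <= / INR (S K).
Proof.
  assert (Z : Rabs (0 ^ 2 - 0 - bern_partial K 0) <= / INR (S K)).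
  { replace (bern_partial K 0) with 0.
    - replace (0 ^ 2 - 0 - 0) with 0 by ring. rewrite Rabs_R0.
      left; apply Rinv_0_lt_compat, lt_0_INR; lia.
    - unfold bern_partial. rewrite (rsum_ext _ (fun _ => 0)); [rewrite rsum_const; ring|].
      intros k _. rewrite Rmult_0_r, cos_0. unfold Rdiv. ring. }
  assert (H : forall y, 0 <= y <= / 2 -> Rabs (y ^ 2 - y - bern_partial K y) <= / INR (S K)).
  { intros y Hy. destruct (Req_dec y 0) as [->|]; [exact Z|]. apply bern_approx_half. lra. }
  intros Hx. destruct (Rle_dec x (/ 2)) as [Hl|Hl]; [apply H; lra|].
  replace (x ^ 2 - x - bern_partial K x) with ((1 - x) ^ 2 - (1 - x) - bern_partial K (1 - x)).
  - apply H. lra.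
  - replace (bern_partial K (1 - x)) with (bern_partial K x); [ring|].
    apply rsum_ext. intros k _. f_equal. f_equal.
    pose proof (cos_2PI_INR (S k) 1) as E1. pose proof (sin_2PI_INR (S k) 1) as E2.
    replace (INR 1) with 1 in E1, E2 by reflexivity.
    replace (2 * PI * INR (S k) * (1 - x)) with
      (2 * PI * INR (S k) * 1 - 2 * PI * INR (S k) * x) by ring.
    rewrite cos_minus, E1, E2. ring.
Qed.

(** Frequencies are summed symmetrically, because the symmetric partial sums are integrals against
    the Dirichlet kernel; absolute convergence is not involved. *)
Definition zsum (f : Z -> C) (K : nat) : C :=
  (f 0%Z + csum (fun k => f (Z.of_nat (S k)) + f (- Z.of_nat (S k))%Z) K)%C.

Lemma zsum_ext (f g : Z -> C) (K : nat) : (forall k, f k = g k) -> zsum f K = zsum g K.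
Proof. intros H. unfold zsum. rewrite H. f_equal. apply csum_ext. intros; now rewrite !H. Qed.

Lemma zsum_scal (c : C) (f : Z -> C) (K : nat) : zsum (fun k => c * f k)%C K = (c * zsum f K)%C.
Proof.
  unfold zsum. rewrite (csum_ext _ (fun k => c * (f (Z.of_nat (S k)) + f (- Z.of_nat (S k))%Z))%C)
    by (intros; ring). rewrite csum_scal. ring.
Qed.

Lemma zsum_csum (f : Z -> nat -> C) (K n : nat) :
  zsum (fun k => csum (f k) n) K = csum (fun u => zsum (fun k => f k u) K) n.
Proof.
  unfold zsum. rewrite (csum_plus (f 0%Z)). f_equal.
  rewrite csum_swap. apply csum_ext. intros k _. now rewrite csum_plus.
Qed.

Lemma zsum_e (K : nat) (x : R) :
  zsum (fun k => e (- IZR k * x)) K = RtoC (dirichlet_kernel K x).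
Proof.
  unfold zsum, dirichlet_kernel.
  replace (- 0 * x) with 0 by ring. rewrite e_0.
  induction K as [|K IH].
  - simpl. apply C_ext; simpl; ring.
  - cbn [csum rsum].
    transitivity (RtoC (1 + 2 * rsum (fun k => cos (2 * PI * INR (S k) * x)) K)
      + (e (- IZR (Z.of_nat (S K)) * x) + e (- IZR (- Z.of_nat (S K)) * x)))%C;
      [rewrite <- IH; ring|].
    rewrite opp_IZR, <- INR_IZR_INZ.
    set (c := INR (S K)).
    replace (- - c * x) with (c * x) by ring. replace (- c * x) with (- (c * x)) by ring.
    unfold e. replace (2 * PI * - (c * x)) with (- (2 * PI * c * x)) by ring.
    replace (2 * PI * (c * x)) with (2 * PI * c * x) by ring.
    rewrite cos_neg, sin_neg. apply C_ext; simpl; ring.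
Qed.

Lemma continuous_cos_scal (c x : R) : continuous (fun t => cos (c * t)) x.
Proof. apply (continuous_derive _ _ (- c * sin (c * x))). auto_derive; [exact I|ring]. Qed.

Lemma continuous_dirichlet_kernel (K : nat) (x : R) : continuous (dirichlet_kernel K) x.
Proof.
  unfold dirichlet_kernel. apply continuous_Rplus; [apply continuous_const|].
  apply continuous_Rmult; [apply continuous_const|].
  induction K as [|K IH]; cbn [rsum]; [apply continuous_const|].
  apply continuous_Rplus; [exact IH|apply continuous_cos_scal].
Qed.

(* Integration by parts twice against the periodic Bernoulli polynomial, whose Fourier
   partial sums are bern_partial. *)
Lemma euler_maclaurin_step (h h1 h2 : R -> C) (M : R) (K j : nat) :
  (forall x, Cder h x (h1 x)) -> (forall x, Cder h1 x (h2 x)) -> (forall x, Cct h2 x) ->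
  (forall x, 0 <= x -> Cmod (h2 x) <= M / (1 + x) ^ 2) ->
  Cmod (h (INR (S j)) + h (INR j) - 2 * CInt (fun x => h x * RtoC (dirichlet_kernel K x))%C (INR j) (INR (S j)))
  <= 2 * (M * / INR (S K)) * (/ (1 + INR j) - / (1 + INR (S j))).
Proof.
  intros D1 D2 C2 B2.
  set (a := INR j). assert (Eb : INR (S j) = a + 1) by apply S_INR. rewrite Eb.
  assert (Ha : 0 <= a) by apply pos_INR.
  set (r := fun x => (x - a) ^ 2 - (x - a) - bern_partial K (x - a)).
  set (r1 := fun x => 2 * (x - a) - 1 +
    2 * rsum (fun k => sin (2 * PI * INR (S k) * (x - a)) / (PI * INR (S k))) K).
  assert (Dr : forall x, is_derive r x (r1 x)).
  { intros x. replace (r1 x) with (1 * r1 x) by ring.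
    apply (is_derive_Rcomp (fun t => t ^ 2 - t - bern_partial K t) (fun t => t - a)).
    - apply bern_partial_derive.
    - auto_derive; [exact I|ring]. }
  assert (Dr1 : forall x, is_derive r1 x (2 * dirichlet_kernel K x)).
  { intros x.
    assert (E : dirichlet_kernel K x = dirichlet_kernel K (x - a)).
    { unfold dirichlet_kernel. do 2 f_equal. apply rsum_ext. intros k _.
      replace x with (a + (x - a)) at 1 by ring. unfold a.
      rewrite Rmult_plus_distr_l, cos_plus, cos_2PI_INR, sin_2PI_INR. ring. }
    rewrite E. replace (2 * _) with (1 * (2 * dirichlet_kernel K (x - a))) by ring.
    apply (is_derive_Rcomp (fun t => 2 * t - 1 +
      2 * rsum (fun k => sin (2 * PI * INR (S k) * t) / (PI * INR (S k))) K) (fun t => t - a)).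
    - apply bern_partial_derive2.
    - auto_derive; [exact I|ring]. }
  set (A := fun x => (h1 x * RtoC (r x) - h x * RtoC (r1 x))%C).
  set (f2 := fun x => (h2 x * RtoC (r x))%C).
  set (f0 := fun x => (h x * RtoC (dirichlet_kernel K x))%C).
  assert (DA : forall x, Cder A x (f2 x - 2 * f0 x)%C).
  { intros x. eapply Cder_eq; [|apply Cder_minus; apply Cder_mult;
      [apply D2|apply Cder_RtoC, Dr|apply D1|apply Cder_RtoC, Dr1]].
    unfold f2, f0. rewrite RtoC_mult. ring. }
  assert (Cf0 : forall x, Cct f0 x).
  { intros x. apply Cct_mult; [eapply Cder_Cct, D1|].
    apply Cct_RtoC, continuous_dirichlet_kernel. }
  assert (Cf2 : forall x, Cct f2 x).
  { intros x. apply Cct_mult; [apply C2|]. eapply Cct_RtoC, continuous_derive, Dr. }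
  assert (F : CInt (fun x => f2 x - 2 * f0 x)%C a (a + 1) = (A (a + 1)%R - A a)%C).
  { apply CInt_FTC; [lra|auto|]. intros x _. apply Cct_minus; auto.
    apply Cct_mult; [apply Cct_const|auto]. }
  assert (Rsin : forall n, rsum (fun k => sin (2 * PI * INR (S k) * INR n) / (PI * INR (S k))) K = 0).
  { intros n. rewrite (rsum_ext _ (fun _ => 0)); [rewrite rsum_const; ring|].
    intros k _. rewrite sin_2PI_INR. unfold Rdiv; ring. }
  assert (Rb : forall n, bern_partial K (INR n) = 0).
  { intros n. unfold bern_partial. rewrite (rsum_ext _ (fun _ => 0)); [rewrite rsum_const; ring|].
    intros k _. rewrite cos_2PI_INR. unfold Rdiv; ring. }
  assert (E : (A (a + 1)%R - A a)%C = (- (h (a + 1)%R + h a))%C).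
  { unfold A, r, r1. replace (a + 1 - a) with (INR 1) by (simpl; ring).
    replace (a - a) with (INR 0) by (simpl; ring). rewrite !Rb, !Rsin.
    apply C_ext; simpl; ring. }
  rewrite E in F.
  rewrite (CInt_minus f2 (fun x => 2 * f0 x)%C) in F; [|lra|auto|].
  2:{ intros x _. apply Cct_mult; [apply Cct_const|auto]. }
  rewrite CInt_scal in F by (auto; lra).
  replace (h (a + 1)%R + h a - 2 * CInt f0 a (a + 1))%C with (- CInt f2 a (a + 1))%C.
  2:{ replace (h (a + 1)%R + h a)%C with (- - (h (a + 1)%R + h a))%C by ring.
      rewrite <- F. ring. }
  rewrite Cmod_opp.
  pose proof (lt_0_INR (S K) ltac:(lia)) as HK.
  replace (2 * (M * / INR (S K)) * (/ (1 + a) - / (1 + (a + 1)))) with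
    (2 * (- (M * / INR (S K) / (1 + (a + 1))) - - (M * / INR (S K) / (1 + a))))
    by (field; lra).
  apply (CInt_bound f2 (fun x => - (M * / INR (S K) / (1 + x)))
    (fun x => M * / INR (S K) / (1 + x) ^ 2)).
  - lra.
  - auto.
  - intros x Hx. generalize (M * / INR (S K)). intros c. auto_derive; [lra|]. field. lra.
  - intros x Hx. apply continuous_inv_sqr. lra.
  - intros x Hx. unfold f2. rewrite Cmod_mult, Cmod_R.
    replace (M * / INR (S K) / (1 + x) ^ 2) with (M / (1 + x) ^ 2 * / INR (S K)) by (field; lra).
    apply Rmult_le_compat; [apply Cmod_ge_0|apply Rabs_pos|apply B2; lra|].
    apply bern_approx. lra.
Qed.

(** Sum of the unit steps. Each interval contributes [h] at both of its ends, hence twice the sum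
    minus the last value, as [h 0 = 0]; the errors telescope. *)
Lemma euler_maclaurin (h h1 h2 : R -> C) (M : R) (K J : nat) :
  (forall x, Cder h x (h1 x)) -> (forall x, Cder h1 x (h2 x)) -> (forall x, Cct h2 x) ->
  (forall x, 0 <= x -> Cmod (h2 x) <= M / (1 + x) ^ 2) -> h 0 = RtoC 0 ->
  Cmod (2 * csum (fun j => h (INR (S j))) J - h (INR J)
        - 2 * CInt (fun x => h x * RtoC (dirichlet_kernel K x))%C 0 (INR J))
  <= 2 * (M * / INR (S K)).
Proof.
  intros D1 D2 C2 B2 h0.
  assert (HM : 0 <= M).
  { specialize (B2 0 (Rle_refl _)). replace (M / (1 + 0) ^ 2) with M in B2 by field.
    eapply Rle_trans; [apply Cmod_ge_0|exact B2]. }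
  set (E := 2 * (M * / INR (S K))).
  assert (HE : 0 <= E).
  { unfold E. pose proof (lt_0_INR (S K) ltac:(lia)) as HK.
    apply Rinv_0_lt_compat in HK. apply Rmult_le_pos; nra. }
  apply Rle_trans with (E * (1 - / (1 + INR J))).
  2:{ rewrite <- (Rmult_1_r E) at 2. apply Rmult_le_compat_l; [assumption|].
      pose proof (pos_INR J). assert (0 < / (1 + INR J)) by (apply Rinv_0_lt_compat; lra). lra. }
  induction J as [|J IH].
  - simpl. rewrite CInt_point, h0. replace (_ - _ - _)%C with (RtoC 0) by ring.
    rewrite Cmod_0. right. field.
  - cbn [csum]. set (f0 := fun x => (h x * RtoC (dirichlet_kernel K x))%C) in *.
    assert (Cf0 : forall x, Cct f0 x).
    { intros x. apply Cct_mult; [eapply Cder_Cct, D1|].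
      apply Cct_RtoC, continuous_dirichlet_kernel. }
    pose proof (euler_maclaurin_step h h1 h2 M K J D1 D2 C2 B2) as St. fold f0 in St. fold E in St.
    rewrite <- (CInt_Chasles f0 0 (INR J) (INR (S J))); auto.
    2:{ split; [apply pos_INR|apply le_INR; lia]. }
    replace (_ - _ - _)%C with
      ((2 * csum (fun j => h (INR (S j))) J - h (INR J) - 2 * CInt f0 0 (INR J)) +
       (h (INR (S J)) + h (INR J) - 2 * CInt f0 (INR J) (INR (S J))))%C by ring.
    eapply Rle_trans; [apply Cmod_triangle|]. lra.
Qed.

Lemma rsum_inv_sqr_tail (n m : nat) :
  rsum (fun k => / (1 + INR (S (n + k))) ^ 2) m <= / INR (S n).
Proof.
  apply Rle_trans with (rsum (fun k => - / INR (S (n + S k)) - - / INR (S (n + k))) m).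
  - apply rsum_le. intros k _. rewrite Nat.add_succ_r, !(S_INR (S _)).
    pose proof (lt_0_INR (S (n + k)) ltac:(lia)) as H. set (x := INR (S (n + k))) in *.
    replace (- / (x + 1) - - / x) with (/ (x * (x + 1))) by (field; lra).
    apply Rinv_le_contravar; nra.
  - rewrite (rsum_telescope (fun k => - / INR (S (n + k)))), Nat.add_0_r.
    assert (0 <= / INR (S (n + m))); [|lra].
    left; apply Rinv_0_lt_compat, lt_0_INR; lia.
Qed.

(** The number [L] of terms and the cut-off [K] of the frequencies are independent, each with its
    own error; the double summation below relies on this freedom. *)
Lemma poisson_integers (h h1 h2 : R -> C) (M : R) (K L : nat) :
  (forall x, Cder h x (h1 x)) -> (forall x, Cder h1 x (h2 x)) -> (forall x, Cct h2 x) ->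
  (forall x, 0 <= x -> Cmod (h x) <= M / (1 + x) ^ 2) ->
  (forall x, 0 <= x -> Cmod (h2 x) <= M / (1 + x) ^ 2) -> h 0 = RtoC 0 ->
  Cmod (csum (fun j => h (INR (S j))) L
        - zsum (fun k => Cint0oo (fun x => h x * e (- IZR k * x))%C) K)
  <= M * (/ INR (S L) + / INR (S K)).
Proof.
  intros D1 D2 C2 B0 B2 h0.
  assert (Hd : dominated h M) by (split; [intros x; eapply Cder_Cct, D1|exact B0]).
  pose proof (dominated_ge_0 h M Hd) as HM.
  set (f0 := fun x => (h x * RtoC (dirichlet_kernel K x))%C).
  assert (Hdk : forall k, dominated (fun x => h x * e (- IZR k * x))%C M).
  { intros k. apply (dominated_mult_e h M (- IZR k)), Hd. }
  assert (Efin : forall a b, a <= b ->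
    zsum (fun k => CInt (fun x => h x * e (- IZR k * x))%C a b) K = CInt f0 a b).
  { intros a b Hab. unfold zsum.
    rewrite (csum_ext _ (fun k => CInt (fun x => h x * e (- IZR (Z.of_nat (S k)) * x)
       + h x * e (- IZR (- Z.of_nat (S k)) * x))%C a b)).
    2:{ intros k _. rewrite CInt_plus; auto; intros; apply Hdk. }
    rewrite <- CInt_csum; auto.
    2:{ intros; apply Cct_plus; apply Hdk. }
    rewrite <- CInt_plus; auto.
    2:{ intros; apply Hdk. }
    2:{ intros. apply Cct_csum. intros. apply Cct_plus; apply Hdk. }
    apply CInt_ext; auto. intros x _. unfold f0. rewrite <- zsum_e. unfold zsum.
    rewrite (csum_ext _ (fun k => h x * (e (- IZR (Z.of_nat (S k)) * x)
       + e (- IZR (- Z.of_nat (S k)) * x)))%C) by (intros; ring).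
    rewrite csum_scal. ring. }
  assert (Lim : Clim (fun N => CInt f0 0 (INR N))
    (zsum (fun k => Cint0oo (fun x => h x * e (- IZR k * x))%C) K)).
  { eapply Clim_ext; [intros n; apply Efin, pos_INR|]. unfold zsum.
    apply Clim_plus; [apply (dominated_Clim _ _ (Hdk 0%Z))|].
    apply (Clim_csum (fun n k => _) (fun k => _)). intros k _.
    apply Clim_plus; [apply (dominated_Clim _ _ (Hdk (Z.of_nat (S k))))|].
    apply (dominated_Clim _ _ (Hdk (- Z.of_nat (S k))%Z)). }
  rewrite Cmod_minus_sym.
  set (G := csum (fun j => h (INR (S j))) L).
  (* Comparison at the upper limit [N + L]: the terms of index beyond [L] cost at most
     [M / (L + 1)], and [N] tends to infinity. *)
  apply (Clim_Cmod_le (fun N => CInt f0 0 (INR (N + L))) _ G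
    (fun N => M * (/ INR (S L) + / INR (S K)) + M / INR (S N))).
  - apply (is_lim_seq_incr_n (fun N => Cmod (CInt f0 0 (INR N) - _)) L 0), Lim.
  - rewrite <- (Rplus_0_r (M * _)) at 1.
    apply is_lim_seq_plus'; [apply is_lim_seq_const|apply is_lim_seq_scal_inv_S].
  - intros N.
    pose proof (euler_maclaurin h h1 h2 M K (L + N) D1 D2 C2 B2 h0) as EM.
    fold f0 in EM. rewrite (Nat.add_comm N L).
    set (I0 := CInt f0 0 (INR (L + N))) in *. rewrite csum_add in EM. fold G in EM.
    set (T := csum (fun k => h (INR (S (L + k)))) N) in *.
    assert (HT : Cmod T <= M * / INR (S L)).
    { unfold T. eapply Rle_trans; [apply csum_bound with (g := fun k => M * / (1 + INR (S (L + k))) ^ 2)|].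
      - intros k _. apply B0, pos_INR.
      - rewrite rsum_scal. apply Rmult_le_compat_l; [assumption|apply rsum_inv_sqr_tail]. }
    assert (Hh : Cmod (h (INR (L + N))) <= M / INR (S N)).
    { eapply Rle_trans; [apply B0, pos_INR|].
      apply Rmult_le_compat_l; [assumption|]. apply Rinv_le_contravar.
      - apply lt_0_INR; lia.
      - rewrite S_INR, plus_INR. pose proof (pos_INR N). pose proof (pos_INR L). nra. }
    assert (H2 : 2 * Cmod (I0 - G) <= 2 * Cmod T + Cmod (h (INR (L + N))) + 2 * (M * / INR (S K))).
    { replace (2 * Cmod (I0 - G)) with (Cmod (RtoC 2 * (I0 - G))) by (apply Cmod_RtoC_mult; lra).
      replace (RtoC 2 * (I0 - G))%C with (RtoC 2 * T - h (INR (L + N)) -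
         (2 * (G + T) - h (INR (L + N)) - 2 * I0))%C by ring.
      eapply Rle_trans; [apply Cmod_minus_le|].
      pose proof (Cmod_minus_le (RtoC 2 * T) (h (INR (L + N)))) as Q.
      rewrite Cmod_RtoC_mult in Q by lra. lra. }
    assert (0 <= M / INR (S N)) by (apply Rdiv_le_0_compat; [auto|apply lt_0_INR; lia]).
    lra.
Qed.

Lemma csum_mul (F : nat -> C) (q L : nat) :
  csum F (q * L) = csum (fun u => csum (fun j => F (u + q * j)%nat) L) q.
Proof.
  induction L as [|L IH].
  - rewrite Nat.mul_0_r. symmetry. apply csum_zero. reflexivity.
  - rewrite Nat.mul_succ_r, csum_add, IH. cbn [csum]. rewrite csum_plus. f_equal.
    apply csum_ext. intros u _. f_equal. lia.
Qed.

Lemma CInt_comp_lin (f : R -> C) (u v a b : R) :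
  0 < u -> a <= b -> (forall x, Cct f x) ->
  CInt (fun x => f (u * x + v)) a b = (RtoC (/ u) * CInt f (u * a + v) (u * b + v))%C.
Proof.
  intros Hu Hab Hf.
  assert (G : forall p : R -> R, (forall x, continuous p x) ->
    RInt (fun x => p (u * x + v)) a b = / u * RInt p (u * a + v) (u * b + v)).
  { intros p Hp.
    rewrite <- (RInt_comp_lin (V := R_CompleteNormedModule)).
    2:{ apply ex_RInt_cont; [nra|auto]. }
    rewrite (RInt_scal (V := R_CompleteNormedModule) (fun x => p (u * x + v))).
    - assert (E : forall I : R, I = / u * (u * I)) by (intros; field; lra). apply E.
    - apply ex_RInt_cont; [lra|]. intros x _. apply (continuous_comp (fun t => u * t + v) p); auto.
      apply (continuous_derive _ _ u). auto_derive; [exact I|ring]. }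
  apply C_ext; simpl.
  - rewrite (G (fun t => fst (f t))) by apply Hf. ring.
  - rewrite (G (fun t => snd (f t))) by apply Hf. ring.
Qed.

(** The plus sign in the exponential arises from translating by [u] the Fourier integral with kernel
    [e(- k x / q)]. *)
Definition dft (q : nat) (phi : Z -> C) (k : Z) : C :=
  csum (fun u => phi (Z.of_nat u) * e (IZR k * INR u / INR q))%C q.

Definition periodic (q : nat) (phi : Z -> C) : Prop :=
  forall x, phi (x + Z.of_nat q)%Z = phi x.

Lemma periodic_mul (q : nat) (phi : Z -> C) (x : Z) (j : nat) :
  periodic q phi -> phi (x + Z.of_nat (q * j))%Z = phi x.
Proof.
  intros H. induction j as [|j IH].
  - f_equal. rewrite Nat.mul_0_r. simpl. ring.
  - rewrite <- IH, <- (H (x + Z.of_nat (q * j))%Z). f_equal. rewrite Nat.mul_succ_r, Nat2Z.inj_add. ring.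
Qed.

(** This is the substitution [y = q x + u - q]; the part of the range below [0] contributes nothing
    because [f] vanishes there. *)
Lemma Cint0oo_residue (f : R -> C) (M : R) (q u : nat) (k : Z) :
  (u < q)%nat -> dominated f M -> (forall x, x <= 0 -> f x = RtoC 0) ->
  Cint0oo (fun x => f (INR q * x + (INR u - INR q))%R * e (- IZR k * x))%C =
  (RtoC (/ INR q) * e (IZR k * INR u / INR q) * Cint0oo (fun y => f y * e (- IZR k / INR q * y)))%C.
Proof.
  intros Hu Hd Hz.
  assert (Hq : 0 < INR q) by (apply lt_0_INR; lia).
  assert (Huq : INR u <= INR q) by (apply le_INR; lia).
  set (F := fun y => (f y * e (- IZR k / INR q * y))%C).
  assert (HF : dominated F M) by (apply dominated_mult_e; assumption).
  apply Clim_Cint0oo.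
  (* The upper limit [N + 1] becomes [q N + u], which is at least [N]. *)
  apply (is_lim_seq_incr_1 (fun N => Cmod (CInt _ 0 (INR N) - _)) 0).
  change (Clim (fun N => CInt (fun x => f (INR q * x + (INR u - INR q))%R * e (- IZR k * x))%C 0 (INR (S N)))
    (RtoC (/ INR q) * e (IZR k * INR u / INR q) * Cint0oo F)%C).
  apply Clim_ext with (fun N => RtoC (/ INR q) * e (IZR k * INR u / INR q) *
    CInt F 0 (INR q * INR N + INR u))%C.
  - intros N. pose proof (pos_INR N). pose proof (pos_INR u). symmetry.
    rewrite (CInt_ext _ (fun x => e (IZR k * INR u / INR q) * F (INR q * x + (INR u - INR q))%R)%C).
    + rewrite CInt_scal; [|rewrite S_INR; lra|].
      2:{ intros x _. apply (Cct_comp F (fun x => INR q * x + (INR u - INR q))); [|apply HF].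
          apply (continuous_derive _ _ (INR q)). auto_derive; [exact I|ring]. }
      rewrite CInt_comp_lin; [|assumption|rewrite S_INR; lra|apply HF].
      rewrite <- (CInt_Chasles F _ 0); [|rewrite S_INR; split; nra|intros; apply HF].
      replace (CInt F (INR q * 0 + (INR u - INR q)) 0) with (RtoC 0).
      * replace (INR q * INR (S N) + (INR u - INR q)) with (INR q * INR N + INR u)
          by (rewrite S_INR; ring). ring.
      * rewrite (CInt_ext F (fun _ => RtoC 0)); [|lra|].
        -- apply C_ext; simpl; rewrite (RInt_const (V := R_CompleteNormedModule));
             symmetry; apply Rmult_0_r.
        -- intros x Hx. unfold F. rewrite Hz by lra. ring.
    + rewrite S_INR; lra.
    + intros x _. unfold F.
      replace (- IZR k * x) with (- IZR k / INR q * (INR q * x + (INR u - INR q)) +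
        (IZR k * INR u / INR q + IZR (- k))).
      * rewrite !e_plus, e_IZR. ring.
      * rewrite opp_IZR. field. lra.
  - apply Clim_scal. apply (Cint0oo_limit F M); [assumption|].
    intros n. pose proof (pos_INR n). pose proof (pos_INR u).
    assert (1 <= INR q) by (apply (le_INR 1); lia). nra.
Qed.

(** One application of [poisson_integers] to each residue class [u] modulo [q]. *)
Lemma poisson (q : nat) (phi : Z -> C) (Phi : R) (f f1 f2 : R -> C) (M : R) (K L : nat) :
  (0 < q)%nat -> periodic q phi -> (forall x, Cmod (phi x) <= Phi) ->
  (forall x, Cder f x (f1 x)) -> (forall x, Cder f1 x (f2 x)) -> (forall x, Cct f2 x) ->
  (forall x, x <= 0 -> f x = RtoC 0) -> (forall x, x <= 0 -> f2 x = RtoC 0) ->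
  (forall x, 0 <= x -> Cmod (f x) <= M / (1 + x) ^ 2) ->
  (forall x, 0 <= x -> Cmod (f2 x) <= M / (1 + x) ^ 2) ->
  Cmod (csum (fun m => phi (Z.of_nat m) * f (INR m))%C (q * L)
        - RtoC (/ INR q) * zsum (fun k => dft q phi k *
            Cint0oo (fun x => f x * e (- IZR k / INR q * x)))%C K)
  <= 4 * INR q ^ 3 * Phi * M * (/ INR (S L) + / INR (S K)).
Proof.
  intros Hq Hper HPhi D1 D2 C2 Z0 Z2 B0 B2.
  assert (Hq1 : 1 <= INR q) by (apply (le_INR 1); lia).
  assert (Hd : dominated f M) by (split; [intros x; eapply Cder_Cct, D1|exact B0]).
  pose proof (dominated_ge_0 f M Hd) as HM.
  assert (HPhi0 : 0 <= Phi) by (eapply Rle_trans; [apply Cmod_ge_0|apply (HPhi 0%Z)]).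
  set (fh := fun k => Cint0oo (fun x => f x * e (- IZR k / INR q * x))%C).
  change (zsum _ K) with (zsum (fun k => dft q phi k * fh k)%C K).
  rewrite csum_mul.
  replace (RtoC (/ INR q) * zsum (fun k => dft q phi k * fh k)%C K)%C with
    (csum (fun u => phi (Z.of_nat u) * zsum (fun k => RtoC (/ INR q) *
       e (IZR k * INR u / INR q) * fh k) K)%C q).
  2:{ rewrite <- zsum_scal.
      rewrite (zsum_ext _ (fun k => csum (fun u => phi (Z.of_nat u) *
        (RtoC (/ INR q) * e (IZR k * INR u / INR q) * fh k))%C q)).
      - rewrite zsum_csum. apply csum_ext. intros u _. now rewrite zsum_scal.
      - intros k. unfold dft. rewrite Cmult_assoc, (Cmult_comm _ (fh k)), <- !csum_scal.
        apply csum_ext. intros; ring. }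
  rewrite <- csum_minus.
  apply Rle_trans with (rsum (fun _ => Phi * (4 * INR q ^ 2 * M * (/ INR (S L) + / INR (S K)))) q).
  2:{ rewrite rsum_const. right. ring. }
  apply csum_bound. intros u Hu.
  assert (Huq : INR u + 1 <= INR q) by (rewrite <- S_INR; apply le_INR; lia).
  pose proof (pos_INR u) as Hu0.
  (* The argument [j + 1] corresponds to [q j + u]. The shift by [- q] makes [h 0 = f (u - q)]
     vanish, as the summation over the integers requires. *)
  set (h := fun x => f (INR q * x + (INR u - INR q))%R).
  rewrite (csum_ext _ (fun j => phi (Z.of_nat u) * h (INR (S j)))%C).
  2:{ intros j _. f_equal.
      - rewrite Nat2Z.inj_add. apply periodic_mul, Hper.
      - unfold h. f_equal. rewrite plus_INR, mult_INR, S_INR. ring. }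
  rewrite csum_scal.
  replace (_ - _)%C with (phi (Z.of_nat u) * (csum (fun j => h (INR (S j))) L -
    zsum (fun k => RtoC (/ INR q) * e (IZR k * INR u / INR q) * fh k)%C K))%C by ring.
  rewrite Cmod_mult. apply Rmult_le_compat; [apply Cmod_ge_0|apply Cmod_ge_0|apply HPhi|].
  rewrite (zsum_ext _ (fun k => Cint0oo (fun x => h x * e (- IZR k * x))%C)).
  2:{ intros k. symmetry. apply (Cint0oo_residue f M); assumption. }
  assert (Dl : forall x, is_derive (fun t => INR q * t + (INR u - INR q)) x (INR q)).
  { intros x. auto_derive; [exact I|ring]. }
  (* If [y = q x + u - q] is positive, then [1 + x <= 2 (1 + y)]; squaring gives the factor [4]. *)
  assert (Bd : forall g : R -> C, (forall x, x <= 0 -> g x = RtoC 0) ->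
    (forall x, 0 <= x -> Cmod (g x) <= M / (1 + x) ^ 2) ->
    forall x, 0 <= x -> Cmod (g (INR q * x + (INR u - INR q))%R) <= 4 * M / (1 + x) ^ 2).
  { intros g G0 GB x Hx. set (y := INR q * x + (INR u - INR q)).
    destruct (Rle_dec y 0) as [Hy|Hy].
    - rewrite G0, Cmod_0 by assumption. apply Rdiv_le_0_compat; nra.
    - eapply Rle_trans; [apply GB; lra|].
      assert (1 + x <= 2 * (1 + y)).
      { assert (INR q * x = y + INR q - INR u) by (unfold y; ring).
        assert (x <= y + 1); [|lra].
        apply Rmult_le_reg_l with (INR q); [lra|]. nra. }
      apply Rmult_le_reg_r with ((1 + x) ^ 2 * (1 + y) ^ 2); [apply Rmult_lt_0_compat; nra|].
      replace (M / (1 + y) ^ 2 * ((1 + x) ^ 2 * (1 + y) ^ 2)) with (M * (1 + x) ^ 2)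
        by (field; lra).
      replace (4 * M / (1 + x) ^ 2 * ((1 + x) ^ 2 * (1 + y) ^ 2)) with (M * (2 * (1 + y)) ^ 2)
        by (field; lra).
      apply Rmult_le_compat_l; [assumption|]. apply pow_incr. lra. }
  apply (poisson_integers h (fun x => RtoC (INR q) * f1 (INR q * x + (INR u - INR q))%R)%C
    (fun x => RtoC (INR q) * (RtoC (INR q) * f2 (INR q * x + (INR u - INR q))%R))%C).
  - intros x. apply (Cder_comp f (fun t => INR q * t + (INR u - INR q))); auto.
  - intros x. apply Cder_scal.
    apply (Cder_comp f1 (fun t => INR q * t + (INR u - INR q))); auto.
  - intros x. repeat (apply Cct_mult; [apply Cct_const|]).
    apply (Cct_comp f2 (fun t => INR q * t + (INR u - INR q))); auto.
    eapply continuous_derive, Dl.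
  - intros x Hx. eapply Rle_trans; [apply (Bd f Z0 B0 x Hx)|].
    apply Rmult_le_compat_r; [left; apply Rinv_0_lt_compat; nra|].
    assert (1 <= INR q ^ 2) by nra. nra.
  - intros x Hx. rewrite !Cmod_RtoC_mult by lra.
    replace (4 * INR q ^ 2 * M / (1 + x) ^ 2) with (INR q * (INR q * (4 * M / (1 + x) ^ 2)))
      by (field; lra).
    repeat (apply Rmult_le_compat_l; [lra|]). apply (Bd f2 Z2 B2 x Hx).
  - unfold h. apply Z0. lra.
Qed.

(** * The integrals of exp(-alpha y - beta / y) / y^j *)

(** Extended by [0] to [y <= 0]: when [be] has positive real part, [exp(- be / y)] is flat at [0],
    and the extension is differentiable on the whole line. *)
Definition kf (j : nat) (al be : C) (y : R) : C :=
  if Rle_dec y 0 then RtoC 0 else (cexp (- al * RtoC y - be * RtoC (/ y)) * RtoC (/ y ^ j))%C.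

(** [Jint 1 al be] is [2 K_0(2 sqrt(al be))]; other [j] give Bessel functions [K] of order [j - 1],
    up to a power of [be / al]. *)
Definition Jint (j : nat) (al be : C) : C := Cint0oo (kf j al be).

Lemma kf_nonpos (j : nat) (al be : C) (y : R) : y <= 0 -> kf j al be y = RtoC 0.
Proof. intros H. unfold kf. destruct (Rle_dec y 0); [reflexivity|contradiction]. Qed.

Lemma kf_pos (j : nat) (al be : C) (y : R) :
  0 < y -> kf j al be y = (cexp (- al * RtoC y - be * RtoC (/ y)) * RtoC (/ y ^ j))%C.
Proof. intros H. unfold kf. destruct (Rle_dec y 0); [lra|reflexivity]. Qed.

Lemma Cmod_kf (j : nat) (al be : C) (y : R) :
  0 < y -> Cmod (kf j al be y) = exp (- fst al * y - fst be * / y) * / y ^ j.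
Proof.
  intros Hy. rewrite kf_pos by assumption. rewrite Cmod_mult, Cmod_cexp, Cmod_R.
  rewrite Rabs_pos_eq by (left; apply Rinv_0_lt_compat, pow_lt; assumption).
  f_equal. f_equal. simpl. ring.
Qed.

Lemma exp_pow_INR (n : nat) (x : R) : exp x ^ n = exp (INR n * x).
Proof.
  induction n as [|n IH]; [simpl; now rewrite Rmult_0_l, exp_0|].
  rewrite S_INR, Rmult_plus_distr_r, Rmult_1_l, exp_plus, <- IH. simpl. ring.
Qed.

(** [exp x] is the [n]-th power of [exp(x / n)], which is at least [x / n]. *)
Lemma pow_le_exp (n : nat) (x : R) : (0 < n)%nat -> 0 <= x -> x ^ n <= INR n ^ n * exp x.
Proof.
  intros Hn Hx. assert (Hn' : 0 < INR n) by (apply lt_0_INR; lia).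
  replace (exp x) with (exp (x / INR n) ^ n).
  - rewrite <- Rpow_mult_distr. apply pow_incr. split; [assumption|].
    pose proof (exp_ineq1_le (x / INR n)) as E.
    apply Rle_trans with (INR n * (x / INR n)); [right; field; lra|].
    apply Rmult_le_compat_l; lra.
  - rewrite exp_pow_INR. f_equal. field. lra.
Qed.

Lemma exp_opp_le (n : nat) (x : R) : (0 < n)%nat -> 0 < x -> exp (- x) <= INR n ^ n / x ^ n.
Proof.
  intros Hn Hx. pose proof (pow_le_exp n x Hn ltac:(lra)) as H.
  pose proof (exp_pos x). assert (0 < x ^ n) by (apply pow_lt; assumption).
  rewrite exp_Ropp. apply Rmult_le_reg_r with (exp x * x ^ n); [nra|].
  replace (/ exp x * (exp x * x ^ n)) with (x ^ n) by (field; lra).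
  replace (INR n ^ n / x ^ n * (exp x * x ^ n)) with (INR n ^ n * exp x) by (field; lra).
  assumption.
Qed.

(** The shape [y^2 / (1 + y)^4] serves twice: [y^2] gives differentiability at [0], the rest
    integrability. Only lower bounds of the real parts enter. *)
Lemma kf_bound_aux (j : nat) (a0 b0 : R) : 0 < a0 -> 0 < b0 ->
  exists M, 0 < M /\ forall al be y, a0 <= fst al -> b0 <= fst be -> 0 < y ->
    Cmod (kf j al be y) <= M * (y ^ 2 / (1 + y) ^ 4).
Proof.
  intros Ha Hb.
  (* The factor [(y / b0)^n] obtained from [exp(- b0 / y)] absorbs [1 / y^j] and leaves [y^2]; the
     fourth power in the denominator comes from [exp(- a0 y)]. *)
  set (n := (j + 2)%nat).
  exists (INR n ^ n / b0 ^ n * (exp a0 * (INR 4 ^ 4 / a0 ^ 4))).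
  assert (Hn : 0 < INR n) by (apply lt_0_INR; unfold n; lia).
  split.
  - apply Rmult_lt_0_compat; [apply Rdiv_lt_0_compat; apply pow_lt; assumption|].
    apply Rmult_lt_0_compat; [apply exp_pos|].
    apply Rdiv_lt_0_compat; apply pow_lt; [simpl; lra|assumption].
  - intros al be y Hal Hbe Hy. rewrite Cmod_kf by assumption.
    assert (Hyi : 0 < / y) by (apply Rinv_0_lt_compat; assumption).
    assert (H1 : exp (- fst al * y - fst be * / y) <=
      exp (- (b0 / y)) * (exp a0 * exp (- (a0 * (1 + y))))).
    { rewrite <- !exp_plus. apply exp_le. unfold Rdiv. nra. }
    assert (H2 : exp (- (b0 / y)) <= INR n ^ n / b0 ^ n * y ^ n).
    { eapply Rle_trans; [apply (exp_opp_le n); [unfold n; lia|apply Rdiv_lt_0_compat; assumption]|].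
      right. unfold Rdiv. rewrite Rpow_mult_distr, pow_inv, Rinv_mult, Rinv_inv. ring. }
    assert (H3 : exp (- (a0 * (1 + y))) <= INR 4 ^ 4 / a0 ^ 4 / (1 + y) ^ 4).
    { eapply Rle_trans; [apply (exp_opp_le 4); [lia|nra]|].
      right. rewrite Rpow_mult_distr. field. lra. }
    assert (Hyj : 0 < / y ^ j) by (apply Rinv_0_lt_compat, pow_lt; assumption).
    replace (INR n ^ n / b0 ^ n * (exp a0 * (INR 4 ^ 4 / a0 ^ 4)) * (y ^ 2 / (1 + y) ^ 4)) with
      (INR n ^ n / b0 ^ n * y ^ n * (exp a0 * (INR 4 ^ 4 / a0 ^ 4 / (1 + y) ^ 4)) * / y ^ j).
    2:{ replace (y ^ 2) with (y ^ n * / y ^ j)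
          by (unfold n; rewrite pow_add; field; apply pow_nonzero; lra).
        unfold Rdiv. ring. }
    apply Rmult_le_compat_r; [lra|]. eapply Rle_trans; [exact H1|].
    pose proof (exp_pos (- (b0 / y))). pose proof (exp_pos a0).
    pose proof (exp_pos (- (a0 * (1 + y)))).
    apply Rmult_le_compat; [lra|nra|assumption|]. apply Rmult_le_compat_l; lra.
Qed.

Lemma kf_bound (j : nat) (a0 b0 : R) : 0 < a0 -> 0 < b0 ->
  exists M, 0 < M /\ forall al be y, a0 <= fst al -> b0 <= fst be -> 
    Cmod (kf j al be y) <= M * y ^ 2 /\
    (0 <= y -> Cmod (kf j al be y) <= M / (1 + y) ^ 2).
Proof.
  intros Ha Hb. destruct (kf_bound_aux j a0 b0 Ha Hb) as (M & HM & H).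
  exists M. split; [assumption|]. intros al be y Hal Hbe.
  destruct (Rle_dec y 0) as [Hy|Hy].
  - rewrite kf_nonpos, Cmod_0 by assumption. split; [nra|].
    intros. apply Rdiv_le_0_compat; nra.
  - specialize (H al be y Hal Hbe ltac:(lra)). split; [|intros _];
      (eapply Rle_trans; [exact H|]); apply Rmult_le_compat_l; try lra.
    + apply Rmult_le_reg_r with ((1 + y) ^ 4); [apply pow_lt; lra|].
      replace (y ^ 2 / (1 + y) ^ 4 * (1 + y) ^ 4) with (y ^ 2 * 1) by (field; lra).
      apply Rmult_le_compat_l; [nra|]. apply pow_R1_Rle; lra.
    + apply Rmult_le_reg_r with ((1 + y) ^ 4); [apply pow_lt; lra|].
      replace (y ^ 2 / (1 + y) ^ 4 * (1 + y) ^ 4) with (y ^ 2) by (field; lra).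
      replace (/ (1 + y) ^ 2 * (1 + y) ^ 4) with ((1 + y) ^ 2) by (field; lra). nra.
Qed.

Lemma locally_gt (a x : R) : a < x -> locally x (fun t => a < t).
Proof. apply open_gt. Qed.

Lemma locally_lt (b x : R) : x < b -> locally x (fun t => t < b).
Proof. apply open_lt. Qed.

Lemma is_derive_inv_pow (j : nat) (y : R) :
  0 < y -> is_derive (fun t => / t ^ j) y (- INR j * / y ^ S j).
Proof.
  intros Hy. auto_derive; [apply pow_nonzero; lra|].
  destruct j as [|j]; [simpl; field; lra|].
  cbn [Init.Nat.pred]. change (match S j with O => 1 | _ => _ end) with (INR (S j)) || idtac.
  assert (y ^ j <> 0) by (apply pow_nonzero; lra).
  simpl pow. field. split; lra.
Qed.

(** The family [kf] is closed under differentiation. At [y = 0] the quadratic bound of [kf_bound]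
    shows that the derivative is [0]. *)
Lemma kf_derive (j : nat) (al be : C) (y : R) : 0 < fst al -> 0 < fst be ->
  Cder (kf j al be) y (- al * kf j al be y + be * kf (j + 2) al be y
    - RtoC (INR j) * kf (j + 1) al be y)%C.
Proof.
  intros Hal Hbe. destruct (Rtotal_order y 0) as [Hy|[Hy|Hy]].
  - rewrite !kf_nonpos by lra.
    apply Cder_ext_loc with (fun _ => RtoC 0).
    + apply filter_imp with (2 := locally_lt 0 y Hy). intros t Ht. rewrite kf_nonpos; [auto|lra].
    + eapply Cder_eq; [|apply Cder_const]. ring.
  - subst y. rewrite !kf_nonpos by lra.
    destruct (kf_bound j (fst al) (fst be) Hal Hbe) as (M & HM & H).
    apply Cder_quadratic with M 1; [lra|]. intros h _.
    rewrite Rplus_0_l, (kf_nonpos _ _ _ 0) by lra.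
    replace (_ - _ - _)%C with (kf j al be h) by ring. apply H; lra.
  - rewrite !kf_pos by lra.
    apply Cder_ext_loc with (fun y => cexp (- al * RtoC y - be * RtoC (/ y)) * RtoC (/ y ^ j))%C.
    { apply filter_imp with (2 := locally_gt 0 y Hy). intros t Ht. rewrite kf_pos; auto. }
    eapply Cder_eq; [|apply Cder_mult; [apply Cder_cexp; apply Cder_minus; apply Cder_scal, Cder_RtoC|
      apply Cder_RtoC, is_derive_inv_pow, Hy]].
    2:{ apply (is_derive_id (K := R_AbsRing)). }
    2:{ apply (is_derive_Rext (fun t => / t ^ 1)); [intros; simpl; now rewrite Rmult_1_r|].
        apply is_derive_inv_pow, Hy. }
    change (@one R_AbsRing) with 1.
    replace (j + 1)%nat with (S j) by lia. replace (j + 2)%nat with (S (S j)) by lia.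
    replace (RtoC (/ y ^ S (S j))) with (RtoC (/ y ^ 2) * RtoC (/ y ^ j))%C.
    2:{ rewrite <- RtoC_mult. f_equal. simpl. field.
        repeat split; try lra; apply pow_nonzero; lra. }
    replace (- INR 1 * / y ^ 2) with (- / y ^ 2) by (simpl; ring).
    rewrite RtoC_opp, RtoC_mult, RtoC_opp. ring.
Qed.

Lemma kf_dominated (j : nat) (a0 b0 : R) : 0 < a0 -> 0 < b0 ->
  exists M, 0 < M /\ forall al be, a0 <= fst al -> b0 <= fst be -> dominated (kf j al be) M.
Proof.
  intros Ha Hb. destruct (kf_bound j a0 b0 Ha Hb) as (M & HM & H).
  exists M. split; [assumption|]. intros al be Hal Hbe. split.
  - intros x. eapply Cder_Cct, kf_derive; lra.
  - intros x Hx. apply H; auto.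
Qed.

(** Integrate the derivative of [kf 0], which vanishes at [0] and at infinity. *)
Lemma Jint_recurrence (al be : C) : 0 < fst al -> 0 < fst be ->
  (be * Jint 2 al be = al * Jint 0 al be)%C.
Proof.
  intros Hal Hbe.
  destruct (kf_dominated 0 (fst al) (fst be) Hal Hbe) as (M0 & _ & D0).
  destruct (kf_dominated 2 (fst al) (fst be) Hal Hbe) as (M2 & _ & D2).
  specialize (D0 al be (Rle_refl _) (Rle_refl _)). specialize (D2 al be (Rle_refl _) (Rle_refl _)).
  assert (E : Cint0oo (fun y => - al * kf 0 al be y + be * kf 2 al be y)%C = (- kf 0 al be 0)%C).
  { eapply Cint0oo_derivative; [exact D0|apply dominated_plus; apply dominated_scal; eassumption|].
    intros x. eapply Cder_eq; [|apply kf_derive; assumption]. simpl. ring. }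
  rewrite kf_nonpos in E by lra.
  erewrite Cint0oo_plus in E; [|apply dominated_scal, D0|apply dominated_scal, D2].
  erewrite Cint0oo_scal in E by apply D0. erewrite Cint0oo_scal in E by apply D2.
  unfold Jint.
  transitivity (al * Cint0oo (kf 0 al be) + (- al * Cint0oo (kf 0 al be) +
    be * Cint0oo (kf 2 al be)))%C; [ring|]. rewrite E. ring.
Qed.

(** Differentiation under the integral: the derivative in [t] produces the factor [- be / y], which
    raises [j] by one. *)
Lemma Jint_derive (j : nat) (al be : C) (s : R) : 0 < fst al -> 0 < fst be -> 0 < s ->
  Cder (fun t => Jint j al (RtoC t * be)) s (- be * Jint (j + 1) al (RtoC s * be))%C.
Proof.
  intros Hal Hbe Hs.
  set (b := Cmod be).
  assert (Hb : fst be <= b) by (eapply Rle_trans; [apply Rle_abs|apply Cmod_fst]).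
  (* For [|h| <= eta] one has [|h be| <= s Re(be) / 2], so the growth [exp(|h be| / y)] of the
     Taylor remainder is paid for by half of the decay [exp(- s Re(be) / y)]. *)
  set (eta := s * fst be / (2 * b)).
  assert (Heta : 0 < eta) by (apply Rdiv_lt_0_compat; nra).
  assert (Heb : eta * b = s * fst be / 2) by (unfold eta; field; lra).
  assert (Hes : eta <= s / 2) by (apply Rmult_le_reg_r with b; [lra|]; rewrite Heb; nra).
  destruct (kf_dominated j (fst al) (s / 2 * fst be) Hal ltac:(nra)) as (M0 & _ & D0).
  destruct (kf_dominated (j + 1) (fst al) (s * fst be) Hal ltac:(nra)) as (M1 & _ & D1).
  destruct (kf_bound (j + 2) (fst al) (s * fst be / 2) Hal ltac:(nra)) as (M2 & HM2 & D2).
  assert (Efst : forall r : R, fst (RtoC r * be)%C = r * fst be) by (intros; simpl; ring).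
  specialize (D1 al (RtoC s * be)%C (Rle_refl _)). rewrite Efst in D1.
  specialize (D1 (Rle_refl _)).
  unfold Jint.
  assert (D1' : dominated (fun y => - be * kf (j + 1) al (RtoC s * be) y)%C (Cmod (- be) * M1))
    by (apply dominated_scal, D1).
  rewrite <- (Cint0oo_scal (- be) _ _ D1).
  apply (Cder_Cint0oo (fun t => kf j al (RtoC t * be)) _ s eta (4 * b ^ 2 * M2) (Cmod (- be) * M1)
    (fun _ => M0)); [assumption| |assumption|].
  - intros h Hh. apply D0; [lra|]. rewrite Efst. apply Rabs_le_between in Hh.
    apply Rmult_le_compat_r; lra.
  - intros h y Hh Hy.
    assert (Hbh : b * Rabs h <= s * fst be / 2).
    { rewrite <- Heb, Rmult_comm. apply Rmult_le_compat_r; lra. }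
    destruct (Req_dec y 0) as [->|Hy0].
    + rewrite !kf_nonpos by lra. replace (_ - _ - _)%C with (RtoC 0) by ring. rewrite Cmod_0.
      apply Rdiv_le_0_compat; [|lra]. pose proof (pow2_ge_0 b). pose proof (pow2_ge_0 h).
      apply Rmult_le_pos; [apply Rmult_le_pos|]; lra.
    + assert (Hyp : 0 < y) by lra.
      assert (Hyi : 0 < / y) by (apply Rinv_0_lt_compat; assumption).
      set (z := (- (RtoC h * be) * RtoC (/ y))%C).
      assert (Ez : kf j al (RtoC (s + h) * be) y = (kf j al (RtoC s * be) y * cexp z)%C).
      { rewrite !kf_pos by assumption.
        replace (- al * RtoC y - RtoC (s + h) * be * RtoC (/ y))%C with
          ((- al * RtoC y - RtoC s * be * RtoC (/ y)) + z)%C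
          by (unfold z; rewrite RtoC_plus; ring).
        rewrite cexp_plus. ring. }
      assert (E1 : kf (j + 1) al (RtoC s * be) y = (kf j al (RtoC s * be) y * RtoC (/ y))%C).
      { rewrite !kf_pos by assumption. rewrite pow_add, pow_1, Rinv_mult, RtoC_mult. ring. }
      rewrite Ez, E1.
      replace (_ - _ - _)%C with (kf j al (RtoC s * be) y * (cexp z - 1 - z))%C
        by (unfold z; ring).
      rewrite Cmod_mult.
      assert (Cz : Cmod z = b * Rabs h * / y).
      { unfold z. rewrite Cmod_mult, Cmod_opp, Cmod_mult, !Cmod_R, (Rabs_pos_eq (/ y)) by lra.
        unfold b. ring. }
      pose proof (cexp_taylor_2 z) as Tz. rewrite Cz in Tz.
      specialize (D2 al (RtoC (s / 2) * be)%C y (Rle_refl _)).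
      rewrite Efst in D2. destruct (D2 ltac:(lra)) as [_ D2']. specialize (D2' Hy).
      rewrite Cmod_kf in D2' by assumption.
      rewrite Cmod_kf by assumption. rewrite Efst in *.
      apply Rle_trans with (exp (- fst al * y - s * fst be * / y) * / y ^ j *
        (4 * (b * Rabs h * / y) ^ 2 * exp (s * fst be / 2 * / y))).
      * apply Rmult_le_compat_l.
        -- apply Rmult_le_pos; left; [apply exp_pos|apply Rinv_0_lt_compat, pow_lt; assumption].
        -- eapply Rle_trans; [exact Tz|]. apply Rmult_le_compat_l; [|apply exp_le; nra].
           pose proof (pow2_ge_0 (b * Rabs h * / y)). lra.
      * replace (exp (- fst al * y - s * fst be * / y) * / y ^ j *
          (4 * (b * Rabs h * / y) ^ 2 * exp (s * fst be / 2 * / y))) with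
          (4 * b ^ 2 * Rabs h ^ 2 * (exp (- fst al * y - s / 2 * fst be * / y) * / y ^ (j + 2))).
        -- rewrite pow2_abs.
           replace (4 * b ^ 2 * M2 * h ^ 2 / (1 + y) ^ 2) with
             (4 * b ^ 2 * h ^ 2 * (M2 / (1 + y) ^ 2)) by (field; lra).
           apply Rmult_le_compat_l; [|exact D2'].
           pose proof (pow2_ge_0 b). pose proof (pow2_ge_0 h). apply Rmult_le_pos; lra.
        -- rewrite pow_add, Rinv_mult.
           replace (- fst al * y - s / 2 * fst be * / y) with
             ((- fst al * y - s * fst be * / y) + s * fst be / 2 * / y) by (field; lra).
           rewrite exp_plus. field. split; [lra|apply pow_nonzero; lra].
Qed.

(** With [u = Jint 1] this reads [t u' = - al Jint 0] and [(t u')' = al be u]: the equation of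
    [K_0(2 sqrt(al be t))] as a first-order system. *)
Lemma Jint_ode (al be : C) (s : R) : 0 < fst al -> 0 < fst be -> 0 < s ->
  Cder (fun t => Jint 1 al (RtoC t * be)) s (- RtoC (/ s) * (al * Jint 0 al (RtoC s * be)))%C /\
  Cder (fun t => al * Jint 0 al (RtoC t * be))%C s (- (al * be) * Jint 1 al (RtoC s * be))%C.
Proof.
  intros Hal Hbe Hs. split.
  - eapply Cder_eq; [|apply Jint_derive; assumption].
    assert (H : 0 < fst (RtoC s * be)%C) by (simpl; nra).
    pose proof (Jint_recurrence al (RtoC s * be) Hal H) as E.
    rewrite <- E. simpl Nat.add.
    assert (Es : (RtoC (/ s) * RtoC s)%C = RtoC 1).
    { rewrite <- RtoC_mult. f_equal. field. lra. }
    symmetry. transitivity (- (RtoC (/ s) * RtoC s) * (be * Jint 2 al (RtoC s * be)))%C; [ring|].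
    rewrite Es. ring.
  - eapply Cder_eq; [|apply Cder_scal, Jint_derive; assumption]. simpl. ring.
Qed.

Definition imag (x : R) : C := (0, x).

(** A Fourier factor only shifts [al] by an imaginary number, so the Fourier transform of [kf] is
    again a [Jint]. *)
Lemma kf_mult_e (j : nat) (al be : C) (u y : R) :
  (kf j al be y * e (u * y))%C = kf j (al - imag (2 * PI * u)) be y.
Proof.
  destruct (Rle_dec y 0) as [Hy|Hy].
  - rewrite !kf_nonpos by assumption. ring.
  - rewrite !kf_pos by lra. rewrite e_cexp. fold (imag (2 * PI * (u * y))).
    replace (- (al - imag (2 * PI * u)) * RtoC y - be * RtoC (/ y))%C with
      ((- al * RtoC y - be * RtoC (/ y)) + imag (2 * PI * (u * y)))%C.
    + rewrite cexp_plus. ring.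
    + apply C_ext; simpl; ring.
Qed.

(** The constant is uniform over a bounded range of [al] and [be] away from the imaginary axis, so
    that the estimate can later be integrated over the parameter [t] in [t be]. *)
Lemma kf_poisson (q : nat) (phi : Z -> C) (Phi a0 b0 R0 : R) :
  (0 < q)%nat -> periodic q phi -> (forall x, Cmod (phi x) <= Phi) -> 0 < a0 -> 0 < b0 ->
  exists M, forall al be K L, a0 <= fst al -> b0 <= fst be -> Cmod al <= R0 -> Cmod be <= R0 ->
  Cmod (csum (fun m => phi (Z.of_nat m) * kf 1 al be (INR m))%C (q * L)
        - RtoC (/ INR q) * zsum (fun k => dft q phi k *
            Jint 1 (al + imag (2 * PI * IZR k / INR q)) be)%C K)
  <= M * (/ INR (S L) + / INR (S K)).
Proof.
  intros Hq Hper HPhi Ha Hb.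
  destruct (kf_dominated 1 a0 b0 Ha Hb) as (M1 & HM1 & D1).
  destruct (kf_dominated 2 a0 b0 Ha Hb) as (M2 & HM2 & D2).
  destruct (kf_dominated 3 a0 b0 Ha Hb) as (M3 & HM3 & D3).
  destruct (kf_dominated 4 a0 b0 Ha Hb) as (M4 & HM4 & D4).
  destruct (kf_dominated 5 a0 b0 Ha Hb) as (M5 & HM5 & D5).
  set (S1 := R0 * M1 + R0 * M3 + 1 * M2).
  set (S2 := R0 * M2 + R0 * M4 + 2 * M3).
  set (S3 := R0 * M3 + R0 * M5 + 3 * M4).
  set (MM := M1 + (R0 * S1 + R0 * S3 + 1 * S2)).
  exists (4 * INR q ^ 3 * Phi * MM).
  intros al be K L Hal Hbe Ra Rb.
  assert (HR0 : 0 <= R0) by (eapply Rle_trans; [apply Cmod_ge_0|exact Ra]).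
  assert (Q1 : 0 <= S1) by (unfold S1; nra). assert (Q2 : 0 <= S2) by (unfold S2; nra).
  assert (Q3 : 0 <= S3) by (unfold S3; nra).
  specialize (D1 al be Hal Hbe). specialize (D2 al be Hal Hbe). specialize (D3 al be Hal Hbe).
  specialize (D4 al be Hal Hbe). specialize (D5 al be Hal Hbe).
  (* The shape of the derivative in [kf_derive]; two applications express the second derivative [ff]
     through [kf 1] to [kf 5]. *)
  set (lin := fun (n : R) (f g h : R -> C) (y : R) => (- al * f y + be * g y - RtoC n * h y)%C).
  assert (Dlin : forall n f g h F G H, 0 <= n -> 0 <= F -> 0 <= G ->
    dominated f F -> dominated g G -> dominated h H ->
    dominated (lin n f g h) (R0 * F + R0 * G + n * H)).
  { intros n f g h F G H Hn HF HG [f1 f2] [g1 g2] [h1 h2]. split.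
    - intros x. unfold lin. apply Cct_minus; [apply Cct_plus|];
        (apply Cct_mult; [apply Cct_const|auto]).
    - intros x Hx. unfold lin. specialize (f2 x Hx). specialize (g2 x Hx). specialize (h2 x Hx).
      eapply Rle_trans; [apply Cmod_minus_le|].
      eapply Rle_trans; [apply Rplus_le_compat_r, Cmod_triangle|].
      rewrite !Cmod_mult, Cmod_opp, Cmod_R, (Rabs_pos_eq n) by assumption.
      unfold Rdiv in *. rewrite !Rmult_plus_distr_r, !Rmult_assoc.
      pose proof (Cmod_ge_0 al). pose proof (Cmod_ge_0 be).
      pose proof (Cmod_ge_0 (f x)). pose proof (Cmod_ge_0 (g x)).
      apply Rplus_le_compat; [apply Rplus_le_compat|].
      + apply Rmult_le_compat; assumption.
      + apply Rmult_le_compat; assumption.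
      + apply Rmult_le_compat_l; assumption. }
  set (f1 := lin 1 (kf 1 al be) (kf 3 al be) (kf 2 al be)).
  set (f2 := lin 2 (kf 2 al be) (kf 4 al be) (kf 3 al be)).
  set (f3 := lin 3 (kf 3 al be) (kf 5 al be) (kf 4 al be)).
  assert (d1 : dominated f1 S1) by (apply Dlin; auto; lra).
  assert (d2 : dominated f2 S2) by (apply Dlin; auto; lra).
  assert (d3 : dominated f3 S3) by (apply Dlin; auto; lra).
  set (ff := lin 1 f1 f3 f2).
  assert (dd : dominated ff (R0 * S1 + R0 * S3 + 1 * S2)) by (apply Dlin; auto; lra).
  assert (k1 : forall x, Cder (kf 1 al be) x (f1 x)) by (intros; apply kf_derive; lra).
  assert (k2 : forall x, Cder (kf 2 al be) x (f2 x)).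
  { intros x. eapply Cder_eq; [|apply kf_derive; lra]. reflexivity. }
  assert (k3 : forall x, Cder (kf 3 al be) x (f3 x)).
  { intros x. eapply Cder_eq; [|apply kf_derive; lra]. unfold f3, lin.
    replace (INR 3) with 3 by (simpl; ring). reflexivity. }
  assert (kk : forall x, Cder f1 x (ff x)).
  { intros x. unfold f1, ff, lin. apply Cder_minus; [apply Cder_plus|]; apply Cder_scal; auto. }
  rewrite (zsum_ext _ (fun k => dft q phi k * Cint0oo (fun x => kf 1 al be x *
    e (- IZR k / INR q * x)))%C).
  2:{ intros k. f_equal. unfold Jint. apply Cint0oo_ext. intros x _.
      rewrite kf_mult_e. f_equal. apply C_ext; simpl; field;
        apply Rgt_not_eq, lt_0_INR; assumption. }
  assert (Hle : 0 <= R0 * S1 + R0 * S3 + 1 * S2) by nra.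
  apply (poisson q phi Phi (kf 1 al be) f1 ff MM K L); auto.
  - apply dd.
  - intros x Hx. apply kf_nonpos, Hx.
  - intros x Hx. unfold ff, f1, f2, f3, lin. rewrite !kf_nonpos by assumption. ring.
  - intros x Hx. eapply Rle_trans; [apply D1, Hx|]. apply Rmult_le_compat_r.
    + left; apply Rinv_0_lt_compat; nra.
    + unfold MM; lra.
  - intros x Hx. eapply Rle_trans; [apply dd, Hx|]. apply Rmult_le_compat_r.
    + left; apply Rinv_0_lt_compat; nra.
    + unfold MM; lra.
Qed.

(** * The exponential integral and Euler's constant *)

Lemma Cct_lipschitz (f : R -> C) (x K eta : R) :
  0 < eta -> 0 <= K -> (forall h, Rabs h <= eta -> Cmod (f (x + h) - f x) <= K * Rabs h) ->
  Cct f x.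
Proof.
  intros Heta HK H.
  assert (G : forall p : C -> R, (forall z w, Rabs (p z - p w) <= Cmod (z - w)) ->
    continuous (fun t => p (f t)) x).
  { intros p Hp. apply continuity_pt_filterlim. intros eps Heps.
    assert (Hd : 0 < Rmin eta (eps / (K + 1))).
    { apply Rmin_pos; [assumption|apply Rdiv_lt_0_compat; lra]. }
    exists (Rmin eta (eps / (K + 1))). split; [exact Hd|].
    intros y [_ Hy]. simpl in *. unfold Rdist in *.
    eapply Rle_lt_trans; [apply Hp|].
    replace y with (x + (y - x)) by ring.
    eapply Rle_lt_trans; [apply H|].
    - left. eapply Rlt_le_trans; [exact Hy|apply Rmin_l].
    - assert (h2 : Rabs (y - x) < eps / (K + 1)) by (eapply Rlt_le_trans; [exact Hy|apply Rmin_r]).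
      apply Rle_lt_trans with ((K + 1) * Rabs (y - x)).
      + pose proof (Rabs_pos (y - x)). nra.
      + replace eps with ((K + 1) * (eps / (K + 1))) by (field; lra).
        apply Rmult_lt_compat_l; lra. }
  split; apply G.
  - intros z w. apply (Cmod_fst (z - w)).
  - intros z w. apply (Cmod_snd (z - w)).
Qed.

Lemma Cder_CInt (f : R -> C) (a x : R) :
  (forall t, Cct f t) -> Cder (fun y => CInt f a y) x (f x).
Proof.
  intros Hf.
  assert (G : forall p : R -> R, (forall t, continuous p t) ->
    is_derive (fun y => RInt p a y) x (p x)).
  { intros p Hp. apply (is_derive_RInt (V := R_NormedModule) p _ a); auto.
    apply filter_forall. intros y. apply (RInt_correct (V := R_CompleteNormedModule)).
    apply (ex_RInt_continuous (V := R_CompleteNormedModule)). auto. }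
  split; simpl; apply (G (fun t => _ (f t))); intros t; apply Hf.
Qed.

(** The value [al] at [0] removes the singularity; the integral is the entire exponential integral
    [Ein]. *)
Definition ein_f (al : C) (y : R) : C :=
  if Req_EM_T y 0 then al else ((1 - cexp (- al * RtoC y)) * RtoC (/ y))%C.

Definition Ein (al : C) (x : R) : C := CInt (ein_f al) 0 x.

Lemma Cder_cexp_lin (al : C) (y : R) :
  Cder (fun t => cexp (- al * RtoC t)) y (- al * cexp (- al * RtoC y))%C.
Proof.
  apply (Cder_cexp (fun t => - al * RtoC t)%C).
  eapply Cder_eq; [|apply Cder_scal, Cder_RtoC, (is_derive_id (K := R_AbsRing))].
  change (@one R_AbsRing) with 1. ring.
Qed.

Lemma continuous_Rinv (y : R) : y <> 0 -> continuous (fun t => / t) y.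
Proof.
  intros Hy. apply (ex_derive_continuous (V := R_NormedModule)). auto_derive. exact Hy.
Qed.

Lemma ein_f_continuous (al : C) (y : R) : Cct (ein_f al) y.
Proof.
  destruct (Req_dec y 0) as [->|Hy].
  - apply Cct_lipschitz with (4 * Cmod al ^ 2 * exp (Cmod al)) 1; [lra| |].
    + pose proof (exp_pos (Cmod al)). pose proof (pow2_ge_0 (Cmod al)). nra.
    + intros h Hh. rewrite Rplus_0_l. unfold ein_f at 2.
      destruct (Req_EM_T 0 0) as [_|]; [|contradiction].
      unfold ein_f. destruct (Req_EM_T h 0) as [->|Hh0].
      * replace (al - al)%C with (RtoC 0) by ring. rewrite Cmod_0, Rabs_R0. lra.
      * pose proof (cexp_taylor_2 (- al * RtoC h)) as T.
        replace ((1 - cexp (- al * RtoC h)) * RtoC (/ h) - al)%C with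
          (- (cexp (- al * RtoC h) - 1 - - al * RtoC h) * RtoC (/ h))%C.
        -- rewrite Cmod_mult, Cmod_opp, Cmod_R, Rabs_inv.
           rewrite Cmod_mult, Cmod_opp, Cmod_R in T.
           assert (Hp : 0 < Rabs h) by (apply Rabs_pos_lt; assumption).
           apply Rmult_le_reg_r with (Rabs h); [assumption|].
           rewrite Rmult_assoc, Rinv_l, Rmult_1_r by lra.
           eapply Rle_trans; [exact T|].
           assert (exp (Cmod al * Rabs h) <= exp (Cmod al)).
           { apply exp_le. pose proof (Cmod_ge_0 al). nra. }
           replace (4 * Cmod al ^ 2 * exp (Cmod al) * Rabs h * Rabs h) with
             (4 * (Cmod al * Rabs h) ^ 2 * exp (Cmod al)) by ring.
           apply Rmult_le_compat_l; [|assumption].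
           pose proof (pow2_ge_0 (Cmod al * Rabs h)). lra.
        -- assert (E : (RtoC h * RtoC (/ h))%C = RtoC 1) by (rewrite <- RtoC_mult; f_equal; field; auto).
           transitivity ((1 - cexp (- al * RtoC h)) * RtoC (/ h) - al * (RtoC h * RtoC (/ h)))%C;
             [ring|]. rewrite E. ring.
  - apply Cct_ext_loc with (fun t => ((1 - cexp (- al * RtoC t)) * RtoC (/ t))%C).
    + assert (L : locally y (fun t => t <> 0)).
      { apply (open_neq 0). exact Hy. }
      apply filter_imp with (2 := L). intros t Ht. unfold ein_f.
      destruct (Req_EM_T t 0); [contradiction|reflexivity].
    + apply Cct_mult; [|apply Cct_RtoC, continuous_Rinv, Hy].
      apply Cct_minus; [apply Cct_const|eapply Cder_Cct, Cder_cexp_lin].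
Qed.

Lemma ein_f_bound (al : C) (y : R) : 0 <= fst al -> 0 <= y -> Cmod (ein_f al y) <= 2 * Cmod al.
Proof.
  intros Ha Hy. pose proof (Cmod_ge_0 al). unfold ein_f.
  destruct (Req_EM_T y 0) as [_|Hy0]; [lra|].
  rewrite Cmod_mult, Cmod_R, Rabs_inv, (Rabs_pos_eq y), Cmod_minus_sym by lra.
  apply Rmult_le_reg_r with y; [lra|]. rewrite Rmult_assoc, Rinv_l, Rmult_1_r by lra.
  eapply Rle_trans; [apply cexp_minus_1_left; simpl; nra|].
  rewrite Cmod_mult, Cmod_opp, Cmod_R, Rabs_pos_eq by lra. lra.
Qed.

Lemma Ein_bound (al : C) (x : R) : 0 <= fst al -> 0 <= x -> Cmod (Ein al x) <= 4 * Cmod al * x.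
Proof.
  intros Ha Hx. unfold Ein. replace (4 * Cmod al * x) with (2 * (2 * Cmod al) * (x - 0)) by ring.
  apply CInt_bound_const; [assumption|intros; apply ein_f_continuous|].
  intros y Hy. apply ein_f_bound; lra.
Qed.

(** A primitive of [- exp(- al x) / x]. Its limit at infinity is [log al + euler_gamma], as shown in
    [Vlim_clog]. *)
Definition Vln (al : C) (x : R) : C := (Ein al x - RtoC (ln x))%C.

Lemma Vln_derive (al : C) (x : R) : 0 < x ->
  Cder (Vln al) x (- cexp (- al * RtoC x) * RtoC (/ x))%C.
Proof.
  intros Hx. eapply Cder_eq; [|apply Cder_minus; [apply Cder_CInt, ein_f_continuous|]].
  2:{ apply Cder_RtoC, is_derive_ln, Hx. }
  unfold ein_f. destruct (Req_EM_T x 0); [lra|]. ring.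
Qed.

Lemma Vln_Cauchy (al : C) (x y : R) : 0 < fst al -> 1 <= x <= y ->
  Cmod (Vln al y - Vln al x) <= 2 / fst al * exp (- fst al * x).
Proof.
  intros Ha Hxy.
  apply Rle_trans with (2 * (- (exp (- fst al * y) / fst al) - - (exp (- fst al * x) / fst al))).
  - apply (Cmvt_bound (Vln al) (fun t => - cexp (- al * RtoC t) * RtoC (/ t))%C
      (fun t => - (exp (- fst al * t) / fst al)) (fun t => exp (- fst al * t))); [lra| | |].
    + intros t Ht. apply Vln_derive; lra.
    + intros t Ht. auto_derive; [exact I|]. field. lra.
    + intros t Ht. rewrite Cmod_mult, Cmod_opp, Cmod_cexp, Cmod_R.
      rewrite Rabs_pos_eq by (left; apply Rinv_0_lt_compat; lra).
      replace (fst (- al * RtoC t)%C) with (- fst al * t) by (simpl; ring).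
      rewrite <- (Rmult_1_r (exp _)) at 2. apply Rmult_le_compat_l; [left; apply exp_pos|].
      rewrite <- Rinv_1. apply Rinv_le_contravar; lra.
  - pose proof (exp_pos (- fst al * y)). pose proof (exp_pos (- fst al * x)).
    assert (0 < exp (- fst al * y) / fst al) by (apply Rdiv_lt_0_compat; assumption).
    unfold Rdiv in *. lra.
Qed.

Lemma exp_opp_le_inv (a : R) (n : nat) : 0 < a ->
  exp (- a * INR (S n)) <= / a / INR (S n).
Proof.
  intros Ha. pose proof (lt_0_INR (S n) ltac:(lia)) as Hc. set (c := INR (S n)) in *.
  replace (- a * c) with (- (a * c)) by ring.
  eapply Rle_trans; [apply (exp_opp_le 1); [lia|nra]|]. right.
  rewrite !pow_1. change (INR 1) with 1. field. split; lra.
Qed.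

Definition Vlim (al : C) : C :=
  (real (Lim_seq (fun n => fst (Vln al (INR (S n))))),
   real (Lim_seq (fun n => snd (Vln al (INR (S n)))))).

Lemma Vlim_Clim (al : C) : 0 < fst al -> Clim (fun n => Vln al (INR (S n))) (Vlim al).
Proof.
  intros Ha.
  destruct (Clim_Cauchy (fun n => Vln al (INR (S n))) (2 / fst al * / fst al)) as (l & Hl & _).
  - intros n m Hnm. eapply Rle_trans; [apply Vln_Cauchy; [assumption|]|].
    + split; [apply (le_INR 1); lia|apply le_INR; lia].
    + unfold Rdiv at 2. rewrite Rmult_assoc. apply Rmult_le_compat_l.
      * apply Rdiv_le_0_compat; lra.
      * apply exp_opp_le_inv, Ha.
  - replace (Vlim al) with l; [exact Hl|]. unfold Vlim.
    rewrite (is_lim_seq_unique _ _ (Clim_fst _ _ Hl)), (is_lim_seq_unique _ _ (Clim_snd _ _ Hl)).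
    apply surjective_pairing.
Qed.

Lemma Vln_Vlim_bound (al : C) (x : R) : 0 < fst al -> 1 <= x ->
  Cmod (Vln al x - Vlim al) <= 2 / fst al * exp (- fst al * x).
Proof.
  intros Ha Hx. rewrite Cmod_minus_sym, <- (Rplus_0_l (2 / fst al * _)).
  destruct (INR_unbounded x) as [N HN].
  apply (is_lim_seq_eventually_le (fun n => Cmod (Vlim al - Vln al x))
    (fun n => Cmod (Vln al (INR (S n)) - Vlim al) + 2 / fst al * exp (- fst al * x)) _ _ N).
  - apply is_lim_seq_const.
  - apply is_lim_seq_plus'; [apply Vlim_Clim, Ha|apply is_lim_seq_const].
  - intros n Hn. eapply Rle_trans; [apply (Cmod_minus_triangle _ (Vln al (INR (S n))))|].
    rewrite (Cmod_minus_sym (Vlim al)). apply Rplus_le_compat_l.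
    apply Vln_Cauchy; [assumption|]. split; [assumption|].
    apply le_INR in Hn. rewrite S_INR. lra.
Qed.

(** With [n] for [S n]: the product of [(1 - x/n)^n] and [(1 + x/n)^n] is
    [(1 - x^2/n^2)^n >= 1 - x^2/n] by Bernoulli's inequality, and [(1 + x/n)^n <= exp x]. *)
Lemma pow_one_minus_bounds (n : nat) (x : R) : 0 <= x <= INR (S n) ->
  0 <= exp (- x) - (1 - x / INR (S n)) ^ S n <= x ^ 2 / INR (S n) * exp (- x).
Proof.
  intros Hx. set (N := S n) in *. set (c := INR N) in *.
  assert (Hc : 0 < c) by (apply lt_0_INR; unfold N; lia).
  assert (Hq : 0 <= x / c <= 1).
  { split; [apply Rdiv_le_0_compat; lra|]. apply Rmult_le_reg_r with c; [assumption|].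
    unfold Rdiv. rewrite Rmult_assoc, Rinv_l; lra. }
  assert (E : forall y, exp y = exp (y / c) ^ N).
  { intros y. rewrite exp_pow_INR. f_equal. fold c. field. lra. }
  split.
  - rewrite (E (- x)).
    assert ((1 - x / c) ^ N <= exp (- x / c) ^ N); [|lra].
    apply pow_incr. split; [lra|]. pose proof (exp_ineq1_le (- x / c)). unfold Rdiv in *. lra.
  - assert (B : forall k, (1 - (x / c) ^ 2) ^ k >= 1 - INR k * (x / c) ^ 2).
    { assert (Hq2 : 0 <= (x / c) ^ 2 <= 1) by nra. revert Hq2. generalize ((x / c) ^ 2).
      intros q Hq2. induction k as [|k IH]; [simpl; lra|]. rewrite S_INR.
      cbn [pow]. pose proof (pos_INR k).
      pose proof (pow_incr (1 - q) 1 k ltac:(lra)) as P1. rewrite pow1 in P1. nra. }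
    specialize (B N). fold c in B.
    assert (P : exp (- x) * (1 - (x / c) ^ 2) ^ N <= (1 - x / c) ^ N).
    { replace (1 - (x / c) ^ 2) with ((1 + x / c) * (1 - x / c)) by ring.
      rewrite Rpow_mult_distr, <- Rmult_assoc.
      assert (Q : (1 + x / c) ^ N <= exp x).
      { rewrite (E x). apply pow_incr. split; [lra|]. apply exp_ineq1_le. }
      assert (Q2 : exp (- x) * exp x = 1) by (rewrite <- exp_plus, Rplus_opp_l; apply exp_0).
      assert (0 <= (1 - x / c) ^ N) by (apply pow_le; lra).
      pose proof (exp_pos (- x)).
      assert (exp (- x) * (1 + x / c) ^ N <= 1) by nra.
      nra. }
    pose proof (exp_pos (- x)).
    replace (x ^ 2 / c) with (c * (x / c) ^ 2) by (field; lra). nra.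
Qed.

(** By the geometric series the harmonic number [H_n] is the integral over [[0, n]] of
    [(1 - (1 - x/n)^n) / x]. Its difference to [Ein] is at most the integral of [x exp(- x) / n],
    hence at most [1 / n]. *)
Lemma harmonic_Ein (n : nat) :
  Rabs (harmonic (S n) - fst (Ein 1 (INR (S n)))) <= / INR (S n).
Proof.
  set (c := INR (S n)). assert (Hc : 0 < c) by (apply lt_0_INR; lia).
  (* An explicit primitive of [(1 - (1 - x/c)^m) / x] which vanishes at [0] and equals [harmonic m]
     at [c]. *)
  set (P := fun m x => rsum (fun k => (1 - (1 - x / c) ^ S k) / INR (S k)) m).
  assert (DP : forall (m : nat) (x : R), is_derive (P m) x (rsum (fun k => / c * (1 - x / c) ^ k) m)).
  { intros m x. induction m as [|m IH]; unfold P; cbn [rsum].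
    - apply (is_derive_const (K := R_AbsRing) (V := R_NormedModule) 0).
    - apply (is_derive_plus (V := R_NormedModule) (P m)); [exact IH|].
      pose proof (lt_0_INR (S m) ltac:(lia)).
      auto_derive; [exact I|]. cbn [Init.Nat.pred].
      change (match m with O => 1 | S _ => INR m + 1 end) with (INR (S m)).
      replace (1 + - (x * / c)) with (1 - x / c) by (unfold Rdiv; ring).
      generalize ((1 - x / c) ^ m). intros w. field. split; lra. }
  assert (Geo : forall m x, x * rsum (fun k => / c * (1 - x / c) ^ k) m = 1 - (1 - x / c) ^ m).
  { intros m x. induction m as [|m IH]; cbn [rsum]; [simpl; ring|].
    rewrite Rmult_plus_distr_l, IH. simpl. field. lra. }
  assert (HPc : forall m, P m c = harmonic m).
  { induction m as [|m IH]; [reflexivity|]. unfold P in *. cbn [rsum harmonic]. rewrite IH.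
    f_equal. replace (1 - c / c) with 0 by (field; lra). rewrite pow_i by lia.
    unfold Rdiv. ring. }
  assert (HP0 : forall m, P m 0 = 0).
  { induction m as [|m IH]; [reflexivity|]. unfold P in *. cbn [rsum]. rewrite IH.
    replace (1 - 0 / c) with 1 by (field; lra). rewrite pow1. unfold Rdiv. ring. }
  assert (Ee : forall x, x <> 0 -> fst (ein_f 1 x) = (1 - exp (- x)) / x).
  { intros x Hx. unfold ein_f. destruct (Req_EM_T x 0); [contradiction|]. simpl.
    replace (- (1) * x - - 0 * 0) with (- x) by ring.
    replace (- (1) * 0 + - 0 * x) with 0 by ring. rewrite cos_0. field. assumption. }
  pose proof (Rmvt_bound (fun x => P (S n) x - fst (Ein 1 x))
    (fun x => rsum (fun k => / c * (1 - x / c) ^ k) (S n) - fst (ein_f 1 x))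
    (fun x => - ((x + 1) * exp (- x)) / c) (fun x => x * exp (- x) / c) 0 c ltac:(lra)) as M.
  cbv beta in M. rewrite HPc, HP0 in M. 
  assert (E0 : fst (Ein 1 0) = 0) by (unfold Ein; rewrite CInt_point; reflexivity).
  rewrite E0, !Rminus_0_r in M.
  eapply Rle_trans; [apply M|].
  - intros x _. apply (is_derive_minus (V := R_NormedModule) (P (S n)) (fun t => fst (Ein 1 t))).
    + apply DP.
    + apply (Cder_CInt (ein_f 1) 0 x), ein_f_continuous.
  - intros x _. auto_derive; [exact I|]. field. lra.
  - intros x Hx. destruct (Req_dec x 0) as [->|Hx0].
    + unfold ein_f. destruct (Req_EM_T 0 0); [|contradiction].
      rewrite (rsum_ext _ (fun _ => / c)).
      2:{ intros k _. replace (1 - 0 / c) with 1 by (field; lra). rewrite pow1. ring. }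
      rewrite rsum_const. fold c. simpl. rewrite Rinv_r, Rminus_diag, Rabs_R0 by lra.
      unfold Rdiv. rewrite !Rmult_0_l. lra.
    + rewrite Ee by assumption.
      pose proof (pow_one_minus_bounds n x Hx) as B. fold c in B.
      specialize (Geo (S n) x). set (G := rsum _ (S n)) in *.
      replace G with ((1 - (1 - x / c) ^ S n) / x) by (rewrite <- Geo; field; assumption).
      replace (_ - _) with ((exp (- x) - (1 - x / c) ^ S n) / x) by (field; assumption).
      rewrite Rabs_pos_eq by (apply Rdiv_le_0_compat; lra).
      apply Rmult_le_reg_r with x; [lra|]. unfold Rdiv at 1. rewrite Rmult_assoc, Rinv_l, Rmult_1_r by assumption.
      replace (x * exp (- x) / c * x) with (x ^ 2 / c * exp (- x)) by (field; lra). lra.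
  - rewrite Ropp_0, exp_0. pose proof (exp_pos (- c)).
    replace (- ((c + 1) * exp (- c)) / c - - ((0 + 1) * 1) / c) with
      (/ c - (c + 1) * exp (- c) / c) by (field; lra).
    assert (0 <= (c + 1) * exp (- c) / c); [|lra]. apply Rdiv_le_0_compat; nra.
Qed.

Lemma Ein_1_imag (x : R) : 0 <= x -> snd (Ein 1 x) = 0.
Proof.
  intros Hx. simpl. rewrite (RInt_ext _ (fun _ => 0)).
  - rewrite (RInt_const (V := R_CompleteNormedModule)). apply Rmult_0_r.
  - intros t _. unfold ein_f. destruct (Req_EM_T t 0); [reflexivity|]. simpl.
    replace (- (1) * 0 + - 0 * t) with 0 by ring. rewrite sin_0. ring.
Qed.

(** Here [euler_gamma], defined as the limit of [harmonic n - ln n], enters the analysis, through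
    the comparison of [harmonic] with [Ein]. *)
Lemma Vlim_1 : Vlim 1 = RtoC euler_gamma.
Proof.
  assert (H : 0 < fst (RtoC 1)) by (simpl; lra).
  pose proof (Vlim_Clim 1 H) as L.
  assert (Lf : is_lim_seq (fun n => harmonic (S n) - ln (INR (S n))) (fst (Vlim 1))).
  { apply is_lim_seq_minus_0.
    apply is_lim_seq_le_le with (fun _ => 0)
      (fun n => Cmod (Vln 1 (INR (S n)) - Vlim 1) + / INR (S n)).
    - intros n. split; [apply Rabs_pos|].
      replace (harmonic (S n) - ln (INR (S n)) - fst (Vlim 1)) with
        (fst (Vln 1 (INR (S n)) - Vlim 1)%C + (harmonic (S n) - fst (Ein 1 (INR (S n))))).
      + eapply Rle_trans; [apply Rabs_triang|]. apply Rplus_le_compat; [apply Cmod_fst|].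
        apply harmonic_Ein.
      + unfold Vln. simpl. ring.
    - apply is_lim_seq_const.
    - rewrite <- (Rplus_0_r 0). apply is_lim_seq_plus'; [exact L|apply is_lim_seq_inv_S]. }
  apply C_ext.
  - simpl fst at 2. unfold euler_gamma.
    apply (is_lim_seq_incr_1 (fun n => harmonic n - ln (INR n))) in Lf.
    now rewrite (is_lim_seq_unique _ _ Lf).
  - simpl snd at 2. pose proof (is_lim_seq_unique _ _ (Clim_snd _ _ L)) as E.
    rewrite (Lim_seq_ext _ (fun _ => 0)), Lim_seq_const in E.
    + now injection E.
    + intros n. unfold Vln. simpl snd. 
      pose proof (Ein_1_imag (INR (S n)) (pos_INR _)) as Z. simpl snd in Z. rewrite Z. ring.
Qed.

(** The principal logarithm for positive real part, where [atan] of the slope is the argument. *)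
Definition clog (z : C) : C := (ln (fst z ^ 2 + snd z ^ 2) / 2, atan (snd z / fst z)).

Lemma exp_y_bound (a y : R) : 0 < a -> 0 <= y -> y * exp (- a * y) <= exp a * (27 / a ^ 3) / (1 + y) ^ 2.
Proof.
  intros Ha Hy.
  apply Rle_trans with ((1 + y) * (exp a * (27 / a ^ 3 / (1 + y) ^ 3))).
  - replace (exp (- a * y)) with (exp a * exp (- (a * (1 + y)))).
    + pose proof (exp_opp_le 3 (a * (1 + y)) ltac:(lia) ltac:(nra)) as H.
      replace (INR 3 ^ 3 / (a * (1 + y)) ^ 3) with (27 / a ^ 3 / (1 + y) ^ 3) in H.
      * pose proof (exp_pos a). pose proof (exp_pos (- (a * (1 + y)))).
        apply Rmult_le_compat; [lra|nra|lra|]. apply Rmult_le_compat_l; lra.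
      * rewrite Rpow_mult_distr. simpl INR. field. lra.
    + rewrite <- exp_plus. f_equal. ring.
  - right. field. lra.
Qed.

Lemma CInt_cexp (al : C) (N : R) : 0 < fst al -> 0 <= N ->
  CInt (fun y => cexp (- al * RtoC y)) 0 N = ((1 - cexp (- al * RtoC N)) / al)%C.
Proof.
  intros Ha HN.
  assert (Hal : al <> RtoC 0) by (intros E; rewrite E in Ha; simpl in Ha; lra).
  rewrite (CInt_FTC _ (fun y => - / al * cexp (- al * RtoC y))%C); [|assumption| |].
  - replace (- al * RtoC 0)%C with (RtoC 0) by ring. rewrite cexp_0. field. assumption.
  - intros y _. eapply Cder_eq; [|apply Cder_scal, Cder_cexp_lin]. field. assumption.
  - intros y _. eapply Cder_Cct, Cder_cexp_lin.
Qed.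

(** [Vlim] has complex derivative [1 / al], the integral of [exp(- al y)]. The second-order
    remainder of the exponential, divided by [y], stays integrable with a constant uniform for
    [|d| <= Re(al) / 2]. *)
Lemma Vlim_increment (al : C) : 0 < fst al ->
  exists K, forall d : C, Cmod d <= fst al / 2 ->
    Cmod (Vlim (al + d) - Vlim al - d / al) <= K * Cmod d ^ 2.
Proof.
  intros Ha. set (a := fst al) in *.
  (* From [exp_y_bound] at [a / 2]: half of the decay [exp(- a y)] is spent on the growth
     [exp(|d| y)] of the remainder. *)
  set (M := exp (a / 2) * (27 / (a / 2) ^ 3)).
  exists (8 * M). intros d Hd.
  assert (Hal : al <> RtoC 0) by (intros E; unfold a in Ha; rewrite E in Ha; simpl in Ha; lra).
  assert (HM : 0 < M).
  { apply Rmult_lt_0_compat; [apply exp_pos|]. apply Rdiv_lt_0_compat; [lra|]. apply pow_lt; lra. }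
  assert (Had : 0 < fst (al + d)%C).
  { simpl. pose proof (Cmod_fst d) as Q. apply Rabs_le_between in Q. fold a. lra. }
  set (D := fun y => (ein_f (al + d) y - ein_f al y - d * cexp (- al * RtoC y))%C).
  assert (DD : dominated D (4 * Cmod d ^ 2 * M)).
  { split.
    - intros y. apply Cct_minus; [apply Cct_minus; apply ein_f_continuous|].
      apply Cct_mult; [apply Cct_const|eapply Cder_Cct, Cder_cexp_lin].
    - intros y Hy. unfold D, ein_f. destruct (Req_EM_T y 0) as [->|Hy0].
      + replace (- al * RtoC 0)%C with (RtoC 0) by ring. rewrite cexp_0.
        replace (_ - _ - _)%C with (RtoC 0) by ring. rewrite Cmod_0.
        apply Rdiv_le_0_compat; [|lra]. pose proof (pow2_ge_0 (Cmod d)). nra.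
      + set (z := (- d * RtoC y)%C).
        replace (- (al + d) * RtoC y)%C with (- al * RtoC y + z)%C by (unfold z; ring).
        rewrite cexp_plus.
        assert (E1 : (RtoC y * RtoC (/ y))%C = RtoC 1) by (rewrite <- RtoC_mult; f_equal; field; auto).
        replace (_ - _ - _)%C with (- (cexp (- al * RtoC y) * (cexp z - 1 - z)) * RtoC (/ y))%C.
        2:{ transitivity ((1 - cexp (- al * RtoC y) * cexp z) * RtoC (/ y) -
              (1 - cexp (- al * RtoC y)) * RtoC (/ y) - d * cexp (- al * RtoC y) * (RtoC y * RtoC (/ y)))%C;
              [unfold z; ring|rewrite E1; ring]. }
        rewrite Cmod_mult, Cmod_opp, Cmod_mult, Cmod_cexp, Cmod_R, Rabs_inv, (Rabs_pos_eq y) by lra.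
        replace (fst (- al * RtoC y)%C) with (- a * y) by (unfold a; simpl; ring).
        pose proof (cexp_taylor_2 z) as T.
        assert (Cz : Cmod z = Cmod d * y)
          by (unfold z; rewrite Cmod_mult, Cmod_opp, Cmod_R, Rabs_pos_eq; auto).
        rewrite Cz in T.
        assert (T2 : exp (Cmod d * y) <= exp (a / 2 * y)) by (apply exp_le; nra).
        pose proof (exp_y_bound (a / 2) y ltac:(lra) Hy) as Q. fold M in Q.
        apply Rle_trans with (exp (- a * y) * (4 * (Cmod d * y) ^ 2 * exp (a / 2 * y)) * / y).
        * apply Rmult_le_compat_r; [left; apply Rinv_0_lt_compat; lra|].
          apply Rmult_le_compat_l; [left; apply exp_pos|]. eapply Rle_trans; [exact T|].
          apply Rmult_le_compat_l; [|exact T2]. pose proof (pow2_ge_0 (Cmod d * y)). lra.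
        * replace (exp (- a * y) * (4 * (Cmod d * y) ^ 2 * exp (a / 2 * y)) * / y) with
            (4 * Cmod d ^ 2 * (y * exp (- (a / 2) * y))).
          -- unfold Rdiv. rewrite (Rmult_assoc _ M). apply Rmult_le_compat_l; [|exact Q].
             pose proof (pow2_ge_0 (Cmod d)). lra.
          -- replace (- (a / 2) * y) with (- a * y + a / 2 * y) by field.
             rewrite exp_plus. field. assumption. }
  replace (8 * M * Cmod d ^ 2) with (2 * (4 * Cmod d ^ 2 * M)) by ring.
  assert (LE : Clim (fun n => cexp (- al * RtoC (INR (S n)))) 0%C).
  { apply Clim_squeeze with (fun n => / a / INR (S n)); [|apply is_lim_seq_scal_inv_S].
    intros n. replace (cexp (- al * RtoC (INR (S n))) - 0)%C with (cexp (- al * RtoC (INR (S n)))) by ring.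
    rewrite Cmod_cexp. replace (fst (- al * RtoC (INR (S n)))%C) with (- a * INR (S n))
      by (unfold a; simpl; ring).
    apply exp_opp_le_inv, Ha. }
  assert (L : Clim (fun n => Vln (al + d) (INR (S n)) - Vln al (INR (S n)) -
    d * ((1 - cexp (- al * RtoC (INR (S n)))) / al))%C (Vlim (al + d) - Vlim al - d * ((1 - 0) / al))%C).
  { apply Clim_minus; [apply Clim_minus; apply Vlim_Clim; assumption|]. apply Clim_scal.
    unfold Cdiv. apply Clim_mult; [|apply Clim_const]. apply Clim_minus; [apply Clim_const|exact LE]. }
  replace (Vlim (al + d) - Vlim al - d / al)%C with
    ((Vlim (al + d) - Vlim al - d * ((1 - 0) / al)) - 0)%C by (field; assumption).
  apply (Clim_Cmod_le _ _ 0%C (fun _ => 2 * (4 * Cmod d ^ 2 * M)) _ L); [apply is_lim_seq_const|].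
  intros n. pose proof (pos_INR (S n)) as Hn.
  replace (_ - 0)%C with (CInt D 0 (INR (S n))).
  - eapply Rle_trans; [apply (dominated_CInt D _ _ _ DD); lra|].
    assert (0 <= 4 * Cmod d ^ 2 * M / (1 + INR (S n))).
    { apply Rdiv_le_0_compat; [|lra]. pose proof (pow2_ge_0 (Cmod d)). nra. }
    replace (4 * Cmod d ^ 2 * M / (1 + 0)) with (4 * Cmod d ^ 2 * M) by field. lra.
  - assert (Ce : forall x, Cct (fun y => cexp (- al * RtoC y)) x)
      by (intros; eapply Cder_Cct, Cder_cexp_lin).
    transitivity ((CInt (ein_f (al + d)) 0 (INR (S n)) - CInt (ein_f al) 0 (INR (S n))) -
      d * CInt (fun y => cexp (- al * RtoC y)) 0 (INR (S n)))%C.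
    + rewrite <- (CInt_scal d (fun y => cexp (- al * RtoC y))) by auto.
      rewrite <- (CInt_minus (ein_f (al + d)) (ein_f al)) by (auto using ein_f_continuous).
      apply (CInt_minus (fun x => ein_f (al + d) x - ein_f al x)%C
        (fun x => d * cexp (- al * RtoC x))%C); [assumption| |].
      * intros. apply Cct_minus; apply ein_f_continuous.
      * intros. apply Cct_mult; [apply Cct_const|auto].
    + rewrite CInt_cexp by assumption. unfold Vln, Ein. ring.
Qed.

(** [Vlim] and [clog] have the same derivative along the segment from [1] to [al], and [Vlim_1]
    fixes the constant. *)
Lemma Vlim_clog (al : C) : 0 < fst al -> Vlim al = (clog al + RtoC euler_gamma)%C.
Proof.
  intros Ha. set (d := (al - 1)%C).
  set (path := fun t : R => (1 + RtoC t * d)%C).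
  assert (Hp : forall t, 0 <= t <= 1 -> 0 < fst (path t)).
  { intros t Ht. unfold path, d. simpl. nra. }
  assert (Ed : (1 + d)%C = al) by (unfold d; ring).
  clearbody d.
  assert (D1 : forall t, 0 <= t <= 1 -> Cder (fun t => Vlim (path t)) t (d / path t)%C).
  { intros t Ht. specialize (Hp t Ht). destruct (Vlim_increment (path t) Hp) as [K HK].
    assert (Hd : 0 <= Cmod d) by apply Cmod_ge_0.
    apply Cder_quadratic with (K * Cmod d ^ 2) (fst (path t) / 2 / (Cmod d + 1)).
    - apply Rdiv_lt_0_compat; lra.
    - intros h Hh. specialize (HK (RtoC h * d)%C).
      replace (path (t + h)%R) with (path t + RtoC h * d)%C
        by (unfold path; rewrite RtoC_plus; ring).
      replace (RtoC h * (d / path t))%C with (RtoC h * d / path t)%C by (unfold Cdiv; ring).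
      rewrite Cmod_mult, Cmod_R in HK.
      replace (K * Cmod d ^ 2 * h ^ 2) with (K * (Rabs h * Cmod d) ^ 2)
        by (rewrite Rpow_mult_distr, pow2_abs; ring).
      apply HK.
      apply Rle_trans with (fst (path t) / 2 / (Cmod d + 1) * (Cmod d + 1)).
      + apply Rmult_le_compat; try lra. apply Rabs_pos.
      + right. field. lra. }
  assert (D2 : forall t, 0 <= t <= 1 -> Cder (fun t => clog (path t)) t (d / path t)%C).
  { intros t Ht. specialize (Hp t Ht).
    assert (Hpos : 0 < (1 + t * fst d) ^ 2 + (t * snd d) ^ 2).
    { unfold path in Hp; simpl in Hp. assert (0 < (1 + t * fst d) ^ 2) by (apply pow_lt; lra).
      pose proof (pow2_ge_0 (t * snd d)). lra. }
    assert (Hx : 0 < 1 + t * fst d) by (unfold path in Hp; simpl in Hp; lra).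
    split; simpl fst; simpl snd.
    - apply (is_derive_Rext (fun t => ln ((1 + t * fst d) ^ 2 + (t * snd d) ^ 2) / 2)).
      { intros s. unfold path; simpl. f_equal. f_equal. ring. }
      unfold path. simpl.
      auto_derive; [simpl in Hpos; exact Hpos|]. 
      field. simpl in Hpos. intros E; lra.
    - apply (is_derive_Rext (fun t => atan ((t * snd d) / (1 + t * fst d)))).
      { intros s. unfold path; simpl. f_equal. f_equal; ring. }
      unfold path. simpl.
      auto_derive; [lra|]. simpl in Hpos.
      field. repeat split; try lra; intros E; lra. }
  set (F := fun t => (Vlim (path t) - clog (path t))%C).
  pose proof (Cmvt_bound_const F (fun _ => 0%C) 0 1 0 ltac:(lra)) as H.
  assert (H' : Cmod (F 1 - F 0) <= 0).
  { replace 0 with (2 * 0 * (1 - 0)) at 2 by ring. apply H.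
    - intros t Ht. eapply Cder_eq; [|apply Cder_minus; [apply D1|apply D2]; assumption]. ring.
    - intros. rewrite Cmod_0. lra. }
  assert (E : (F 1 - F 0)%C = 0%C).
  { apply Cmod_eq_0. pose proof (Cmod_ge_0 (F 1 - F 0)). lra. }
  unfold F in E. replace (path 1) with al in E by (rewrite <- Ed; unfold path; ring).
  replace (path 0) with (RtoC 1) in E by (unfold path; ring).
  rewrite Vlim_1 in E.
  replace (clog 1) with (RtoC 0) in E.
  - transitivity ((Vlim al - clog al - (RtoC euler_gamma - 0)) + clog al + RtoC euler_gamma)%C; [ring|].
    rewrite E. ring.
  - unfold clog. simpl. replace (1 * (1 * 1) + 0 * (0 * 1)) with 1 by ring.
    rewrite ln_1. replace (0 / 1) with 0 by field. rewrite atan_0. unfold Rdiv. now rewrite Rmult_0_l.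
Qed.

(** The exponential integral: [exp(- al y) / y] integrated over [y > x]. *)
Definition E1 (al : C) (x : R) : C := (Vln al x - Vlim al)%C.

Lemma E1_derive (al : C) (x : R) : 0 < x -> Cder (E1 al) x (- cexp (- al * RtoC x) * RtoC (/ x))%C.
Proof.
  intros Hx. eapply Cder_eq; [|apply Cder_minus; [apply Vln_derive, Hx|apply Cder_const]]. ring.
Qed.

Lemma E1_limit (al : C) (X : nat -> R) : 0 < fst al -> (forall n, INR (S n) <= X n) ->
  Clim (fun n => E1 al (X n)) 0%C.
Proof.
  intros Ha HX. apply Clim_squeeze with (fun n => 2 / fst al * / fst al / INR (S n));
    [|apply is_lim_seq_scal_inv_S].
  intros n. replace (E1 al (X n) - 0)%C with (E1 al (X n)) by ring.
  assert (H1 : 1 <= INR (S n)) by (apply (le_INR 1); lia). specialize (HX n).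
  eapply Rle_trans; [apply Vln_Vlim_bound; [assumption|lra]|].
  unfold Rdiv. rewrite !Rmult_assoc. rewrite <- !Rmult_assoc, (Rmult_assoc (2 * _)).
  apply Rmult_le_compat_l; [apply Rdiv_le_0_compat; lra|].
  apply Rle_trans with (exp (- fst al * INR (S n))).
  - apply exp_le. nra.
  - apply exp_opp_le_inv, Ha.
Qed.

(* Splitting the range of integration at sqrt s, the factor exp(-s be/y) (above sqrt s), respectively
   exp(-al y) (below), may be replaced by 1 up to O(sqrt s). *)
Lemma Jint_1_split (al be : C) (s : R) : 0 < fst al -> 0 < fst be -> 0 < s ->
  Cmod (Jint 1 al (RtoC s * be) - E1 al (sqrt s) - E1 be (sqrt s))
  <= 4 * (Cmod al + Cmod be) * sqrt s.
Proof.
  intros Ha Hb Hs. set (r := sqrt s).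
  assert (Hr : 0 < r) by (apply sqrt_lt_R0, Hs).
  assert (Hrr : r * r = s) by (apply sqrt_sqrt; lra).
  assert (Hsb : 0 < fst (RtoC s * be)%C) by (simpl; nra).
  destruct (kf_dominated 1 (fst al) (fst (RtoC s * be)%C) Ha Hsb) as (M & HM & Hd).
  specialize (Hd al (RtoC s * be)%C (Rle_refl _) (Rle_refl _)).
  set (k := kf 1 al (RtoC s * be)) in *.
  set (U := fun y => CInt k 0 y).
  assert (DU : forall y, Cder U y (k y)) by (intros; apply Cder_CInt, Hd).
  assert (Ek : forall y, 0 < y -> k y = (cexp (- al * RtoC y) * cexp (- be * RtoC (s / y)) * RtoC (/ y))%C).
  { intros y Hy. unfold k. rewrite kf_pos, pow_1 by assumption. f_equal.
    rewrite <- cexp_plus. f_equal. unfold Rdiv. rewrite RtoC_mult. ring. }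
  pose proof (Cmod_ge_0 al) as Ga. pose proof (Cmod_ge_0 be) as Gb.
  (* Above [r] the derivative of [U + E1 al] is [exp(- al y) (exp(- s be / y) - 1) / y], of size
     [2 s |be| / y^2]; integrated from [r] on this is [O(s / r) = O(r)]. *)
  assert (Up : forall N, r <= N ->
    Cmod ((U N + E1 al N) - (U r + E1 al r)) <= 4 * Cmod be * r).
  { intros N HN.
    apply Rle_trans with (2 * (- (2 * s * Cmod be / N) - - (2 * s * Cmod be / r))).
    - apply (Cmvt_bound (fun y => U y + E1 al y)%C
        (fun y => k y + - cexp (- al * RtoC y) * RtoC (/ y))%C
        (fun y => - (2 * s * Cmod be / y)) (fun y => 2 * s * Cmod be / y ^ 2)); [assumption| | |].
      + intros y Hy. apply Cder_plus; [apply DU|apply E1_derive; lra].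
      + intros y Hy. auto_derive; [lra|]. field. lra.
      + intros y Hy. assert (Hy0 : 0 < y) by lra. rewrite Ek by assumption.
        replace (_ + _)%C with (cexp (- al * RtoC y) * (cexp (- be * RtoC (s / y)) - 1) * RtoC (/ y))%C by ring.
        rewrite !Cmod_mult, Cmod_cexp, Cmod_R, (Rabs_pos_eq (/ y)) by (left; apply Rinv_0_lt_compat; assumption).
        assert (Hsy : 0 < s / y) by (apply Rdiv_lt_0_compat; assumption).
        assert (Q1 : exp (fst (- al * RtoC y)%C) <= 1).
        { rewrite <- exp_0. apply exp_le. simpl. nra. }
        assert (Q2 : Cmod (cexp (- be * RtoC (s / y)) - 1) <= 2 * (Cmod be * (s / y))).
        { eapply Rle_trans; [apply cexp_minus_1_left; simpl; nra|].
          rewrite Cmod_mult, Cmod_opp, Cmod_R, Rabs_pos_eq by lra. lra. }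
        replace (2 * s * Cmod be / y ^ 2) with (1 * (2 * (Cmod be * (s / y))) * / y) by (field; lra).
        apply Rmult_le_compat_r; [left; apply Rinv_0_lt_compat; assumption|].
        apply Rmult_le_compat; try assumption; [left; apply exp_pos|apply Cmod_ge_0].
    - assert (0 <= 2 * s * Cmod be / N) by (apply Rdiv_le_0_compat; nra).
      replace (2 * s * Cmod be / r) with (2 * Cmod be * r) by (rewrite <- Hrr; field; lra). lra. }
  (* Below [r] the substitution [y -> s / y] turns [exp(- s be / y) / y] into the integrand of
     [E1 be]; the error has bounded derivative on an interval of length at most [r]. *)
  assert (Lo : forall y0, 0 < y0 <= r ->
    Cmod ((U r - E1 be (s / r)) - (U y0 - E1 be (s / y0))) <= 4 * Cmod al * r).
  { intros y0 Hy0.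
    apply Rle_trans with (2 * (2 * Cmod al) * (r - y0)); [|nra].
    apply (Cmvt_bound_const (fun y => U y - E1 be (s / y))%C
      (fun y => k y - RtoC (- s / y ^ 2) * (- cexp (- be * RtoC (s / y)) * RtoC (/ (s / y))))%C); [lra| |].
    - intros y Hy. apply Cder_minus; [apply DU|].
      apply (Cder_comp (E1 be) (fun y => s / y)).
      + apply E1_derive, Rdiv_lt_0_compat; lra.
      + auto_derive; [lra|]. field. lra.
    - intros y Hy. assert (Hy1 : 0 < y) by lra. rewrite Ek by assumption.
      replace (- cexp (- be * RtoC (s / y)) * RtoC (/ (s / y)))%C with
        (RtoC (- (/ (s / y))) * cexp (- be * RtoC (s / y)))%C by (rewrite RtoC_opp; ring).
      rewrite Cmult_assoc, <- RtoC_mult.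
      replace (- s / y ^ 2 * - / (s / y)) with (/ y) by (field; lra).
      replace (_ - _)%C with ((cexp (- al * RtoC y) - 1) * RtoC (/ y) * cexp (- be * RtoC (s / y)))%C by ring.
      rewrite !Cmod_mult, Cmod_cexp, Cmod_R, (Rabs_pos_eq (/ y)) by (left; apply Rinv_0_lt_compat; assumption).
      assert (Hsy : 0 < s / y) by (apply Rdiv_lt_0_compat; lra).
      assert (Q1 : exp (fst (- be * RtoC (s / y))%C) <= 1).
      { rewrite <- exp_0. apply exp_le. simpl. nra. }
      assert (Q2 : Cmod (cexp (- al * RtoC y) - 1) <= 2 * (Cmod al * y)).
      { eapply Rle_trans; [apply cexp_minus_1_left; simpl; nra|].
        rewrite Cmod_mult, Cmod_opp, Cmod_R, Rabs_pos_eq by lra. lra. }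
      rewrite <- (Rmult_1_r (2 * Cmod al)).
      apply Rmult_le_compat; [|left; apply exp_pos| |assumption].
      + apply Rmult_le_pos; [apply Cmod_ge_0|left; apply Rinv_0_lt_compat; assumption].
      + apply Rmult_le_reg_r with y; [assumption|]. rewrite Rmult_assoc, Rinv_l by lra. lra. }
  assert (Esr : s / r = r) by (rewrite <- Hrr; field; lra). rewrite Esr in Lo.
  destruct (INR_unbounded r) as [N0 HN0].
  assert (Up' : Cmod ((Jint 1 al (RtoC s * be) + 0) - (U r + E1 al r)) <= 4 * Cmod be * r).
  { apply (Clim_Cmod_le (fun n => U (INR (S n + N0)) + E1 al (INR (S n + N0)))%C _ _ (fun _ => 4 * Cmod be * r)).
    - apply Clim_plus.
      + apply (Cint0oo_limit k M); [assumption|]. intros n. apply le_INR. lia.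
      + apply E1_limit; [assumption|]. intros n. apply le_INR. lia.
    - apply is_lim_seq_const.
    - intros n. apply Up. apply Rle_trans with (INR N0); [lra|apply le_INR; lia]. }
  assert (Lo' : Cmod ((U r - E1 be r) - (0 - 0)) <= 4 * Cmod al * r).
  { rewrite Cmod_minus_sym.
    (* Points tending to [0] with [Y n <= r] and [s / Y n >= n + 1], so that both [U (Y n)] and
       [E1 be (s / Y n)] tend to [0]. *)
    set (Y := fun n => Rmin 1 (Rmin r s) / INR (S n)).
    assert (HY : forall n, 0 < Y n <= r /\ Y n <= 1 / INR (S n) /\ INR (S n) <= s / Y n).
    { intros n. assert (Hn : 1 <= INR (S n)) by (apply (le_INR 1); lia).
      assert (Hm : 0 < Rmin 1 (Rmin r s)) by (repeat apply Rmin_pos; lra).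
      assert (Hm1 : Rmin 1 (Rmin r s) <= 1) by apply Rmin_l.
      assert (Hm2 : Rmin 1 (Rmin r s) <= r) by (eapply Rle_trans; [apply Rmin_r|apply Rmin_l]).
      assert (Hm3 : Rmin 1 (Rmin r s) <= s) by (eapply Rle_trans; [apply Rmin_r|apply Rmin_r]).
      unfold Y. set (m := Rmin 1 (Rmin r s)) in *. split; [split|split].
      - apply Rdiv_lt_0_compat; lra.
      - apply Rmult_le_reg_r with (INR (S n)); [lra|].
        unfold Rdiv. rewrite Rmult_assoc, Rinv_l by lra. nra.
      - apply Rmult_le_compat_r; [left; apply Rinv_0_lt_compat; lra|assumption].
      - replace (s / (m / INR (S n))) with (s / m * INR (S n)) by (field; lra).
        assert (1 <= s / m); [|nra]. apply Rmult_le_reg_r with m; [assumption|].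
        unfold Rdiv. rewrite Rmult_assoc, Rinv_l; lra. }
    apply (Clim_Cmod_le (fun n => U (Y n) - E1 be (s / Y n))%C _ _ (fun _ => 4 * Cmod al * r)).
    - apply Clim_minus.
      + apply Clim_squeeze with (fun n => 2 * M / INR (S n)); [|apply is_lim_seq_scal_inv_S].
        intros n. destruct (HY n) as ([H1 H2] & H3 & _).
        replace (U (Y n) - 0)%C with (U (Y n)) by ring. unfold U.
        eapply Rle_trans; [apply (dominated_CInt k M _ _ Hd); lra|].
        replace (2 * M / INR (S n)) with (2 * (M * (1 / INR (S n)))) by (unfold Rdiv; ring).
        apply Rmult_le_compat_l; [lra|].
        replace (M / (1 + 0) - M / (1 + Y n)) with (M * (1 - / (1 + Y n))) by (field; lra).
        apply Rmult_le_compat_l; [lra|]. apply Rle_trans with (Y n); [|assumption].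
        apply Rmult_le_reg_r with (1 + Y n); [lra|].
        rewrite Rmult_minus_distr_r, Rinv_l by lra. nra.
      + apply E1_limit; [assumption|]. intros n. apply HY.
    - apply is_lim_seq_const.
    - intros n. rewrite Cmod_minus_sym. apply Lo. apply HY. }
  replace (_ - _ - _)%C with (((Jint 1 al (RtoC s * be) + 0) - (U r + E1 al r)) +
    ((U r - E1 be r) - (0 - 0)))%C by ring.
  eapply Rle_trans; [apply Cmod_triangle|]. lra.
Qed.

(** The logarithmic behaviour at [0]: with [r = sqrt s], each of the two [E1] in [Jint_1_split] is
    [- ln r - Vlim] up to [O(r)], and [2 ln r = ln s]. *)
Lemma Jint_1_small (al be : C) (s : R) : 0 < fst al -> 0 < fst be -> 0 < s ->
  Cmod (Jint 1 al (RtoC s * be) + RtoC (ln s) + Vlim al + Vlim be)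
  <= 8 * (Cmod al + Cmod be) * sqrt s.
Proof.
  intros Ha Hb Hs. pose proof (Jint_1_split al be s Ha Hb Hs) as H.
  assert (Hr : 0 < sqrt s) by (apply sqrt_lt_R0, Hs).
  assert (El : ln s = ln (sqrt s) + ln (sqrt s)).
  { rewrite <- ln_mult by assumption. rewrite sqrt_sqrt by lra. reflexivity. }
  pose proof (Ein_bound al (sqrt s) ltac:(lra) ltac:(lra)) as B1.
  pose proof (Ein_bound be (sqrt s) ltac:(lra) ltac:(lra)) as B2.
  replace (_ + _ + _ + _)%C with ((Jint 1 al (RtoC s * be) - E1 al (sqrt s) - E1 be (sqrt s)) +
    (Ein al (sqrt s) + Ein be (sqrt s)))%C
    by (unfold E1, Vln; rewrite El, RtoC_plus; ring).
  eapply Rle_trans; [apply Cmod_triangle|].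
  pose proof (Cmod_triangle (Ein al (sqrt s)) (Ein be (sqrt s))). lra.
Qed.

(** At [s = 0] the integral of [al exp(- al y)] is [1]; the effect of the factor [exp(- s be / y)]
    is again estimated separately below and above [sqrt s]. *)
Lemma Jint_0_small (al be : C) (s : R) : 0 < fst al -> 0 < fst be -> 0 < s ->
  Cmod (al * Jint 0 al (RtoC s * be) - 1)
  <= (4 * Cmod al + 4 * Cmod al * Cmod be / fst al) * sqrt s.
Proof.
  intros Ha Hb Hs. set (r := sqrt s).
  assert (Hr : 0 < r) by (apply sqrt_lt_R0, Hs).
  assert (Hrr : r * r = s) by (apply sqrt_sqrt; lra).
  assert (Hsb : 0 < fst (RtoC s * be)%C) by (simpl; nra).
  destruct (kf_dominated 0 (fst al) (fst (RtoC s * be)%C) Ha Hsb) as (M & HM & Hd).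
  specialize (Hd al (RtoC s * be)%C (Rle_refl _) (Rle_refl _)).
  set (k := kf 0 al (RtoC s * be)) in *.
  (* It equals [1] at [0] and tends to [al Jint 0] at infinity, so the claim bounds its total
     change. *)
  set (U := fun y => (al * CInt k 0 y + cexp (- al * RtoC y))%C).
  set (U' := fun y => (al * k y + - al * cexp (- al * RtoC y))%C).
  assert (DU : forall y, Cder U y (U' y)).
  { intros y. apply Cder_plus; [apply Cder_scal, Cder_CInt, Hd|apply Cder_cexp_lin]. }
  pose proof (Cmod_ge_0 al) as Ga. pose proof (Cmod_ge_0 be) as Gb.
  assert (Efst : forall y, fst (- al * RtoC y)%C = - fst al * y) by (intros; simpl; ring).
  assert (Ex : forall y, 0 <= y -> exp (- fst al * y) <= 1).
  { intros y Hy. rewrite <- exp_0. apply exp_le. nra. }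
  assert (Bk : forall y, 0 < y -> Cmod (k y) <= 1).
  { intros y Hy. unfold k. rewrite Cmod_kf by assumption. simpl. rewrite Rinv_1, Rmult_1_r.
    rewrite <- exp_0. apply exp_le.
    assert (0 < / y) by (apply Rinv_0_lt_compat; assumption).
    assert (0 < s * fst be) by nra. nra. }
  assert (Lo : Cmod (U r - U 0) <= 4 * Cmod al * r).
  { replace (4 * Cmod al * r) with (2 * (2 * Cmod al) * (r - 0)) by ring.
    apply (Cmvt_bound_const U U'); [lra|auto|].
    intros y Hy. unfold U'.
    replace (_ + _)%C with (al * (k y - cexp (- al * RtoC y)))%C by ring. rewrite Cmod_mult.
    rewrite Rmult_comm. apply Rmult_le_compat_r; [assumption|].
    eapply Rle_trans; [apply Cmod_minus_le|]. rewrite Cmod_cexp, Efst.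
    specialize (Ex y ltac:(lra)). destruct (Req_dec y 0) as [->|Hy0].
    - unfold k. rewrite kf_nonpos, Cmod_0 by lra. lra.
    - specialize (Bk y ltac:(lra)). lra. }
  assert (Up : forall N, r <= N -> Cmod (U N - U r) <= 4 * Cmod al * Cmod be / fst al * r).
  { intros N HN.
    set (c := 2 * Cmod al * Cmod be * r).
    assert (Hc : 0 <= c).
    { unfold c. apply Rmult_le_pos; [apply Rmult_le_pos|]; lra. }
    apply Rle_trans with (2 * (- (c * exp (- fst al * N) / fst al) - - (c * exp (- fst al * r) / fst al))).
    - apply (Cmvt_bound U U' (fun y => - (c * exp (- fst al * y) / fst al))
        (fun y => c * exp (- fst al * y))); [assumption|auto| |].
      + intros y _. auto_derive; [exact I|]. field. lra.
      + intros y Hy. assert (Hy0 : 0 < y) by lra.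
        assert (Hyi : 0 < / y) by (apply Rinv_0_lt_compat; assumption).
        assert (E : U' y = (al * (cexp (- al * RtoC y) * (cexp (- (RtoC s * be) * RtoC (/ y)) - 1)))%C).
        { unfold U', k. rewrite kf_pos by assumption. rewrite pow_O, Rinv_1.
          replace (- al * RtoC y - RtoC s * be * RtoC (/ y))%C with
            (- al * RtoC y + - (RtoC s * be) * RtoC (/ y))%C by ring.
          rewrite cexp_plus. ring. }
        rewrite E, !Cmod_mult, Cmod_cexp, Efst.
        assert (Q2 : Cmod (cexp (- (RtoC s * be) * RtoC (/ y)) - 1) <= 2 * (Cmod be * r)).
        { assert (Q0 : 0 < s * fst be * / y)
            by (apply Rmult_lt_0_compat; [apply Rmult_lt_0_compat|]; lra).
          eapply Rle_trans; [apply cexp_minus_1_left; simpl; lra|].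
          rewrite !Cmod_mult, Cmod_opp, Cmod_mult, !Cmod_R, (Rabs_pos_eq s), (Rabs_pos_eq (/ y)) by lra.
          apply Rmult_le_compat_l; [lra|].
          apply Rle_trans with (s * Cmod be * / r).
          - apply Rmult_le_compat_l; [nra|]. apply Rinv_le_contravar; lra.
          - rewrite <- Hrr. right. field. lra. }
        unfold c. pose proof (exp_pos (- fst al * y)).
        replace (2 * Cmod al * Cmod be * r * exp (- fst al * y)) with
          (Cmod al * (exp (- fst al * y) * (2 * (Cmod be * r)))) by ring.
        apply Rmult_le_compat_l; [assumption|]. apply Rmult_le_compat_l; lra.
    - pose proof (exp_pos (- fst al * N)). specialize (Ex r ltac:(lra)).
      assert (0 <= c * exp (- fst al * N) / fst al) by (apply Rdiv_le_0_compat; nra).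
      assert (c * exp (- fst al * r) / fst al <= c / fst al).
      { unfold Rdiv. apply Rmult_le_compat_r; [left; apply Rinv_0_lt_compat; assumption|]. nra. }
      replace (4 * Cmod al * Cmod be / fst al * r) with (2 * (c / fst al)) by (unfold c; field; lra).
      lra. }
  assert (U0 : U 0 = RtoC 1).
  { unfold U. rewrite CInt_point. replace (- al * RtoC 0)%C with (RtoC 0) by ring. rewrite cexp_0. ring. }
  assert (Up' : Cmod ((al * Jint 0 al (RtoC s * be) + 0) - U r) <= 4 * Cmod al * Cmod be / fst al * r).
  { destruct (INR_unbounded r) as [N0 HN0].
    apply (Clim_Cmod_le (fun n => U (INR (S n + N0))) _ _ (fun _ => 4 * Cmod al * Cmod be / fst al * r)).
    - apply Clim_plus.
      + apply Clim_scal. apply (Cint0oo_limit k M); [assumption|]. intros n. apply le_INR. lia.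
      + apply Clim_squeeze with (fun n => / fst al / INR (S n)); [|apply is_lim_seq_scal_inv_S].
        intros n. replace (cexp (- al * RtoC (INR (S n + N0))) - 0)%C with
          (cexp (- al * RtoC (INR (S n + N0)))) by ring.
        rewrite Cmod_cexp, Efst. eapply Rle_trans; [|apply exp_opp_le_inv, Ha].
        apply exp_le. pose proof (le_INR (S n) (S n + N0) ltac:(lia)). nra.
    - apply is_lim_seq_const.
    - intros n. apply Up. apply Rle_trans with (INR N0); [lra|apply le_INR; lia]. }
  replace (_ - 1)%C with (((al * Jint 0 al (RtoC s * be) + 0) - U r) + (U r - U 0))%C
    by (rewrite U0; ring).
  eapply Rle_trans; [apply Cmod_triangle|]. lra.
Qed.

(** * Power series of the Bessel functions *)

(** Coefficients of an entire function of exponential type. The class is stable under [d/ds] and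
    [s d/ds], with explicit constants. *)
Definition fast (c : nat -> C) (K r : R) : Prop :=
  0 <= K /\ 0 <= r /\ forall k, Cmod (c k) <= K * r ^ k / INR (fact k).

Definition CP (c : nat -> C) (s : R) : C :=
  (PSeries (fun k => fst (c k)) s, PSeries (fun k => snd (c k)) s).

Lemma exp_series (x : R) : is_series (fun k => x ^ k / INR (fact k)) (exp x).
Proof.
  pose proof (is_exp_Reals x) as H. unfold is_pseries in H.
  eapply is_series_ext; [|exact H]. intros n. simpl.
  unfold scal; simpl; unfold mult; simpl. rewrite pow_n_pow. reflexivity.
Qed.

Lemma fast_real (b : nat -> R) (K r x : R) : 0 <= K -> 0 <= r ->
  (forall k, Rabs (b k) <= K * r ^ k / INR (fact k)) ->
  CV_disk b x /\ Rabs (PSeries b x) <= K * exp (r * Rabs x) /\ Rbar_lt (Rabs x) (CV_radius b).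
Proof.
  intros HK Hr Hb.
  assert (B : forall y k, Rabs (b k * y ^ k) <= K * ((r * Rabs y) ^ k / INR (fact k))).
  { intros y k. rewrite Rabs_mult, <- RPow_abs, Rpow_mult_distr.
    replace (K * (r ^ k * Rabs y ^ k / INR (fact k))) with (K * r ^ k / INR (fact k) * Rabs y ^ k)
      by (unfold Rdiv; ring).
    apply Rmult_le_compat_r; [apply pow_le, Rabs_pos|apply Hb]. }
  assert (Ex : forall y, ex_series (fun k => K * ((r * Rabs y) ^ k / INR (fact k)))).
  { intros y. apply (ex_series_scal (V := R_NormedModule) K). eexists; apply exp_series. }
  assert (D : forall y, CV_disk b y).
  { intros y. apply (ex_series_le (V := R_CompleteNormedModule)) with (2 := Ex y).
    intros k. unfold norm; simpl. unfold abs; simpl. rewrite Rabs_Rabsolu. apply B. }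
  split; [apply D|split].
  - unfold PSeries. eapply Rle_trans; [apply Series_Rabs, D|].
    rewrite <- (is_series_unique _ _ (exp_series (r * Rabs x))), <- Series_scal_l.
    apply Series_le; [|apply Ex]. intros k. split; [apply Rabs_pos|apply B].
  - apply Rbar_lt_le_trans with (Finite (Rabs x + 1)); [simpl; lra|].
    unfold CV_radius. apply (Lub_Rbar_correct (CV_disk b)). apply D.
Qed.

Lemma fast_fst (c : nat -> C) (K r : R) : fast c K r ->
  0 <= K /\ 0 <= r /\ (forall k, Rabs (fst (c k)) <= K * r ^ k / INR (fact k)) /\
  (forall k, Rabs (snd (c k)) <= K * r ^ k / INR (fact k)).
Proof.
  intros (HK & Hr & Hc). repeat split; auto; intros k; (eapply Rle_trans; [|apply Hc]).
  - apply Cmod_fst.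
  - apply Cmod_snd.
Qed.

Definition CP_derive (c : nat -> C) (k : nat) : C := (RtoC (INR (S k)) * c (S k))%C.

Lemma fast_derive (c : nat -> C) (K r : R) : fast c K r -> fast (CP_derive c) (K * r) r.
Proof.
  intros (HK & Hr & Hc). repeat split; [nra|assumption|]. intros k. unfold CP_derive.
  rewrite Cmod_RtoC_mult by apply pos_INR. specialize (Hc (S k)).
  pose proof (lt_0_INR (S k) ltac:(lia)) as Hk. pose proof (INR_fact_lt_0 k) as Hf.
  eapply Rle_trans; [apply Rmult_le_compat_l; [lra|exact Hc]|]. right.
  rewrite fact_simpl, mult_INR. simpl pow. field. lra.
Qed.

Lemma CP_Cder (c : nat -> C) (K r s : R) : fast c K r -> Cder (CP c) s (CP (CP_derive c) s).
Proof.
  intros H. destruct (fast_fst c K r H) as (HK & Hr & H1 & H2). split.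
  - simpl. destruct (fast_real _ K r s HK Hr H1) as (_ & _ & D).
    replace (PSeries _ s) with (PSeries (PS_derive (fun k => fst (c k))) s).
    + apply is_derive_PSeries, D.
    + apply PSeries_ext. intros k. unfold PS_derive, CP_derive. simpl. ring.
  - simpl. destruct (fast_real _ K r s HK Hr H2) as (_ & _ & D).
    replace (PSeries _ s) with (PSeries (PS_derive (fun k => snd (c k))) s).
    + apply is_derive_PSeries, D.
    + apply PSeries_ext. intros k. unfold PS_derive, CP_derive. simpl. ring.
Qed.

Lemma CP_bound (c : nat -> C) (K r s : R) : fast c K r -> 0 <= s <= 1 ->
  Cmod (CP c s) <= 2 * (K * exp r).
Proof.
  intros H Hs. destruct (fast_fst c K r H) as (HK & Hr & H1 & H2).
  destruct (fast_real _ K r s HK Hr H1) as (_ & B1 & _).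
  destruct (fast_real _ K r s HK Hr H2) as (_ & B2 & _).
  rewrite (Rabs_pos_eq s) in B1, B2 by lra.
  assert (E : K * exp (r * s) <= K * exp r) by (apply Rmult_le_compat_l; [lra|apply exp_le; nra]).
  eapply Rle_trans; [apply Cmod_le_components|]. simpl. lra.
Qed.

Lemma CP_near_0 (c : nat -> C) (K r s : R) : fast c K r -> 0 <= s <= 1 ->
  Cmod (CP c s - c O) <= 4 * (K * r * exp r) * s.
Proof.
  intros H Hs.
  replace (c O) with (CP c 0).
  - replace (4 * (K * r * exp r) * s) with (2 * (2 * (K * r * exp r)) * (s - 0)) by ring.
    apply (Cmvt_bound_const (CP c) (CP (CP_derive c))); [lra| |].
    + intros x _. eapply CP_Cder, H.
    + intros x Hx. apply CP_bound; [apply fast_derive, H|lra].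
  - unfold CP. rewrite !PSeries_0. symmetry. apply surjective_pairing.
Qed.

Lemma CP_scal (x : C) (c : nat -> C) (K r s : R) : fast c K r ->
  CP (fun k => x * c k)%C s = (x * CP c s)%C.
Proof.
  intros H. destruct (fast_fst c K r H) as (HK & Hr & H1 & H2).
  destruct (fast_real _ K r s HK Hr H1) as (D1 & _ & _).
  destruct (fast_real _ K r s HK Hr H2) as (D2 & _ & _).
  apply ex_series_Rabs in D1, D2.
  assert (L : forall u v : R, Series (fun k => (u * fst (c k) + v * snd (c k)) * s ^ k) =
    u * Series (fun k => fst (c k) * s ^ k) + v * Series (fun k => snd (c k) * s ^ k)).
  { intros u v. rewrite <- !Series_scal_l, <- Series_plus.
    - apply Series_ext. intros; ring.
    - apply (ex_series_scal (V := R_NormedModule) u). exact D1.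
    - apply (ex_series_scal (V := R_NormedModule) v). exact D2. }
  apply C_ext; simpl; unfold PSeries.
  - rewrite <- (Ropp_involutive (snd x * _)), Ropp_mult_distr_l.
    transitivity (fst x * Series (fun k => fst (c k) * s ^ k) +
      (- snd x) * Series (fun k => snd (c k) * s ^ k)); [rewrite <- L|ring].
    apply Series_ext. intros; ring.
  - transitivity (snd x * Series (fun k => fst (c k) * s ^ k) +
      fst x * Series (fun k => snd (c k) * s ^ k)); [rewrite <- L|ring].
    apply Series_ext. intros; ring.
Qed.

Lemma CP_plus (c d : nat -> C) (K r L t s : R) : fast c K r -> fast d L t ->
  CP (fun k => c k + d k)%C s = (CP c s + CP d s)%C.
Proof.
  intros H G. destruct (fast_fst c K r H) as (HK & Hr & H1 & H2).
  destruct (fast_fst d L t G) as (HL & Ht & G1 & G2).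
  apply C_ext; simpl; unfold PSeries; (rewrite <- Series_plus; [apply Series_ext; intros; ring| |]);
    apply ex_series_Rabs.
  - apply (fast_real (fun k => fst (c k)) K r s HK Hr H1).
  - apply (fast_real (fun k => fst (d k)) L t s HL Ht G1).
  - apply (fast_real (fun k => snd (c k)) K r s HK Hr H2).
  - apply (fast_real (fun k => snd (d k)) L t s HL Ht G2).
Qed.

Lemma CP_ext (c d : nat -> C) (s : R) : (forall k, c k = d k) -> CP c s = CP d s.
Proof. intros H. unfold CP. f_equal; apply PSeries_ext; intros k; now rewrite H. Qed.

(** The operator [s d/ds] acting on coefficients. *)
Definition theta (c : nat -> C) (k : nat) : C := (RtoC (INR k) * c k)%C.

Lemma CP_theta (c : nat -> C) (s : R) :
  CP (theta c) s = (RtoC s * CP (CP_derive c) s)%C.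
Proof.
  apply C_ext; simpl.
  - rewrite Rmult_0_l, Rminus_0_r, <- PSeries_incr_1. apply PSeries_ext.
    intros [|k]; simpl; unfold zero; simpl; ring.
  - rewrite Rmult_0_l, Rplus_0_r, <- PSeries_incr_1. apply PSeries_ext.
    intros [|k]; simpl; unfold zero; simpl; ring.
Qed.

Lemma fast_theta (c : nat -> C) (K r : R) : fast c K r -> fast (theta c) (K * r) (r + 1).
Proof.
  intros (HK & Hr & Hc). repeat split; [nra|lra|]. intros [|k]; unfold theta.
  - simpl INR at 1. rewrite Cmult_0_l, Cmod_0. simpl. apply Rdiv_le_0_compat; nra.
  - destruct (fast_derive c K r (conj HK (conj Hr Hc))) as (_ & _ & H). specialize (H k).
    unfold CP_derive in H.
    pose proof (INR_fact_lt_0 k) as Hf. pose proof (lt_0_INR (S k) ltac:(lia)) as Hk.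
    eapply Rle_trans; [exact H|]. rewrite fact_simpl, mult_INR.
    apply Rmult_le_reg_r with (INR (S k) * INR (fact k)); [nra|].
    replace (K * r * r ^ k / INR (fact k) * (INR (S k) * INR (fact k))) with
      (K * r * (INR (S k) * r ^ k)) by (field; lra).
    replace (K * r * (r + 1) ^ S k / (INR (S k) * INR (fact k)) * (INR (S k) * INR (fact k))) with
      (K * r * (r + 1) ^ S k) by (field; lra).
    apply Rmult_le_compat_l; [nra|].
    clear - Hr. induction k as [|k IH]; [simpl; lra|].
    rewrite S_INR. cbn [pow] in *.
    assert (r ^ k <= (r + 1) ^ k) by (apply pow_incr; lra).
    pose proof (pow_le r k Hr). nra.
Qed.

(** The sum of [coefI k w^k] is [I_0(2 sqrt w)]; [coefH] gives the power series accompanying the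
    logarithm in the second solution. *)
Definition coefI (k : nat) : R := / INR (fact k) ^ 2.
Definition coefH (k : nat) : R := harmonic k / INR (fact k) ^ 2.

Lemma fact_ge_n (k : nat) : INR k <= INR (fact k) /\ 1 <= INR (fact k).
Proof.
  split.
  - apply le_INR. induction k as [|k IH]; [simpl; lia|]. rewrite fact_simpl.
    pose proof (lt_O_fact k). nia.
  - apply (le_INR 1). apply (lt_O_fact k).
Qed.

Lemma harmonic_bounds (k : nat) : 0 <= harmonic k <= INR k.
Proof.
  induction k as [|k IH]; [simpl; lra|]. rewrite S_INR. cbn [harmonic].
  assert (H : 1 <= INR (S k)) by (apply (le_INR 1); lia).
  assert (0 < / INR (S k) <= 1).
  { split; [apply Rinv_0_lt_compat; lra|]. rewrite <- Rinv_1. apply Rinv_le_contravar; lra. }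
  lra.
Qed.

Lemma coefI_bound (k : nat) : Rabs (coefI k) <= / INR (fact k).
Proof.
  destruct (fact_ge_n k) as [_ H]. unfold coefI.
  rewrite Rabs_pos_eq by (left; apply Rinv_0_lt_compat; nra).
  apply Rinv_le_contravar; nra.
Qed.

Lemma coefH_bound (k : nat) : Rabs (coefH k) <= / INR (fact k).
Proof.
  destruct (fact_ge_n k) as [H0 H]. destruct (harmonic_bounds k) as [Ha Hb]. unfold coefH.
  rewrite Rabs_pos_eq by (apply Rdiv_le_0_compat; nra).
  apply Rmult_le_reg_r with (INR (fact k) ^ 2); [nra|].
  replace (harmonic k / INR (fact k) ^ 2 * INR (fact k) ^ 2) with (harmonic k) by (field; lra).
  replace (/ INR (fact k) * INR (fact k) ^ 2) with (INR (fact k)) by (field; lra). lra.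
Qed.

Lemma fast_coef (a : nat -> R) (z : C) : (forall k, Rabs (a k) <= / INR (fact k)) ->
  fast (fun k => RtoC (a k) * z ^ k)%C 1 (Cmod z).
Proof.
  intros H. repeat split; [lra|apply Cmod_ge_0|]. intros k.
  rewrite Cmod_mult, Cmod_R, Cmod_pow, Rmult_1_l. unfold Rdiv. rewrite Rmult_comm.
  apply Rmult_le_compat_l; [apply pow_le, Cmod_ge_0|apply H].
Qed.

(** The recurrence [(k + 1)^2 coefI (k + 1) = coefI k], that is [(s F')' = z F] for the series
    [F]. *)
Lemma coefI_theta (z : C) (k : nat) :
  CP_derive (theta (fun k => RtoC (coefI k) * z ^ k)%C) k = (z * (RtoC (coefI k) * z ^ k))%C.
Proof.
  unfold CP_derive, theta, coefI. cbn [Cpow].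
  assert (E : INR (S k) * (INR (S k) * / INR (fact (S k)) ^ 2) = / INR (fact k) ^ 2).
  { pose proof (INR_fact_lt_0 k). pose proof (lt_0_INR (S k) ltac:(lia)).
    rewrite fact_simpl, mult_INR. field. lra. }
  rewrite <- E, !RtoC_mult. ring.
Qed.

(** The increment [1 / (k + 1)] of [harmonic] produces the extra term [F'], with [F] the series of
    [coefI]; it compensates the derivatives of the logarithm. *)
Lemma coefH_theta (z : C) (k : nat) :
  CP_derive (theta (fun k => RtoC (coefH k) * z ^ k)%C) k =
  (z * (RtoC (coefH k) * z ^ k) + CP_derive (fun k => RtoC (coefI k) * z ^ k) k)%C.
Proof.
  unfold CP_derive, theta, coefI, coefH. cbn [Cpow].
  assert (E : INR (S k) * (INR (S k) * (harmonic (S k) / INR (fact (S k)) ^ 2)) =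
    harmonic k / INR (fact k) ^ 2 + INR (S k) * / INR (fact (S k)) ^ 2).
  { pose proof (INR_fact_lt_0 k). pose proof (lt_0_INR (S k) ltac:(lia)).
    rewrite fact_simpl, mult_INR. cbn [harmonic]. field. lra. }
  transitivity (RtoC (INR (S k) * (INR (S k) * (harmonic (S k) / INR (fact (S k)) ^ 2))) * (z * z ^ k))%C.
  - rewrite !RtoC_mult. ring.
  - rewrite E, RtoC_plus, RtoC_mult. ring.
Qed.

(** It amounts to [ln (1 / sqrt s) <= 1 / sqrt s]. *)
Lemma sqrt_ln_bound (s : R) : 0 < s <= 1 -> s * Rabs (ln s) <= 2 * sqrt s.
Proof.
  intros Hs. set (r := sqrt s).
  assert (Hr : 0 < r) by (apply sqrt_lt_R0; lra).
  assert (Hrr : r * r = s) by (apply sqrt_sqrt; lra).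
  assert (El : ln s = - (2 * ln (/ r))).
  { rewrite <- Hrr, ln_mult, ln_Rinv by assumption. ring. }
  assert (Hir : 0 < / r) by (apply Rinv_0_lt_compat; assumption).
  assert (H1 : ln (/ r) <= / r).
  { pose proof (exp_ineq1_le (ln (/ r))) as Q. rewrite exp_ln in Q by assumption. lra. }
  assert (H2 : 0 <= ln (/ r)).
  { rewrite <- ln_1. apply Rcomplements.ln_le; [lra|]. rewrite <- Rinv_1.
    apply Rinv_le_contravar; [assumption|]. nra. }
  rewrite El, Rabs_Ropp, Rabs_pos_eq by lra.
  rewrite <- Hrr. replace (2 * r) with (r * r * (2 * / r)) by (field; lra).
  apply Rmult_le_compat_l; nra.
Qed.

(** The derivative is available only for [s > 0], so the mean value inequality runs from [dl k] to
    [s], and [F (dl k)] tends to [0] by the [sqrt] bound. *)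
Lemma vanish_at_0_bound (F F' : R -> C) (K c S : R) (n : nat) :
  0 <= c -> (forall s, 0 < s -> Cder F s (F' s)) ->
  (forall s, 0 < s <= 1 -> Cmod (F s) <= K * sqrt s) ->
  (forall s, 0 < s <= S -> Cmod (F' s) <= c * s ^ n) ->
  forall s, 0 < s <= S -> Cmod (F s) <= 2 * c / INR (n + 1) * s ^ (n + 1).
Proof.
  intros Hc HD HK HB s Hs.
  assert (Hn : 0 < INR (n + 1)) by (apply lt_0_INR; lia).
  (* A square, so that its square root is visibly at most [1 / (k + 1)]. *)
  set (dl := fun k => (Rmin 1 s / INR (k + 1)) ^ 2 * / 1).
  assert (HK0 : 0 <= K).
  { specialize (HK 1 ltac:(lra)). rewrite sqrt_1 in HK. pose proof (Cmod_ge_0 (F 1)). lra. }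
  assert (Hm : 0 < Rmin 1 s) by (apply Rmin_pos; lra).
  assert (Hm1 : Rmin 1 s <= 1) by apply Rmin_l. assert (Hm2 : Rmin 1 s <= s) by apply Rmin_r.
  assert (Hdl : forall k, 0 < dl k /\ dl k <= s /\ dl k <= 1 /\ sqrt (dl k) <= 1 / INR (Datatypes.S k)).
  { intros k. unfold dl. rewrite Rinv_1, Rmult_1_r, Nat.add_1_r.
    assert (H1 : 1 <= INR (Datatypes.S k)) by (apply (le_INR 1); lia).
    set (w := INR (Datatypes.S k)) in *. set (m := Rmin 1 s) in *.
    assert (Hq : 0 < m / w) by (apply Rdiv_lt_0_compat; lra).
    assert (Hqm : m / w <= m).
    { apply Rmult_le_reg_r with w; [lra|]. unfold Rdiv. rewrite Rmult_assoc, Rinv_l by lra. nra. }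
    repeat split.
    - apply pow_lt; assumption.
    - nra.
    - nra.
    - rewrite sqrt_pow2 by lra. apply Rmult_le_compat_r; [left; apply Rinv_0_lt_compat; lra|lra]. }
  replace (Cmod (F s)) with (Cmod (0 - F s)) by (rewrite Cmod_minus_sym; f_equal; ring).
  apply (Clim_Cmod_le (fun k => F (dl k)) _ _ (fun _ => 2 * c / INR (n + 1) * s ^ (n + 1))).
  - apply Clim_squeeze with (fun k => K / INR (Datatypes.S k)); [|apply is_lim_seq_scal_inv_S].
    intros k. destruct (Hdl k) as (H1 & H2 & H3 & H4).
    replace (F (dl k) - 0)%C with (F (dl k)) by ring.
    eapply Rle_trans; [apply HK; lra|]. unfold Rdiv in *. rewrite Rmult_1_l in H4.
    apply Rmult_le_compat_l; assumption.
  - apply is_lim_seq_const.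
  - intros k. destruct (Hdl k) as (H1 & H2 & _ & _). rewrite Cmod_minus_sym.
    apply Rle_trans with (2 * (c / INR (n + 1) * s ^ (n + 1) - c / INR (n + 1) * dl k ^ (n + 1))).
    + apply (Cmvt_bound F F' (fun x => c / INR (n + 1) * x ^ (n + 1)) (fun x => c * x ^ n)); [assumption| | |].
      * intros x Hx. apply HD. lra.
      * intros x Hx. auto_derive; [exact I|]. rewrite Nat.add_1_r. cbn [Init.Nat.pred].
        rewrite Nat.add_1_r in Hn. field. lra.
      * intros x Hx. apply HB. lra.
    + assert (0 <= c / INR (n + 1) * dl k ^ (n + 1)).
      { apply Rmult_le_pos; [apply Rdiv_le_0_compat; lra|apply pow_le; lra]. }
      unfold Rdiv in *. lra.
Qed.

(** Iterating the system gives [|d s| <= B (4 |z| s)^n / (n!)^2] for every [n], the [4] being two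
    factors 2 of [vanish_at_0_bound]. The [O(sqrt s)] conditions exclude both the regular and the
    logarithmic solution. *)
Lemma bessel_ode_unique (d d1 : R -> C) (z : C) (K : R) :
  (forall s, 0 < s -> Cder d s (RtoC (/ s) * d1 s)%C) ->
  (forall s, 0 < s -> Cder d1 s (z * d s)%C) ->
  (forall s, 0 < s <= 1 -> Cmod (d s) <= K * sqrt s) ->
  (forall s, 0 < s <= 1 -> Cmod (d1 s) <= K * sqrt s) ->
  forall s, 0 < s -> d s = RtoC 0.
Proof.
  intros D0 D1 B0 B1 s0 Hs0.
  set (S := Rmax 1 s0).
  assert (HS1 : 1 <= S) by apply Rmax_l. assert (HSs : s0 <= S) by apply Rmax_r.
  assert (HK0 : 0 <= K).
  { specialize (B0 1 ltac:(lra)). rewrite sqrt_1 in B0. pose proof (Cmod_ge_0 (d 1)). lra. }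
  (* Start of the iteration: the [sqrt] bound up to [1] and compactness of [[1, S]] beyond. *)
  assert (Bd : exists B, 0 <= B /\ forall s, 0 < s <= S -> Cmod (d s) <= B).
  { assert (G : forall p : R -> R, (forall s, 0 < s -> continuous p s) ->
      exists B, forall s, 1 <= s <= S -> Rabs (p s) <= B).
    { intros p Hp. destruct (continuity_ab_maj (fun s => Rabs (p s)) 1 S HS1) as (m & Hm & _).
      - intros c Hc. apply continuity_pt_filterlim.
        apply (continuous_comp p Rabs); [apply Hp; lra|].
        apply continuity_pt_filterlim, Rcontinuity_abs.
      - exists (Rabs (p m)). auto. }
    destruct (G (fun s => fst (d s))) as [b1 H1].
    { intros s Hs. apply (Cder_Cct d s _ (D0 s Hs)). }
    destruct (G (fun s => snd (d s))) as [b2 H2].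
    { intros s Hs. apply (Cder_Cct d s _ (D0 s Hs)). }
    assert (P1 : 0 <= b1) by (eapply Rle_trans; [apply Rabs_pos|apply (H1 1); lra]).
    assert (P2 : 0 <= b2) by (eapply Rle_trans; [apply Rabs_pos|apply (H2 1); lra]).
    exists (K + (b1 + b2)). split; [lra|]. intros s Hs. destruct (Rle_dec s 1) as [H|H].
    - eapply Rle_trans; [apply B0; lra|].
      assert (sqrt s <= 1) by (rewrite <- sqrt_1; apply sqrt_le_1; lra).
      pose proof (sqrt_pos s). nra.
    - eapply Rle_trans; [apply Cmod_le_components|].
      specialize (H1 s ltac:(lra)). specialize (H2 s ltac:(lra)). lra. }
  destruct Bd as (B & HB & Bd).
  pose proof (Cmod_ge_0 z) as Hz.
  assert (It : forall n s, 0 < s <= S ->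
    Cmod (d s) <= B * (4 * Cmod z) ^ n / INR (fact n) ^ 2 * s ^ n).
  { induction n as [|n IH].
    - intros s Hs. simpl. specialize (Bd s Hs). lra.
    - set (c := B * (4 * Cmod z) ^ n / INR (fact n) ^ 2) in *.
      pose proof (INR_fact_lt_0 n) as Hf.
      assert (Hc : 0 <= c).
      { apply Rdiv_le_0_compat; [|apply pow_lt; assumption].
        apply Rmult_le_pos; [assumption|apply pow_le; lra]. }
      assert (Hn : 0 < INR (n + 1)) by (apply lt_0_INR; lia).
      assert (Hc2 : 0 <= 2 * (Cmod z * c) / INR (n + 1)) by (apply Rdiv_le_0_compat; nra).
      assert (I1 : forall s, 0 < s <= S ->
        Cmod (d1 s) <= 2 * (Cmod z * c) / INR (n + 1) * s ^ (n + 1)).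
      { apply (vanish_at_0_bound d1 (fun s => z * d s)%C K); auto; [nra|].
        intros s Hs. rewrite Cmod_mult, Rmult_assoc. apply Rmult_le_compat_l; auto. }
      assert (I2 : forall s, 0 < s <= S ->
        Cmod (d s) <= 2 * (2 * (Cmod z * c) / INR (n + 1)) / INR (n + 1) * s ^ (n + 1)).
      { apply (vanish_at_0_bound d (fun s => RtoC (/ s) * d1 s)%C K); auto.
        intros s Hs. assert (Hsi : 0 < / s) by (apply Rinv_0_lt_compat; lra).
        rewrite Cmod_RtoC_mult by lra. specialize (I1 s Hs).
        rewrite pow_add, pow_1 in I1.
        apply Rmult_le_reg_l with s; [lra|]. rewrite <- Rmult_assoc, Rinv_r by lra. lra. }
      intros s Hs. eapply Rle_trans; [apply I2; assumption|]. right.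
      rewrite Nat.add_1_r in *. unfold c. rewrite fact_simpl, mult_INR. cbn [pow].
      generalize ((4 * Cmod z) ^ n) (s ^ n). intros p q. field. lra. }
  apply Cmod_eq_0. apply Rle_antisym; [|apply Cmod_ge_0].
  apply (is_lim_seq_le (fun _ => Cmod (d s0))
    (fun n => B * ((4 * Cmod z * s0) ^ n / INR (fact n))) (Cmod (d s0)) 0).
  - intros n. eapply Rle_trans; [apply (It n s0); lra|].
    destruct (fact_ge_n n) as [_ Hf].
    replace (B * (4 * Cmod z) ^ n / INR (fact n) ^ 2 * s0 ^ n) with
      (B * ((4 * Cmod z * s0) ^ n / INR (fact n)) * / INR (fact n))
      by (rewrite Rpow_mult_distr; field; lra).
    rewrite <- (Rmult_1_r (B * _)) at 2. apply Rmult_le_compat_l.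
    + apply Rmult_le_pos; [assumption|]. apply Rdiv_le_0_compat; [apply pow_le; nra|lra].
    + rewrite <- Rinv_1. apply Rinv_le_contravar; lra.
  - apply is_lim_seq_const.
  - replace 0 with (B * 0) by ring. apply (is_lim_seq_scal_l _ B 0).
    apply is_lim_seq_Reals, cv_speed_pow_fact.
Qed.

(** * [Jint 1] in terms of a logarithm and two power series *)

Definition Cpser (a : nat -> R) (z : C) : C :=
  (Series (fun k => a k * fst (z ^ k)%C), Series (fun k => a k * snd (z ^ k)%C)).

Lemma CP_1_Cpser (a : nat -> R) (z : C) : CP (fun k => RtoC (a k) * z ^ k)%C 1 = Cpser a z.
Proof.
  unfold CP, Cpser, PSeries. f_equal; apply Series_ext; intros k; simpl; rewrite pow1; ring.
Qed.

(** [W] is the classical logarithmic solution. Along [s be] it solves the same system as [Jint 1]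
    and agrees with it at [0] up to [O(sqrt s)], so both coincide; the claim is the case [s = 1]. *)
Lemma Jint_1_series (al be : C) : 0 < fst al -> 0 < fst be ->
  Jint 1 al be = (- (clog al + clog be + RtoC (2 * euler_gamma)) * Cpser coefI (al * be)
    + 2 * Cpser coefH (al * be))%C.
Proof.
  intros Ha Hb. set (z := (al * be)%C).
  set (Lm := (clog al + clog be + RtoC (2 * euler_gamma))%C).
  assert (ELm : Lm = (Vlim al + Vlim be)%C).
  { unfold Lm. rewrite !Vlim_clog by assumption. rewrite RtoC_mult. ring. }
  set (ci := fun k => (RtoC (coefI k) * z ^ k)%C). set (ch := fun k => (RtoC (coefH k) * z ^ k)%C).
  assert (Fi : fast ci 1 (Cmod z)) by (apply fast_coef, coefI_bound).
  assert (Fh : fast ch 1 (Cmod z)) by (apply fast_coef, coefH_bound).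
  pose proof (fast_theta _ _ _ Fi) as Fti. pose proof (fast_theta _ _ _ Fh) as Fth.
  set (W := fun s => (- (Lm + RtoC (ln s)) * CP ci s + 2 * CP ch s)%C).
  (* [W1] is [s W'], the second component of the system. *)
  set (W1 := fun s => (- (Lm + RtoC (ln s)) * CP (theta ci) s - CP ci s + 2 * CP (theta ch) s)%C).
  assert (Dln : forall s, 0 < s -> Cder (fun s => - (Lm + RtoC (ln s)))%C s (- RtoC (/ s))%C).
  { intros s Hs. eapply Cder_eq; [|apply Cder_ext with (fun s => RtoC (-1) * (Lm + RtoC (ln s)))%C;
      [intros; ring|apply Cder_scal, Cder_plus; [apply Cder_const|apply Cder_RtoC, is_derive_ln, Hs]]].
    ring. }
  assert (Es : forall s, 0 < s -> (RtoC (/ s) * RtoC s)%C = RtoC 1).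
  { intros s Hs. rewrite <- RtoC_mult. f_equal. field. lra. }
  assert (DW : forall s, 0 < s -> Cder W s (RtoC (/ s) * W1 s)%C).
  { intros s Hs. eapply Cder_eq; [|apply Cder_plus; [apply Cder_mult; [apply Dln, Hs|eapply CP_Cder, Fi]|
      apply Cder_scal; eapply CP_Cder, Fh]].
    unfold W1. rewrite !CP_theta.
    transitivity (- RtoC (/ s) * CP ci s + (RtoC (/ s) * RtoC s) * (- (Lm + RtoC (ln s)) * CP (CP_derive ci) s
      + 2 * CP (CP_derive ch) s))%C; [rewrite (Es s Hs)|]; ring. }
  assert (DW1 : forall s, 0 < s -> Cder W1 s (z * W s)%C).
  { intros s Hs. eapply Cder_eq; [|apply Cder_plus; [apply Cder_minus; [apply Cder_mult;
      [apply Dln, Hs|eapply CP_Cder, Fti]|eapply CP_Cder, Fi]|apply Cder_scal; eapply CP_Cder, Fth]].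
    rewrite (CP_ext (CP_derive (theta ci)) (fun k => z * ci k)%C) by apply coefI_theta.
    rewrite (CP_ext (CP_derive (theta ch)) (fun k => z * ch k + CP_derive ci k)%C) by apply coefH_theta.
    rewrite (CP_scal z ci 1 (Cmod z)) by assumption.
    assert (Fzh : fast (fun k => z * ch k)%C (Cmod z * 1) (Cmod z)).
    { destruct Fh as (h1 & h2 & h3). repeat split; [nra|assumption|]. intros k.
      rewrite Cmod_mult. unfold Rdiv. rewrite !Rmult_assoc. apply Rmult_le_compat_l; [assumption|].
      rewrite <- Rmult_assoc. apply h3. }
    rewrite (CP_plus _ _ _ _ _ _ s Fzh (fast_derive _ _ _ Fi)), (CP_scal z ch 1 (Cmod z)) by assumption.
    rewrite CP_theta. unfold W.
    (* The two terms [- F'], one from the derivative of the logarithm and one from [CP ci], are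
       offset by the [2 F'] of [coefH_theta]. *)
    transitivity (- (RtoC (/ s) * RtoC s) * CP (CP_derive ci) s + - (Lm + RtoC (ln s)) * (z * CP ci s)
      - CP (CP_derive ci) s + 2 * (z * CP ch s + CP (CP_derive ci) s))%C; [ring|].
    rewrite (Es s Hs). ring. }
  set (d := fun s => (Jint 1 al (RtoC s * be) - W s)%C).
  set (d1 := fun s => (RtoC (-1) * (al * Jint 0 al (RtoC s * be)) - W1 s)%C).
  set (Ki := 4 * (1 * Cmod z * exp (Cmod z))).
  set (Kt := 4 * (1 * Cmod z * (Cmod z + 1) * exp (Cmod z + 1))).
  pose proof (Cmod_ge_0 z) as Hz. pose proof (Cmod_ge_0 Lm) as HLm.
  assert (HKi : 0 <= Ki) by (unfold Ki; pose proof (exp_pos (Cmod z)); nra).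
  assert (HKt : 0 <= Kt).
  { unfold Kt. pose proof (exp_pos (Cmod z + 1)). repeat apply Rmult_le_pos; lra. }
  assert (LnB : forall s X, 0 < s <= 1 -> 0 <= X ->
    Cmod (Lm + RtoC (ln s)) * (X * s) <= X * (Cmod Lm + 2) * sqrt s).
  { intros s X Hs HX. pose proof (sqrt_ln_bound s Hs) as Q.
    pose proof (Cmod_triangle Lm (RtoC (ln s))) as T. rewrite Cmod_R in T.
    assert (Hss : s <= sqrt s).
    { rewrite <- (sqrt_sqrt s) at 1 by lra. pose proof (sqrt_pos s).
      assert (sqrt s <= 1) by (rewrite <- sqrt_1; apply sqrt_le_1; lra). nra. }
    apply Rle_trans with ((Cmod Lm + Rabs (ln s)) * (X * s)).
    - apply Rmult_le_compat_r; [nra|assumption].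
    - replace ((Cmod Lm + Rabs (ln s)) * (X * s)) with (X * (Cmod Lm * s + s * Rabs (ln s))) by ring.
      rewrite (Rmult_assoc X). apply Rmult_le_compat_l; [assumption|]. nra. }
  assert (Hss : forall s, 0 < s <= 1 -> s <= sqrt s).
  { intros s Hs. rewrite <- (sqrt_sqrt s) at 1 by lra. pose proof (sqrt_pos s).
    assert (sqrt s <= 1) by (rewrite <- sqrt_1; apply sqrt_le_1; lra). nra. }
  assert (ci0 : ci O = RtoC 1) by (unfold ci, coefI; simpl; apply C_ext; simpl; field).
  assert (ch0 : ch O = RtoC 0) by (unfold ch, coefH; simpl; apply C_ext; simpl; field).
  assert (ti0 : theta ci O = RtoC 0) by (unfold theta; simpl INR; ring).
  assert (th0 : theta ch O = RtoC 0) by (unfold theta; simpl INR; ring).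
  set (Kd := 8 * (Cmod al + Cmod be) + Ki * (Cmod Lm + 2) + 2 * Ki).
  set (Kd1 := (4 * Cmod al + 4 * Cmod al * Cmod be / fst al) + Kt * (Cmod Lm + 2) + Ki + 2 * Kt).
  assert (Bd : forall s, 0 < s <= 1 -> Cmod (d s) <= Kd * sqrt s).
  { intros s Hs. pose proof (Jint_1_small al be s Ha Hb ltac:(lra)) as J.
    pose proof (CP_near_0 ci _ _ s Fi ltac:(lra)) as N1. rewrite ci0 in N1. fold Ki in N1.
    pose proof (CP_near_0 ch _ _ s Fh ltac:(lra)) as N2. rewrite ch0 in N2. fold Ki in N2.
    replace (d s) with ((Jint 1 al (RtoC s * be) + RtoC (ln s) + Vlim al + Vlim be) +
      (Lm + RtoC (ln s)) * (CP ci s - 1) - 2 * (CP ch s - 0))%C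
      by (unfold d, W; rewrite ELm; ring).
    eapply Rle_trans; [apply Cmod_minus_le|]. 
    eapply Rle_trans; [apply Rplus_le_compat_r, Cmod_triangle|].
    rewrite Cmod_mult, Cmod_RtoC_mult by lra.
    assert (Q : Cmod (Lm + RtoC (ln s)) * Cmod (CP ci s - 1) <= Ki * (Cmod Lm + 2) * sqrt s).
    { eapply Rle_trans; [|apply LnB; assumption].
      apply Rmult_le_compat_l; [apply Cmod_ge_0|assumption]. }
    specialize (Hss s Hs). unfold Kd. rewrite !Rmult_plus_distr_r.
    assert (Ki * s <= Ki * sqrt s) by (apply Rmult_le_compat_l; lra). lra. }
  assert (Bd1 : forall s, 0 < s <= 1 -> Cmod (d1 s) <= Kd1 * sqrt s).
  { intros s Hs. pose proof (Jint_0_small al be s Ha Hb ltac:(lra)) as J.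
    pose proof (CP_near_0 ci _ _ s Fi ltac:(lra)) as N1. rewrite ci0 in N1. fold Ki in N1.
    pose proof (CP_near_0 (theta ci) _ _ s Fti ltac:(lra)) as N2. rewrite ti0 in N2. fold Kt in N2.
    pose proof (CP_near_0 (theta ch) _ _ s Fth ltac:(lra)) as N3. rewrite th0 in N3. fold Kt in N3.
    replace (d1 s) with (- (al * Jint 0 al (RtoC s * be) - 1) +
      (Lm + RtoC (ln s)) * (CP (theta ci) s - 0) + ((CP ci s - 1) - 2 * (CP (theta ch) s - 0)))%C
      by (unfold d1, W1; ring).
    eapply Rle_trans; [apply Cmod_triangle|].
    eapply Rle_trans; [apply Rplus_le_compat; [apply Cmod_triangle|apply Cmod_minus_le]|].
    rewrite Cmod_opp, Cmod_mult, Cmod_RtoC_mult by lra.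
    assert (Q : Cmod (Lm + RtoC (ln s)) * Cmod (CP (theta ci) s - 0) <= Kt * (Cmod Lm + 2) * sqrt s).
    { eapply Rle_trans; [|apply LnB; assumption].
      apply Rmult_le_compat_l; [apply Cmod_ge_0|assumption]. }
    specialize (Hss s Hs). unfold Kd1. rewrite !Rmult_plus_distr_r in *.
    assert (Ki * s <= Ki * sqrt s) by (apply Rmult_le_compat_l; lra).
    assert (Kt * s <= Kt * sqrt s) by (apply Rmult_le_compat_l; lra). lra. }
  assert (H0 : d 1 = RtoC 0).
  { apply (bessel_ode_unique d d1 z (Rmax Kd Kd1)); [| | | |lra].
    - intros s Hs. eapply Cder_eq; [|exact (Cder_minus _ _ _ _ _ (proj1 (Jint_ode al be s Ha Hb Hs)) (DW s Hs))].
      unfold d1. ring.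
    - intros s Hs. eapply Cder_eq; [|exact (Cder_minus _ _ _ _ _ (Cder_scal (RtoC (-1)) _ _ _
        (proj2 (Jint_ode al be s Ha Hb Hs))) (DW1 s Hs))].
      unfold d, z. ring.
    - intros s Hs. eapply Rle_trans; [apply Bd, Hs|].
      apply Rmult_le_compat_r; [apply sqrt_pos|apply Rmax_l].
    - intros s Hs. eapply Rle_trans; [apply Bd1, Hs|].
      apply Rmult_le_compat_r; [apply sqrt_pos|apply Rmax_r]. }
  unfold d, W in H0. rewrite ln_1, Cmult_1_l in H0. unfold ci, ch in H0. rewrite !CP_1_Cpser in H0.
  transitivity ((Jint 1 al be - (- (Lm + 0) * Cpser coefI z + 2 * Cpser coefH z)) +
    (- Lm * Cpser coefI z + 2 * Cpser coefH z))%C; [ring|]. rewrite H0. ring.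
Qed.

(** * Uniform bounds for the Bessel transform *)

Lemma C_neq_0_fst (z : C) : 0 < fst z -> z <> RtoC 0.
Proof. intros H E. rewrite E in H. simpl in H. lra. Qed.

Lemma Cmod_kf_0_le_1 (al be : C) (y : R) : 0 <= fst al -> 0 <= fst be -> Cmod (kf 0 al be y) <= 1.
Proof.
  intros Ha Hb. destruct (Rle_dec y 0) as [H|H].
  - rewrite kf_nonpos, Cmod_0 by assumption. lra.
  - rewrite Cmod_kf by lra. rewrite pow_O, Rinv_1, Rmult_1_r, <- exp_0. apply exp_le.
    assert (0 < / y) by (apply Rinv_0_lt_compat; lra). nra.
Qed.

(* Splits 1/y into parts that become integrable after one integration by parts against
   exp(-al y) near infinity, respectively exp(-be/y) near 0. *)
Lemma Jint_1_bound (al be : C) : 0 < fst al -> 0 < fst be ->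
  Cmod (Jint 1 al be) <= 4 * (2 + Cmod al / Cmod be + Cmod be / Cmod al + 3 / Cmod al + 3 / Cmod be).
Proof.
  intros Ha Hb.
  pose proof (C_neq_0_fst al Ha) as Na. pose proof (C_neq_0_fst be Hb) as Nb.
  assert (Ga : 0 < Cmod al) by (apply Cmod_gt_0; assumption).
  assert (Gb : 0 < Cmod be) by (apply Cmod_gt_0; assumption).
  set (p1 := fun y => y / (1 + y ^ 2) ^ 2). set (p3 := fun y => y ^ 3 / (1 + y ^ 2) ^ 2).
  set (q1 := fun y => (1 - 3 * y ^ 2) / (1 + y ^ 2) ^ 3).
  set (q3 := fun y => (3 * y ^ 2 - y ^ 4) / (1 + y ^ 2) ^ 3).
  assert (Hden : forall y, 0 < 1 + y ^ 2) by (intros y; pose proof (pow2_ge_0 y); lra).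
  assert (Dp1 : forall y, is_derive p1 y (q1 y)).
  { intros y. specialize (Hden y). unfold p1, q1. auto_derive.
    - apply Rgt_not_eq. simpl in *. nra.
    - field. simpl in *. lra. }
  assert (Dp3 : forall y, is_derive p3 y (q3 y)).
  { intros y. specialize (Hden y). unfold p3, q3. auto_derive.
    - apply Rgt_not_eq. simpl in *. nra.
    - field. simpl in *. lra. }
  (* One has [1/y = 2 p1 + p3 + p1 / y^2] and [p1 = p3 / y^2]. Multiplying [P] by the derivative of
     [kf 0] produces [p3 + p1 / y^2] up to a multiple of [p1], so what remains is [kf 0] times the
     integrable function [m]. *)
  set (P := fun y => (- / al * RtoC (p3 y) + / be * RtoC (p1 y))%C).
  set (Q := fun y => (- / al * RtoC (q3 y) + / be * RtoC (q1 y))%C).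
  assert (DP : forall y, Cder P y (Q y)).
  { intros y. apply Cder_plus; apply Cder_scal, Cder_RtoC; auto. }
  set (m := fun y => ((2 + al / be + be / al) * RtoC (p1 y) - Q y)%C).
  set (k0 := kf 0 al be). set (k1 := kf 1 al be).
  destruct (kf_dominated 0 (fst al) (fst be) Ha Hb) as (M0 & HM0 & D0).
  destruct (kf_dominated 1 (fst al) (fst be) Ha Hb) as (M1 & HM1 & D1).
  specialize (D0 al be (Rle_refl _) (Rle_refl _)). specialize (D1 al be (Rle_refl _) (Rle_refl _)).
  fold k0 in D0. fold k1 in D1.
  assert (DG : forall y, Cder (fun y => k0 y * P y)%C y (k1 y + RtoC (-1) * (k0 y * m y))%C).
  { intros y. eapply Cder_eq; [|apply Cder_mult; [apply kf_derive; assumption|apply DP]].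
    fold k0. simpl Nat.add. simpl INR. unfold k1. destruct (Rle_dec y 0) as [Hy|Hy].
    - unfold k0. rewrite !kf_nonpos by assumption. ring.
    - assert (Hy' : 0 < y) by lra. specialize (Hden y).
      unfold k0. rewrite !kf_pos by assumption. rewrite pow_O, Rinv_1.
      set (E := cexp _).
      assert (E2 : RtoC (/ y ^ 1) = (2 * RtoC (p1 y) + RtoC (p3 y) + RtoC (/ y ^ 2) * RtoC (p1 y))%C).
      { rewrite <- !RtoC_mult, <- !RtoC_plus. f_equal. unfold p1, p3. field. split; simpl in *; lra. }
      assert (E3 : RtoC (p1 y) = (RtoC (/ y ^ 2) * RtoC (p3 y))%C).
      { rewrite <- !RtoC_mult. f_equal. unfold p1, p3. field. split; simpl in *; lra. }
      unfold m, P. rewrite E2.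
      transitivity (E * (((al * / al) * RtoC (p3 y) - al / be * RtoC (p1 y)) +
        (- (be / al) * (RtoC (/ y ^ 2) * RtoC (p3 y)) + (be * / be) * (RtoC (/ y ^ 2) * RtoC (p1 y))) + Q y))%C.
      + unfold Cdiv. ring.
      + rewrite <- E3. rewrite !Cinv_r by assumption. ring. }
  set (c := 2 + Cmod al / Cmod be + Cmod be / Cmod al + 3 / Cmod al + 3 / Cmod be).
  assert (Hab : 0 < Cmod al / Cmod be) by (apply Rdiv_lt_0_compat; assumption).
  assert (Hba : 0 < Cmod be / Cmod al) by (apply Rdiv_lt_0_compat; assumption).
  assert (Hia : 0 < / Cmod al) by (apply Rinv_0_lt_compat; assumption).
  assert (Hib : 0 < / Cmod be) by (apply Rinv_0_lt_compat; assumption).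
  assert (Bp1 : forall y, 0 <= y -> Rabs (p1 y) <= / (1 + y ^ 2)).
  { intros y Hy. specialize (Hden y). unfold p1.
    rewrite Rabs_pos_eq by (apply Rdiv_le_0_compat; [lra|apply pow_lt; lra]).
    apply Rmult_le_reg_r with ((1 + y ^ 2) ^ 2); [apply pow_lt; lra|].
    replace (y / (1 + y ^ 2) ^ 2 * (1 + y ^ 2) ^ 2) with y by (field; simpl in *; lra).
    replace (/ (1 + y ^ 2) * (1 + y ^ 2) ^ 2) with (1 + y ^ 2) by (field; simpl in *; lra). nra. }
  assert (Bq : forall u y, Rabs u <= 3 * (1 + y ^ 2) ^ 2 -> Rabs (u / (1 + y ^ 2) ^ 3) <= 3 * / (1 + y ^ 2)).
  { intros u y Hu. specialize (Hden y). unfold Rdiv. rewrite Rabs_mult, Rabs_inv.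
    rewrite (Rabs_pos_eq (_ ^ 3)) by (apply pow_le; lra).
    apply Rmult_le_reg_r with ((1 + y ^ 2) ^ 3); [apply pow_lt; lra|].
    rewrite Rmult_assoc, Rinv_l by (apply pow_nonzero; lra).
    replace (3 * / (1 + y ^ 2) * (1 + y ^ 2) ^ 3) with (3 * (1 + y ^ 2) ^ 2) by (field; simpl in *; lra). lra. }
  assert (Bq1 : forall y, Rabs (q1 y) <= 3 * / (1 + y ^ 2)).
  { intros y. apply Bq. specialize (Hden y). apply Rabs_le. nra. }
  assert (Bq3 : forall y, Rabs (q3 y) <= 3 * / (1 + y ^ 2)).
  { intros y. apply Bq. specialize (Hden y). apply Rabs_le. nra. }
  assert (Bm : forall y, 0 <= y -> Cmod (m y) <= c * / (1 + y ^ 2)).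
  { intros y Hy. unfold m, Q. eapply Rle_trans; [apply Cmod_minus_le|].
    rewrite Cmod_mult, Cmod_R.
    assert (T1 : Cmod (2 + al / be + be / al) <= 2 + Cmod al / Cmod be + Cmod be / Cmod al).
    { eapply Rle_trans; [apply Cmod_triangle|]. rewrite Cmod_div by assumption.
      apply Rplus_le_compat_r. eapply Rle_trans; [apply Cmod_triangle|].
      rewrite Cmod_div, Cmod_R, Rabs_pos_eq by (assumption || lra). lra. }
    assert (T2 : Cmod (- / al * RtoC (q3 y) + / be * RtoC (q1 y)) <=
      / Cmod al * (3 * / (1 + y ^ 2)) + / Cmod be * (3 * / (1 + y ^ 2))).
    { eapply Rle_trans; [apply Cmod_triangle|].
      rewrite !Cmod_mult, Cmod_opp, !Cmod_inv, !Cmod_R by assumption.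
      apply Rplus_le_compat; apply Rmult_le_compat_l; auto; lra. }
    specialize (Bp1 y Hy). specialize (Hden y).
    assert (T3 : Cmod (2 + al / be + be / al) * Rabs (p1 y) <=
      (2 + Cmod al / Cmod be + Cmod be / Cmod al) * / (1 + y ^ 2)).
    { apply Rmult_le_compat; [apply Cmod_ge_0|apply Rabs_pos|assumption|assumption]. }
    unfold c, Rdiv in *. lra. }
  assert (Hc : 0 <= c) by (unfold c, Rdiv in *; lra).
  assert (Dm : dominated (fun y => k0 y * m y)%C (2 * c)).
  { split.
    - intros y. apply Cct_mult; [apply D0|]. apply Cct_minus.
      + apply Cct_mult; [apply Cct_const|eapply Cct_RtoC, continuous_derive, Dp1].
      + apply Cct_plus; (apply Cct_mult; [apply Cct_const|]); apply Cct_RtoC.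
        * apply (ex_derive_continuous (V := R_NormedModule)). unfold q3. auto_derive.
          specialize (Hden y). apply Rgt_not_eq. simpl in *. apply Rmult_lt_0_compat; nra.
        * apply (ex_derive_continuous (V := R_NormedModule)). unfold q1. auto_derive.
          specialize (Hden y). apply Rgt_not_eq. simpl in *. apply Rmult_lt_0_compat; nra.
    - intros y Hy. rewrite Cmod_mult.
      apply Rle_trans with (1 * (c * / (1 + y ^ 2))).
      + apply Rmult_le_compat; [apply Cmod_ge_0|apply Cmod_ge_0|apply Cmod_kf_0_le_1; lra|auto].
      + specialize (Hden y). rewrite Rmult_1_l.
        apply Rmult_le_reg_r with ((1 + y) ^ 2 * (1 + y ^ 2)); [apply Rmult_lt_0_compat; nra|].
        replace (c * / (1 + y ^ 2) * ((1 + y) ^ 2 * (1 + y ^ 2))) with (c * (1 + y) ^ 2)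
          by (field; simpl in *; lra).
        replace (2 * c / (1 + y) ^ 2 * ((1 + y) ^ 2 * (1 + y ^ 2))) with (c * (2 * (1 + y ^ 2)))
          by (field; simpl in *; lra).
        apply Rmult_le_compat_l; [assumption|]. pose proof (pow2_ge_0 (1 - y)). lra. }
  assert (Dkp : dominated (fun y => k0 y * P y)%C (M0 * (/ Cmod al + / Cmod be))).
  { split.
    - intros y. apply Cct_mult; [apply D0|eapply Cder_Cct, DP].
    - intros y Hy. rewrite Cmod_mult.
      replace (M0 * (/ Cmod al + / Cmod be) / (1 + y) ^ 2) with
        (M0 / (1 + y) ^ 2 * (/ Cmod al + / Cmod be)) by (unfold Rdiv; ring).
      apply Rmult_le_compat; [apply Cmod_ge_0|apply Cmod_ge_0|apply D0, Hy|].
      unfold P. eapply Rle_trans; [apply Cmod_triangle|].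
      rewrite !Cmod_mult, Cmod_opp, !Cmod_inv, !Cmod_R by assumption.
      specialize (Hden y).
      assert (Rabs (p3 y) <= 1).
      { unfold p3. rewrite Rabs_pos_eq by (apply Rdiv_le_0_compat; [apply pow_le|apply pow_lt]; lra).
        apply Rmult_le_reg_r with ((1 + y ^ 2) ^ 2); [apply pow_lt; lra|].
        replace (y ^ 3 / (1 + y ^ 2) ^ 2 * (1 + y ^ 2) ^ 2) with (y ^ 2 * y) by (field; simpl in *; lra).
        assert (y <= 1 + y ^ 2) by nra. nra. }
      assert (Rabs (p1 y) <= 1).
      { eapply Rle_trans; [apply Bp1, Hy|]. rewrite <- Rinv_1. apply Rinv_le_contravar; nra. }
      pose proof (Rabs_pos (p3 y)). pose proof (Rabs_pos (p1 y)).
      apply Rplus_le_compat; rewrite <- (Rmult_1_r (/ _)) at 2; apply Rmult_le_compat_l; lra. }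
  assert (E : Cint0oo (fun y => k1 y + RtoC (-1) * (k0 y * m y))%C = RtoC 0).
  { rewrite (Cint0oo_derivative (fun y => k0 y * P y)%C _ (M1 + Cmod (RtoC (-1)) * (2 * c)) _ Dkp); auto.
    - unfold k0. rewrite kf_nonpos by lra. ring.
    - apply dominated_plus; [exact D1|apply dominated_scal, Dm]. }
  rewrite (Cint0oo_plus _ _ _ _ D1 (dominated_scal (RtoC (-1)) _ _ Dm)), (Cint0oo_scal _ _ _ Dm) in E.
  unfold Jint. fold k1.
  replace (Cint0oo k1) with (Cint0oo (fun y => k0 y * m y)%C).
  - replace (4 * c) with (2 * (2 * c)) by ring. apply Cint0oo_bound, Dm.
  - transitivity (Cint0oo (fun y => k0 y * m y)%C + (Cint0oo k1 +
      RtoC (-1) * Cint0oo (fun y => k0 y * m y)%C))%C; [rewrite E|]; ring.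
Qed.

(** Away from [0] each of the five terms of [Jint_1_bound] is at most a constant times [|al| |be|].
    The bound is crude but does not involve the real parts. *)
Lemma Jint_1_bound_product (dl : R) : 0 < dl -> exists K, 0 < K /\ forall al be,
  0 < fst al -> 0 < fst be -> dl <= Cmod al -> dl <= Cmod be ->
  Cmod (Jint 1 al be) <= K * (Cmod al * Cmod be).
Proof.
  intros Hd. set (i := / dl).
  assert (Hi : 0 < i) by (apply Rinv_0_lt_compat; assumption).
  assert (Hdi : dl * i = 1) by (unfold i; field; lra).
  exists (4 * (4 * i ^ 2 + 6 * i ^ 3)). split; [pose proof (pow_lt i 2 Hi); pose proof (pow_lt i 3 Hi); lra|].
  intros al be Ha Hb Da Db. eapply Rle_trans; [apply Jint_1_bound; assumption|].
  set (x := Cmod al) in *. set (y := Cmod be) in *.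
  assert (Hix : / x <= i) by (apply Rinv_le_contravar; lra).
  assert (Hiy : / y <= i) by (apply Rinv_le_contravar; lra).
  assert (Px : 0 < / x) by (apply Rinv_0_lt_compat; lra).
  assert (Py : 0 < / y) by (apply Rinv_0_lt_compat; lra).
  assert (Ux : 1 <= i * x) by nra. assert (Uy : 1 <= i * y) by nra.
  assert (H1 : 1 <= i ^ 2 * (x * y)).
  { replace (i ^ 2 * (x * y)) with ((i * x) * (i * y)) by ring. nra. }
  assert (H2 : x / y <= i ^ 2 * (x * y)).
  { unfold Rdiv. replace (i ^ 2 * (x * y)) with (x * (i * (i * y))) by ring.
    apply Rmult_le_compat_l; [lra|]. nra. }
  assert (H3 : y / x <= i ^ 2 * (x * y)).
  { unfold Rdiv. replace (i ^ 2 * (x * y)) with (y * (i * (i * x))) by ring.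
    apply Rmult_le_compat_l; [lra|]. nra. }
  assert (H4 : / x <= i ^ 3 * (x * y)).
  { replace (i ^ 3 * (x * y)) with (i * (i ^ 2 * (x * y))) by ring. nra. }
  assert (H5 : / y <= i ^ 3 * (x * y)).
  { replace (i ^ 3 * (x * y)) with (i * (i ^ 2 * (x * y))) by ring. nra. }
  unfold Rdiv in *. lra.
Qed.

(** * Test functions and the Bessel operator *)

Definition test_family (A B : R) (G : nat -> R -> C) : Prop :=
  (forall n x, Cder (G n) x (G (S n) x)) /\ (forall n x, x <= A \/ B <= x -> G n x = RtoC 0).

(** The [n]-th derivative of [x g'' + g']; all [n] are included so that the operator can be iterated
    on a family of derivatives. *)
Definition bessel_op (G : nat -> R -> C) (n : nat) (x : R) : C :=
  (RtoC x * G (n + 2)%nat x + RtoC (INR (n + 1)) * G (n + 1)%nat x)%C.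

Lemma test_family_bessel_op (A B : R) (G : nat -> R -> C) :
  test_family A B G -> test_family A B (bessel_op G).
Proof.
  intros [HD HZ]. split.
  - intros n x. unfold bessel_op.
    eapply Cder_eq; [|apply Cder_plus; [apply Cder_mult; [apply Cder_RtoC, (is_derive_id (K := R_AbsRing))|apply HD]|
      apply Cder_scal, HD]].
    change (@one R_AbsRing) with 1.
    replace (S n + 2)%nat with (S (n + 2)) by lia. replace (S n + 1)%nat with (n + 2)%nat by lia.
    replace (S (n + 1)) with (n + 2)%nat by lia.
    replace (INR (n + 2)) with (INR (n + 1) + 1) by (rewrite !plus_INR; simpl; ring).
    rewrite RtoC_plus. ring.
  - intros n x Hx. unfold bessel_op. rewrite !HZ by assumption. ring.
Qed.

Definition bessel_transform (A B : R) (g : R -> C) (al be : C) : C :=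
  CInt (fun t => g t * Jint 1 al (RtoC t * be))%C A B.

Lemma Jint_cct (al be : C) (t : R) : 0 < fst al -> 0 < fst be -> 0 < t ->
  Cct (fun t => Jint 1 al (RtoC t * be)) t.
Proof. intros. eapply Cder_Cct, Jint_derive; assumption. Qed.

(** The operator [d/dt (t d/dt)] is formally self-adjoint, with eigenfunction [Jint 1 al (t be)] of
    eigenvalue [al be]; the boundary terms vanish at [A] and [B]. *)
Lemma bessel_transform_op (A B : R) (G : nat -> R -> C) (al be : C) :
  0 < A <= B -> test_family A B G -> 0 < fst al -> 0 < fst be ->
  bessel_transform A B (bessel_op G O) al be = (al * be * bessel_transform A B (G O) al be)%C.
Proof.
  intros HAB [HD HZ] Ha Hb. unfold bessel_transform.
  set (u := fun t => Jint 1 al (RtoC t * be)).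
  set (u1 := fun t => (RtoC (-1) * (al * Jint 0 al (RtoC t * be)))%C).
  set (H := fun t => (u1 t * G O t - u t * (RtoC t * G 1%nat t))%C).
  assert (Du : forall t, A <= t <= B -> Cder u t (RtoC (/ t) * u1 t)%C).
  { intros t Ht. eapply Cder_eq; [|exact (proj1 (Jint_ode al be t Ha Hb ltac:(lra)))].
    unfold u1. ring. }
  assert (Du1 : forall t, A <= t <= B -> Cder u1 t (al * be * u t)%C).
  { intros t Ht. eapply Cder_eq; [|exact (Cder_scal (RtoC (-1)) _ _ _ (proj2 (Jint_ode al be t Ha Hb ltac:(lra))))].
    unfold u. ring. }
  assert (CG : forall n t, Cct (G n) t) by (intros; eapply Cder_Cct, HD).
  assert (Cu : forall t, A <= t <= B -> Cct u t) by (intros; eapply Cder_Cct, Du; assumption).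
  assert (C1 : forall t, A <= t <= B -> Cct (fun t => al * be * (G O t * u t))%C t).
  { intros t Ht. apply Cct_mult; [apply Cct_const|]. apply Cct_mult; auto. }
  assert (C2 : forall t, A <= t <= B -> Cct (fun t => bessel_op G O t * u t)%C t).
  { intros t Ht. apply Cct_mult; auto. unfold bessel_op. apply Cct_plus.
    - apply Cct_mult; [apply Cct_RtoC, continuous_id|auto].
    - apply Cct_mult; [apply Cct_const|auto]. }
  assert (F : CInt (fun t => al * be * (G O t * u t) - bessel_op G O t * u t)%C A B = (H B - H A)%C).
  { apply CInt_FTC; [lra| |].
    - intros t Ht. unfold H.
      eapply Cder_eq; [|apply Cder_minus; [apply Cder_mult; [apply Du1, Ht|apply HD]|
        apply Cder_mult; [apply Du, Ht|apply Cder_mult; [apply Cder_RtoC, (is_derive_id (K := R_AbsRing))|apply HD]]]].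
      change (@one R_AbsRing) with 1. unfold bessel_op. simpl Nat.add. simpl INR.
      assert (E : (RtoC (/ t) * RtoC t)%C = RtoC 1) by (rewrite <- RtoC_mult; f_equal; field; lra).
      transitivity (al * be * u t * G O t + u1 t * G 1%nat t - ((RtoC (/ t) * RtoC t) * (u1 t * G 1%nat t)
        + u t * (1 * G 1%nat t + RtoC t * G 2%nat t)))%C; [ring|]. rewrite E. ring.
    - intros t Ht. apply Cct_minus; auto. }
  assert (HB : H B = RtoC 0) by (unfold H; rewrite !HZ by lra; ring).
  assert (HA : H A = RtoC 0) by (unfold H; rewrite !HZ by lra; ring).
  rewrite HA, HB in F.
  rewrite (CInt_minus (fun t => al * be * (G O t * u t))%C (fun t => bessel_op G O t * u t)%C) in F;
    [|lra|assumption|assumption].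
  rewrite (CInt_scal (al * be) (fun t => G O t * u t)%C) in F; [|lra|intros; apply Cct_mult; auto].
  change (CInt (fun t => bessel_op G O t * u t)%C A B = (al * be * CInt (fun t => G O t * u t)%C A B)%C).
  transitivity (al * be * CInt (fun t => G O t * u t)%C A B - (al * be * CInt (fun t => G O t * u t)%C A B
    - CInt (fun t => bessel_op G O t * u t)%C A B))%C; [ring|]. rewrite F. ring.
Qed.

Lemma Cct_bounded (f : R -> C) (A B : R) : A <= B -> (forall x, A <= x <= B -> Cct f x) ->
  exists K, 0 <= K /\ forall x, A <= x <= B -> Cmod (f x) <= K.
Proof.
  intros HAB Hf.
  assert (G : forall p : R -> R, (forall s, A <= s <= B -> continuous p s) ->
      exists K, forall s, A <= s <= B -> Rabs (p s) <= K).
  { intros p Hp. destruct (continuity_ab_maj (fun s => Rabs (p s)) A B HAB) as (m & Hm & _).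
    - intros c Hc. apply continuity_pt_filterlim.
      apply (continuous_comp p Rabs); [apply Hp; lra|].
      apply continuity_pt_filterlim, Rcontinuity_abs.
    - exists (Rabs (p m)). auto. }
  destruct (G (fun s => fst (f s))) as [b1 H1]; [intros; apply Hf; assumption|].
  destruct (G (fun s => snd (f s))) as [b2 H2]; [intros; apply Hf; assumption|].
  exists (b1 + b2). split.
  - specialize (H1 A ltac:(lra)). specialize (H2 A ltac:(lra)).
    pose proof (Rabs_pos (fst (f A))). pose proof (Rabs_pos (snd (f A))). lra.
  - intros x Hx. eapply Rle_trans; [apply Cmod_le_components|].
    specialize (H1 x Hx). specialize (H2 x Hx). lra.
Qed.

(* Four applications of the Bessel operator gain (al be)^-4 on the crude bound Jint_1_bound_product. *)
Lemma bessel_transform_bound (A B : R) (G : nat -> R -> C) (dl : R) :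
  0 < A <= B -> test_family A B G -> 0 < dl ->
  exists K, 0 <= K /\ forall al be, 0 < fst al -> 0 < fst be -> dl <= Cmod al -> dl <= Cmod be ->
  Cmod (bessel_transform A B (G O) al be) <= K / (Cmod al * Cmod be) ^ 3.
Proof.
  intros HAB HG Hd.
  set (G4 := bessel_op (bessel_op (bessel_op (bessel_op G)))).
  pose proof (test_family_bessel_op A B G HG) as T1.
  pose proof (test_family_bessel_op A B _ T1) as T2.
  pose proof (test_family_bessel_op A B _ T2) as T3.
  pose proof (test_family_bessel_op A B _ T3) as T4. fold G4 in T4.
  assert (C4 : forall x, Cct (G4 O) x) by (intros; eapply Cder_Cct, T4).
  destruct (Cct_bounded (G4 O) A B ltac:(lra) (fun x _ => C4 x)) as (Kg & HKg & BG).
  (* The second argument of [Jint 1] is [t be] with [t >= A]. *)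
  destruct (Jint_1_bound_product (Rmin dl (A * dl))) as (Kj & HKj & BJ).
  { apply Rmin_pos; nra. }
  exists (2 * (Kg * (Kj * B)) * (B - A)). split.
  { apply Rmult_le_pos; [|lra]. apply Rmult_le_pos; [lra|]. apply Rmult_le_pos; [lra|nra]. }
  intros al be Ha Hb Da Db.
  assert (E : bessel_transform A B (G4 O) al be =
    ((al * be) ^ 4 * bessel_transform A B (G O) al be)%C).
  { unfold G4. rewrite !bessel_transform_op by assumption. ring. }
  set (w := Cmod al * Cmod be).
  assert (Hw : 0 < w) by (unfold w; apply Rmult_lt_0_compat; lra).
  assert (B4 : Cmod (bessel_transform A B (G4 O) al be) <= 2 * (Kg * (Kj * B * w)) * (B - A)).
  { apply CInt_bound_const; [lra| |].
    - intros t Ht. apply Cct_mult; [apply C4|apply Jint_cct; lra].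
    - intros t Ht. rewrite Cmod_mult. apply Rmult_le_compat; [apply Cmod_ge_0|apply Cmod_ge_0|auto|].
      assert (Et : Cmod (RtoC t * be) = t * Cmod be) by (apply Cmod_RtoC_mult; lra).
      eapply Rle_trans; [apply BJ; [assumption|simpl; nra| |]|].
      + eapply Rle_trans; [apply Rmin_l|assumption].
      + eapply Rle_trans; [apply Rmin_r|]. rewrite Et. apply Rmult_le_compat; lra.
      + rewrite Et. unfold w. 
        replace (Kj * (Cmod al * (t * Cmod be))) with (Kj * (Cmod al * Cmod be) * t) by ring.
        replace (Kj * B * (Cmod al * Cmod be)) with (Kj * (Cmod al * Cmod be) * B) by ring.
        apply Rmult_le_compat_l; [|lra]. fold w. nra. }
  rewrite E, Cmod_mult, Cmod_pow, Cmod_mult in B4. fold w in B4.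
  apply Rmult_le_reg_r with (w ^ 4); [apply pow_lt; assumption|].
  replace (2 * (Kg * (Kj * B)) * (B - A) / w ^ 3 * w ^ 4) with (2 * (Kg * (Kj * B * w)) * (B - A))
    by (field; lra). lra.
Qed.

(** * Bessel functions as boundary values *)

Lemma pow_diff_bound (z w : C) (r : R) (k : nat) : Cmod z <= r -> Cmod w <= r ->
  Cmod (z ^ k - w ^ k) <= INR k * r ^ (k - 1) * Cmod (z - w).
Proof.
  intros Hz Hw. assert (Hr : 0 <= r) by (eapply Rle_trans; [apply Cmod_ge_0|exact Hz]).
  induction k as [|k IH].
  - simpl. replace (1 - 1)%C with (RtoC 0) by ring. rewrite Cmod_0. lra.
  - cbn [Cpow]. replace (z * z ^ k - w * w ^ k)%C with (z * (z ^ k - w ^ k) + (z - w) * w ^ k)%C by ring.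
    eapply Rle_trans; [apply Cmod_triangle|]. rewrite !Cmod_mult, Cmod_pow.
    assert (H1 : Cmod w ^ k <= r ^ k) by (apply pow_incr; split; [apply Cmod_ge_0|assumption]).
    assert (H2 : Cmod z * Cmod (z ^ k - w ^ k) <= INR k * r ^ k * Cmod (z - w)).
    { apply Rle_trans with (r * (INR k * r ^ (k - 1) * Cmod (z - w))).
      - apply Rmult_le_compat; [apply Cmod_ge_0|apply Cmod_ge_0|assumption|assumption].
      - destruct k as [|k]; [simpl; lra|]. right. replace (S k - 1)%nat with k by lia.
        cbn [pow]. ring. }
    replace (S k - 1)%nat with k by lia. rewrite S_INR.
    pose proof (Cmod_ge_0 (z - w)). nra.
Qed.

(** Termwise, [k r^(k - 1) <= (r + 1)^k] keeps the differences below the series of [exp (r + 1)]. *)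
Lemma Cpser_lipschitz (a : nat -> R) (r : R) (z w : C) :
  (forall k, Rabs (a k) <= / INR (fact k)) -> Cmod z <= r -> Cmod w <= r ->
  Cmod (Cpser a z - Cpser a w) <= 2 * exp (r + 1) * Cmod (z - w).
Proof.
  intros Ha Hz Hw. assert (Hr : 0 <= r) by (eapply Rle_trans; [apply Cmod_ge_0|exact Hz]).
  set (D := Cmod (z - w)). assert (HD : 0 <= D) by apply Cmod_ge_0.
  assert (Bnd : forall k, INR k * r ^ (k - 1) <= (r + 1) ^ k).
  { intros k. induction k as [|k IH]; [simpl; lra|].
    destruct k as [|k]; [simpl; lra|].
    replace (S (S k) - 1)%nat with (S k) by lia. replace (S k - 1)%nat with k in IH by lia.
    rewrite S_INR. cbn [pow] in *.
    assert (r * r ^ k <= (r + 1) * (r + 1) ^ k) by (apply (pow_incr r (r + 1) (S k)); lra). nra. }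
  assert (G : forall p : C -> R, (forall u, Rabs (p u) <= Cmod u) -> (forall u v, p (u - v)%C = p u - p v) ->
    Rabs (Series (fun k => a k * p (z ^ k)%C) - Series (fun k => a k * p (w ^ k)%C)) <= exp (r + 1) * D).
  { intros p Hp Hlin.
    assert (Ex : forall u, ex_series (fun k => a k * p (u ^ k)%C)).
    { intros u. apply (ex_series_le (V := R_CompleteNormedModule)) with (fun k => Cmod u ^ k / INR (fact k)).
      - intros k. unfold norm; simpl. unfold abs; simpl. rewrite Rabs_mult, Rmult_comm.
        apply Rmult_le_compat; [apply Rabs_pos|apply Rabs_pos| |apply Ha].
        rewrite <- Cmod_pow. apply Hp.
      - eexists. apply exp_series. }
    rewrite <- Series_minus by apply Ex.
    assert (Ex2 : ex_series (fun k => D * ((r + 1) ^ k / INR (fact k)))).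
    { apply (ex_series_scal (V := R_NormedModule) D). eexists; apply exp_series. }
    assert (B : forall k, Rabs (a k * p (z ^ k)%C - a k * p (w ^ k)%C) <= D * ((r + 1) ^ k / INR (fact k))).
    { intros k. rewrite <- Rmult_minus_distr_l, <- Hlin, Rabs_mult.
      replace (D * ((r + 1) ^ k / INR (fact k))) with (/ INR (fact k) * ((r + 1) ^ k * D)) by (unfold Rdiv; ring).
      apply Rmult_le_compat; [apply Rabs_pos|apply Rabs_pos|apply Ha|].
      eapply Rle_trans; [apply Hp|]. eapply Rle_trans; [apply (pow_diff_bound z w r); assumption|].
      apply Rmult_le_compat_r; [assumption|apply Bnd]. }
    eapply Rle_trans; [apply Series_Rabs|].
    - apply (ex_series_le (V := R_CompleteNormedModule)) with (2 := Ex2).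
      intros k. unfold norm; simpl. unfold abs; simpl. rewrite Rabs_Rabsolu. apply B.
    - rewrite <- (is_series_unique _ _ (exp_series (r + 1))), Rmult_comm, <- Series_scal_l.
      apply Series_le; [|assumption]. intros k. split; [apply Rabs_pos|apply B]. }
  eapply Rle_trans; [apply Cmod_le_components|].
  pose proof (G fst Cmod_fst (fun u v => eq_refl)). pose proof (G snd Cmod_snd (fun u v => eq_refl)).
  unfold Cpser. simpl fst; simpl snd. unfold Rminus in *. lra.
Qed.

Lemma clog_scal (t : R) (z : C) : 0 < t -> 0 < fst z -> clog (RtoC t * z) = (RtoC (ln t) + clog z)%C.
Proof.
  intros Ht Hz. apply C_ext; simpl.
  - replace ((t * fst z - 0 * snd z) * ((t * fst z - 0 * snd z) * 1) +
      (t * snd z + 0 * fst z) * ((t * snd z + 0 * fst z) * 1)) with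
      (t ^ 2 * (fst z ^ 2 + snd z ^ 2)) by ring.
    rewrite ln_mult, ln_pow; [|assumption|apply pow_lt; assumption|].
    + simpl. field.
    + pose proof (pow2_ge_0 (snd z)). assert (0 < fst z ^ 2) by (apply pow_lt; assumption). lra.
  - rewrite Rplus_0_l. f_equal. field. lra.
Qed.

(** The logarithms and the product [al be] are separate arguments, so that the expression remains
    meaningful, and continuous, when [al] and [be] become purely imaginary. *)
Definition bessel_kernel (lg z : C) (t : R) : C :=
  (- (lg + RtoC (ln t) + RtoC (2 * euler_gamma)) * Cpser coefI (RtoC t * z)
   + 2 * Cpser coefH (RtoC t * z))%C.

Lemma Jint_1_kernel (al be : C) (t : R) : 0 < fst al -> 0 < fst be -> 0 < t ->
  Jint 1 al (RtoC t * be) = bessel_kernel (clog al + clog be) (al * be) t.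
Proof.
  intros Ha Hb Ht. rewrite Jint_1_series; [|assumption|simpl; nra].
  rewrite clog_scal by assumption. unfold bessel_kernel.
  replace (al * (RtoC t * be))%C with (RtoC t * (al * be))%C by ring. 
  replace (clog al + (RtoC (ln t) + clog be) + RtoC (2 * euler_gamma))%C with
    (clog al + clog be + RtoC (ln t) + RtoC (2 * euler_gamma))%C by ring. reflexivity.
Qed.

(** Read off from the series, which is symmetric in [al] and [be]; this takes the place of the
    substitution [y -> t / y]. *)
Lemma Jint_1_sym (al be : C) (t : R) : 0 < fst al -> 0 < fst be -> 0 < t ->
  Jint 1 al (RtoC t * be) = Jint 1 be (RtoC t * al).
Proof.
  intros Ha Hb Ht. rewrite !Jint_1_kernel by assumption.
  rewrite (Cplus_comm (clog al)), (Cmult_comm al). reflexivity.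
Qed.

(** The boundary value of [clog] at [i x] for [x <> 0], approached from positive real parts. *)
Definition clog_imag (x : R) : C := (ln (Rabs x), if Rlt_dec 0 x then PI / 2 else - (PI / 2)).

Definition near_imag (x : R) (n : nat) : C := (/ INR (S n), x).

Lemma near_imag_pos (x : R) (n : nat) : 0 < fst (near_imag x n).
Proof. unfold near_imag. cbn [fst]. apply Rinv_0_lt_compat, lt_0_INR. lia. Qed.

Lemma Clim_near_imag (x : R) : Clim (near_imag x) (0, x).
Proof.
  unfold near_imag. apply Clim_components; cbn [fst snd]; [apply is_lim_seq_inv_S|apply is_lim_seq_const].
Qed.

(** For positive [u], [atan (1 / u) = PI / 2 - atan u] moves the limit from infinity to [0]. *)
Lemma is_lim_seq_atan_pos (x : R) : 0 < x -> is_lim_seq (fun n => atan (x / / INR (S n))) (PI / 2).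
Proof.
  intros Hx.
  apply is_lim_seq_ext with (fun n => PI / 2 - atan (/ x * / INR (S n))).
  - intros n. assert (Hn : 0 < INR (S n)) by (apply lt_0_INR; lia).
    rewrite <- atan_inv.
    + f_equal. field. split; lra.
    + apply Rmult_lt_0_compat; apply Rinv_0_lt_compat; assumption.
  - replace (PI / 2) with (PI / 2 - 0) at 1 by ring.
    apply is_lim_seq_minus'; [apply is_lim_seq_const|].
    rewrite <- atan_0.
    apply (is_lim_seq_continuous atan (fun n => / x * / INR (S n)) 0).
    + apply continuity_pt_filterlim, (continuous_derive _ _ (/ (1 + 0 ^ 2))).
      auto_derive; [exact I|]. field.
    + replace 0 with (/ x * 0) by ring. apply (is_lim_seq_scal_l _ (/ x) 0), is_lim_seq_inv_S.
Qed.

Lemma Clim_clog (x : R) : x <> 0 -> Clim (fun n => clog (near_imag x n)) (clog_imag x).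
Proof.
  intros Hx. assert (Hx2 : 0 < x ^ 2) by nra.
  apply Clim_components; unfold clog, near_imag, clog_imag; cbn [fst snd].
  - replace (ln (Rabs x)) with (/ 2 * ln (x ^ 2)).
    + apply is_lim_seq_ext with (fun n => / 2 * ln ((/ INR (S n)) ^ 2 + x ^ 2)).
      { intros n. unfold Rdiv. apply Rmult_comm. }
      apply (is_lim_seq_scal_l _ (/ 2) (ln (x ^ 2))).
      apply (is_lim_seq_continuous ln (fun n => (/ INR (S n)) ^ 2 + x ^ 2) (x ^ 2)).
      * apply continuity_pt_filterlim, (continuous_derive _ _ (/ x ^ 2)). apply is_derive_ln, Hx2.
      * apply is_lim_seq_ext with (fun n => / INR (S n) * / INR (S n) + x ^ 2); [intros; ring|].
        replace (Finite (x ^ 2)) with (Finite (0 * 0 + x ^ 2)) by (f_equal; ring).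
        apply is_lim_seq_plus'; [|apply is_lim_seq_const].
        apply is_lim_seq_mult'; apply is_lim_seq_inv_S.
    + rewrite <- pow2_abs. rewrite ln_pow by (apply Rabs_pos_lt; assumption). simpl. field.
  - destruct (Rlt_dec 0 x) as [H|H]; [apply is_lim_seq_atan_pos, H|].
    apply is_lim_seq_ext with (fun n => - atan (- x / / INR (S n))).
    + intros n. rewrite <- atan_opp. f_equal. field. apply Rgt_not_eq, lt_0_INR; lia.
    + apply (is_lim_seq_opp _ (PI / 2)), is_lim_seq_atan_pos. lra.
Qed.

Lemma Cpser_bound (a : nat -> R) (r : R) (z : C) : (forall k, Rabs (a k) <= / INR (fact k)) ->
  Cmod z <= r -> Cmod (Cpser a z) <= Cmod (Cpser a 0) + 2 * exp (r + 1) * r.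
Proof.
  intros Ha Hz. assert (Hr : 0 <= r) by (eapply Rle_trans; [apply Cmod_ge_0|exact Hz]).
  pose proof (Cpser_lipschitz a r z 0 Ha Hz) as L. rewrite Cmod_0 in L. specialize (L Hr).
  replace (z - 0)%C with z in L by ring.
  replace (Cpser a z) with ((Cpser a z - Cpser a 0) + Cpser a 0)%C by ring.
  eapply Rle_trans; [apply Cmod_triangle|]. pose proof (exp_pos (r + 1)).
  assert (2 * exp (r + 1) * Cmod z <= 2 * exp (r + 1) * r) by (apply Rmult_le_compat_l; lra). lra.
Qed.

Lemma Cpser_scal_cct (a : nat -> R) (z : C) (t : R) : (forall k, Rabs (a k) <= / INR (fact k)) ->
  Cct (fun t => Cpser a (RtoC t * z)) t.
Proof.
  intros Ha. set (r := (Rabs t + 1) * Cmod z). pose proof (Cmod_ge_0 z) as Hz.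
  apply Cct_lipschitz with (2 * exp (r + 1) * Cmod z) 1; [lra| |].
  - pose proof (exp_pos (r + 1)). nra.
  - intros h Hh.
    replace (2 * exp (r + 1) * Cmod z * Rabs h) with
      (2 * exp (r + 1) * Cmod (RtoC (t + h) * z - RtoC t * z)).
    + apply Cpser_lipschitz; auto; rewrite Cmod_mult, Cmod_R; unfold r;
        apply Rmult_le_compat_r; try assumption; [|lra].
      eapply Rle_trans; [apply Rabs_triang|]. lra.
    + replace (RtoC (t + h) * z - RtoC t * z)%C with (RtoC h * z)%C by (rewrite RtoC_plus; ring).
      rewrite Cmod_mult, Cmod_R. ring.
Qed.

Lemma bessel_kernel_cct (lg z : C) (t : R) : 0 < t -> Cct (bessel_kernel lg z) t.
Proof.
  intros Ht. unfold bessel_kernel. apply Cct_plus.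
  - apply Cct_mult; [|apply Cpser_scal_cct, coefI_bound].
    apply Cct_opp, Cct_plus; [|apply Cct_const]. apply Cct_plus; [apply Cct_const|].
    apply Cct_RtoC. eapply continuous_derive, is_derive_ln, Ht.
  - apply Cct_mult; [apply Cct_const|apply Cpser_scal_cct, coefH_bound].
Qed.

(** Uniformity in [t] on [[A, B]] allows the limit to be taken under the integral. *)
Lemma bessel_kernel_lipschitz (A B Z : R) (lg' z' : C) : 0 < A <= B -> Cmod z' <= Z ->
  exists K, 0 <= K /\ forall lg z t, Cmod z <= Z -> A <= t <= B ->
  Cmod (bessel_kernel lg z t - bessel_kernel lg' z' t) <= K * (Cmod (lg - lg') + Cmod (z - z')).
Proof.
  intros HAB Hz'. assert (HZ : 0 <= Z) by (eapply Rle_trans; [apply Cmod_ge_0|exact Hz']).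
  set (r := B * Z). assert (Hr : 0 <= r) by (unfold r; nra).
  set (PI0 := Cmod (Cpser coefI 0) + 2 * exp (r + 1) * r).
  set (Lp := 2 * exp (r + 1) * B).
  assert (HPI : 0 <= PI0).
  { unfold PI0. pose proof (exp_pos (r + 1)). pose proof (Cmod_ge_0 (Cpser coefI 0)). nra. }
  assert (HLp : 0 <= Lp) by (unfold Lp; pose proof (exp_pos (r + 1)); nra).
  destruct (Cct_bounded (fun t => lg' + RtoC (ln t) + RtoC (2 * euler_gamma))%C A B ltac:(lra)) as (Kl & HKl & Bl).
  { intros t Ht. apply Cct_plus; [|apply Cct_const]. apply Cct_plus; [apply Cct_const|].
    apply Cct_RtoC. eapply continuous_derive, is_derive_ln. lra. }
  exists (PI0 + Kl * Lp + 2 * Lp). split; [nra|].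
  intros lg z t Hz Ht.
  assert (Hs : forall u, Cmod u <= Z -> Cmod (RtoC t * u) <= r).
  { intros u Hu. rewrite Cmod_RtoC_mult by lra. unfold r.
    apply Rmult_le_compat; try lra. apply Cmod_ge_0. }
  assert (HL : forall a, (forall k, Rabs (a k) <= / INR (fact k)) ->
    Cmod (Cpser a (RtoC t * z) - Cpser a (RtoC t * z')) <= Lp * Cmod (z - z')).
  { intros a Ha. eapply Rle_trans; [apply (Cpser_lipschitz a r); auto|].
    replace (RtoC t * z - RtoC t * z')%C with (RtoC t * (z - z'))%C by ring.
    rewrite Cmod_RtoC_mult by lra. unfold Lp. rewrite (Rmult_assoc _ B).
    apply Rmult_le_compat_l; [pose proof (exp_pos (r + 1)); lra|].
    apply Rmult_le_compat_r; [apply Cmod_ge_0|lra]. }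
  unfold bessel_kernel.
  replace (_ - _)%C with (- (lg - lg') * Cpser coefI (RtoC t * z) -
    (lg' + RtoC (ln t) + RtoC (2 * euler_gamma)) * (Cpser coefI (RtoC t * z) - Cpser coefI (RtoC t * z')) +
    2 * (Cpser coefH (RtoC t * z) - Cpser coefH (RtoC t * z')))%C by ring.
  eapply Rle_trans; [apply Cmod_triangle|].
  eapply Rle_trans; [apply Rplus_le_compat_r, Cmod_minus_le|].
  rewrite (Cmod_mult (- _)), Cmod_opp, Cmod_mult, Cmod_RtoC_mult by lra.
  pose proof (HL _ coefI_bound) as L1. pose proof (HL _ coefH_bound) as L2.
  pose proof (Cpser_bound coefI r (RtoC t * z) coefI_bound (Hs z Hz)) as P. fold PI0 in P.
  specialize (Bl t Ht). cbv beta in Bl.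
  set (dl := Cmod (lg - lg')) in *. set (dz := Cmod (z - z')) in *.
  assert (Hdl : 0 <= dl) by apply Cmod_ge_0. assert (Hdz : 0 <= dz) by apply Cmod_ge_0.
  assert (T1 : dl * Cmod (Cpser coefI (RtoC t * z)) <= PI0 * dl) by (rewrite Rmult_comm; apply Rmult_le_compat_r; assumption).
  assert (T2 : Cmod (lg' + RtoC (ln t) + RtoC (2 * euler_gamma)) *
    Cmod (Cpser coefI (RtoC t * z) - Cpser coefI (RtoC t * z')) <= Kl * (Lp * dz)).
  { apply Rmult_le_compat; try assumption; apply Cmod_ge_0. }
  assert (0 <= Kl * Lp) by nra. nra.
Qed.

(** The product of [near_imag x n] and [near_imag y n] tends to [- x y], and the logarithms tend to
    their boundary values. *)
Lemma bessel_transform_limit (A B : R) (g : R -> C) (x y : R) :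
  0 < A <= B -> (forall t, Cct g t) -> x <> 0 -> y <> 0 ->
  Clim (fun n => bessel_transform A B g (near_imag x n) (near_imag y n))
    (CInt (fun t => g t * bessel_kernel (clog_imag x + clog_imag y) (RtoC (- (x * y))) t)%C A B).
Proof.
  intros HAB Hg Hx Hy.
  set (lg' := (clog_imag x + clog_imag y)%C). set (z' := RtoC (- (x * y))).
  set (Z := (1 + Rabs x) * (1 + Rabs y)).
  assert (Hn1 : forall n, 0 < / INR (S n) <= 1).
  { intros n. assert (1 <= INR (S n)) by (apply (le_INR 1); lia).
    split; [apply Rinv_0_lt_compat; lra|]. rewrite <- Rinv_1. apply Rinv_le_contravar; lra. }
  assert (Hni : forall u n, Cmod (near_imag u n) <= 1 + Rabs u).
  { intros u n. eapply Rle_trans; [apply Cmod_le_components|]. unfold near_imag. cbn [fst snd].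
    specialize (Hn1 n). rewrite (Rabs_pos_eq (/ _)) by lra. lra. }
  assert (Hzn : forall n, Cmod (near_imag x n * near_imag y n) <= Z).
  { intros n. rewrite Cmod_mult. apply Rmult_le_compat; auto; apply Cmod_ge_0. }
  assert (Hz' : Cmod z' <= Z).
  { unfold z', Z. rewrite Cmod_R, Rabs_Ropp, Rabs_mult. pose proof (Rabs_pos x). pose proof (Rabs_pos y). nra. }
  destruct (bessel_kernel_lipschitz A B Z lg' z' HAB Hz') as (K & HK & BK).
  destruct (Cct_bounded g A B ltac:(lra) (fun t _ => Hg t)) as (Kg & HKg & BG).
  assert (L1 : Clim (fun n => clog (near_imag x n) + clog (near_imag y n))%C lg').
  { apply Clim_plus; apply Clim_clog; assumption. }
  assert (L2 : Clim (fun n => near_imag x n * near_imag y n)%C z').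
  { replace z' with ((0, x) * (0, y))%C by (apply C_ext; unfold z'; simpl; ring).
    apply Clim_mult; apply Clim_near_imag. }
  apply Clim_squeeze with (fun n => 2 * (B - A) * Kg * K *
    (Cmod (clog (near_imag x n) + clog (near_imag y n) - lg') + Cmod (near_imag x n * near_imag y n - z'))).
  - intros n. unfold bessel_transform.
    assert (E : CInt (fun t => g t * Jint 1 (near_imag x n) (RtoC t * near_imag y n))%C A B =
      CInt (fun t => g t * bessel_kernel (clog (near_imag x n) + clog (near_imag y n))
        (near_imag x n * near_imag y n) t)%C A B).
    { apply CInt_ext; [lra|]. intros t Ht. f_equal. apply Jint_1_kernel; try apply near_imag_pos. lra. }
    rewrite E. clear E.
    set (lgn := (clog (near_imag x n) + clog (near_imag y n))%C) in *.
    set (zn := (near_imag x n * near_imag y n)%C) in *.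
    assert (Ck : forall lg z t, A <= t <= B -> Cct (fun t => g t * bessel_kernel lg z t)%C t).
    { intros lg z t Ht. apply Cct_mult; [apply Hg|apply bessel_kernel_cct; lra]. }
    rewrite <- (CInt_minus (fun t => g t * bessel_kernel lgn zn t)%C (fun t => g t * bessel_kernel lg' z' t)%C);
      [|lra|apply Ck|apply Ck].
    replace (2 * (B - A) * Kg * K * (Cmod (lgn - lg') + Cmod (zn - z'))) with
      (2 * (Kg * (K * (Cmod (lgn - lg') + Cmod (zn - z')))) * (B - A)) by ring.
    apply CInt_bound_const; [lra| |].
    + intros t Ht. apply Cct_minus; apply Ck; assumption.
    + intros t Ht.
      replace (_ - _)%C with (g t * (bessel_kernel lgn zn t - bessel_kernel lg' z' t))%C by ring.
      rewrite Cmod_mult. apply Rmult_le_compat; [apply Cmod_ge_0|apply Cmod_ge_0|auto|].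
      apply BK; [apply Hzn|assumption].
  - replace 0 with (2 * (B - A) * Kg * K * (0 + 0)) by ring.
    apply (is_lim_seq_scal_l _ (2 * (B - A) * Kg * K) (0 + 0)).
    apply is_lim_seq_plus'; assumption.
Qed.

Lemma RtoC_pow_real (r : R) (k : nat) : (RtoC r ^ k)%C = RtoC (r ^ k).
Proof. induction k as [|k IH]; [reflexivity|]. cbn [Cpow pow]. rewrite IH, RtoC_mult. reflexivity. Qed.

Lemma Cpser_RtoC (a : nat -> R) (r : R) : Cpser a (RtoC r) = RtoC (Series (fun k => a k * r ^ k)).
Proof.
  apply C_ext; simpl.
  - apply Series_ext. intros k. now rewrite RtoC_pow_real.
  - rewrite (Series_ext _ (fun k => 0 * 0)).
    + rewrite Series_scal_l. ring.
    + intros k. rewrite RtoC_pow_real. simpl. ring.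
Qed.

Lemma ln_abs_sum (x y t X : R) : x <> 0 -> y <> 0 -> 0 < t -> 0 < X -> X * X / 4 = t * Rabs (x * y) ->
  ln (Rabs x) + ln (Rabs y) + ln t = 2 * ln (X / 2).
Proof.
  intros Hx Hy Ht HX E. apply Rabs_pos_lt in Hx, Hy.
  rewrite Rabs_mult in E.
  replace (2 * ln (X / 2)) with (ln (X / 2) + ln (X / 2)) by ring.
  rewrite <- !ln_mult by nra. f_equal. lra.
Qed.

(** For [x], [y] of equal sign the two arguments add up to [+- PI]: this gives the [J0] term with
    its sign, while the series at a negative argument become those of [J0] and [Y0]. It is the
    formula for [2 K_0(+- i X)]. *)
Lemma bessel_kernel_JY (x y t X : R) : 0 < t -> 0 < X -> 0 < x * y -> X * X / 4 = t * (x * y) ->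
  bessel_kernel (clog_imag x + clog_imag y) (RtoC (- (x * y))) t =
  (RtoC (- PI * BesselY0 X) - RtoC ((if Rlt_dec 0 x then 1 else - 1) * PI * BesselJ0 X) * Ci)%C.
Proof.
  intros Ht HX Hxy E.
  assert (Hx : x <> 0) by (intros ->; lra). assert (Hy : y <> 0) by (intros ->; lra).
  pose proof (ln_abs_sum x y t X Hx Hy Ht HX) as L. rewrite Rabs_pos_eq in L by lra. specialize (L E).
  pose proof PI_RGT_0 as Hpi.
  set (J := Series (fun k => coefI k * (- (X * X / 4)) ^ k)).
  set (H := Series (fun k => coefH k * (- (X * X / 4)) ^ k)).
  assert (EJ : BesselJ0 X = J).
  { apply Series_ext. intros k. unfold coefI.
    replace (- (X * X / 4)) with (-1 * (X * X / 4)) by ring. rewrite Rpow_mult_distr. unfold Rdiv. ring. }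
  assert (EY : BesselY0 X = 2 / PI * (ln (X / 2) + euler_gamma) * J - 2 / PI * H).
  { unfold BesselY0. rewrite EJ. unfold Rminus. f_equal.
    rewrite <- Ropp_mult_distr_r_reverse. f_equal. unfold H. rewrite <- Series_opp. apply Series_ext. intros k. unfold coefH.
    replace (- (X * X / 4)) with (-1 * (X * X / 4)) by ring. rewrite Rpow_mult_distr. simpl pow. unfold Rdiv. ring. }
  unfold bessel_kernel. rewrite <- RtoC_mult, !Cpser_RtoC.
  replace (t * - (x * y)) with (- (X * X / 4)) by lra. fold J. fold H.
  rewrite EJ, EY.
  assert (Ei : snd (clog_imag x + clog_imag y)%C = (if Rlt_dec 0 x then 1 else - 1) * PI).
  { simpl. destruct (Rlt_dec 0 x), (Rlt_dec 0 y); try field; nra. }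
  replace (clog_imag x + clog_imag y)%C with
    (ln (Rabs x) + ln (Rabs y), (if Rlt_dec 0 x then 1 else - 1) * PI)
    by (rewrite <- Ei; apply C_ext; reflexivity).
  replace (ln (Rabs x) + ln (Rabs y)) with (2 * ln (X / 2) - ln t) by lra.
  apply C_ext; simpl; field; lra.
Qed.

(** For opposite signs the arguments of the two logarithms cancel and the kernel is real. *)
Lemma bessel_kernel_K (x y t X : R) : 0 < t -> 0 < X -> x * y < 0 -> X * X / 4 = t * - (x * y) ->
  bessel_kernel (clog_imag x + clog_imag y) (RtoC (- (x * y))) t = RtoC (2 * BesselK0 X).
Proof.
  intros Ht HX Hxy E.
  assert (Hx : x <> 0) by (intros ->; lra). assert (Hy : y <> 0) by (intros ->; lra).
  pose proof (ln_abs_sum x y t X Hx Hy Ht HX) as L. rewrite Rabs_left in L by lra. specialize (L E).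
  set (J := Series (fun k => coefI k * (X * X / 4) ^ k)).
  set (H := Series (fun k => coefH k * (X * X / 4) ^ k)).
  assert (EJ : BesselI0 X = J) by (apply Series_ext; intros k; unfold coefI, Rdiv; ring).
  assert (EK : BesselK0 X = - (ln (X / 2) + euler_gamma) * J + H).
  { unfold BesselK0. rewrite EJ. f_equal. apply Series_ext; intros k; unfold coefH, Rdiv; ring. }
  unfold bessel_kernel. rewrite <- RtoC_mult, !Cpser_RtoC.
  replace (t * - (x * y)) with (X * X / 4) by lra. fold J. fold H. rewrite EK.
  assert (Ei : snd (clog_imag x + clog_imag y)%C = 0).
  { simpl. destruct (Rlt_dec 0 x), (Rlt_dec 0 y); try field; nra. }
  replace (clog_imag x + clog_imag y)%C with (RtoC (ln (Rabs x) + ln (Rabs y)))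
    by (apply C_ext; [reflexivity|symmetry; exact Ei]).
  replace (ln (Rabs x) + ln (Rabs y)) with (2 * ln (X / 2) - ln t) by lra.
  apply C_ext; simpl; ring.
Qed.

(** * Sums over residues and Gauss sums *)

Definition psum (m : Z) (F : Z -> C) : C := csum (fun k => F (Z.of_nat k)) (Z.to_nat m).

Definition ez (k m : Z) : C := e (IZR k / IZR m).

Definition zperiodic (m : Z) (F : Z -> C) : Prop := forall x, F (x + m)%Z = F x.

Lemma psum_ext (m : Z) (F G : Z -> C) : (forall k, (0 <= k < m)%Z -> F k = G k) -> psum m F = psum m G.
Proof. intros H. apply csum_ext. intros k Hk. apply H. lia. Qed.

Lemma psum_scal (m : Z) (x : C) (F : Z -> C) : psum m (fun k => x * F k)%C = (x * psum m F)%C.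
Proof. apply csum_scal. Qed.

Lemma psum_swap (m n : Z) (F : Z -> Z -> C) :
  psum m (fun i => psum n (F i)) = psum n (fun j => psum m (fun i => F i j)).
Proof. apply csum_swap. Qed.

Lemma psum_const (m : Z) (x : C) : (0 <= m)%Z -> psum m (fun _ => x) = (RtoC (IZR m) * x)%C.
Proof.
  intros Hm. unfold psum. rewrite <- (Z2Nat.id m) at 2 by assumption. rewrite <- INR_IZR_INZ.
  induction (Z.to_nat m) as [|n IH]; [simpl; ring|]. cbn [csum]. rewrite IH, S_INR, RtoC_plus. ring.
Qed.

Lemma psum_0 (m : Z) (F : Z -> C) : (forall k, (0 <= k < m)%Z -> F k = RtoC 0) -> psum m F = RtoC 0.
Proof. intros H. apply csum_zero. intros k Hk. apply H. lia. Qed.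

Lemma psum_single (m : Z) (F : Z -> C) : (0 < m)%Z -> (forall k, (0 < k < m)%Z -> F k = RtoC 0) ->
  psum m F = F 0%Z.
Proof.
  intros Hm H. unfold psum. replace (Z.to_nat m) with (1 + Z.to_nat (m - 1))%nat by lia.
  rewrite csum_add, (csum_zero (fun k => F (Z.of_nat (1 + k)))).
  - simpl. ring.
  - intros k Hk. apply H. lia.
Qed.

Lemma zperiodic_mul (m : Z) (F : Z -> C) (k x : Z) : zperiodic m F -> F (x + k * m)%Z = F x.
Proof.
  intros H.
  assert (P : forall n x, F (x + Z.of_nat n * m)%Z = F x).
  { induction n as [|n IH]; intros y; [f_equal; lia|].
    rewrite <- (IH y), <- (H (y + Z.of_nat n * m)%Z). f_equal. lia. }
  destruct (Z_le_gt_dec 0 k) as [Hk|Hk].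
  - rewrite <- (Z2Nat.id k) by assumption. apply P.
  - rewrite <- (P (Z.to_nat (- k)) (x + k * m)%Z). f_equal. lia.
Qed.

Lemma zperiodic_mod (m : Z) (F : Z -> C) (x : Z) : (0 < m)%Z -> zperiodic m F -> F (x mod m)%Z = F x.
Proof.
  intros Hm H. rewrite (Z_div_mod_eq_full x m) at 2.
  rewrite Z.add_comm, (Z.mul_comm m). symmetry. apply zperiodic_mul, H.
Qed.

Lemma zperiodic_eqm (m : Z) (F : Z -> C) (x y : Z) : zperiodic m F -> (m | x - y)%Z -> F x = F y.
Proof.
  intros H [k Hk]. replace x with (y + k * m)%Z by lia. apply zperiodic_mul, H.
Qed.

Lemma psum_mul (m n : Z) (F : Z -> C) : (0 < m)%Z -> (0 <= n)%Z ->
  psum (m * n) F = psum m (fun i => psum n (fun j => F (i + m * j)%Z)).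
Proof.
  intros Hm Hn. unfold psum. rewrite Z2Nat.inj_mul by lia.
  set (q := Z.to_nat m). set (L := Z.to_nat n).
  transitivity (csum (fun u => csum (fun j => F (Z.of_nat (u + q * j))) L) q).
  - induction L as [|L IH].
    + rewrite Nat.mul_0_r. symmetry. apply csum_zero. reflexivity.
    + rewrite Nat.mul_succ_r, csum_add, IH. cbn [csum]. rewrite csum_plus. f_equal.
      apply csum_ext. intros u _. do 2 f_equal. lia.
  - apply csum_ext. intros u _. apply csum_ext. intros j _. f_equal.
    rewrite Nat2Z.inj_add, Nat2Z.inj_mul. unfold q. rewrite Z2Nat.id by lia. reflexivity.
Qed.

Definition lsum (l : list Z) (F : Z -> C) : C := fold_right (fun x s => (F x + s)%C) (RtoC 0) l.

Lemma lsum_perm (l l' : list Z) (F : Z -> C) : Permutation l l' -> lsum l F = lsum l' F.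
Proof.
  induction 1 as [|x l1 l2 _ IH|x y l0|l1 l2 l3 _ IH1 _ IH2]; simpl.
  - reflexivity.
  - now rewrite IH.
  - ring.
  - congruence.
Qed.

Definition residues (m : Z) : list Z := map Z.of_nat (seq 0 (Z.to_nat m)).

Lemma in_residues (m x : Z) : In x (residues m) <-> (0 <= x < m)%Z.
Proof.
  unfold residues. rewrite in_map_iff. split.
  - intros (n & <- & Hn). apply in_seq in Hn. lia.
  - intros Hx. exists (Z.to_nat x). split; [lia|]. apply in_seq. lia.
Qed.

Lemma psum_lsum (m : Z) (F : Z -> C) : psum m F = lsum (residues m) F.
Proof.
  unfold psum, residues. induction (Z.to_nat m) as [|n IH]; [reflexivity|].
  cbn [csum]. rewrite seq_S, map_app. simpl map.
  assert (E : forall l x, lsum (l ++ x :: nil) F = (lsum l F + F x)%C).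
  { induction l as [|y l IHl]; intros x; simpl; [ring|]. rewrite IHl. ring. }
  rewrite E, IH. reflexivity.
Qed.

Lemma lsum_map (l : list Z) (f : Z -> Z) (F : Z -> C) : lsum (map f l) F = lsum l (fun x => F (f x)).
Proof. induction l as [|x l IH]; simpl; [reflexivity|]. now rewrite IH. Qed.

(** A map injective on residue classes permutes the finite list of residues. *)
Lemma psum_bij (m : Z) (f : Z -> Z) (F : Z -> C) : (0 < m)%Z -> zperiodic m F ->
  (forall x y, (m | f x - f y)%Z -> (m | x - y)%Z) ->
  psum m (fun k => F (f k)) = psum m F.
Proof.
  intros Hm HF Hf.
  transitivity (psum m (fun k => F (f k mod m)%Z)).
  { apply psum_ext. intros k _. symmetry. apply zperiodic_mod; assumption. }
  rewrite !psum_lsum, <- (lsum_map _ (fun x => f x mod m)%Z F). apply lsum_perm.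
  assert (ND : NoDup (residues m)).
  { unfold residues. apply FinFun.Injective_map_NoDup; [|apply seq_NoDup].
    intros x y Hxy. lia. }
  apply NoDup_Permutation_bis.
  - assert (G : forall l, NoDup l -> (forall x, In x l -> (0 <= x < m)%Z) ->
      NoDup (map (fun x => f x mod m)%Z l)).
    { induction l as [|x l IH]; intros Hl Hin; simpl; [constructor|].
      inversion Hl as [|? ? Hx Hl']; subst. constructor.
      - intros HI. apply in_map_iff in HI. destruct HI as (y & Hy & Hyl).
        assert (D : (m | f y - f x)%Z).
        { exists (f y / m - f x / m)%Z.
          pose proof (Z_div_mod_eq_full (f y) m). pose proof (Z_div_mod_eq_full (f x) m). lia. }
        apply Hf in D.
        assert (y = x); [|subst; contradiction].
        pose proof (Hin x (or_introl eq_refl)). pose proof (Hin y (or_intror Hyl)).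
        destruct D as [k Hk]. assert (k = 0)%Z; [|lia].
        destruct (Z.lt_trichotomy k 0) as [?|[?|?]]; [|assumption|]; nia.
      - apply IH; [assumption|]. intros; apply Hin; now right. }
    apply G; [exact ND|]. intros x Hx. now apply in_residues.
  - rewrite (length_map _ (residues m)). apply le_n.
  - intros x Hx. apply in_map_iff in Hx. destruct Hx as (y & <- & _).
    apply in_residues. apply Z.mod_pos_bound, Hm.
Qed.

Lemma psum_shift (m s : Z) (F : Z -> C) : (0 < m)%Z -> zperiodic m F ->
  psum m (fun k => F (k + s)%Z) = psum m F.
Proof.
  intros Hm HF. apply (psum_bij m (fun k => (k + s)%Z)); auto.
  intros x y. now replace (x + s - (y + s))%Z with (x - y)%Z by ring.
Qed.

Lemma psum_mul_unit (m u : Z) (F : Z -> C) : (0 < m)%Z -> zperiodic m F -> Z.gcd u m = 1%Z ->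
  psum m (fun k => F (u * k)%Z) = psum m F.
Proof.
  intros Hm HF Hu. apply (psum_bij m (fun k => (u * k)%Z)); auto.
  intros x y. replace (u * x - u * y)%Z with (u * (x - y))%Z by ring.
  intros H. apply Z.gauss with u; [assumption|]. now rewrite Z.gcd_comm.
Qed.

(** Start from the division with remainder [i + m j] and multiply the outer variable by [n], a unit
    modulo [m]. *)
Lemma psum_crt (m n : Z) (F : Z -> C) : (0 < m)%Z -> (0 < n)%Z -> Z.gcd m n = 1%Z ->
  zperiodic (m * n) F ->
  psum (m * n) F = psum m (fun i => psum n (fun j => F (n * i + m * j)%Z)).
Proof.
  intros Hm Hn Hg HF. rewrite psum_mul by lia. symmetry.
  apply (psum_mul_unit m n (fun i => psum n (fun j => F (i + m * j)%Z))); auto.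
  - intros x.
    rewrite <- (psum_shift n 1 (fun j => F (x + m * j)%Z)); [|assumption|].
    + apply psum_ext. intros j _. f_equal. ring.
    + intros j. rewrite <- (HF (x + m * j)%Z). f_equal. ring.
  - now rewrite Z.gcd_comm.
Qed.

Lemma ez_add (x y m : Z) : ez (x + y) m = (ez x m * ez y m)%C.
Proof.
  unfold ez. rewrite <- e_plus. f_equal. rewrite plus_IZR. unfold Rdiv. ring.
Qed.

Lemma ez_multiple (k m : Z) : m <> 0%Z -> ez (k * m) m = RtoC 1.
Proof.
  intros Hm. unfold ez. rewrite mult_IZR. replace (IZR k * IZR m / IZR m) with (IZR k).
  - apply e_IZR.
  - field. now apply eq_IZR_contrapositive.
Qed.

Lemma ez_eqm (x y m : Z) : m <> 0%Z -> (m | x - y)%Z -> ez x m = ez y m.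
Proof.
  intros Hm [k Hk]. replace x with (y + k * m)%Z by lia.
  rewrite ez_add, ez_multiple by assumption. ring.
Qed.

Lemma ez_cancel (k x m : Z) : k <> 0%Z -> m <> 0%Z -> ez (k * x) (k * m) = ez x m.
Proof.
  intros Hk Hm. unfold ez. f_equal. rewrite !mult_IZR. field. split; now apply eq_IZR_contrapositive.
Qed.

Lemma e_eq_1 (x : R) : 0 < x < 1 -> e x <> RtoC 1.
Proof.
  intros Hx E. apply (f_equal fst) in E. simpl in E.
  replace (2 * PI * x) with (2 * (PI * x)) in E by ring. rewrite cos_2a_sin in E.
  assert (0 < sin (PI * x)) by (apply sin_gt_0; pose proof PI_RGT_0; nra). nra.
Qed.

Lemma ez_eq_1 (x m : Z) : (0 < m)%Z -> ez x m = RtoC 1 -> (m | x)%Z.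
Proof.
  intros Hm E. apply Z.mod_divide; [lia|].
  destruct (Z.eq_dec (x mod m) 0) as [|Hx]; [assumption|exfalso].
  pose proof (Z.mod_pos_bound x m Hm) as B.
  rewrite (ez_eqm x (x mod m)) in E; [|lia|].
  - revert E. apply e_eq_1.
    assert (0 < IZR m) by (apply IZR_lt; lia).
    assert (0 < IZR (x mod m)) by (apply IZR_lt; lia).
    assert (IZR (x mod m) < IZR m) by (apply IZR_lt; lia).
    split; [apply Rdiv_lt_0_compat; assumption|].
    apply Rmult_lt_reg_r with (IZR m); [assumption|].
    unfold Rdiv. rewrite Rmult_assoc, Rinv_l by lra. lra.
  - exists (x / m)%Z. pose proof (Z_div_mod_eq_full x m). lia.
Qed.

Lemma zperiodic_ez (x m : Z) : m <> 0%Z -> zperiodic m (fun k => ez (k * x) m).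
Proof.
  intros Hm k. apply ez_eqm; [assumption|]. exists x. ring.
Qed.

(** A shift of the variable shows that the sum is invariant under multiplication by [ez x m], which
    differs from [1]. *)
Lemma psum_ez (m x : Z) : (0 < m)%Z -> ~ (m | x)%Z -> psum m (fun k => ez (k * x) m) = RtoC 0.
Proof.
  intros Hm Hx. set (S := psum m _).
  assert (E : S = (ez x m * S)%C).
  { unfold S at 1. rewrite <- (psum_shift m 1); [|assumption|apply zperiodic_ez; lia].
    unfold S. rewrite <- psum_scal. apply psum_ext. intros k _.
    rewrite <- ez_add. f_equal. ring. }
  assert (N : (1 - ez x m)%C <> RtoC 0).
  { intros Q. apply Hx, ez_eq_1; [assumption|].
    transitivity (RtoC 1 - (1 - ez x m))%C; [ring|]. rewrite Q. ring. }
  transitivity (/ (1 - ez x m) * (S - ez x m * S))%C; [field; exact N|].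
  rewrite <- E. ring.
Qed.

(* Shifting j by c / E2 shows that only j' = - inv * p mod E2 contributes; then the inner sum
   over j' is c times the indicator of j = - inv * q mod c. *)

Lemma double_exponential_sum (c E1 E2 A inv p q : Z) (f h : Z -> C) :
  (0 < c)%Z -> (0 < E1)%Z -> (0 < E2)%Z -> (E1 * E2 | c)%Z ->
  zperiodic E1 f -> zperiodic E2 h -> (c | A * inv - 1)%Z ->
  psum c (fun j => psum c (fun k => f j * h k * ez (A * j * k + j * p + k * q) c))%C =
  (RtoC (IZR c) * f (- inv * q)%Z * h (- inv * p)%Z * ez (- inv * p * q) c)%C.
Proof.
  intros Hc HE1 HE2 [r Hr] Hf Hh Hinv.
  assert (HE1c : (E1 | c)%Z) by (exists (r * E2)%Z; rewrite Hr; ring).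
  assert (HE2c : (E2 | c)%Z) by (exists (r * E1)%Z; rewrite Hr; ring).
  assert (Hfc : zperiodic c f).
  { intros x. apply (zperiodic_eqm E1); [assumption|]. now replace (x + c - x)%Z with c by ring. }
  rewrite psum_swap.
  set (G := fun k => psum c (fun j => f j * ez (j * (A * k + p)) c)%C).
  assert (HG : forall k, (h k * G k)%C = (h (- inv * p)%Z * G k)%C).
  { intros k. destruct (Zdivide_dec E2 (A * k + p)) as [HD|HD].
    - f_equal. apply (zperiodic_eqm E2); [assumption|].
      replace (k - - inv * p)%Z with (inv * (A * k + p) - (A * inv - 1) * k)%Z by ring.
      apply Z.divide_sub_r; [apply Z.divide_mul_r, HD|].
      apply Z.divide_mul_l. now apply Z.divide_trans with c.
    - assert (E : G k = (ez (A * k + p) E2 * G k)%C).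
      { unfold G at 1. rewrite <- (psum_shift c (r * E1)); [|assumption|].
        - unfold G. rewrite <- psum_scal. apply psum_ext. intros j _.
          rewrite (Z.mul_comm r), (zperiodic_eqm E1 f _ j Hf) by (exists r; ring).
          rewrite Z.mul_add_distr_r, ez_add.
          replace (ez (E1 * r * (A * k + p)) c) with (ez (A * k + p) E2).
          + ring.
          + rewrite Hr. rewrite (Z.mul_comm r), <- Z.mul_assoc.
            replace (E1 * E2 * r)%Z with ((E1 * r) * E2)%Z by ring.
            rewrite Z.mul_assoc. symmetry. apply ez_cancel; [|lia]. intros Q.
            assert (c = 0)%Z; [|lia]. rewrite Hr. nia.
        - intros j. rewrite Hfc. f_equal. apply zperiodic_ez. lia. }
      assert (N : (1 - ez (A * k + p) E2)%C <> RtoC 0).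
      { intros Q. apply HD, ez_eq_1; [assumption|].
        transitivity (RtoC 1 - (1 - ez (A * k + p) E2))%C; [ring|]. rewrite Q. ring. }
      assert (G0 : G k = RtoC 0).
      { transitivity (/ (1 - ez (A * k + p) E2) * (G k - ez (A * k + p) E2 * G k))%C; [field; exact N|].
        rewrite <- E. ring. }
      rewrite G0. ring. }
  transitivity (psum c (fun k => h (- inv * p)%Z * (ez (k * q) c * G k))%C).
  { apply psum_ext. intros k _.
    transitivity (ez (k * q) c * (h k * G k))%C; [|rewrite HG; ring].
    unfold G. rewrite <- !psum_scal. apply psum_ext. intros j _.
    replace (A * j * k + j * p + k * q)%Z with (k * q + j * (A * k + p))%Z by ring.
    rewrite ez_add. ring. }
  rewrite psum_scal.
  set (H := fun j => psum c (fun k => ez (k * (A * j + q)) c)).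
  transitivity (h (- inv * p)%Z * psum c (fun j => f j * ez (j * p) c * H j))%C.
  { f_equal. transitivity (psum c (fun k => psum c (fun j => ez (k * q) c * (f j * ez (j * (A * k + p)) c)))%C).
    - apply psum_ext. intros k _. unfold G. now rewrite psum_scal.
    - rewrite psum_swap. apply psum_ext. intros j _. unfold H. rewrite <- psum_scal.
      apply psum_ext. intros k _.
      replace (k * (A * j + q))%Z with (k * A * j + k * q)%Z by ring.
      replace (j * (A * k + p))%Z with (k * A * j + j * p)%Z by ring. rewrite !ez_add. ring. }
  assert (HH : forall j, (f j * ez (j * p) c * H j)%C =
    (f (- inv * q)%Z * ez (- inv * p * q) c * H j)%C).
  { intros j. destruct (Zdivide_dec c (A * j + q)) as [HD|HD].
    - assert (D : (c | j - - inv * q)%Z).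
      { replace (j - - inv * q)%Z with (inv * (A * j + q) - (A * inv - 1) * j)%Z by ring.
        apply Z.divide_sub_r; [apply Z.divide_mul_r, HD|apply Z.divide_mul_l, Hinv]. }
      f_equal. f_equal; [apply (zperiodic_eqm c); assumption|].
      apply ez_eqm; [lia|]. replace (j * p - - inv * p * q)%Z with ((j - - inv * q) * p)%Z by ring.
      apply Z.divide_mul_l, D.
    - unfold H. rewrite psum_ez by assumption. ring. }
  rewrite (psum_ext c _ _ (fun j _ => HH j)), psum_scal.
  (* [A] is a unit modulo [c], so [A j + q] runs over all residues; exchanging the sums leaves only
     [k = 0]. *)
  assert (SH : psum c H = RtoC (IZR c)).
  { assert (GA : Z.gcd A c = 1%Z).
    { apply Z.bezout_1_gcd. destruct Hinv as [t Ht]. exists inv, (- t)%Z. lia. }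
    set (K := fun x => psum c (fun k => ez (k * x) c)).
    assert (PK : zperiodic c K).
    { intros x. apply psum_ext. intros k _. apply ez_eqm; [lia|]. exists k. ring. }
    transitivity (psum c (fun j => K (A * j + q)%Z)); [reflexivity|].
    rewrite (psum_mul_unit c A (fun x => K (x + q)%Z)); [|assumption| |assumption].
    - rewrite (psum_shift c q K) by assumption. unfold K. rewrite psum_swap.
      rewrite psum_single; [|assumption|].
      + rewrite (psum_ext c _ (fun _ => RtoC 1)); [rewrite psum_const by lia; ring|].
        intros i _. unfold ez, Rdiv. rewrite Z.mul_0_l, Rmult_0_l. apply e_0.
      + intros k Hk. rewrite (psum_ext c _ (fun i => ez (i * k) c)) by (intros; f_equal; ring).
        apply psum_ez; [assumption|]. intros [t Ht]. assert (t = 0)%Z; [|lia]. nia.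
    - intros x. replace (x + c + q)%Z with (x + q + c)%Z by ring. apply PK. }
  rewrite SH. ring.
Qed.

(** * Dirichlet characters *)

Lemma char_zperiodic (m : Z) (chi : Z -> C) : dirichlet_char m chi -> zperiodic m chi.
Proof. intros H x. apply (dc_per m chi H). Qed.

Lemma unit_inverse (x m : Z) : Z.gcd x m = 1%Z -> exists y, (m | x * y - 1)%Z.
Proof.
  intros H. apply Z.gcd_bezout in H. destruct H as (u & v & E). exists u, (- v)%Z. lia.
Qed.

Lemma gcd_1_of_inverse (x y m : Z) : (m | x * y - 1)%Z -> Z.gcd x m = 1%Z.
Proof. intros [t Ht]. apply Z.bezout_1_gcd. exists y, (- t)%Z. lia. Qed.

Lemma invmod_spec (x m : Z) : (0 < m)%Z -> Z.gcd x m = 1%Z -> (m | x * invmod x m - 1)%Z.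
Proof.
  intros Hm Hg. unfold invmod.
  assert (D : forall b, ((x * b) mod m =? 1 mod m)%Z = true <-> (m | x * b - 1)%Z).
  { intros b. rewrite Z.eqb_eq. split.
    - intros E. exists (x * b / m - 1 / m)%Z.
      pose proof (Z_div_mod_eq_full (x * b) m). pose proof (Z_div_mod_eq_full 1 m). lia.
    - intros [t Ht]. replace (x * b)%Z with (1 + t * m)%Z by lia. apply Z_mod_plus_full. }
  destruct (find _ _) as [b|] eqn:E.
  - apply find_some in E. now apply D.
  - exfalso. destruct (unit_inverse x m Hg) as [y Hy].
    assert (I : In (y mod m)%Z (map Z.of_nat (seq 0 (Z.to_nat m)))).
    { apply in_residues. apply Z.mod_pos_bound, Hm. }
    pose proof (find_none _ _ E _ I) as N. cbv beta in N.
    assert (T : ((x * (y mod m)) mod m =? 1 mod m)%Z = true).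
    { apply D. rewrite (Z_div_mod_eq_full y m) in Hy.
      replace (x * (y mod m) - 1)%Z with ((x * (m * (y / m) + y mod m) - 1) - m * (x * (y / m)))%Z by ring.
      apply Z.divide_sub_r; [exact Hy|apply Z.divide_factor_l]. }
    congruence.
Qed.

Lemma char_inverse (m : Z) (chi : Z -> C) (x y : Z) : dirichlet_char m chi -> (m | x * y - 1)%Z ->
  (chi x * chi y)%C = RtoC 1.
Proof.
  intros H D. rewrite <- (dc_mul m chi H), <- (dc_one m chi H).
  apply (zperiodic_eqm m); [apply char_zperiodic, H|exact D].
Qed.

Lemma char_pow (m : Z) (chi : Z -> C) (x : Z) (n : nat) : dirichlet_char m chi ->
  chi (x ^ Z.of_nat n)%Z = (chi x ^ n)%C.
Proof.
  intros H. induction n as [|n IH].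
  - simpl. apply (dc_one m chi H).
  - rewrite Nat2Z.inj_succ, Z.pow_succ_r, (dc_mul m chi H), IH by lia. reflexivity.
Qed.

(** Periodicity bounds [chi] by some [M]; as [chi(x)^n = chi(x^n)] for all [n], a value of modulus
    above [1] is impossible. *)
Lemma char_bound (m : Z) (chi : Z -> C) (x : Z) : dirichlet_char m chi -> Cmod (chi x) <= 1.
Proof.
  intros H. pose proof (dc_pos m chi H) as Hm.
  set (M := rsum (fun k => Cmod (chi (Z.of_nat k))) (Z.to_nat m)).
  assert (B : forall y, Cmod (chi y) <= M).
  { intros y. rewrite <- (zperiodic_mod m chi y Hm (char_zperiodic m chi H)).
    pose proof (Z.mod_pos_bound y m Hm) as By.
    rewrite <- (Z2Nat.id (y mod m)) by lia.
    assert (Hk : (Z.to_nat (y mod m) < Z.to_nat m)%nat) by lia.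
    unfold M. revert Hk. generalize (Z.to_nat (y mod m)) (Z.to_nat m). intros k n Hk.
    assert (P : forall j, 0 <= rsum (fun k => Cmod (chi (Z.of_nat k))) j).
    { induction j as [|j IHj]; cbn [rsum]; [lra|]. pose proof (Cmod_ge_0 (chi (Z.of_nat j))). lra. }
    induction n as [|n IH]; [lia|]. cbn [rsum]. destruct (Nat.eq_dec k n) as [->|].
    - specialize (P n). lra.
    - specialize (IH ltac:(lia)). pose proof (Cmod_ge_0 (chi (Z.of_nat n))). lra. }
  destruct (Rle_dec (Cmod (chi x)) 1) as [|N]; [assumption|exfalso].
  destruct (Pow_x_infinity (Cmod (chi x))) with (b := M + 1) as [n Hn].
  - rewrite Rabs_pos_eq by apply Cmod_ge_0. lra.
  - specialize (Hn n (le_n _)). rewrite Rabs_pos_eq in Hn by (apply pow_le, Cmod_ge_0).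
    rewrite <- Cmod_pow, <- (char_pow m) in Hn by assumption.
    specialize (B (x ^ Z.of_nat n)%Z). lra.
Qed.

(** If [y] inverts [x], then [|chi x| |chi y| = 1] with both factors at most [1]. *)
Lemma char_unit_conj (m : Z) (chi : Z -> C) (x : Z) : dirichlet_char m chi -> Z.gcd x m = 1%Z ->
  (Cconj (chi x) * chi x)%C = RtoC 1.
Proof.
  intros H Hx. destruct (unit_inverse x m Hx) as [y Hy].
  pose proof (char_inverse m chi x y H Hy) as E.
  pose proof (char_bound m chi x H) as B1. pose proof (char_bound m chi y H) as B2.
  pose proof (f_equal Cmod E) as E2. rewrite Cmod_mult, Cmod_1 in E2.
  pose proof (Cmod_ge_0 (chi x)). pose proof (Cmod_ge_0 (chi y)).
  assert (E3 : Cmod (chi x) = 1) by nra.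
  rewrite Cmult_comm, <- Cmod2_conj, E3. f_equal. ring.
Qed.

Lemma char_conj_inverse (m : Z) (chi : Z -> C) (x y : Z) : dirichlet_char m chi -> (m | x * y - 1)%Z ->
  chi y = Cconj (chi x).
Proof.
  intros H D. pose proof (char_inverse m chi x y H D) as E.
  pose proof (char_unit_conj m chi x H (gcd_1_of_inverse x y m D)) as E2.
  transitivity (Cconj (chi x) * chi x * chi y)%C; [rewrite E2; ring|].
  rewrite <- Cmult_assoc, E. ring.
Qed.

Lemma Cconj_0 : Cconj 0 = RtoC 0.
Proof. apply C_ext; simpl; ring. Qed.

Lemma gauss_sum_psum (m : Z) (chi : Z -> C) :
  gauss_sum m chi = psum m (fun u => chi u * ez u m)%C.
Proof.
  apply csum_ext. intros k _. unfold ez. now rewrite <- INR_IZR_INZ.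
Qed.

(** For [p] prime to [m] substitute [u -> p u]. Otherwise let [g = gcd(p, m)]: primitivity at
    [d = m / g] supplies a unit [z] congruent to [1] modulo [d] with [chi z <> 1], and the sum
    equals [chi z] times itself, hence [0]. *)
Lemma gauss_twist (m : Z) (chi : Z -> C) (p : Z) : primitive_char m chi ->
  psum m (fun u => chi u * ez (u * p) m)%C = (Cconj (chi p) * gauss_sum m chi)%C.
Proof.
  intros [H Hprim]. pose proof (dc_pos m chi H) as Hm.
  assert (Per : forall x, zperiodic m (fun u => chi u * ez (u * x) m)%C).
  { intros x u. rewrite (char_zperiodic m chi H). f_equal. apply zperiodic_ez. lia. }
  set (G := psum m _).
  assert (Tw : forall z, Z.gcd z m = 1%Z -> G = (chi z * psum m (fun u => chi u * ez (u * (z * p)) m))%C).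
  { intros z Hz. unfold G. rewrite <- (psum_mul_unit m z _ Hm (Per p) Hz), <- psum_scal.
    apply psum_ext. intros u _. rewrite (dc_mul m chi H).
    replace (z * u * p)%Z with (u * (z * p))%Z by ring. ring. }
  destruct (Z.eq_dec (Z.gcd p m) 1) as [Hp|Hp].
  - rewrite gauss_sum_psum.
    replace (psum m (fun u => chi u * ez u m)%C) with (chi p * G)%C.
    + rewrite Cmult_assoc, (char_unit_conj m) by assumption. ring.
    + unfold G. rewrite <- (psum_mul_unit m p (fun u => chi u * ez u m)%C), <- psum_scal; auto.
      * apply psum_ext. intros u _. rewrite (dc_mul m chi H), (Z.mul_comm u). ring.
      * intros u. specialize (Per 1%Z u). cbv beta in Per. now rewrite !Z.mul_1_r in Per.
  - rewrite (dc_zero m chi H p Hp), Cconj_0, Cmult_0_l.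
    set (g := Z.gcd p m) in *.
    assert (Hg0 : (0 <= g)%Z) by apply Z.gcd_nonneg.
    assert (Hg : (0 < g)%Z).
    { assert (g <> 0)%Z; [|lia]. intros Q. apply Z.gcd_eq_0_r in Q. lia. }
    destruct (Z.gcd_divide_l p m) as [p' Hp']. destruct (Z.gcd_divide_r p m) as [d Hd].
    fold g in Hp', Hd.
    assert (Hdpos : (0 < d < m)%Z) by nia.
    destruct (Hprim d Hdpos) as (x & y & Hx & Hy & Hxy & Hne); [exists g; lia|].
    destruct (unit_inverse y m Hy) as [y' Hy'].
    assert (Hy'u : Z.gcd y' m = 1%Z) by (apply (gcd_1_of_inverse y' y); now rewrite Z.mul_comm).
    assert (Hz : Z.gcd (x * y') m = 1%Z).
    { apply Zgcd_1_rel_prime, rel_prime_sym, rel_prime_mult; apply rel_prime_sym, Zgcd_1_rel_prime; assumption. }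
    pose proof (Tw (x * y')%Z Hz) as E.
    rewrite (psum_ext m _ (fun u => chi u * ez (u * p) m)%C) in E.
    2:{ intros u _. f_equal. apply ez_eqm; [lia|].
        assert (D : (d | x * y' - 1)%Z).
        { replace (x * y' - 1)%Z with ((x - y) * y' + (y * y' - 1))%Z by ring.
          apply Z.divide_add_r.
          - apply Z.divide_mul_l. exists (x / d - y / d)%Z.
            pose proof (Z_div_mod_eq_full x d). pose proof (Z_div_mod_eq_full y d). lia.
          - apply Z.divide_trans with m; [exists g; lia|exact Hy']. }
        destruct D as [t Ht]. exists (u * p' * t)%Z.
        replace (u * (x * y' * p) - u * p)%Z with (u * p * (x * y' - 1))%Z by ring.
        rewrite Ht, Hp', Hd. ring. }
    fold G in E.
    assert (N : (1 - chi (x * y')%Z)%C <> RtoC 0).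
    { intros Q. apply Hne.
      assert (Q1 : chi (x * y')%Z = RtoC 1).
      { transitivity (RtoC 1 - (1 - chi (x * y')%Z))%C; [ring|]. rewrite Q. ring. }
      rewrite (dc_mul m chi H) in Q1. pose proof (char_inverse m chi y y' H Hy') as Q2.
      transitivity (chi x * (chi y * chi y'))%C; [rewrite Q2; ring|].
      transitivity (chi x * chi y' * chi y)%C; [ring|]. rewrite Q1. ring. }
    transitivity (/ (1 - chi (x * y')%Z) * (G - chi (x * y')%Z * G))%C; [field; exact N|].
    rewrite <- E. ring.
Qed.

Lemma char_sum_0 (m : Z) (chi : Z -> C) : primitive_char m chi -> (1 < m)%Z -> psum m chi = RtoC 0.
Proof.
  intros H Hm. pose proof (gauss_twist m chi 0 H) as E.
  rewrite (dc_zero m chi (proj1 H) 0) in E by (rewrite Z.gcd_0_l; lia).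
  rewrite Cconj_0, Cmult_0_l in E. rewrite <- E. apply psum_ext. intros k _.
  rewrite Z.mul_0_r. unfold ez, Rdiv. rewrite Rmult_0_l, e_0. ring.
Qed.

Lemma psum_factor (A1 A2 c : Z) (X Y : Z -> C) (W : Z -> Z -> C) :
  psum A1 (fun i => psum c (fun j => psum A2 (fun i' => psum c (fun j' => X i * Y i' * W j j')%C))) =
  (psum A1 X * psum A2 Y * psum c (fun j => psum c (W j)))%C.
Proof.
  transitivity (psum A1 (fun i => psum A2 Y * psum c (fun j => psum c (W j)) * X i)%C).
  - apply psum_ext. intros i _. 
    transitivity (psum c (fun j => X i * psum A2 Y * psum c (W j))%C).
    + apply psum_ext. intros j _.
      transitivity (psum A2 (fun i' => X i * psum c (W j) * Y i')%C).
      * apply psum_ext. intros i' _. rewrite psum_scal. ring.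
      * rewrite psum_scal. ring.
    + rewrite psum_scal. ring.
  - rewrite psum_scal. ring.
Qed.

(** Write [u = c i + A1 j] and [v = c i' + A2 j']. Only [j] and [j'] enter [e(a u v / c)], so the
    sum splits into two twisted Gauss sums over [i], [i'] and the double exponential sum over [j],
    [j'] with [a A1 A2] in place of [a]. *)
Lemma twisted_double_dft (A1 A2 E1 E2 a c inv p q : Z) (chi1' chi1'' chi2' chi2'' : Z -> C) :
  primitive_char A1 chi1' -> dirichlet_char E1 chi1'' ->
  primitive_char A2 chi2' -> dirichlet_char E2 chi2'' ->
  (0 < c)%Z -> Z.gcd A1 c = 1%Z -> Z.gcd A2 c = 1%Z -> (E1 * E2 | c)%Z ->
  (c | a * A1 * A2 * inv - 1)%Z ->
  psum (c * A1) (fun u => psum (c * A2) (fun v =>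
    chi1' u * chi1'' u * (chi2' v * chi2'' v) * ez (a * u * v) c * ez (u * p) (c * A1) * ez (v * q) (c * A2)))%C =
  (gauss_sum A1 chi1' * gauss_sum A2 chi2' * chi1' c * chi2' c * (chi1'' A1 * chi2'' A2) *
   (Cconj (chi1' p) * Cconj (chi2' q)) *
   (RtoC (IZR c) * chi1'' (- inv * q)%Z * chi2'' (- inv * p)%Z * ez (- inv * p * q) c))%C.
Proof.
  intros P1 H1 P2 H2 Hc G1 G2 HE Hinv.
  pose proof (dc_pos _ _ (proj1 P1)) as HA1. pose proof (dc_pos _ _ (proj1 P2)) as HA2.
  pose proof (dc_pos _ _ H1) as HE1. pose proof (dc_pos _ _ H2) as HE2.
  assert (HE1c : (E1 | c)%Z) by (apply Z.divide_trans with (E1 * E2)%Z; [apply Z.divide_factor_l|assumption]).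
  assert (HE2c : (E2 | c)%Z) by (apply Z.divide_trans with (E1 * E2)%Z; [apply Z.divide_factor_r|assumption]).
  pose proof (char_zperiodic _ _ (proj1 P1)) as Q1. pose proof (char_zperiodic _ _ (proj1 P2)) as Q2.
  pose proof (char_zperiodic _ _ H1) as R1. pose proof (char_zperiodic _ _ H2) as R2.
  rewrite (Z.mul_comm c A1), (Z.mul_comm c A2).
  assert (PV : forall u, zperiodic (A2 * c) (fun v =>
    chi1' u * chi1'' u * (chi2' v * chi2'' v) * ez (a * u * v) c * ez (u * p) (A1 * c) * ez (v * q) (A2 * c))%C).
  { intros u v.
    rewrite (zperiodic_eqm A2 chi2' (v + A2 * c) v Q2) by (exists c; ring).
    rewrite (zperiodic_eqm E2 chi2'' (v + A2 * c) v R2)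
      by (apply Z.divide_trans with c; [assumption|exists A2; ring]).
    rewrite (ez_eqm (a * u * (v + A2 * c)) (a * u * v) c) by (try lia; exists (a * u * A2)%Z; ring).
    rewrite (ez_eqm ((v + A2 * c) * q) (v * q) (A2 * c)) by (try nia; exists q; ring). reflexivity. }
  rewrite (psum_crt A1 c); try assumption.
  2:{ intros u. apply psum_ext. intros v _.
      rewrite (zperiodic_eqm A1 chi1' (u + A1 * c) u Q1) by (exists c; ring).
      rewrite (zperiodic_eqm E1 chi1'' (u + A1 * c) u R1)
        by (apply Z.divide_trans with c; [assumption|exists A1; ring]).
      rewrite (ez_eqm (a * (u + A1 * c) * v) (a * u * v) c) by (try lia; exists (a * A1 * v)%Z; ring).
      rewrite (ez_eqm ((u + A1 * c) * p) (u * p) (A1 * c)) by (try nia; exists p; ring). reflexivity. }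
  set (A := (a * A1 * A2)%Z).
  transitivity (psum A1 (fun i => psum c (fun j => psum A2 (fun i' => psum c (fun j' =>
    (chi1' c * (chi1' i * ez (i * p) A1)) * (chi2' c * (chi2' i' * ez (i' * q) A2)) *
    ((chi1'' A1 * chi2'' A2) * (chi1'' j * chi2'' j' * ez (A * j * j' + j * p + j' * q) c))))))%C).
  { apply psum_ext. intros i _. apply psum_ext. intros j _.
    rewrite (psum_crt A2 c); try assumption; [|apply PV].
    apply psum_ext. intros i' _. apply psum_ext. intros j' _.
    rewrite (zperiodic_eqm A1 chi1' (c * i + A1 * j) (c * i) Q1) by (exists j; ring).
    rewrite (zperiodic_eqm E1 chi1'' (c * i + A1 * j) (A1 * j) R1)
      by (apply Z.divide_trans with c; [assumption|exists i; ring]).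
    rewrite (zperiodic_eqm A2 chi2' (c * i' + A2 * j') (c * i') Q2) by (exists j'; ring).
    rewrite (zperiodic_eqm E2 chi2'' (c * i' + A2 * j') (A2 * j') R2)
      by (apply Z.divide_trans with c; [assumption|exists i'; ring]).
    rewrite (dc_mul _ _ (proj1 P1)), (dc_mul _ _ (proj1 P2)), (dc_mul _ _ H1), (dc_mul _ _ H2).
    rewrite (ez_eqm (a * (c * i + A1 * j) * (c * i' + A2 * j')) (A * j * j') c);
      [|lia|exists (a * i * (c * i' + A2 * j') + a * A1 * j * i')%Z; unfold A; ring].
    replace ((c * i + A1 * j) * p)%Z with (c * (i * p) + A1 * (j * p))%Z by ring.
    replace ((c * i' + A2 * j') * q)%Z with (c * (i' * q) + A2 * (j' * q))%Z by ring.
    rewrite !ez_add.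
    rewrite (ez_cancel A1), (ez_cancel A2) by lia.
    rewrite (Z.mul_comm A1 c), (Z.mul_comm A2 c), !ez_cancel by lia. ring. }
  rewrite (psum_factor A1 A2 c (fun i => chi1' c * (chi1' i * ez (i * p) A1))%C
    (fun i' => chi2' c * (chi2' i' * ez (i' * q) A2))%C).
  rewrite !psum_scal, (gauss_twist A1), (gauss_twist A2) by assumption.
  rewrite <- (double_exponential_sum c E1 E2 A inv p q chi1'' chi2'') by assumption.
  replace (psum c (fun j => psum c (fun k => (chi1'' A1 * chi2'' A2) *
    (chi1'' j * chi2'' k * ez (A * j * k + j * p + k * q) c))))%C with
    ((chi1'' A1 * chi2'' A2) * psum c (fun j => psum c (fun k => chi1'' j * chi2'' k *
      ez (A * j * k + j * p + k * q) c)))%C.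
  - ring.
  - rewrite <- psum_scal. apply psum_ext. intros j _. now rewrite psum_scal.
Qed.

Lemma gcd_mul_1 (x y m : Z) : Z.gcd x m = 1%Z -> Z.gcd y m = 1%Z -> Z.gcd (x * y) m = 1%Z.
Proof.
  intros Hx Hy. apply Zgcd_1_rel_prime, rel_prime_sym, rel_prime_mult;
    apply rel_prime_sym, Zgcd_1_rel_prime; assumption.
Qed.

Lemma gcd_divisor_1 (x m d : Z) : Z.gcd x m = 1%Z -> (d | m)%Z -> Z.gcd x d = 1%Z.
Proof.
  intros H [k Hk]. apply Zgcd_1_rel_prime. apply rel_prime_sym.
  apply rel_prime_div with m; [|exists k; exact Hk]. apply rel_prime_sym, Zgcd_1_rel_prime, H.
Qed.

(** At a frequency divisible by [r = c / E] the exponential has period [E]. The sum consists of [r]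
    copies of a Gauss sum modulo [A E]; the [A] inside [chi] comes from writing [1 / E] as
    [A / (A E)]. *)
Lemma character_mean_multiple (A E a c r m : Z) (chi : Z -> C) :
  primitive_char (A * E) chi -> (0 < A)%Z -> (0 < E)%Z -> (0 < c)%Z -> c = (r * E)%Z ->
  psum (c * A) (fun v => chi v * ez (a * (r * m) * v) c)%C =
  (RtoC (IZR r) * (Cconj (chi (a * m * A)%Z) * gauss_sum (A * E) chi))%C.
Proof.
  intros P HA HE Hc Hr. assert (Hr0 : (0 < r)%Z) by nia.
  replace (c * A)%Z with ((A * E) * r)%Z by (rewrite Hr; ring).
  rewrite psum_mul by nia.
  rewrite <- (gauss_twist (A * E) chi (a * m * A)), <- psum_scal by assumption.
  apply psum_ext. intros i _.
  rewrite <- psum_const by lia. symmetry.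
  rewrite psum_const by lia.
  rewrite (psum_ext r _ (fun _ => chi i * ez (i * (a * m * A)) (A * E))%C).
  - rewrite psum_const by lia. ring.
  - intros j _. rewrite (zperiodic_eqm (A * E) chi (i + A * E * j) i (char_zperiodic _ _ (proj1 P)))
      by (exists j; ring).
    f_equal. rewrite Hr.
    replace (a * (r * m) * (i + A * E * j))%Z with (r * (a * m * i + (a * m * A * j) * E))%Z by ring.
    rewrite ez_cancel by lia. replace (i * (a * m * A))%Z with (A * (a * m * i))%Z by ring.
    rewrite ez_cancel by lia. rewrite ez_add, ez_multiple by lia. ring.
Qed.

(** With [v = i + A E j] the sum over [j] is a complete exponential sum modulo [r] at the frequency
    [a m A], which [r] does not divide. *)
Lemma character_mean_zero (A E a c r m : Z) (chi : Z -> C) :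
  primitive_char (A * E) chi -> (0 < A)%Z -> (0 < E)%Z -> (0 < c)%Z -> c = (r * E)%Z ->
  Z.gcd A c = 1%Z -> Z.gcd a c = 1%Z -> ~ (r | m)%Z ->
  psum (c * A) (fun v => chi v * ez (a * m * v) c)%C = RtoC 0.
Proof.
  intros P HA HE Hc Hr GA Ga Hm. assert (Hr0 : (0 < r)%Z) by nia.
  replace (c * A)%Z with ((A * E) * r)%Z by (rewrite Hr; ring).
  rewrite psum_mul by nia. apply psum_0. intros i _.
  rewrite (psum_ext r _ (fun j => chi i * ez (a * m * i) c * ez (j * (a * m * A)) r)%C).
  - rewrite psum_scal, psum_ez; [ring|assumption|].
    intros D. apply Hm.
    assert (G : Z.gcd r (a * A) = 1%Z).
    { rewrite Z.gcd_comm. apply gcd_divisor_1 with c; [apply gcd_mul_1; assumption|exists E; lia]. }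
    apply Z.gauss with (a * A)%Z; [|exact G]. now replace (a * A * m)%Z with (a * m * A)%Z by ring.
  - intros j _. rewrite (zperiodic_eqm (A * E) chi (i + A * E * j) i (char_zperiodic _ _ (proj1 P)))
      by (exists j; ring).
    replace (a * m * (i + A * E * j))%Z with (a * m * i + E * (j * (a * m * A)))%Z by ring.
    rewrite ez_add. replace (ez (E * (j * (a * m * A))) c) with (ez (j * (a * m * A)) r); [ring|].
    rewrite Hr, (Z.mul_comm r). symmetry. apply ez_cancel; lia.
Qed.

Lemma csum_multiples (f : Z -> C) (r L : nat) : (0 < r)%nat ->
  (forall m, ~ (Z.of_nat r | m)%Z -> f m = RtoC 0) ->
  csum (fun k => f (Z.of_nat (S k))) (r * L) = csum (fun k => f (Z.of_nat r * Z.of_nat (S k))%Z) L.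
Proof.
  intros Hr Hf. induction L as [|L IH].
  - rewrite Nat.mul_0_r. reflexivity.
  - rewrite Nat.mul_succ_r, csum_add, IH. cbn [csum]. f_equal.
    destruct r as [|r']; [lia|]. cbn [csum]. rewrite csum_zero.
    + replace (S (S r' * L + r'))%nat with (S r' * S L)%nat by lia.
      rewrite Nat2Z.inj_mul. ring.
    + intros k Hk. apply Hf. intros [t Ht].
      assert (E : Z.of_nat (S (S r' * L + k)) = (Z.of_nat (S r') * Z.of_nat L + Z.of_nat (S k))%Z) by lia.
      rewrite E in Ht.
      assert (E2 : Z.of_nat (S k) = (Z.of_nat (S r') * (t - Z.of_nat L))%Z) by lia.
      assert (0 < Z.of_nat (S k) < Z.of_nat (S r'))%Z by lia.
      destruct (Z_le_gt_dec (t - Z.of_nat L) 0); nia.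
Qed.

(** * Conditionally convergent series with periodic coefficients of mean zero *)

(** Full periods cancel, and fewer than [q] terms remain. *)
Lemma mean_zero_partial_sums (q : Z) (psi : Z -> C) : (0 < q)%Z -> zperiodic q psi ->
  (forall x, Cmod (psi x) <= 1) -> psum q psi = RtoC 0 ->
  forall n, Cmod (csum (fun k => psi (Z.of_nat k)) n) <= IZR q.
Proof.
  intros Hq Hper Hb H0 n. set (Q := Z.to_nat q).
  assert (Hsh : forall N, csum (fun k => psi (Z.of_nat (N + k))) Q = RtoC 0).
  { intros N. rewrite <- H0, <- (psum_shift q (Z.of_nat N) psi Hq Hper).
    apply csum_ext. intros k _. f_equal. lia. }
  assert (P : forall j r, csum (fun k => psi (Z.of_nat k)) (r + Q * j) = csum (fun k => psi (Z.of_nat k)) r).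
  { induction j as [|j IH]; intros r; [f_equal; lia|].
    replace (r + Q * S j)%nat with ((r + Q * j) + Q)%nat by lia.
    rewrite csum_add, Hsh, IH. ring. }
  assert (HQ : (Q <> 0)%nat) by lia.
  rewrite (Nat.div_mod n Q HQ), Nat.add_comm, P.
  eapply Rle_trans; [apply csum_bound with (g := fun _ => 1); auto|].
  rewrite rsum_const, Rmult_1_r. rewrite <- (Z2Nat.id q), <- INR_IZR_INZ by lia. fold Q.
  apply le_INR. pose proof (Nat.mod_upper_bound n Q HQ). lia.
Qed.

(** Summation by parts. The variation of [w] is compared with a telescoping quantity, so that its
    total beyond [N] is at most [K / N]. *)
Lemma abel_summation_tail (psi w : nat -> C) (Bs K : R) (N m : nat) : (0 < N)%nat -> 0 <= Bs -> 0 <= K ->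
  (forall n, Cmod (csum psi n) <= Bs) ->
  (forall k, (0 < k)%nat -> Cmod (w k) <= K / INR k) ->
  (forall k, (0 < k)%nat -> Cmod (w (S k) - w k) <= K / INR k - K / INR (S k)) ->
  Cmod (csum (fun k => psi (N + k)%nat * w (N + k)%nat)%C m) <= 2 * Bs * K / INR N.
Proof.
  intros HN HB HK Hs Hw Hd.
  assert (E : csum (fun k => psi (N + k)%nat * w (N + k)%nat)%C m =
    (csum psi (N + m) * w (N + m)%nat - csum psi N * w N -
     csum (fun k => csum psi (S (N + k)) * (w (S (N + k)) - w (N + k)%nat)) m)%C).
  { induction m as [|m IH]; cbn [csum].
    - rewrite Nat.add_0_r. ring.
    - rewrite IH, Nat.add_succ_r. cbn [csum]. ring. }
  rewrite E. eapply Rle_trans; [apply Cmod_minus_le|].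
  assert (T1 : Cmod (csum psi (N + m) * w (N + m)%nat - csum psi N * w N) <=
    Bs * (K / INR (N + m)) + Bs * (K / INR N)).
  { eapply Rle_trans; [apply Cmod_minus_le|]. rewrite !Cmod_mult.
    apply Rplus_le_compat; apply Rmult_le_compat; try apply Cmod_ge_0; auto; apply Hw; lia. }
  assert (T2 : Cmod (csum (fun k => csum psi (S (N + k)) * (w (S (N + k)) - w (N + k)%nat))%C m) <=
    Bs * (K / INR N - K / INR (N + m))).
  { eapply Rle_trans; [apply csum_bound with (g := fun k => Bs * (- (K / INR (N + S k)) - - (K / INR (N + k))))|].
    - intros k _. rewrite Cmod_mult. apply Rmult_le_compat; try apply Cmod_ge_0; auto.
      specialize (Hd (N + k)%nat ltac:(lia)). rewrite Nat.add_succ_r. lra.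
    - rewrite rsum_scal, (rsum_telescope (fun k => - (K / INR (N + k)))), Nat.add_0_r.
      right. ring. }
  unfold Rdiv in *. lra.
Qed.

Lemma inv_INR_difference (k : nat) : (0 < k)%nat -> 0 <= / INR k - / INR (S k).
Proof.
  intros Hk. assert (0 < INR k) by (apply lt_0_INR; lia).
  assert (/ INR (S k) <= / INR k); [|lra]. apply Rinv_le_contravar; [assumption|apply le_INR; lia].
Qed.

Lemma L1_convergent (q : Z) (psi : Z -> C) : (0 < q)%Z -> zperiodic q psi ->
  (forall x, Cmod (psi x) <= 1) -> psum q psi = RtoC 0 ->
  Clim (fun N => csum (fun k => psi (Z.of_nat (S k)) * RtoC (/ INR (S k)))%C N) (L1 psi).
Proof.
  intros Hq Hper Hb H0.
  pose proof (mean_zero_partial_sums q psi Hq Hper Hb H0) as PS.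
  assert (Hq0 : 0 <= IZR q) by (apply IZR_le; lia).
  destruct (Clim_Cauchy (fun N => csum (fun k => psi (Z.of_nat (S k)) * RtoC (/ INR (S k)))%C N)
    (2 * IZR q * 1)) as (l & Hl & _).
  - intros n m Hnm. replace m with (n + (m - n))%nat by lia. rewrite csum_add.
    replace (_ - _)%C with (csum (fun k => psi (Z.of_nat (S n + k)) * RtoC (/ INR (S n + k)))%C (m - n))
      by (cbn [Nat.add]; ring).
    apply (abel_summation_tail (fun k => psi (Z.of_nat k)) (fun k => RtoC (/ INR k)) (IZR q) 1 (S n));
      try lia; try lra; try exact PS.
    + intros k Hk. rewrite Cmod_R, Rabs_pos_eq; [unfold Rdiv; lra|].
      left; apply Rinv_0_lt_compat, lt_0_INR; lia.
    + intros k Hk. rewrite <- RtoC_minus, Cmod_R, Rabs_minus_sym.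
      rewrite Rabs_pos_eq by (apply inv_INR_difference; assumption). unfold Rdiv. lra.
  - unfold L1. rewrite (Clim_CSeries1 _ l); exact Hl.
Qed.

(** The sum factors by the Chinese remainder theorem, and [1 < D1 * D2] makes at least one of the
    two complete character sums vanish. *)
Lemma product_char_sum_0 (D1 D2 : Z) (chi1 chi2 : Z -> C) : primitive_char D1 chi1 ->
  primitive_char D2 chi2 -> Z.gcd D1 D2 = 1%Z -> (1 < D1 * D2)%Z ->
  psum (D1 * D2) (fun x => Cconj (chi1 x) * chi2 x)%C = RtoC 0.
Proof.
  intros P1 P2 Hg Hn.
  pose proof (dc_pos _ _ (proj1 P1)) as H1. pose proof (dc_pos _ _ (proj1 P2)) as H2.
  pose proof (char_zperiodic _ _ (proj1 P1)) as Q1. pose proof (char_zperiodic _ _ (proj1 P2)) as Q2.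
  rewrite psum_crt; try assumption.
  2:{ intros x. rewrite (zperiodic_eqm D1 chi1 (x + D1 * D2) x Q1) by (exists D2; ring).
      rewrite (zperiodic_eqm D2 chi2 (x + D1 * D2) x Q2) by (exists D1; ring). reflexivity. }
  transitivity (psum D1 (fun i => Cconj (chi1 (D2 * i)%Z)) * psum D2 (fun j => chi2 (D1 * j)%Z))%C.
  { transitivity (psum D1 (fun i => psum D2 (fun j => chi2 (D1 * j)%Z) * Cconj (chi1 (D2 * i)%Z))%C).
    - apply psum_ext. intros i _. rewrite Cmult_comm, <- psum_scal. apply psum_ext. intros j _.
      rewrite (zperiodic_eqm D1 chi1 (D2 * i + D1 * j) (D2 * i) Q1) by (exists j; ring).
      rewrite (zperiodic_eqm D2 chi2 (D2 * i + D1 * j) (D1 * j) Q2) by (exists i; ring). reflexivity.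
    - rewrite psum_scal. ring. }
  rewrite (psum_mul_unit D2 D1 chi2) by (assumption).
  rewrite (psum_mul_unit D1 D2 (fun x => Cconj (chi1 x)));
    [|assumption|intros x; now rewrite Q1|now rewrite Z.gcd_comm].
  destruct (Z.eq_dec D2 1) as [E|E].
  - assert (C0 : psum D1 (fun x => Cconj (chi1 x)) = Cconj (psum D1 chi1)).
    { unfold psum. generalize (Z.to_nat D1). induction n as [|n IH]; cbn [csum]; [symmetry; apply Cconj_0|].
      rewrite IH, Cplus_conj. reflexivity. }
    rewrite C0, char_sum_0, Cconj_0 by (assumption || lia). ring.
  - rewrite (char_sum_0 D2) by (assumption || lia). ring.
Qed.

(** * Double Poisson summation *)

Lemma le_of_le_inv (X K b : R) : (forall n, X <= K + b / INR (S n)) -> X <= K.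
Proof.
  intros H. rewrite <- (Rplus_0_r K).
  apply (is_lim_seq_le (fun _ => X) (fun n => K + b / INR (S n)) X (K + 0)); auto.
  - apply is_lim_seq_const.
  - apply is_lim_seq_plus'; [apply is_lim_seq_const|apply is_lim_seq_scal_inv_S].
Qed.

Lemma CInt_mult_csum (g : R -> C) (x : nat -> C) (F : nat -> R -> C) (n : nat) (A B : R) : A <= B ->
  (forall t, A <= t <= B -> Cct g t) -> (forall k t, A <= t <= B -> Cct (F k) t) ->
  CInt (fun t => g t * csum (fun k => x k * F k t) n)%C A B =
  csum (fun k => x k * CInt (fun t => g t * F k t) A B)%C n.
Proof.
  intros HAB Hg HF.
  rewrite (CInt_ext _ (fun t => csum (fun k => x k * (g t * F k t)) n)%C); [|assumption|].
  - rewrite (CInt_csum (fun k t => x k * (g t * F k t))%C); [|assumption|].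
    + apply csum_ext. intros k _. apply (CInt_scal (x k) (fun t => g t * F k t)%C); [assumption|].
      intros t Ht. apply Cct_mult; auto.
    + intros k t _ Ht. apply Cct_mult; [apply Cct_const|apply Cct_mult; auto].
  - intros t _. rewrite <- csum_scal. apply csum_ext. intros; ring.
Qed.

Lemma CInt_mult_zsum (g : R -> C) (x : Z -> C) (F : Z -> R -> C) (n : nat) (A B : R) : A <= B ->
  (forall t, A <= t <= B -> Cct g t) -> (forall k t, A <= t <= B -> Cct (F k) t) ->
  CInt (fun t => g t * zsum (fun k => x k * F k t) n)%C A B =
  zsum (fun k => x k * CInt (fun t => g t * F k t) A B)%C n.
Proof.
  intros HAB Hg HF. unfold zsum.
  set (xp := fun k => x (Z.of_nat (S k))). set (xm := fun k => x (- Z.of_nat (S k))%Z).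
  set (Fp := fun k => F (Z.of_nat (S k))). set (Fm := fun k => F (- Z.of_nat (S k))%Z).
  assert (Cp : forall y H t, (forall k, Cct (H k) t) -> Cct (fun t => csum (fun k => y k * H k t) n)%C t).
  { intros y H t Hc. apply (Cct_csum (fun k t => y k * H k t)%C). intros k _.
    apply Cct_mult; [apply Cct_const|auto]. }
  rewrite (CInt_ext _ (fun t => x 0%Z * (g t * F 0%Z t) +
    (g t * csum (fun k => xp k * Fp k t) n + g t * csum (fun k => xm k * Fm k t) n))%C); [|assumption|].
  - rewrite (CInt_plus (fun t => x 0%Z * (g t * F 0%Z t))%C
      (fun t => g t * csum (fun k => xp k * Fp k t) n + g t * csum (fun k => xm k * Fm k t) n)%C);
      [|assumption| |].
    + f_equal.
      * apply (CInt_scal (x 0%Z) (fun t => g t * F 0%Z t)%C); [assumption|].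
        intros t Ht. apply Cct_mult; auto.
      * rewrite (CInt_plus (fun t => g t * csum (fun k => xp k * Fp k t) n)%C
          (fun t => g t * csum (fun k => xm k * Fm k t) n)%C); [|assumption| |].
        -- rewrite !CInt_mult_csum by (unfold Fp, Fm; auto). rewrite <- csum_plus. reflexivity.
        -- intros t Ht. apply Cct_mult; [auto|apply Cp; intros; apply HF, Ht].
        -- intros t Ht. apply Cct_mult; [auto|apply Cp; intros; apply HF, Ht].
    + intros t Ht. apply Cct_mult; [apply Cct_const|apply Cct_mult; auto].
    + intros t Ht. apply Cct_plus; (apply Cct_mult; [auto|apply Cp; intros; apply HF, Ht]).
  - intros t _. unfold xp, xm, Fp, Fm. rewrite csum_plus. ring.
Qed.

(** The number [eps + i x] combines the damping rate with the frequency. *)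
Definition damp (eps x : R) : C := (eps, x).

(** The Fourier transform in [m] of the damped summand as a function of [l], after the substitution
    [t = m l]; the damping in [l] is included. *)
Definition om (A B : R) (g : R -> C) (eps x l : R) : C :=
  CInt (fun t => g t * kf 1 (RtoC eps) (RtoC t * damp eps x) l)%C A B.

Lemma kf_cct_param (j : nat) (al be : C) (y t : R) : Cct (fun t => kf j al (RtoC t * be) y) t.
Proof.
  destruct (Rle_dec y 0) as [Hy|Hy].
  - apply Cct_ext with (fun _ => RtoC 0); [intros; rewrite kf_nonpos; auto|apply Cct_const].
  - apply Cct_ext with (fun t => cexp (- al * RtoC y - RtoC t * be * RtoC (/ y)) * RtoC (/ y ^ j))%C.
    { intros s. rewrite kf_pos by lra. reflexivity. }
    apply Cct_mult; [|apply Cct_const]. apply Cct_cexp, Cct_minus; [apply Cct_const|].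
    apply Cct_mult; [|apply Cct_const]. apply Cct_mult; [|apply Cct_const].
    apply Cct_RtoC, continuous_id.
Qed.

(** Poisson summation in the second variable under the integral over [t]; it is uniform there
    because [t (eps + i x)] has real part at least [A eps]. *)
Lemma om_poisson (q : nat) (psi : Z -> C) (Psi A B eps x : R) (g : R -> C) :
  (0 < q)%nat -> periodic q psi -> (forall k, Cmod (psi k) <= Psi) -> 0 < A <= B ->
  (forall t, Cct g t) -> 0 < eps ->
  exists M, 0 <= M /\ forall L K,
  Cmod (csum (fun l => psi (Z.of_nat l) * om A B g eps x (INR l))%C (q * L)
    - RtoC (/ INR q) * zsum (fun k => dft q psi k *
        bessel_transform A B g (damp eps (2 * PI * IZR k / INR q)) (damp eps x))%C K)
  <= M * (/ INR (S L) + / INR (S K)).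
Proof.
  intros Hq Hper Hpsi HAB Hg He.
  destruct (Cct_bounded g A B ltac:(lra) (fun t _ => Hg t)) as (Kg & HKg & BG).
  pose proof (Cmod_ge_0 (damp eps x)) as Hdx.
  destruct (kf_poisson q psi Psi eps (A * eps) (eps + B * Cmod (damp eps x)) Hq Hper Hpsi He ltac:(nra))
    as (M & HM).
  exists (2 * (Kg * Rabs M) * (B - A)). split.
  { apply Rmult_le_pos; [|lra]. pose proof (Rabs_pos M). nra. }
  intros L K.
  set (S0 := fun t => csum (fun l => psi (Z.of_nat l) * kf 1 (RtoC eps) (RtoC t * damp eps x) (INR l))%C (q * L)).
  set (Z0 := fun t => zsum (fun k => dft q psi k *
    Jint 1 (damp eps (2 * PI * IZR k / INR q)) (RtoC t * damp eps x))%C K).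
  assert (CF : forall k t, A <= t <= B -> Cct (fun t => kf 1 (RtoC eps) (RtoC t * damp eps x) (INR k)) t)
    by (intros; apply kf_cct_param).
  assert (CJ : forall k t, A <= t <= B ->
    Cct (fun t => Jint 1 (damp eps (2 * PI * IZR k / INR q)) (RtoC t * damp eps x)) t).
  { intros k t Ht. apply Jint_cct; simpl; lra. }
  assert (CS : forall t, A <= t <= B -> Cct S0 t).
  { intros t Ht. apply (Cct_csum (fun l t => psi (Z.of_nat l) * kf 1 (RtoC eps) (RtoC t * damp eps x) (INR l))%C).
    intros k _. apply Cct_mult; [apply Cct_const|auto]. }
  assert (CZ : forall t, A <= t <= B -> Cct Z0 t).
  { intros t Ht. unfold Z0, zsum. apply Cct_plus; [apply Cct_mult; [apply Cct_const|auto]|].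
    apply (Cct_csum (fun k t => dft q psi (Z.of_nat (S k)) *
      Jint 1 (damp eps (2 * PI * IZR (Z.of_nat (S k)) / INR q)) (RtoC t * damp eps x) +
      dft q psi (- Z.of_nat (S k)) * Jint 1 (damp eps (2 * PI * IZR (- Z.of_nat (S k)) / INR q))
        (RtoC t * damp eps x))%C).
    intros k _. apply Cct_plus; (apply Cct_mult; [apply Cct_const|auto]). }
  replace (_ - _)%C with (CInt (fun t => g t * (S0 t - RtoC (/ INR q) * Z0 t))%C A B).
  - assert (HLK : 0 < / INR (S L) + / INR (S K)).
    { apply Rplus_lt_0_compat; apply Rinv_0_lt_compat, lt_0_INR; lia. }
    replace (2 * (Kg * Rabs M) * (B - A) * (/ INR (S L) + / INR (S K))) with
      (2 * (Kg * (Rabs M * (/ INR (S L) + / INR (S K)))) * (B - A)) by ring.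
    apply CInt_bound_const; [lra| |].
    + intros t Ht. apply Cct_mult; [auto|]. apply Cct_minus; [auto|].
      apply Cct_mult; [apply Cct_const|auto].
    + intros t Ht. rewrite Cmod_mult. apply Rmult_le_compat; [apply Cmod_ge_0|apply Cmod_ge_0|auto|].
      apply Rle_trans with (M * (/ INR (S L) + / INR (S K))).
      2:{ apply Rmult_le_compat_r; [lra|apply Rle_abs]. }
      unfold S0, Z0.
      rewrite (zsum_ext _ (fun k => dft q psi k * Jint 1 (RtoC eps + imag (2 * PI * IZR k / INR q))
        (RtoC t * damp eps x))%C).
      2:{ intros k. f_equal. f_equal. apply C_ext; simpl; ring. }
      apply HM.
      * simpl; lra.
      * simpl. nra.
      * rewrite Cmod_R, Rabs_pos_eq by lra. nra.
      * rewrite Cmod_RtoC_mult by lra. nra.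
  - transitivity (CInt (fun t => g t * S0 t - RtoC (/ INR q) * (g t * Z0 t))%C A B).
    { apply CInt_ext; [lra|]. intros; ring. }
    rewrite (CInt_minus (fun t => g t * S0 t)%C (fun t => RtoC (/ INR q) * (g t * Z0 t))%C);
      [|lra|intros; apply Cct_mult; auto|].
    2:{ intros t Ht. apply Cct_mult; [apply Cct_const|apply Cct_mult; auto]. }
    rewrite (CInt_scal _ (fun t => g t * Z0 t)%C); [|lra|intros; apply Cct_mult; auto].
    unfold S0, Z0. f_equal.
    + apply (CInt_mult_csum g (fun l => psi (Z.of_nat l))
        (fun l t => kf 1 (RtoC eps) (RtoC t * damp eps x) (INR l))); auto. lra.
    + f_equal. apply (CInt_mult_zsum g (dft q psi)
        (fun k t => Jint 1 (damp eps (2 * PI * IZR k / INR q)) (RtoC t * damp eps x))); auto. lra.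
Qed.

Lemma test_family_bounded (A B : R) (G : nat -> R -> C) (n : nat) : A <= B -> test_family A B G ->
  exists K, 0 <= K /\ forall x, Cmod (G n x) <= K.
Proof.
  intros HAB [HD HZ].
  destruct (Cct_bounded (G n) A B HAB) as (K & HK & BK); [intros; eapply Cder_Cct, HD|].
  exists K. split; [assumption|]. intros x.
  destruct (Rle_dec x A) as [H|H]; [rewrite HZ, Cmod_0 by (now left); assumption|].
  destruct (Rle_dec B x) as [H'|H']; [rewrite HZ, Cmod_0 by (now right); assumption|].
  apply BK. lra.
Qed.

Lemma CInt_zero (f : R -> C) (a b : R) : a <= b -> (forall x, a <= x <= b -> f x = RtoC 0) ->
  CInt f a b = RtoC 0.
Proof.
  intros Hab H. rewrite (CInt_ext f (fun _ => RtoC 0)) by assumption.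
  apply C_ext; simpl; rewrite (RInt_const (V := R_CompleteNormedModule)); apply Rmult_0_r.
Qed.

Lemma CInt_support (f : R -> C) (A B X : R) : 0 <= A <= B -> B <= X -> (forall x, 0 <= x <= X -> Cct f x) ->
  (forall x, x <= A \/ B <= x -> f x = RtoC 0) -> CInt f 0 X = CInt f A B.
Proof.
  intros HAB HX Hc Hz.
  rewrite <- (CInt_Chasles f 0 A X), <- (CInt_Chasles f A B X); try lra; try (intros; apply Hc; lra).
  rewrite (CInt_zero f 0 A), (CInt_zero f B X); try lra.
  - ring.
  - intros; apply Hz; lra.
  - intros; apply Hz; lra.
Qed.

(** Poisson summation in the first variable at fixed [l]. Two derivatives of [g(l x)] cost [l^2],
    which the damping makes summable over [l]; [K] is chosen before [psi], [eps] and [l]. *)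
Lemma damped_poisson (A B : R) (G : nat -> R -> C) (q : nat) : (0 < q)%nat -> 0 < A <= B ->
  test_family A B G ->
  exists K, 0 <= K /\ forall (psi : Z -> C) eps l M N, periodic q psi -> (forall k, Cmod (psi k) <= 1) ->
  0 < eps <= 1 ->
  Cmod (RtoC (exp (- eps * INR l)) *
      csum (fun m => psi (Z.of_nat m) * (G O (INR m * INR l)%R * RtoC (exp (- eps * INR m))))%C (q * M)
    - RtoC (/ INR q) * zsum (fun p => dft q psi p *
        om A B (G O) eps (2 * PI * IZR p / INR q) (INR l))%C N)
  <= K * (INR l ^ 2 * exp (- eps * INR l)) * (/ INR (S M) + / INR (S N)).
Proof.
  intros Hq HAB HG. pose proof HG as [HD HZ].
  destruct (test_family_bounded A B G 0 ltac:(lra) HG) as (K0 & HK0 & B0).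
  destruct (test_family_bounded A B G 1 ltac:(lra) HG) as (K1 & HK1 & B1).
  destruct (test_family_bounded A B G 2 ltac:(lra) HG) as (K2 & HK2 & B2).
  set (Kb := (K0 + 2 * K1 + K2) * (1 + B) ^ 2).
  assert (HKb : 0 <= Kb) by (unfold Kb; pose proof (pow2_ge_0 (1 + B)); nra).
  assert (Hq0 : 0 < INR q) by (apply lt_0_INR; lia).
  exists (4 * INR q ^ 3 * 1 * Kb). split; [pose proof (pow_lt (INR q) 3 Hq0); nra|].
  intros psi eps l M N Hper Hpsi He.
  (* At [l = 0] everything vanishes: the test function at [0] on one side, [kf] at [0] on the
     other. *)
  destruct (Nat.eq_dec l 0) as [->|Hl0].
  { simpl INR. rewrite (csum_zero (fun m => _)).
    2:{ intros m _. rewrite Rmult_0_r, HZ by lra. ring. }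
    rewrite (zsum_ext _ (fun _ => RtoC 0 * 0)%C).
    - rewrite zsum_scal. replace (_ - _)%C with (RtoC 0) by ring. rewrite Cmod_0.
      right. ring.
    - intros p. unfold om. rewrite CInt_zero; [ring|lra|]. intros t _. rewrite kf_nonpos by lra. ring. }
  assert (Hl : 1 <= INR l) by (apply (le_INR 1); lia).
  set (L := INR l) in *.
  set (f := fun x => (G O (L * x)%R * RtoC (exp (- eps * x)))%C).
  set (f1 := fun x => ((RtoC L * G 1%nat (L * x)%R - RtoC eps * G O (L * x)%R) * RtoC (exp (- eps * x)))%C).
  set (f2 := fun x => ((RtoC (L * L) * G 2%nat (L * x)%R - RtoC (2 * eps * L) * G 1%nat (L * x)%R
    + RtoC (eps * eps) * G O (L * x)%R) * RtoC (exp (- eps * x)))%C).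
  assert (Dlin : forall x, is_derive (fun t => L * t) x L) by (intros; auto_derive; [exact I|ring]).
  assert (Dexp : forall x, Cder (fun x => RtoC (exp (- eps * x))) x (RtoC (- eps * exp (- eps * x)))).
  { intros x. apply Cder_RtoC. auto_derive; [exact I|ring]. }
  assert (DG : forall n x, Cder (fun x => G n (L * x)%R) x (RtoC L * G (S n) (L * x)%R)%C).
  { intros n x. apply (Cder_comp (G n) (fun t => L * t)); [apply HD|apply Dlin]. }
  assert (Df : forall x, Cder f x (f1 x)).
  { intros x. eapply Cder_eq; [|apply Cder_mult; [apply DG|apply Dexp]].
    unfold f1. rewrite RtoC_mult, RtoC_opp. ring. }
  assert (Df1 : forall x, Cder f1 x (f2 x)).
  { intros x. eapply Cder_eq; [|apply Cder_mult; [apply Cder_minus; apply Cder_scal, DG|apply Dexp]].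
    unfold f2. rewrite !RtoC_mult, RtoC_opp. ring. }
  assert (CG : forall n x, Cct (fun x => G n (L * x)%R) x) by (intros; eapply Cder_Cct, DG).
  assert (Cf2 : forall x, Cct f2 x).
  { intros x. apply Cct_mult; [|eapply Cder_Cct, Dexp].
    apply Cct_plus; [apply Cct_minus|]; (apply Cct_mult; [apply Cct_const|apply CG]). }
  assert (Bex : forall x, 0 <= x -> 0 <= exp (- eps * x) <= 1).
  { intros x Hx. split; [left; apply exp_pos|]. rewrite <- exp_0. apply exp_le. nra. }
  assert (Supp : forall (h : R -> C) K', 0 <= K' -> (forall x, B < L * x -> h x = RtoC 0) ->
    (forall x, 0 <= x -> Cmod (h x) <= K') -> K' * (1 + B) ^ 2 <= Kb * L ^ 2 ->
    forall x, 0 <= x -> Cmod (h x) <= Kb * L ^ 2 / (1 + x) ^ 2).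
  { intros h K' HK' Hh0 Hh HKK x Hx. destruct (Rlt_dec B (L * x)) as [H|H].
    - rewrite Hh0, Cmod_0 by assumption. apply Rdiv_le_0_compat; [|nra].
      pose proof (pow2_ge_0 L). nra.
    - eapply Rle_trans; [apply Hh, Hx|].
      apply Rmult_le_reg_r with ((1 + x) ^ 2); [nra|].
      unfold Rdiv. rewrite Rmult_assoc, Rinv_l, Rmult_1_r by nra.
      eapply Rle_trans; [|exact HKK]. apply Rmult_le_compat_l; [assumption|].
      apply pow_incr. split; [lra|]. assert (x <= L * x) by nra. lra. }
  assert (HL2 : 1 <= L ^ 2) by nra.
  assert (Q1B : 0 <= (1 + B) ^ 2) by apply pow2_ge_0.
  assert (Bf : forall x, 0 <= x -> Cmod (f x) <= Kb * L ^ 2 / (1 + x) ^ 2).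
  { apply (Supp f K0); [assumption| | |].
    - intros x Hx. unfold f. rewrite HZ by lra. ring.
    - intros x Hx. unfold f. rewrite Cmod_mult, Cmod_R. specialize (Bex x Hx).
      rewrite Rabs_pos_eq by lra. specialize (B0 (L * x)). pose proof (Cmod_ge_0 (G O (L * x))). nra.
    - unfold Kb. assert (K0 <= (K0 + 2 * K1 + K2) * L ^ 2) by nra.
      replace ((K0 + 2 * K1 + K2) * (1 + B) ^ 2 * L ^ 2) with ((K0 + 2 * K1 + K2) * L ^ 2 * (1 + B) ^ 2) by ring.
      apply Rmult_le_compat_r; assumption. }
  assert (Bf2 : forall x, 0 <= x -> Cmod (f2 x) <= Kb * L ^ 2 / (1 + x) ^ 2).
  { apply (Supp f2 ((K0 + 2 * K1 + K2) * L ^ 2)).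
    - nra.
    - intros x Hx. unfold f2. rewrite !HZ by lra. ring.
    - intros x Hx. unfold f2. rewrite Cmod_mult, Cmod_R. specialize (Bex x Hx).
      rewrite (Rabs_pos_eq (exp _)) by lra.
      assert (T : Cmod (RtoC (L * L) * G 2%nat (L * x)%R - RtoC (2 * eps * L) * G 1%nat (L * x)%R
        + RtoC (eps * eps) * G O (L * x)%R) <= (K0 + 2 * K1 + K2) * L ^ 2).
      { eapply Rle_trans; [apply Cmod_triangle|].
        eapply Rle_trans; [apply Rplus_le_compat_r, Cmod_minus_le|].
        rewrite !Cmod_RtoC_mult by nra.
        specialize (B0 (L * x)). specialize (B1 (L * x)). specialize (B2 (L * x)).
        pose proof (Cmod_ge_0 (G O (L * x))). pose proof (Cmod_ge_0 (G 1%nat (L * x))).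
        pose proof (Cmod_ge_0 (G 2%nat (L * x))).
        assert (L * L * Cmod (G 2%nat (L * x)) <= L ^ 2 * K2) by (apply Rmult_le_compat; nra).
        assert (2 * eps * L * Cmod (G 1%nat (L * x)) <= 2 * L ^ 2 * K1) by (apply Rmult_le_compat; nra).
        assert (eps * eps * Cmod (G O (L * x)) <= L ^ 2 * K0) by (apply Rmult_le_compat; nra).
        lra. }
      pose proof (Cmod_ge_0 (RtoC (L * L) * G 2%nat (L * x)%R - RtoC (2 * eps * L) * G 1%nat (L * x)%R
        + RtoC (eps * eps) * G O (L * x)%R)). nra.
    - unfold Kb. right. ring. }
  pose proof (poisson q psi 1 f f1 f2 (Kb * L ^ 2) N M Hq Hper Hpsi Df Df1 Cf2) as P.
  assert (P' := P ltac:(intros x Hx; unfold f; rewrite HZ by (left; nra); ring)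
    ltac:(intros x Hx; unfold f2; rewrite !HZ by (left; nra); ring) Bf Bf2). clear P.
  set (el := exp (- eps * L)). assert (Hel : 0 < el) by apply exp_pos.
  assert (Eom : forall p, om A B (G O) eps (2 * PI * IZR p / INR q) L =
    (RtoC el * Cint0oo (fun x => f x * e (- IZR p / INR q * x)))%C).
  { intros p. set (xp := 2 * PI * IZR p / INR q).
    set (h := fun t => (G O t * cexp (- damp eps xp * RtoC (t / L)))%C).
    assert (Ch : forall t, Cct h t).
    { intros t. apply Cct_mult; [eapply Cder_Cct, HD|]. apply Cct_cexp.
      apply Cct_mult; [apply Cct_const|]. apply Cct_RtoC.
      apply (continuous_derive _ _ (/ L)). auto_derive; [lra|]. field. lra. }
    assert (Eh : forall x, (f x * e (- IZR p / INR q * x))%C = h (L * x + 0)).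
    { intros x. unfold f, h. rewrite Rplus_0_r, e_cexp.
      replace (RtoC (exp (- eps * x))) with (cexp (RtoC (- eps * x))).
      - rewrite <- Cmult_assoc, <- cexp_plus. f_equal. f_equal.
        apply C_ext; unfold xp; simpl; field; lra.
      - apply C_ext; simpl; rewrite ?cos_0, ?sin_0; ring. }
    assert (Ec : Cint0oo (fun x => f x * e (- IZR p / INR q * x))%C = (RtoC (/ L) * CInt h A B)%C).
    { rewrite (Cint0oo_ext _ (fun x => h (L * x + 0))) by (intros; apply Eh).
      apply Clim_Cint0oo. destruct (INR_unbounded B) as [n0 Hn0].
      apply (is_lim_seq_incr_n (fun n => Cmod (CInt (fun x => h (L * x + 0)) 0 (INR n) - _)) n0 0).
      change (Clim (fun n => CInt (fun x => h (L * x + 0)) 0 (INR (n + n0))) (RtoC (/ L) * CInt h A B)%C).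
      apply Clim_ext with (fun _ => RtoC (/ L) * CInt h A B)%C; [|apply Clim_const].
      intros n. assert (Hn : B <= INR (n + n0)) by (apply Rle_trans with (INR n0); [lra|apply le_INR; lia]).
      rewrite CInt_comp_lin; [|lra|lra|assumption]. f_equal.
      rewrite Rmult_0_r, Rplus_0_l, Rplus_0_r. symmetry. apply CInt_support; [lra|nra|auto|].
      intros x Hx. unfold h. rewrite HZ by assumption. ring. }
    rewrite Ec. unfold om. rewrite Cmult_assoc, <- RtoC_mult, <- (CInt_scal _ h); [|lra|auto].
    apply CInt_ext; [lra|]. intros t Ht. unfold h. rewrite kf_pos, pow_1 by lra.
    replace (cexp (- RtoC eps * RtoC L - RtoC t * damp eps xp * RtoC (/ L))) with
      (RtoC el * cexp (- damp eps xp * RtoC (t / L)))%C.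
    - rewrite RtoC_mult. ring.
    - replace (RtoC el) with (cexp (RtoC (- eps * L))).
      + rewrite <- cexp_plus. f_equal. unfold Rdiv. rewrite !RtoC_mult, RtoC_opp. ring.
      + unfold el. apply C_ext; simpl; rewrite ?cos_0, ?sin_0; ring. }
  rewrite (zsum_ext _ (fun p => RtoC el * (dft q psi p * Cint0oo (fun x => f x * e (- IZR p / INR q * x))))%C).
  2:{ intros p. rewrite Eom. ring. }
  rewrite zsum_scal.
  replace (_ - _)%C with (RtoC el * (csum (fun m => psi (Z.of_nat m) * f (INR m)) (q * M) -
    RtoC (/ INR q) * zsum (fun p => dft q psi p * Cint0oo (fun x => f x * e (- IZR p / INR q * x))) N))%C.
  2:{ rewrite (csum_ext (fun m => psi (Z.of_nat m) * (G O (INR m * L)%R * RtoC (exp (- eps * INR m))))%C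
        (fun m => psi (Z.of_nat m) * f (INR m))%C).
      - ring.
      - intros m _. unfold f. now rewrite (Rmult_comm L). }
  rewrite Cmod_RtoC_mult by lra.
  replace (4 * INR q ^ 3 * 1 * Kb * (L ^ 2 * el) * (/ INR (S M) + / INR (S N))) with
    (el * (4 * INR q ^ 3 * 1 * (Kb * L ^ 2) * (/ INR (S M) + / INR (S N)))) by ring.
  apply Rmult_le_compat_l; [lra|]. exact P'.
Qed.

(** An iterated limit: [b] may depend on [n], so [l] tends to infinity before [n] does. *)
Lemma le_of_le_inv2 (X K : R) :
  (exists a, forall n, exists b, forall l, X <= K + a / INR (S n) + b / INR (S l)) -> X <= K.
Proof.
  intros (a & H). apply (le_of_le_inv X K a). intros n. destruct (H n) as (b & Hb).
  apply (le_of_le_inv X _ b). exact Hb.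
Qed.

Lemma inv_INR_le (n m : nat) : (n <= m)%nat -> / INR (S m) <= / INR (S n).
Proof.
  intros H. apply Rinv_le_contravar; [apply lt_0_INR; lia|apply le_INR; lia].
Qed.

Lemma inv_INR_S_pos (n : nat) : 0 < / INR (S n).
Proof. apply Rinv_0_lt_compat, lt_0_INR. lia. Qed.

Lemma csum_family_bound (a : nat -> nat -> C) (n : nat) :
  (forall k, exists M, 0 <= M /\ forall L, Cmod (a k L) <= M / INR (S L)) ->
  exists M, 0 <= M /\ forall L, Cmod (csum (fun k => a k L) n) <= M / INR (S L).
Proof.
  intros H. induction n as [|n (M & HM & IH)].
  - exists 0. split; [lra|]. intros L. cbn [csum]. rewrite Cmod_0. unfold Rdiv. lra.
  - destruct (H n) as (M' & HM' & H'). exists (M + M'). split; [lra|]. intros L.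
    cbn [csum]. eapply Rle_trans; [apply Cmod_triangle|].
    specialize (IH L). specialize (H' L). unfold Rdiv in *. lra.
Qed.

Definition quad (F : Z -> Z -> C) (i j : nat) : C :=
  (F (Z.of_nat (S i)) (Z.of_nat (S j)) + F (Z.of_nat (S i)) (- Z.of_nat (S j))%Z +
   F (- Z.of_nat (S i))%Z (Z.of_nat (S j)) + F (- Z.of_nat (S i))%Z (- Z.of_nat (S j))%Z)%C.

Definition dsum (f : nat -> nat -> C) (N K : nat) : C := csum (fun i => csum (f i) K) N.

(** The extra pairs have [j >= N] or [i >= N]; each of these two families contributes at most
    [4 Kf / (N + 1)]. *)
Lemma dsum_tail (f : nat -> nat -> C) (Kf : R) (N n k : nat) : 0 <= Kf ->
  (forall i j, Cmod (f i j) <= Kf / (INR (S i) ^ 2 * INR (S j) ^ 2)) ->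
  Cmod (dsum f (N + n) (N + k) - dsum f N N) <= 8 * Kf / INR (S N).
Proof.
  intros HK Hf.
  assert (P : forall i, 0 < INR (S i)) by (intros; apply lt_0_INR; lia).
  assert (Hin : forall i u m, Cmod (csum (fun j => f i (u + j)%nat) m) <=
    2 * Kf / INR (S u) * / INR (S i) ^ 2).
  { intros i u m. eapply Rle_trans.
    - apply (csum_bound _ (fun j => Kf / INR (S i) ^ 2 * / INR (S (u + j)) ^ 2)). intros j _.
      eapply Rle_trans; [apply Hf|]. right. field. split; apply Rgt_not_eq, P.
    - rewrite rsum_scal. pose proof (rsum_inv_sqr u m) as Hr.
      assert (0 <= Kf / INR (S i) ^ 2).
      { apply Rdiv_le_0_compat; [assumption|apply pow_lt, P]. }
      apply Rle_trans with (Kf / INR (S i) ^ 2 * (2 / INR (S u))).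
      + apply Rmult_le_compat_l; assumption.
      + right. field. split; apply Rgt_not_eq, P. }
  assert (Hs : forall m, rsum (fun i => / INR (S i) ^ 2) m <= 2).
  { intros m. pose proof (rsum_inv_sqr 0 m) as Hr. simpl INR in Hr at 2.
    rewrite Rdiv_1_r in Hr. exact Hr. }
  unfold dsum. rewrite csum_add.
  replace (_ - _)%C with (csum (fun i => csum (fun j => f i (N + j)%nat) k) N +
    csum (fun i => csum (f (N + i)%nat) (N + k)) n)%C.
  2:{ rewrite (csum_ext (fun i => csum (f i) (N + k)) (fun i => csum (f i) N + csum (fun j => f i (N + j)%nat) k)%C)
        by (intros; apply csum_add). rewrite csum_plus. ring. }
  eapply Rle_trans; [apply Cmod_triangle|].
  replace (8 * Kf / INR (S N)) with (2 * Kf / INR (S N) * 2 + 2 * Kf * (2 / INR (S N)))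
    by (field; apply Rgt_not_eq, P).
  apply Rplus_le_compat.
  - eapply Rle_trans; [apply csum_bound; intros i _; apply Hin|]. rewrite rsum_scal.
    apply Rmult_le_compat_l; [|apply Hs]. apply Rdiv_le_0_compat; [lra|apply P].
  - eapply Rle_trans.
    + apply (csum_bound _ (fun i => 2 * Kf * / INR (S (N + i)) ^ 2)). intros i _.
      eapply Rle_trans; [apply (Hin (N + i)%nat O)|]. right. simpl (INR 1). field. apply Rgt_not_eq, P.
    + rewrite rsum_scal. apply Rmult_le_compat_l; [lra|apply rsum_inv_sqr].
Qed.

(** [W p L] stands for the partial sum over [l] at frequency [p], and [V L] for the partial sum over
    [m] at frequency [k = 0]. The row [p = 0] remains as [W 0], and the column [k = 0] of dual terms
    is exchanged for [V]; since [Gt] vanishes at [(0, 0)], nothing is counted twice. The constants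
    called [M] are arbitrary and disappear in an iterated limit; only the truncation at [N] and the
    bounds [Kw], [Kv], [Kg] survive. *)
Lemma four_term_split (S0 : C) (W : Z -> nat -> C) (V : nat -> C) (Gt : Z -> Z -> C)
  (r1 r2 K1 Kw Kv Kg : R) (N : nat) :
  0 <= r1 -> 0 <= r2 -> 0 <= K1 -> 0 <= Kg ->
  (exists L0, forall n L, (L0 <= L)%nat -> Cmod (S0 - RtoC r1 * zsum (fun p => W p L) n) <= K1 / INR (S n)) ->
  (forall p, exists M, 0 <= M /\ forall L K,
    Cmod (W p L - RtoC r2 * zsum (Gt p) K) <= M * (/ INR (S L) + / INR (S K))) ->
  (exists M, 0 <= M /\ forall L K,
    Cmod (V L - RtoC r1 * zsum (fun p => Gt p 0%Z) K) <= M * (/ INR (S L) + / INR (S K))) ->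
  Gt 0%Z 0%Z = RtoC 0 ->
  (forall i j, Cmod (quad Gt i j) <= Kg / (INR (S i) ^ 2 * INR (S j) ^ 2)) ->
  (forall n, Cmod (W 0%Z (N + n)%nat - W 0%Z N) <= Kw) ->
  (forall n, Cmod (V (N + n)%nat - V N) <= Kv) ->
  Cmod (S0 - RtoC r1 * W 0%Z N - RtoC r2 * V N - RtoC (r1 * r2) * dsum (quad Gt) N N)
  <= r1 * Kw + r2 * Kv + r1 * r2 * (8 * Kg / INR (S N)).
Proof.
  intros Hr1 Hr2 HK1 HKg (L0 & H1) H2 (Mc & HMc & H3) H4 H5 H6 H7.
  apply le_of_le_inv2. exists (K1 + r2 * Mc). intros n.
  set (N' := (N + n)%nat).
  set (D := fun p L => (W p L - RtoC r2 * zsum (Gt p) L)%C).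
  assert (HD : exists M, 0 <= M /\ forall L,
    Cmod (csum (fun i => D (Z.of_nat (S i)) L + D (- Z.of_nat (S i))%Z L)%C N') <= M / INR (S L)).
  { apply (csum_family_bound (fun i L => D (Z.of_nat (S i)) L + D (- Z.of_nat (S i))%Z L)%C).
    intros i. destruct (H2 (Z.of_nat (S i))) as (M1 & HM1 & B1).
    destruct (H2 (- Z.of_nat (S i))%Z) as (M2 & HM2 & B2). exists (2 * M1 + 2 * M2). split; [lra|].
    intros L. eapply Rle_trans; [apply Cmod_triangle|]. specialize (B1 L L). specialize (B2 L L).
    unfold D, Rdiv. lra. }
  destruct HD as (Md & HMd & HD). exists (r1 * Md + r2 * Mc). intros l.
  (* [N'] limits the frequencies [p], [L] the numbers of terms. Both are at least [N], so the tails
     beyond [N] apply, and [L] is at least [L0]. *)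
  set (L := (N + (n + (L0 + l)))%nat).
  replace (_ - _)%C with
    ((S0 - RtoC r1 * zsum (fun p => W p L) N') + RtoC r1 * (W 0%Z L - W 0%Z N)
     + RtoC r1 * csum (fun i => D (Z.of_nat (S i)) L + D (- Z.of_nat (S i))%Z L)%C N'
     + RtoC r2 * (V L - V N)
     - RtoC r2 * (V L - RtoC r1 * zsum (fun p => Gt p 0%Z) N')
     + RtoC (r1 * r2) * (dsum (quad Gt) N' L - dsum (quad Gt) N N))%C.
  - assert (A1 := H1 N' L ltac:(unfold L; lia)).
    assert (A2 := H6 (n + (L0 + l))%nat). assert (A3 := HD L). assert (A4 := H7 (n + (L0 + l))%nat).
    assert (A5 := H3 L N').
    assert (A6 := dsum_tail (quad Gt) Kg N n (n + (L0 + l)) HKg H5).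
    fold N' in A6. fold L in A2, A4, A6.
    pose proof (inv_INR_le n N' ltac:(unfold N'; lia)) as I1.
    pose proof (inv_INR_le l L ltac:(unfold L; lia)) as I2.
    eapply Rle_trans; [apply Cmod_triangle|].
    eapply Rle_trans; [apply Rplus_le_compat_r, Cmod_minus_le|].
    eapply Rle_trans; [apply Rplus_le_compat_r, Rplus_le_compat_r, Cmod_triangle|].
    eapply Rle_trans; [apply Rplus_le_compat_r, Rplus_le_compat_r, Rplus_le_compat_r, Cmod_triangle|].
    eapply Rle_trans; [apply Rplus_le_compat_r, Rplus_le_compat_r, Rplus_le_compat_r, Rplus_le_compat_r, Cmod_triangle|].
    rewrite !Cmod_RtoC_mult by nra.
    assert (T1 : K1 / INR (S N') <= K1 / INR (S n)) by (apply Rmult_le_compat_l; assumption).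
    assert (T3 : Md / INR (S L) <= Md / INR (S l)) by (apply Rmult_le_compat_l; assumption).
    assert (T5 : Mc * (/ INR (S L) + / INR (S N')) <= Mc * (/ INR (S l) + / INR (S n)))
      by (apply Rmult_le_compat_l; lra).
    assert (U2 := Rmult_le_compat_l r1 _ _ Hr1 A2).
    assert (U3 := Rmult_le_compat_l r1 _ _ Hr1 (Rle_trans _ _ _ A3 T3)).
    assert (U4 := Rmult_le_compat_l r2 _ _ Hr2 A4).
    assert (U5 := Rmult_le_compat_l r2 _ _ Hr2 (Rle_trans _ _ _ A5 T5)).
    assert (U6 := Rmult_le_compat_l (r1 * r2) _ _ (Rmult_le_pos _ _ Hr1 Hr2) A6).
    unfold Rdiv in *. lra.
  - assert (Z1 : zsum (fun p => W p L) N' = (W 0%Z L +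
      csum (fun i => D (Z.of_nat (S i)) L + D (- Z.of_nat (S i))%Z L)%C N' +
      RtoC r2 * (csum (fun i => Gt (Z.of_nat (S i)) 0%Z + Gt (- Z.of_nat (S i))%Z 0%Z)%C N' +
        dsum (quad Gt) N' L))%C).
    { unfold zsum at 1. unfold dsum. rewrite <- csum_plus, <- csum_scal, <- Cplus_assoc, <- csum_plus.
      f_equal. apply csum_ext. intros i _.
      rewrite (csum_ext (quad Gt i) (fun k => (Gt (Z.of_nat (S i)) (Z.of_nat (S k)) + Gt (Z.of_nat (S i)) (- Z.of_nat (S k))%Z) +
        (Gt (- Z.of_nat (S i))%Z (Z.of_nat (S k)) + Gt (- Z.of_nat (S i))%Z (- Z.of_nat (S k))%Z))%C)
        by (intros; unfold quad; ring).
      rewrite csum_plus. unfold D, zsum. ring. }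
    rewrite Z1. unfold zsum. rewrite H4, RtoC_mult. ring.
Qed.

Lemma dft_bound (q : nat) (phi : Z -> C) (Phi : R) (k : Z) :
  (forall x, Cmod (phi x) <= Phi) -> Cmod (dft q phi k) <= INR q * Phi.
Proof.
  intros H. unfold dft. rewrite <- rsum_const. apply csum_bound. intros u _.
  rewrite Cmod_mult, Cmod_e, Rmult_1_r. apply H.
Qed.

Lemma dft_periodic (q1 q2 : nat) (psi : Z -> Z -> C) (p : Z) :
  (forall m, periodic q2 (psi m)) -> periodic q2 (fun l => dft q1 (fun m => psi m l) p).
Proof.
  intros H l. unfold dft. apply csum_ext. intros u _. now rewrite H.
Qed.

Lemma dft_swap (q1 q2 : nat) (psi : Z -> Z -> C) (p k : Z) :
  dft q2 (fun l => dft q1 (fun m => psi m l) p) k = dft q1 (fun m => dft q2 (psi m) k) p.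
Proof.
  unfold dft.
  transitivity (csum (fun v => csum (fun u => psi (Z.of_nat u) (Z.of_nat v) *
    e (IZR p * INR u / INR q1) * e (IZR k * INR v / INR q2))%C q1) q2).
  - apply csum_ext. intros v _. rewrite Cmult_comm, <- csum_scal. apply csum_ext. intros; ring.
  - rewrite csum_swap. apply csum_ext. intros u _.
    symmetry. rewrite Cmult_comm, <- csum_scal. apply csum_ext. intros; ring.
Qed.

Lemma periodic_partial_sums (q : nat) (phi : Z -> C) (Phi : R) : (0 < q)%nat -> 0 < Phi ->
  periodic q phi -> (forall x, Cmod (phi x) <= Phi) -> dft q phi 0 = RtoC 0 ->
  forall n, Cmod (csum (fun k => phi (Z.of_nat k)) n) <= INR q * Phi.
Proof.
  intros Hq HP Hper Hphi H0 n.
  assert (H := mean_zero_partial_sums (Z.of_nat q) (fun x => RtoC (/ Phi) * phi x)%C ltac:(lia)).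
  assert (Q : 0 < / Phi) by (apply Rinv_0_lt_compat; assumption).
  lapply H; [clear H; intros H|intros x; now rewrite Hper].
  lapply H; [clear H; intros H|].
  2:{ intros x. rewrite Cmod_RtoC_mult by lra. apply Rmult_le_reg_l with Phi; [assumption|].
      rewrite <- Rmult_assoc, Rinv_r by lra. rewrite Rmult_1_r, Rmult_1_l. apply Hphi. }
  lapply H; [clear H; intros H|].
  2:{ rewrite psum_scal. unfold psum. rewrite Nat2Z.id.
      replace (csum _ q) with (dft q phi 0); [rewrite H0; ring|].
      unfold dft. apply csum_ext. intros u _. unfold Rdiv. rewrite !Rmult_0_l, e_0. ring. }
  specialize (H n). rewrite csum_scal, Cmod_RtoC_mult, <- INR_IZR_INZ in H by lra.
  apply Rmult_le_reg_l with (/ Phi); [assumption|].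
  replace (/ Phi * (INR q * Phi)) with (INR q) by (field; lra). exact H.
Qed.

(** At frequency [0] the parameters are real, and the derivative of [kf 1] is at most [3 / x^2]
    uniformly in [eps], because [z exp(- z) <= 1] absorbs the factors [eps x] and [t eps / x]. *)
Lemma kf_difference_bound (eps t y : R) : 0 < eps -> 0 < t -> 0 < y ->
  Cmod (kf 1 (RtoC eps) (RtoC t * damp eps 0) (y + 1) - kf 1 (RtoC eps) (RtoC t * damp eps 0) y)
  <= 6 * (/ y - / (y + 1)).
Proof.
  intros He Ht Hy. set (be := (RtoC t * damp eps 0)%C).
  assert (Eb : be = RtoC (t * eps)) by (apply C_ext; simpl; ring).
  replace (6 * (/ y - / (y + 1))) with (2 * (- (3 / (y + 1)) - - (3 / y))) by (field; lra).
  apply (Cmvt_bound (kf 1 (RtoC eps) be) (fun x => - RtoC eps * kf 1 (RtoC eps) be x + be * kf 3 (RtoC eps) be x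
    - RtoC (INR 1) * kf 2 (RtoC eps) be x)%C (fun x => - (3 / x)) (fun x => 3 / x ^ 2)); [lra| | |].
  - intros x Hx. apply (kf_derive 1); [exact He|]. rewrite Eb. exact (Rmult_lt_0_compat _ _ Ht He).
  - intros x Hx. auto_derive; [lra|]. field. lra.
  - intros x Hx.
    assert (Hx2 : 0 < x ^ 2) by nra.
    assert (T : 0 < t * eps) by nra.
    assert (He1 : forall z, 0 < z -> z * exp (- z) <= 1).
    { intros z Hz. pose proof (exp_opp_le 1 z ltac:(lia) Hz) as H. rewrite !pow_1 in H. simpl in H.
      apply Rle_trans with (z * (1 / z)); [apply Rmult_le_compat_l; lra|right; field; lra]. }
    assert (Hle : forall j, Cmod (kf j (RtoC eps) be x) = exp (- (eps * x)) * exp (- (t * eps / x)) * / x ^ j).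
    { intros j. rewrite Cmod_kf by lra. rewrite Eb, <- exp_plus. f_equal. f_equal. simpl. field. lra. }
    pose proof (exp_pos (- (eps * x))) as P1. pose proof (exp_pos (- (t * eps / x))) as P2.
    assert (Q1 : exp (- (eps * x)) <= 1) by (rewrite <- exp_0; apply exp_le; nra).
    assert (Hz : 0 < t * eps / x) by (apply Rdiv_lt_0_compat; lra).
    assert (Q2 : exp (- (t * eps / x)) <= 1) by (rewrite <- exp_0; apply exp_le; lra).
    pose proof (He1 (eps * x) ltac:(nra)) as R1. pose proof (He1 _ Hz) as R2.
    set (a := exp (- (eps * x))) in *. set (b := exp (- (t * eps / x))) in *.
    eapply Rle_trans; [apply Cmod_minus_le|].
    eapply Rle_trans; [apply Rplus_le_compat_r, Cmod_triangle|].
    rewrite !Cmod_mult, Cmod_opp, !Cmod_R, !Hle. rewrite Eb, Cmod_R.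
    rewrite !Rabs_pos_eq by (simpl; lra).
    replace (3 / x ^ 2) with (1 * / x ^ 2 + 1 * / x ^ 2 + 1 * / x ^ 2) by (field; lra).
    assert (HI : 0 < / x ^ 2) by (apply Rinv_0_lt_compat; assumption).
    repeat apply Rplus_le_compat.
    + replace (eps * (a * b * / x ^ 1)) with (eps * x * a * b * / x ^ 2) by (field; lra).
      apply Rmult_le_compat_r; [lra|].
      assert (Hex : 0 < eps * x) by nra.
      apply Rle_trans with (1 * 1); [|lra]. apply Rmult_le_compat; [apply Rmult_le_pos|..]; lra.
    + replace (t * eps * (a * b * / x ^ 3)) with (a * (t * eps / x * b) * / x ^ 2) by (field; lra).
      apply Rmult_le_compat_r; [lra|].
      apply Rle_trans with (1 * 1); [|lra]. apply Rmult_le_compat; [lra|apply Rmult_le_pos|..]; lra.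
    + simpl INR. rewrite Rmult_1_l. apply Rmult_le_compat_r; [lra|].
      apply Rle_trans with (1 * 1); [|lra]. apply Rmult_le_compat; lra.
Qed.

(** Size and variation of the weights at frequency [0], in the form used by [abel_summation_tail]
    and uniformly in [eps]. *)
Lemma om_zero_bounds (A B : R) (g : R -> C) : 0 < A <= B -> (forall t, Cct g t) ->
  exists K, 0 <= K /\ forall eps k, 0 < eps -> (0 < k)%nat ->
    Cmod (om A B g eps 0 (INR k)) <= K / INR k /\
    Cmod (om A B g eps 0 (INR (S k)) - om A B g eps 0 (INR k)) <= K / INR k - K / INR (S k).
Proof.
  intros HAB Hg. destruct (Cct_bounded g A B ltac:(lra) (fun t _ => Hg t)) as (Kg & HKg & BG).
  exists (12 * Kg * (B - A)). split; [nra|]. intros eps k He Hk.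
  assert (Hk0 : 0 < INR k) by (apply lt_0_INR; lia).
  assert (Hk1 : 0 < INR (S k)) by (apply lt_0_INR; lia).
  assert (CF : forall l t, Cct (fun t => g t * kf 1 (RtoC eps) (RtoC t * damp eps 0) l)%C t)
    by (intros; apply Cct_mult; [auto|apply kf_cct_param]).
  split.
  - apply Rle_trans with (2 * (Kg * / INR k) * (B - A)).
    + apply CInt_bound_const; [lra|auto|]. intros t Ht. rewrite Cmod_mult.
      apply Rmult_le_compat; [apply Cmod_ge_0|apply Cmod_ge_0|auto|].
      rewrite Cmod_kf, pow_1 by assumption.
      apply Rle_trans with (1 * / INR k); [|lra].
      apply Rmult_le_compat_r; [left; now apply Rinv_0_lt_compat|].
      rewrite <- exp_0. apply exp_le. simpl fst.
      assert (0 <= (t * eps - 0 * 0) * / INR k).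
      { apply Rmult_le_pos; [nra|left; now apply Rinv_0_lt_compat]. }
      nra.
    + unfold Rdiv. pose proof (Rinv_0_lt_compat _ Hk0).
      assert (0 <= Kg * (B - A) * / INR k) by (apply Rmult_le_pos; nra). lra.
  - unfold om. rewrite <- (CInt_minus (fun t => g t * kf 1 (RtoC eps) (RtoC t * damp eps 0) (INR (S k)))%C
      (fun t => g t * kf 1 (RtoC eps) (RtoC t * damp eps 0) (INR k))%C); [|lra|auto|auto].
    replace (_ / _ - _ / _) with (2 * (Kg * (6 * (/ INR k - / INR (S k)))) * (B - A)) by (field; lra).
    apply CInt_bound_const; [lra|intros; apply Cct_minus; auto|]. intros t Ht.
    replace (g t * _ - _)%C with (g t * (kf 1 (RtoC eps) (RtoC t * damp eps 0) (INR (S k)) -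
      kf 1 (RtoC eps) (RtoC t * damp eps 0) (INR k)))%C by ring.
    rewrite Cmod_mult. apply Rmult_le_compat; [apply Cmod_ge_0|apply Cmod_ge_0|auto|].
    rewrite S_INR. apply kf_difference_bound; lra.
Qed.

Lemma csum_eventually_zero (f : nat -> C) (n m : nat) : (n <= m)%nat ->
  (forall k, (n <= k)%nat -> f k = RtoC 0) -> csum f m = csum f n.
Proof.
  intros Hnm H. replace m with (n + (m - n))%nat by lia. rewrite csum_add.
  rewrite (csum_zero (fun k => f (n + k)%nat)); [ring|]. intros; apply H; lia.
Qed.

(** The constant is [256 * 4 * 2]: [exp(- z) <= 256 / z^4], [(x + 1)^2 <= 4 x^2], and the sum of
    inverse squares is at most [2]. The growth in [1 / eps] is harmless, as the bound serves only a
    limit at fixed [eps]. *)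
Lemma sqr_exp_sum_bound (eps : R) (n : nat) : 0 < eps ->
  rsum (fun l => INR l ^ 2 * exp (- eps * INR l)) n <= 2048 / eps ^ 4.
Proof.
  intros He. assert (He4 : 0 < eps ^ 4) by (apply pow_lt; assumption).
  assert (Q : 0 <= 1024 / eps ^ 4) by (apply Rdiv_le_0_compat; lra).
  apply Rle_trans with (rsum (fun l => 1024 / eps ^ 4 * / INR (S l) ^ 2) n).
  - apply rsum_le. intros l _. destruct l as [|l].
    { simpl (INR 0). rewrite pow_i, Rmult_0_l by lia.
      apply Rmult_le_pos; [assumption|]. left. apply Rinv_0_lt_compat, pow_lt, lt_0_INR; lia. }
    assert (Hl : 1 <= INR (S l)) by (apply (le_INR 1); lia).
    rewrite (S_INR (S l)). set (x := INR (S l)) in *.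
    pose proof (exp_opp_le 4 (eps * x) ltac:(lia) ltac:(nra)) as H.
    replace (- eps * x) with (- (eps * x)) by ring.
    apply Rle_trans with (x ^ 2 * (INR 4 ^ 4 / (eps * x) ^ 4)); [apply Rmult_le_compat_l; nra|].
    replace (x ^ 2 * (INR 4 ^ 4 / (eps * x) ^ 4)) with (256 / eps ^ 4 * / x ^ 2) by (simpl INR; field; lra).
    replace (1024 / eps ^ 4) with (256 / eps ^ 4 * 4) by (field; lra). rewrite Rmult_assoc.
    apply Rmult_le_compat_l; [apply Rdiv_le_0_compat; lra|].
    apply Rmult_le_reg_l with (x ^ 2 * (x + 1) ^ 2); [apply Rmult_lt_0_compat; nra|].
    replace (x ^ 2 * (x + 1) ^ 2 * / x ^ 2) with ((x + 1) ^ 2) by (field; lra).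
    replace (x ^ 2 * (x + 1) ^ 2 * (4 * / (x + 1) ^ 2)) with (4 * x ^ 2) by (field; lra). nra.
  - rewrite rsum_scal. pose proof (rsum_inv_sqr 0 n) as H.
    replace (2048 / eps ^ 4) with (1024 / eps ^ 4 * (2 / INR 1)) by (simpl INR; field; lra).
    apply Rmult_le_compat_l; assumption.
Qed.

Definition damped_sum (psi : Z -> Z -> C) (g : R -> C) (eps : R) (M L : nat) : C :=
  csum (fun l => RtoC (exp (- eps * INR l)) *
    csum (fun m => psi (Z.of_nat m) (Z.of_nat l) * (g (INR m * INR l)%R * RtoC (exp (- eps * INR m))))%C M)%C L.

(** [g(m l)] vanishes once [m] or [l] reaches [M0], also when the other one is [0]. The ranges can
    therefore be adjusted to multiples of the periods. *)
Lemma damped_sum_stable (psi : Z -> Z -> C) (g : R -> C) (A B eps : R) (M0 M L : nat) :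
  (forall x, x <= A \/ B <= x -> g x = RtoC 0) -> 0 < A -> B <= INR M0 -> (M0 <= M)%nat -> (M0 <= L)%nat ->
  damped_sum psi g eps M L = damped_sum psi g eps M0 M0.
Proof.
  intros Hg HA HB HM HL. unfold damped_sum.
  assert (Z0 : forall m l, (M0 <= m)%nat \/ (M0 <= l)%nat -> g (INR m * INR l) = RtoC 0).
  { intros m l H. apply Hg. destruct m as [|m]; [left; simpl; lra|]. destruct l as [|l]; [left; simpl INR; lra|].
    right. assert (1 <= INR (S m)) by (apply (le_INR 1); lia).
    assert (1 <= INR (S l)) by (apply (le_INR 1); lia).
    destruct H as [H|H]; apply le_INR in H; nra. }
  rewrite (csum_eventually_zero _ M0 L HL).
  - apply csum_ext. intros l _. f_equal. apply csum_eventually_zero; [assumption|].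
    intros m Hm. rewrite Z0 by auto. ring.
  - intros l Hl. rewrite csum_zero; [ring|]. intros m _. rewrite Z0 by auto. ring.
Qed.

Definition first_sum (q1 q2 : nat) (psi : Z -> Z -> C) (w : R -> R -> C) (p : Z) (L : nat) : C :=
  csum (fun l => dft q1 (fun m => psi m (Z.of_nat l)) p * w (2 * PI * IZR p / INR q1)%R (INR l))%C (q2 * L).

Lemma damped_poisson_sum (A B : R) (G : nat -> R -> C) (q1 q2 M0 : nat) (psi : Z -> Z -> C) (eps : R) :
  (0 < q1)%nat -> (0 < q2)%nat -> 0 < A <= B -> test_family A B G -> B <= INR M0 ->
  (forall l, periodic q1 (fun m => psi m l)) -> (forall m l, Cmod (psi m l) <= 1) -> 0 < eps <= 1 ->
  exists K, 0 <= K /\ forall n L, (M0 <= L)%nat ->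
  Cmod (damped_sum psi (G O) eps M0 M0 - RtoC (/ INR q1) * zsum (fun p =>
    first_sum q1 q2 psi (om A B (G O) eps) p L) n) <= K / INR (S n).
Proof.
  intros Hq1 Hq2 HAB HG HM0 Hper Hpsi He.
  destruct (damped_poisson A B G q1 Hq1 HAB HG) as (K & HK & HP).
  assert (He4 : 0 < eps ^ 4) by (apply pow_lt; lra).
  assert (HKe : 0 <= K * (2048 / eps ^ 4)).
  { apply Rmult_le_pos; [assumption|apply Rdiv_le_0_compat; lra]. }
  exists (K * (2048 / eps ^ 4) * 2). split; [nra|]. intros n L HL.
  set (M := (M0 + n)%nat).
  rewrite <- (damped_sum_stable psi (G O) A B eps M0 (q1 * M) (q2 * L)); [|apply HG|lra|assumption|unfold M; nia|nia].
  unfold damped_sum, first_sum.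
  rewrite (zsum_csum (fun p l => dft q1 (fun m => psi m (Z.of_nat l)) p *
    om A B (G O) eps (2 * PI * IZR p / INR q1) (INR l))%C).
  rewrite <- csum_scal, <- csum_minus.
  eapply Rle_trans; [apply csum_bound; intros l _|].
  - apply (HP (fun m => psi m (Z.of_nat l)) eps l M n); auto.
  - rewrite (rsum_ext _ (fun k => K * (/ INR (S M) + / INR (S n)) * (INR k ^ 2 * exp (- eps * INR k))))
      by (intros; ring).
    rewrite rsum_scal.
    pose proof (sqr_exp_sum_bound eps (q2 * L) ltac:(lra)) as HS.
    pose proof (inv_INR_le n M ltac:(unfold M; lia)) as HI. pose proof (inv_INR_S_pos M).
    pose proof (inv_INR_S_pos n).
    apply Rle_trans with (K * (2 * / INR (S n)) * (2048 / eps ^ 4)); [|right; unfold Rdiv; ring].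
    assert (0 <= rsum (fun k => INR k ^ 2 * exp (- eps * INR k)) (q2 * L)).
    { rewrite <- (Rmult_0_r (INR (q2 * L))), <- rsum_const. apply rsum_le. intros k _.
      apply Rmult_le_pos; [apply pow2_ge_0|left; apply exp_pos]. }
    apply Rmult_le_compat; [apply Rmult_le_pos; lra|assumption|apply Rmult_le_compat_l; lra|exact HS].
Qed.

Definition second_sum (q1 q2 : nat) (psi : Z -> Z -> C) (w : R -> C) (L : nat) : C :=
  csum (fun m => dft q2 (psi (Z.of_nat m)) 0 * w (INR m))%C (q1 * L).

Definition double_dft (q1 q2 : nat) (psi : Z -> Z -> C) (p k : Z) : C :=
  dft q2 (fun l => dft q1 (fun m => psi m l) p) k.

Definition dual_term (q1 q2 : nat) (psi : Z -> Z -> C) (H : R -> R -> C) (p k : Z) : C :=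
  (double_dft q1 q2 psi p k * H (2 * PI * IZR k / INR q2)%R (2 * PI * IZR p / INR q1)%R)%C.

Lemma Cmod_damp (eps x : R) : Rabs x <= Cmod (damp eps x).
Proof. apply (Cmod_snd (damp eps x)). Qed.

Lemma bessel_transform_sym (A B : R) (g : R -> C) (al be : C) : 0 < A <= B -> 0 < fst al -> 0 < fst be ->
  bessel_transform A B g al be = bessel_transform A B g be al.
Proof.
  intros HAB H1 H2. apply CInt_ext; [lra|]. intros t Ht. f_equal. apply Jint_1_sym; lra.
Qed.

Lemma double_dft_bound (q1 q2 : nat) (psi : Z -> Z -> C) (p k : Z) :
  (forall m l, Cmod (psi m l) <= 1) -> Cmod (double_dft q1 q2 psi p k) <= INR q2 * INR q1.
Proof.
  intros H. apply dft_bound. intros l. rewrite <- (Rmult_1_r (INR q1)). apply dft_bound. auto.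
Qed.

Lemma Rabs_frequency (q : nat) (k : Z) (j : nat) (dl : R) : (0 < q)%nat -> 0 < dl -> dl * INR q <= 1 ->
  k = Z.of_nat (S j) \/ k = (- Z.of_nat (S j))%Z -> dl * INR (S j) <= Rabs (2 * PI * IZR k / INR q).
Proof.
  intros Hq Hdl Hd Hk. assert (Q : 0 < INR q) by (apply lt_0_INR; lia).
  assert (P : 1 <= 2 * PI) by (pose proof PI_4; pose proof PI2_1; lra).
  assert (HR : Rabs (IZR k) = INR (S j)).
  { rewrite INR_IZR_INZ, <- abs_IZR. f_equal. lia. }
  unfold Rdiv. rewrite !Rabs_mult, HR, (Rabs_pos_eq 2), (Rabs_pos_eq PI), (Rabs_pos_eq (/ INR q)); try lra.
  2:{ left. now apply Rinv_0_lt_compat. }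
  assert (HJ : 0 < INR (S j)) by (apply lt_0_INR; lia).
  apply Rmult_le_reg_r with (INR q); [assumption|].
  replace (2 * PI * INR (S j) * / INR q * INR q) with (2 * PI * INR (S j)) by (field; lra).
  apply Rle_trans with (1 * INR (S j)); [|nra].
  replace (dl * INR (S j) * INR q) with (dl * INR q * INR (S j)) by ring.
  apply Rmult_le_compat_r; lra.
Qed.

(** [dl = 1 / (q1 q2)] times [i + 1] or [j + 1] bounds the frequencies from below. Cubic decay is
    weakened to inverse squares, which the tail estimate of double sums expects. *)
Lemma dual_term_bound (q1 q2 : nat) (psi : Z -> Z -> C) (dl K : R) (H : R -> R -> C) (i j : nat) (p k : Z) :
  (0 < q1)%nat -> (0 < q2)%nat -> (forall m l, Cmod (psi m l) <= 1) -> 0 <= K ->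
  dl = / (INR q1 * INR q2) ->
  (forall x y, dl <= Rabs x -> dl <= Rabs y -> Cmod (H x y) <= K / (Rabs x * Rabs y) ^ 3) ->
  p = Z.of_nat (S i) \/ p = (- Z.of_nat (S i))%Z ->
  k = Z.of_nat (S j) \/ k = (- Z.of_nat (S j))%Z ->
  Cmod (dual_term q1 q2 psi H p k) <= INR q2 * INR q1 * K / dl ^ 6 / (INR (S i) ^ 2 * INR (S j) ^ 2).
Proof.
  intros Hq1 Hq2 Hpsi HK Hdl HH Hp Hk.
  assert (Q1 : 1 <= INR q1) by (apply (le_INR 1); lia).
  assert (Q2 : 1 <= INR q2) by (apply (le_INR 1); lia).
  assert (I1 : 1 <= INR (S i)) by (apply (le_INR 1); lia).
  assert (I2 : 1 <= INR (S j)) by (apply (le_INR 1); lia).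
  assert (D0 : 0 < dl) by (rewrite Hdl; apply Rinv_0_lt_compat; nra).
  assert (F2 := Rabs_frequency q2 k j dl Hq2 D0 ltac:(rewrite Hdl; apply Rmult_le_reg_l with (INR q1);
     [lra|field_simplify; lra]) Hk).
  assert (F1 := Rabs_frequency q1 p i dl Hq1 D0 ltac:(rewrite Hdl; apply Rmult_le_reg_l with (INR q2);
     [lra|field_simplify; lra]) Hp).
  unfold dual_term. set (x := 2 * PI * IZR k / INR q2) in *. set (y := 2 * PI * IZR p / INR q1) in *.
  specialize (HH x y ltac:(nra) ltac:(nra)).
  rewrite Cmod_mult.
  assert (HB := double_dft_bound q1 q2 psi p k Hpsi).
  assert (HL : (dl * INR (S j) * (dl * INR (S i))) ^ 3 <= (Rabs x * Rabs y) ^ 3).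
  { apply pow_incr. split; [|apply Rmult_le_compat; nra].
    apply Rmult_le_pos; apply Rmult_le_pos; lra. }
  assert (HP : 0 < (dl * INR (S j) * (dl * INR (S i))) ^ 3).
  { apply pow_lt, Rmult_lt_0_compat; apply Rmult_lt_0_compat; lra. }
  assert (HM : K / (Rabs x * Rabs y) ^ 3 <= K / dl ^ 6 / (INR (S i) ^ 2 * INR (S j) ^ 2)).
  { apply Rle_trans with (K / (dl * INR (S j) * (dl * INR (S i))) ^ 3).
    - apply Rmult_le_compat_l; [assumption|]. apply Rinv_le_contravar; assumption.
    - replace (K / dl ^ 6 / (INR (S i) ^ 2 * INR (S j) ^ 2)) with (K * / (dl ^ 6 * (INR (S i) ^ 2 * INR (S j) ^ 2)))
        by (field; lra).
      apply Rmult_le_compat_l; [assumption|]. apply Rinv_le_contravar.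
      + apply Rmult_lt_0_compat; [apply pow_lt; assumption|]. apply Rmult_lt_0_compat; apply pow_lt; lra.
      + replace ((dl * INR (S j) * (dl * INR (S i))) ^ 3) with
          (dl ^ 6 * (INR (S i) ^ 2 * INR (S j) ^ 2) * (INR (S i) * INR (S j))) by ring.
        rewrite <- (Rmult_1_r (dl ^ 6 * _)) at 1. apply Rmult_le_compat_l; [|nra].
        apply Rmult_le_pos; [left; apply pow_lt; assumption|]. apply Rmult_le_pos; apply pow2_ge_0. }
  apply Rle_trans with (INR q2 * INR q1 * (K / dl ^ 6 / (INR (S i) ^ 2 * INR (S j) ^ 2))).
  - apply Rmult_le_compat; [apply Cmod_ge_0|apply Cmod_ge_0|assumption|]. lra.
  - right. field. repeat split; lra.
Qed.

Lemma quad_bound (F : Z -> Z -> C) (K : R) (i j : nat) :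
  (forall p k, p = Z.of_nat (S i) \/ p = (- Z.of_nat (S i))%Z ->
    k = Z.of_nat (S j) \/ k = (- Z.of_nat (S j))%Z -> Cmod (F p k) <= K) ->
  Cmod (quad F i j) <= 4 * K.
Proof.
  intros H. unfold quad.
  eapply Rle_trans; [apply Cmod_triangle|].
  eapply Rle_trans; [apply Rplus_le_compat_r, Cmod_triangle|].
  eapply Rle_trans; [apply Rplus_le_compat_r, Rplus_le_compat_r, Cmod_triangle|].
  assert (H1 := H (Z.of_nat (S i)) (Z.of_nat (S j)) ltac:(now left) ltac:(now left)).
  assert (H2 := H (Z.of_nat (S i)) (- Z.of_nat (S j))%Z ltac:(now left) ltac:(now right)).
  assert (H3 := H (- Z.of_nat (S i))%Z (Z.of_nat (S j)) ltac:(now right) ltac:(now left)).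
  assert (H4 := H (- Z.of_nat (S i))%Z (- Z.of_nat (S j))%Z ltac:(now right) ltac:(now right)).
  lra.
Qed.

(** Uniform in [eps], because the modulus of [eps + i x] is at least [|x|]. *)
Lemma damped_bessel_bound (A B : R) (G : nat -> R -> C) (dl : R) :
  0 < A <= B -> test_family A B G -> 0 < dl ->
  exists K, 0 <= K /\ forall eps x y, 0 < eps -> dl <= Rabs x -> dl <= Rabs y ->
  Cmod (bessel_transform A B (G O) (damp eps x) (damp eps y)) <= K / (Rabs x * Rabs y) ^ 3.
Proof.
  intros HAB HG Hdl. destruct (bessel_transform_bound A B G dl HAB HG Hdl) as (K & HK & HB).
  exists K. split; [assumption|]. intros eps x y He Hx Hy.
  pose proof (Cmod_damp eps x). pose proof (Cmod_damp eps y).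
  eapply Rle_trans; [apply HB; simpl; lra|].
  apply Rmult_le_compat_l; [assumption|]. apply Rinv_le_contravar.
  - apply pow_lt, Rmult_lt_0_compat; lra.
  - apply pow_incr. split; [apply Rmult_le_pos; lra|apply Rmult_le_compat; lra].
Qed.

(** [dft q phi 0 = 0] says that [phi] has mean zero, so its partial sums are at most [q Phi] and
    Abel summation applies; the factor [r] only moves the starting point further out. *)
Lemma weighted_tail (q : nat) (phi : Z -> C) (Phi A B K eps : R) (g : R -> C) (r N n : nat) :
  (0 < q)%nat -> (0 < r)%nat -> (0 < N)%nat -> 0 < Phi -> 0 <= K -> periodic q phi ->
  (forall x, Cmod (phi x) <= Phi) -> dft q phi 0 = RtoC 0 ->
  (forall k, (0 < k)%nat ->
    Cmod (om A B g eps 0 (INR k)) <= K / INR k /\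
    Cmod (om A B g eps 0 (INR (S k)) - om A B g eps 0 (INR k)) <= K / INR k - K / INR (S k)) ->
  Cmod (csum (fun k => phi (Z.of_nat k) * om A B g eps 0 (INR k))%C (r * (N + n))
   - csum (fun k => phi (Z.of_nat k) * om A B g eps 0 (INR k))%C (r * N)) <= 2 * (INR q * Phi) * K / INR N.
Proof.
  intros Hq Hr HN HP HK Hper Hphi H0 Hom.
  replace (r * (N + n))%nat with (r * N + r * n)%nat by lia. rewrite csum_add.
  replace (_ + _ - _)%C with (csum (fun k => phi (Z.of_nat (r * N + k)) *
    om A B g eps 0 (INR (r * N + k)))%C (r * n)) by ring.
  assert (HN0 : 0 < INR N) by (apply lt_0_INR; lia).
  assert (Q : 0 < INR q) by (apply lt_0_INR; lia).
  apply Rle_trans with (2 * (INR q * Phi) * K / INR (r * N)).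
  - apply (abel_summation_tail (fun k => phi (Z.of_nat k)) (fun k => om A B g eps 0 (INR k))); auto.
    + nia.
    + nra.
    + now apply periodic_partial_sums.
    + intros k Hk. apply Hom, Hk.
    + intros k Hk. apply Hom, Hk.
  - assert (0 < INR q * Phi) by (apply Rmult_lt_0_compat; assumption).
    apply Rmult_le_compat_l; [apply Rmult_le_pos; lra|]. apply Rinv_le_contravar; [assumption|].
    apply le_INR. nia.
Qed.

(** [K] is chosen before [eps]; this uniformity permits [eps] to tend to [0] at a fixed [N]. *)
Lemma damped_double_poisson (A B : R) (G : nat -> R -> C) (q1 q2 M0 : nat) (psi : Z -> Z -> C) :
  (0 < q1)%nat -> (0 < q2)%nat -> 0 < A <= B -> test_family A B G -> B <= INR M0 ->
  (forall l, periodic q1 (fun m => psi m l)) -> (forall m, periodic q2 (psi m)) ->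
  (forall m l, Cmod (psi m l) <= 1) -> double_dft q1 q2 psi 0 0 = RtoC 0 ->
  exists K, 0 <= K /\ forall eps N, 0 < eps <= 1 -> (0 < N)%nat ->
  Cmod (damped_sum psi (G O) eps M0 M0 - RtoC (/ INR q1) * first_sum q1 q2 psi (om A B (G O) eps) 0 N
    - RtoC (/ INR q2) * second_sum q1 q2 psi (om A B (G O) eps 0) N
    - RtoC (/ INR q1 * / INR q2) * dsum (quad (dual_term q1 q2 psi (fun x y =>
        bessel_transform A B (G O) (damp eps x) (damp eps y)))) N N) <= K / INR N.
Proof.
  intros Hq1 Hq2 HAB HG HM0 Hper1 Hper2 Hpsi H0.
  assert (CG : forall t, Cct (G O) t) by (intros; eapply Cder_Cct, HG).
  assert (Q1 : 1 <= INR q1) by (apply (le_INR 1); lia).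
  assert (Q2 : 1 <= INR q2) by (apply (le_INR 1); lia).
  set (dl := / (INR q1 * INR q2)).
  assert (Hdl : 0 < dl) by (apply Rinv_0_lt_compat; nra).
  destruct (om_zero_bounds A B (G O) HAB CG) as (Ko & HKo & HO).
  destruct (damped_bessel_bound A B G dl HAB HG Hdl) as (Kb & HKb & HB).
  set (Kg := 4 * (INR q2 * INR q1 * Kb / dl ^ 6)).
  assert (HKg : 0 <= Kg).
  { unfold Kg. apply Rmult_le_pos; [lra|]. apply Rdiv_le_0_compat; [|now apply pow_lt].
    apply Rmult_le_pos; [apply Rmult_le_pos; lra|assumption]. }
  assert (R1 : 0 < / INR q1) by (apply Rinv_0_lt_compat; lra).
  assert (R2 : 0 < / INR q2) by (apply Rinv_0_lt_compat; lra).
  assert (B1 : forall p l, Cmod (dft q1 (fun m => psi m l) p) <= INR q1).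
  { intros p l. rewrite <- (Rmult_1_r (INR q1)). apply dft_bound. auto. }
  assert (B2 : forall k m, Cmod (dft q2 (psi m) k) <= INR q2).
  { intros k m. rewrite <- (Rmult_1_r (INR q2)). apply dft_bound. auto. }
  assert (P1 : forall p, periodic q2 (fun l => dft q1 (fun m => psi m l) p)).
  { intros p. now apply dft_periodic. }
  assert (P2 : periodic q1 (fun m => dft q2 (psi m) 0)).
  { apply (dft_periodic q2 q1 (fun l m => psi m l)). exact Hper1. }
  set (Kw := 2 * (INR q2 * INR q1) * Ko). set (Kv := 2 * (INR q1 * INR q2) * Ko).
  exists (/ INR q1 * Kw + / INR q2 * Kv + / INR q1 * / INR q2 * (8 * Kg)). split.
  { unfold Kw, Kv. assert (0 <= INR q2 * INR q1 * Ko) by (apply Rmult_le_pos; [apply Rmult_le_pos; lra|lra]).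
    assert (0 <= INR q1 * INR q2 * Ko) by (apply Rmult_le_pos; [apply Rmult_le_pos; lra|lra]).
    assert (0 <= / INR q1 * / INR q2) by (apply Rmult_le_pos; lra). apply Rplus_le_le_0_compat; [apply Rplus_le_le_0_compat|]; apply Rmult_le_pos; lra. }
  intros eps N He HN. assert (HN0 : 0 < INR N) by (apply lt_0_INR; lia).
  destruct (damped_poisson_sum A B G q1 q2 M0 psi eps) as (K1 & HK1 & H1); auto.
  set (H := fun x y => bessel_transform A B (G O) (damp eps x) (damp eps y)).
  eapply Rle_trans.
  - apply (four_term_split (damped_sum psi (G O) eps M0 M0) (first_sum q1 q2 psi (om A B (G O) eps))
      (second_sum q1 q2 psi (om A B (G O) eps 0)) (dual_term q1 q2 psi H)
      (/ INR q1) (/ INR q2) K1 (Kw / INR N) (Kv / INR N) Kg N); try lra; auto.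
    + exists M0. intros n L HL. now apply H1.
    + intros p. destruct (om_poisson q2 (fun l => dft q1 (fun m => psi m l) p) (INR q1) A B eps
        (2 * PI * IZR p / INR q1) (G O) Hq2 (P1 p) (B1 p) HAB CG ltac:(lra)) as (M & HM & HP).
      exists M. split; [assumption|]. intros L K. apply HP.
    + destruct (om_poisson q1 (fun m => dft q2 (psi m) 0) (INR q2) A B eps
        0 (G O) Hq1 P2 (B2 0%Z) HAB CG ltac:(lra)) as (M & HM & HP).
      exists M. split; [assumption|]. intros L K.
      (* By the symmetry of the Bessel transform and the exchange of the two discrete transforms,
         the column [k = 0] is exactly what Poisson summation in [m] produces from the weights at
         frequency [0]. *)
      rewrite (zsum_ext _ (fun p => dft q1 (fun m => dft q2 (psi m) 0) p *
        bessel_transform A B (G O) (damp eps (2 * PI * IZR p / INR q1)) (damp eps 0))%C).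
      { apply HP. }
      intros p. unfold dual_term, double_dft, H.
      rewrite dft_swap. apply (f_equal (Cmult (dft q1 (fun m => dft q2 (psi m) 0) p))).
      rewrite (bessel_transform_sym A B (G O) (damp eps (2 * PI * IZR p / INR q1))); simpl; try lra.
      replace (2 * PI * 0 / INR q2) with 0 by (unfold Rdiv; ring). reflexivity.
    + unfold dual_term. rewrite H0. ring.
    + intros i j.
      replace (Kg / (INR (S i) ^ 2 * INR (S j) ^ 2)) with
        (4 * (INR q2 * INR q1 * Kb / dl ^ 6 / (INR (S i) ^ 2 * INR (S j) ^ 2))) by (unfold Kg, Rdiv; ring).
      apply quad_bound. intros p k Hp Hk.
      apply (dual_term_bound q1 q2 psi dl Kb H i j p k); auto.
      intros x y Hx Hy. apply HB; lra.
    + intros n. unfold first_sum.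
      replace (2 * PI * IZR 0 / INR q1) with 0 by (unfold Rdiv; ring).
      apply (weighted_tail q2 (fun l => dft q1 (fun m => psi m l) 0) (INR q1)); auto; try lra.
      intros k Hk. apply HO; lra || assumption.
    + intros n. unfold second_sum.
      apply (weighted_tail q1 (fun m => dft q2 (psi m) 0) (INR q2)); auto; try lra.
      * unfold double_dft in H0. now rewrite dft_swap in H0.
      * intros k Hk. apply HO; lra || assumption.
  - assert (HS : 8 * Kg / INR (S N) <= 8 * Kg / INR N).
    { apply Rmult_le_compat_l; [lra|]. apply Rinv_le_contravar; [assumption|apply le_INR; lia]. }
    replace ((/ INR q1 * Kw + / INR q2 * Kv + / INR q1 * / INR q2 * (8 * Kg)) / INR N)
      with (/ INR q1 * (Kw / INR N) + / INR q2 * (Kv / INR N) +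
      / INR q1 * / INR q2 * (8 * Kg / INR N)) by (field; lra).
    apply Rplus_le_compat_l. apply Rmult_le_compat_l; [|assumption]. nra.
Qed.

Definition bessel_limit (A B : R) (g : R -> C) (x y : R) : C :=
  CInt (fun t => g t * bessel_kernel (clog_imag x + clog_imag y) (RtoC (- (x * y))) t)%C A B.

Lemma bessel_limit_bound (A B : R) (G : nat -> R -> C) (dl : R) :
  0 < A <= B -> test_family A B G -> 0 < dl ->
  exists K, 0 <= K /\ forall x y, dl <= Rabs x -> dl <= Rabs y ->
  Cmod (bessel_limit A B (G O) x y) <= K / (Rabs x * Rabs y) ^ 3.
Proof.
  intros HAB HG Hdl. destruct (damped_bessel_bound A B G dl HAB HG Hdl) as (K & HK & HB).
  exists K. split; [assumption|]. intros x y Hx Hy.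
  assert (x <> 0 /\ y <> 0) as [X0 Y0].
  { split; intros ->; rewrite Rabs_R0 in *; lra. }
  replace (bessel_limit A B (G O) x y) with (bessel_limit A B (G O) x y - 0)%C by ring.
  apply (Clim_Cmod_le (fun n => bessel_transform A B (G O) (near_imag x n) (near_imag y n)) _ 0
    (fun _ => K / (Rabs x * Rabs y) ^ 3)).
  - apply bessel_transform_limit; auto. intros; eapply Cder_Cct, HG.
  - apply is_lim_seq_const.
  - intros n. replace (_ - 0)%C with (bessel_transform A B (G O) (near_imag x n) (near_imag y n)) by ring.
    apply (HB (/ INR (S n))); auto. apply inv_INR_S_pos.
Qed.

(** The weights at frequency [0] tend to [1 / l] times the integral of [g], which turns the row and
    the column into [L]-series at [1]. *)
Lemma om_limit (A B : R) (g : R -> C) (l : nat) : 0 < A <= B -> (forall t, Cct g t) ->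
  Clim (fun n => om A B g (/ INR (S n)) 0 (INR l)) (RtoC (/ INR l) * CInt g A B)%C.
Proof.
  intros HAB Hg. destruct (Nat.eq_dec l 0) as [->|Hl].
  (* The convention [/ 0 = 0] agrees with the vanishing of [kf] at [0]. *)
  { simpl (INR 0). rewrite Rinv_0. apply Clim_ext with (fun _ => RtoC 0).
    - intros n. unfold om. rewrite CInt_zero; [reflexivity|lra|]. intros. rewrite kf_nonpos by lra. ring.
    - replace (RtoC 0 * CInt g A B)%C with (RtoC 0) by ring. apply Clim_const. }
  assert (HL : 1 <= INR l) by (apply (le_INR 1); lia). set (L := INR l) in *.
  destruct (Cct_bounded g A B ltac:(lra) (fun t _ => Hg t)) as (Kg & HKg & BG).
  apply Clim_squeeze with (fun n => (2 * (Kg * (2 * (L + B))) * (B - A)) / INR (S n));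
    [|apply is_lim_seq_scal_inv_S].
  intros n. set (eps := / INR (S n)). assert (He : 0 < eps) by apply inv_INR_S_pos.
  unfold Rdiv. fold eps. unfold om.
  rewrite <- (CInt_scal (RtoC (/ L)) g), <- (CInt_minus (fun t => g t * kf 1 (RtoC eps) (RtoC t * damp eps 0) L)%C
      (fun t => RtoC (/ L) * g t)%C); try lra; auto.
  2:{ intros. apply Cct_mult; [auto|apply kf_cct_param]. }
  2:{ intros. apply Cct_mult; [apply Cct_const|auto]. }
  replace (2 * (Kg * (2 * (L + B))) * (B - A) * eps) with (2 * (Kg * (2 * (eps * (L + B)))) * (B - A)) by ring.
  apply CInt_bound_const; [lra| |].
  - intros. apply Cct_minus; apply Cct_mult; auto. apply kf_cct_param. apply Cct_const.
  - intros t Ht. rewrite kf_pos, pow_1 by lra.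
    replace (g t * (cexp (- RtoC eps * RtoC L - RtoC t * damp eps 0 * RtoC (/ L)) * RtoC (/ L)) - RtoC (/ L) * g t)%C
      with (g t * (RtoC (/ L) * (cexp (RtoC (- (eps * L + t * eps * / L))) - 1)))%C.
    + assert (HI : 0 < / L <= 1).
      { split; [apply Rinv_0_lt_compat; lra|]. rewrite <- Rinv_1. apply Rinv_le_contravar; lra. }
      assert (T0 : 0 <= t * eps * / L <= B * eps).
      { split; [apply Rmult_le_pos; nra|]. apply Rle_trans with (t * eps * 1); [apply Rmult_le_compat_l; nra|nra]. }
      assert (E0 : 0 <= eps * L) by nra.
      rewrite Cmod_mult, Cmod_RtoC_mult by lra.
      apply Rmult_le_compat; [apply Cmod_ge_0|apply Rmult_le_pos; [lra|apply Cmod_ge_0]|auto|].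
      eapply Rle_trans; [apply Rmult_le_compat_l; [lra|]; apply cexp_minus_1_left; simpl; lra|].
      rewrite Cmod_R, Rabs_Ropp, Rabs_pos_eq by lra.
      apply Rle_trans with (1 * (2 * (eps * L + t * eps * / L))); [apply Rmult_le_compat_r; lra|]. lra.
    + replace (RtoC (- (eps * L + t * eps * / L))) with (- RtoC eps * RtoC L - RtoC t * damp eps 0 * RtoC (/ L))%C.
      * ring.
      * apply C_ext; simpl; ring.
Qed.

Lemma damped_sum_limit (psi : Z -> Z -> C) (g : R -> C) (M L : nat) :
  Clim (fun n => damped_sum psi g (/ INR (S n)) M L)
   (csum (fun l => csum (fun m => psi (Z.of_nat m) (Z.of_nat l) * g (INR m * INR l)%R)%C M) L).
Proof.
  assert (HE : forall x, Clim (fun n => RtoC (exp (- / INR (S n) * x))) 1).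
  { intros x. apply Clim_components; [|apply is_lim_seq_const].
    change (is_lim_seq (fun n => exp (- / INR (S n) * x)) 1).
    rewrite <- exp_0. apply (is_lim_seq_continuous exp); [apply derivable_continuous, derivable_exp|].
    apply is_lim_seq_ext with (fun n => - x / INR (S n)); [intros; unfold Rdiv; ring|apply is_lim_seq_scal_inv_S]. }
  unfold damped_sum. apply Clim_csum. intros l _.
  replace (csum (fun m => psi (Z.of_nat m) (Z.of_nat l) * g (INR m * INR l)%R)%C M) with
    (1 * csum (fun m => psi (Z.of_nat m) (Z.of_nat l) * (g (INR m * INR l)%R * 1))%C M)%C.
  - apply (Clim_mult (fun n => RtoC (exp (- / INR (S n) * INR l)))); [apply HE|].
    apply Clim_csum. intros m _. apply (Clim_scal _ (fun n => g (INR m * INR l)%R * RtoC (exp (- / INR (S n) * INR m)))%C).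
    apply (Clim_scal _ (fun n => RtoC (exp (- / INR (S n) * INR m)))). apply HE.
  - rewrite Cmult_1_l. apply csum_ext. intros; ring.
Qed.

Lemma frequency_neq_0 (q : nat) (k : Z) : (0 < q)%nat -> k <> 0%Z -> 2 * PI * IZR k / INR q <> 0.
Proof.
  intros Hq Hk H. assert (Q : 0 < INR q) by (apply lt_0_INR; lia). pose proof PI_RGT_0.
  apply Hk, eq_IZR. apply Rmult_eq_reg_l with (2 * PI / INR q).
  - rewrite Rmult_0_r, <- H. field. lra.
  - apply Rgt_not_eq. apply Rdiv_lt_0_compat; lra.
Qed.

(** The limit of the damped formula along [eps = 1 / (n + 1)] at fixed [N]: all sums in it are
    finite, so the limit is taken term by term. *)
Theorem double_poisson (A B : R) (G : nat -> R -> C) (q1 q2 M0 : nat) (psi : Z -> Z -> C) :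
  (0 < q1)%nat -> (0 < q2)%nat -> 0 < A <= B -> test_family A B G -> B <= INR M0 ->
  (forall l, periodic q1 (fun m => psi m l)) -> (forall m, periodic q2 (psi m)) ->
  (forall m l, Cmod (psi m l) <= 1) -> double_dft q1 q2 psi 0 0 = RtoC 0 ->
  exists K, 0 <= K /\ forall N, (0 < N)%nat ->
  Cmod (csum (fun l => csum (fun m => psi (Z.of_nat m) (Z.of_nat l) * G O (INR m * INR l)%R)%C M0) M0
    - RtoC (/ INR q1) * csum (fun l => dft q1 (fun m => psi m (Z.of_nat l)) 0 *
        (RtoC (/ INR l) * CInt (G O) A B))%C (q2 * N)
    - RtoC (/ INR q2) * csum (fun m => dft q2 (psi (Z.of_nat m)) 0 *
        (RtoC (/ INR m) * CInt (G O) A B))%C (q1 * N)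
    - RtoC (/ INR q1 * / INR q2) * dsum (quad (dual_term q1 q2 psi (bessel_limit A B (G O)))) N N) <= K / INR N.
Proof.
  intros Hq1 Hq2 HAB HG HM0 Hper1 Hper2 Hpsi H0.
  assert (CG : forall t, Cct (G O) t) by (intros; eapply Cder_Cct, HG).
  destruct (damped_double_poisson A B G q1 q2 M0 psi) as (K & HK & HP); auto.
  exists K. split; [assumption|]. intros N HN.
  assert (C0 : forall z : C, Cmod (z - 0) = Cmod z) by (intros; f_equal; ring).
  rewrite <- C0. apply (Clim_Cmod_le (fun n => damped_sum psi (G O) (/ INR (S n)) M0 M0
    - RtoC (/ INR q1) * first_sum q1 q2 psi (om A B (G O) (/ INR (S n))) 0 N
    - RtoC (/ INR q2) * second_sum q1 q2 psi (om A B (G O) (/ INR (S n)) 0) N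
    - RtoC (/ INR q1 * / INR q2) * dsum (quad (dual_term q1 q2 psi (fun x y =>
        bessel_transform A B (G O) (damp (/ INR (S n)) x) (damp (/ INR (S n)) y)))) N N)%C _ 0 (fun _ => K / INR N)).
  - apply Clim_minus; [apply Clim_minus; [apply Clim_minus|]|].
    + apply damped_sum_limit.
    + apply Clim_scal. unfold first_sum. apply Clim_csum. intros l _.
      apply (Clim_scal _ (fun n => om A B (G O) (/ INR (S n)) (2 * PI * IZR 0 / INR q1) (INR l))).
      replace (2 * PI * IZR 0 / INR q1) with 0 by (unfold Rdiv; ring). apply om_limit; assumption.
    + apply Clim_scal. unfold second_sum. apply Clim_csum. intros l _.
      apply (Clim_scal _ (fun n => om A B (G O) (/ INR (S n)) 0 (INR l))). apply om_limit; assumption.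
    + apply Clim_scal. unfold dsum. apply Clim_csum. intros i _. apply Clim_csum. intros j _.
      assert (HD : forall p k, p <> 0%Z -> k <> 0%Z ->
        Clim (fun n => dual_term q1 q2 psi (fun x y =>
          bessel_transform A B (G O) (damp (/ INR (S n)) x) (damp (/ INR (S n)) y)) p k)
          (dual_term q1 q2 psi (bessel_limit A B (G O)) p k)).
      { intros p k Hp Hk. unfold dual_term. apply (Clim_scal _ (fun n => bessel_transform A B (G O)
          (damp (/ INR (S n)) (2 * PI * IZR k / INR q2)) (damp (/ INR (S n)) (2 * PI * IZR p / INR q1)))).
        apply bessel_transform_limit; auto; now apply frequency_neq_0. }
      unfold quad. repeat apply Clim_plus; apply HD; lia.
  - apply is_lim_seq_const.
  - intros n. rewrite C0. apply HP; [|assumption]. split; [apply inv_INR_S_pos|].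
    rewrite <- Rinv_1. apply Rinv_le_contravar; [lra|apply (le_INR 1); lia].
Qed.

(** * Dirichlet convolutions as double sums *)

Lemma csum_delta (x : nat -> C) (a n : nat) :
  csum (fun k => if Nat.eqb a k then x k else RtoC 0) n = if Nat.ltb a n then x a else RtoC 0.
Proof.
  induction n as [|n IH]; [destruct (Nat.ltb_spec a 0); [lia|reflexivity]|].
  cbn [csum]. rewrite IH.
  destruct (Nat.ltb_spec a n), (Nat.eqb_spec a n), (Nat.ltb_spec a (S n)); try lia; subst; ring.
Qed.

(** Spreading the divisor sum over all pairs below a common bound [N] makes the sums over [n] and
    over the two factors interchangeable. *)
Lemma dconv_delta (f g : Z -> C) (n N : nat) : (0 < n <= N)%nat ->
  dconv f g n = csum (fun i => csum (fun j => if Nat.eqb (S i * S j) n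
    then f (Z.of_nat (S i)) * g (Z.of_nat (S j)) else RtoC 0)%C N) N.
Proof.
  intros Hn. unfold dconv.
  rewrite <- (csum_eventually_zero _ n N).
  - apply csum_ext. intros i _.
    destruct (Nat.eqb_spec (n mod S i) 0) as [H|H].
    + assert (E : n = (S i * (n / S i))%nat) by (rewrite (Nat.div_mod_eq n (S i)) at 1; lia).
      set (k := (n / S i)%nat) in *. assert (Hk : (0 < k)%nat) by nia.
      rewrite (csum_ext _ (fun j => if Nat.eqb (k - 1) j then (f (Z.of_nat (S i)) * g (Z.of_nat (S j)))%C else RtoC 0)).
      * rewrite (csum_delta (fun j => f (Z.of_nat (S i)) * g (Z.of_nat (S j)))%C).
        destruct (Nat.ltb_spec (k - 1) N); [|nia]. now replace (S (k - 1)) with k by lia.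
      * intros j _. destruct (Nat.eqb_spec (S i * S j) n), (Nat.eqb_spec (k - 1) j); try reflexivity; nia.
    + symmetry. apply csum_zero. intros j _. destruct (Nat.eqb_spec (S i * S j) n) as [E|E]; [|reflexivity].
      exfalso. apply H. rewrite <- E, Nat.mul_comm. apply Nat.Div0.mod_mul.
  - lia.
  - intros i Hi. rewrite Nat.mod_small by lia. destruct (Nat.eqb_spec n 0); [lia|reflexivity].
Qed.

Lemma dconv_sum (f g : Z -> C) (E : nat -> C) (N : nat) :
  csum (fun n => dconv f g (S n) * E (S n))%C N =
  dsum (fun i j => if Nat.leb (S i * S j) N
    then f (Z.of_nat (S i)) * g (Z.of_nat (S j)) * E (S i * S j)%nat else RtoC 0)%C N N.
Proof.
  unfold dsum.
  rewrite (csum_ext _ (fun n => csum (fun i => csum (fun j => if Nat.eqb (S i * S j) (S n)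
    then f (Z.of_nat (S i)) * g (Z.of_nat (S j)) * E (S n) else RtoC 0)%C N) N)).
  2:{ intros n Hn. rewrite (dconv_delta f g (S n) N) by lia.
      rewrite Cmult_comm, <- csum_scal. apply csum_ext. intros i _. rewrite <- csum_scal.
      apply csum_ext. intros j _. destruct (Nat.eqb _ _); ring. }
  rewrite csum_swap. apply csum_ext. intros i _. rewrite csum_swap. apply csum_ext. intros j _.
  rewrite (csum_ext _ (fun n => if Nat.eqb (S i * S j - 1) n
    then (f (Z.of_nat (S i)) * g (Z.of_nat (S j)) * E (S n))%C else RtoC 0)).
  - rewrite (csum_delta (fun n => f (Z.of_nat (S i)) * g (Z.of_nat (S j)) * E (S n))%C).
    destruct (Nat.ltb_spec (S i * S j - 1) N), (Nat.leb_spec (S i * S j) N); try lia; [|reflexivity].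
    now replace (S (S i * S j - 1)) with (S i * S j)%nat by lia.
  - intros n _. destruct (Nat.eqb_spec (S i * S j) (S n)), (Nat.eqb_spec (S i * S j - 1) n); try reflexivity; lia.
Qed.

(* The square [i, j <= N] and the hyperbolic region [i j <= N] give the same limit because of the cubic decay. *)
Lemma dconv_series (f g : Z -> C) (E : nat -> C) (K : R) :
  (forall x, Cmod (f x) <= 1) -> (forall x, Cmod (g x) <= 1) -> 0 <= K ->
  (forall n, (0 < n)%nat -> Cmod (E n) <= K / INR n ^ 3) ->
  Clim (fun N => dsum (fun i j => f (Z.of_nat (S i)) * g (Z.of_nat (S j)) * E (S i * S j)%nat)%C N N)
    (CSeries1 (fun n => dconv f g n * E n)%C).
Proof.
  intros Hf Hg HK HE.
  set (F := fun i j => (f (Z.of_nat (S i)) * g (Z.of_nat (S j)) * E (S i * S j)%nat)%C).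
  assert (P : forall i, 1 <= INR (S i)) by (intros; apply (le_INR 1); lia).
  assert (BF3 : forall i j, Cmod (F i j) <= K / INR (S i * S j) ^ 3).
  { intros i j. unfold F. rewrite !Cmod_mult. specialize (HE (S i * S j)%nat ltac:(lia)).
    specialize (Hf (Z.of_nat (S i))). specialize (Hg (Z.of_nat (S j))).
    pose proof (Cmod_ge_0 (f (Z.of_nat (S i)))). pose proof (Cmod_ge_0 (g (Z.of_nat (S j)))).
    pose proof (Cmod_ge_0 (E (S i * S j)%nat)).
    assert (Cmod (f (Z.of_nat (S i))) * Cmod (g (Z.of_nat (S j))) <= 1 * 1) by (apply Rmult_le_compat; lra).
    eapply Rle_trans; [|apply HE]. rewrite <- (Rmult_1_l (Cmod (E _))) at 2.
    apply Rmult_le_compat_r; lra. }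
  assert (BN : forall i j N, (N < S i * S j)%nat \/ N = O -> Cmod (F i j) <=
    K / INR (S N) * / (INR (S i) ^ 2 * INR (S j) ^ 2)).
  { intros i j N HN. eapply Rle_trans; [apply BF3|]. rewrite mult_INR.
    assert (Q : 0 < INR (S i) * INR (S j)) by (specialize (P i) as Pi; specialize (P j) as Pj; nra).
    assert (I2 : INR (S N) <= INR (S i) * INR (S j)).
    { rewrite <- mult_INR. apply le_INR. destruct HN as [HN| ->]; lia. }
    replace (K / INR (S N) * / (INR (S i) ^ 2 * INR (S j) ^ 2)) with
      (K * / (INR (S N) * (INR (S i) * INR (S j)) ^ 2)).
    2:{ specialize (P i) as Pi; specialize (P j) as Pj; specialize (P N) as PN. field. lra. }
    apply Rmult_le_compat_l; [assumption|]. apply Rinv_le_contravar.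
    - apply Rmult_lt_0_compat; [specialize (P N); lra|now apply pow_lt].
    - replace ((INR (S i) * INR (S j)) ^ 3) with (INR (S i) * INR (S j) * (INR (S i) * INR (S j)) ^ 2) by ring.
      apply Rmult_le_compat_r; [apply pow2_ge_0|assumption]. }
  assert (BF : forall i j, Cmod (F i j) <= K / (INR (S i) ^ 2 * INR (S j) ^ 2)).
  { intros i j. eapply Rle_trans; [apply (BN i j O); now right|]. right. simpl (INR 1). unfold Rdiv. now rewrite Rinv_1, Rmult_1_r. }
  destruct (Clim_Cauchy (fun N => dsum F N N) (8 * K)) as (l & Hl & _).
  { intros n m Hnm. replace m with (n + (m - n))%nat by lia. apply dsum_tail; assumption. }
  replace (CSeries1 (fun n => dconv f g n * E n)%C) with l; [exact Hl|].
  symmetry. apply Clim_CSeries1.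
  (* The pairs of the square beyond the hyperbola: there [(i + 1) (j + 1) > N], and one of the three
     factors [1 / ((i + 1) (j + 1))] pays for [1 / (N + 1)]. *)
  set (R0 := fun N => dsum (fun i j => if Nat.leb (S i * S j) N then RtoC 0 else F i j) N N).
  apply Clim_ext with (fun N => dsum F N N - R0 N)%C.
  - intros N. rewrite dconv_sum. unfold R0, dsum. rewrite <- csum_minus. apply csum_ext. intros i _.
    rewrite <- csum_minus. apply csum_ext. intros j _. unfold F. destruct (Nat.leb _ _); ring.
  - replace l with (l - 0)%C by ring. apply Clim_minus; [exact Hl|].
    apply Clim_squeeze with (fun N => 4 * K / INR (S N)); [|apply is_lim_seq_scal_inv_S].
    intros N. replace (R0 N - 0)%C with (R0 N) by ring. unfold R0, dsum.
    pose proof (P N) as PN.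
    assert (HS : forall m, rsum (fun i => / INR (S i) ^ 2) m <= 2).
    { intros m. pose proof (rsum_inv_sqr 0 m) as Hr. simpl INR in Hr at 2. rewrite Rdiv_1_r in Hr. exact Hr. }
    assert (KN : 0 <= K / INR (S N)) by (apply Rdiv_le_0_compat; lra).
    apply Rle_trans with (rsum (fun i => K / INR (S N) * 2 * / INR (S i) ^ 2) N).
    + apply csum_bound. intros i _.
      apply Rle_trans with (rsum (fun j => K / INR (S N) * / INR (S i) ^ 2 * / INR (S j) ^ 2) N).
      * apply csum_bound. intros j _. specialize (P i) as Pi. specialize (P j) as Pj.
        assert (T : K / INR (S N) * / INR (S i) ^ 2 * / INR (S j) ^ 2 =
          K / INR (S N) * / (INR (S i) ^ 2 * INR (S j) ^ 2)) by (field; lra).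
        rewrite T. destruct (Nat.leb_spec (S i * S j) N).
        -- rewrite Cmod_0. apply Rmult_le_pos; [assumption|]. left. apply Rinv_0_lt_compat.
           apply Rmult_lt_0_compat; apply pow_lt; lra.
        -- apply BN. now left.
      * rewrite rsum_scal. specialize (P i) as Pi.
        assert (0 <= / INR (S i) ^ 2) by (left; apply Rinv_0_lt_compat, pow_lt; lra).
        replace (K / INR (S N) * 2 * / INR (S i) ^ 2) with (K / INR (S N) * / INR (S i) ^ 2 * 2) by ring.
        apply Rmult_le_compat_l; [now apply Rmult_le_pos|apply HS].
    + rewrite rsum_scal. replace (4 * K / INR (S N)) with (K / INR (S N) * 2 * 2) by (field; lra).
      apply Rmult_le_compat_l; [lra|apply HS].
Qed.

(** * Smooth compactly supported functions and their Bessel integrals *)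

Lemma Derive_n_zero_loc (f : R -> R) (x : R) (n : nat) : locally x (fun t => f t = 0) -> Derive_n f n x = 0.
Proof.
  intros H. rewrite (Derive_n_ext_loc f (fun _ => 0)) by exact H.
  destruct n; [reflexivity|apply Derive_n_const].
Qed.

(** The support is enlarged so that [g] vanishes in a neighbourhood of every point outside the open
    interval, end points included; hence so do all its derivatives. *)
Lemma smooth_test_family (g : R -> C) (A B : R) : smooth_C g -> 0 < A ->
  (forall x, x < A \/ B < x -> g x = RtoC 0) ->
  exists G, G O = g /\ test_family (A / 2) (B + 1) G.
Proof.
  intros Hs HA Hz.
  exists (fun n => match n with O => g | _ =>
    fun x => (Derive_n (fun t => fst (g t)) n x, Derive_n (fun t => snd (g t)) n x) end).
  split; [reflexivity|]. split.
  - intros [|n] x; split; apply Derive_correct; [apply (Hs 1%nat x)|apply (Hs 1%nat x)|..];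
      apply (Hs (S (S n)) x).
  - intros n x Hx.
    assert (L : locally x (fun t => g t = RtoC 0)).
    { destruct Hx as [Hx|Hx].
      - apply filter_imp with (fun t => t < A); [auto|apply (open_lt A x); lra].
      - apply filter_imp with (fun t => B < t); [auto|apply (open_gt B x); lra]. }
    destruct n as [|n]; [exact (locally_singleton x _ L)|].
    apply C_ext; apply Derive_n_zero_loc; eapply filter_imp; try exact L; intros t Ht; simpl; now rewrite Ht.
Qed.

(** The Bessel factor is controlled only for [t > 0]; to the left of [A] the product is identically
    [0]. *)
Lemma Cct_mult_support (g F : R -> C) (A : R) (t : R) : 0 < A -> (forall t, Cct g t) ->
  (forall x, x <= A -> g x = RtoC 0) -> (forall t, 0 < t -> Cct F t) -> Cct (fun t => g t * F t)%C t.
Proof.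
  intros HA Hg Hz HF. destruct (Rlt_dec t A) as [H|H].
  - apply Cct_ext_loc with (fun _ => RtoC 0); [|apply Cct_const].
    apply filter_imp with (fun t => t < A); [|apply (open_lt A t); assumption].
    intros s Hs. rewrite Hz by lra. ring.
  - apply Cct_mult; [auto|apply HF; lra].
Qed.

Lemma Cint0oo_support (f : R -> C) (A B : R) : 0 <= A <= B -> (forall t, Cct f t) ->
  (forall x, x <= A \/ B <= x -> f x = RtoC 0) -> Cint0oo f = CInt f A B.
Proof.
  intros HAB Hf Hz. apply Clim_Cint0oo. destruct (INR_unbounded B) as [n0 Hn0].
  apply (is_lim_seq_incr_n (fun n => Cmod (CInt f 0 (INR n) - _)) n0 0).
  change (Clim (fun n => CInt f 0 (INR (n + n0))) (CInt f A B)).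
  apply Clim_ext with (fun _ => CInt f A B); [|apply Clim_const].
  intros n. symmetry. apply CInt_support; auto.
  apply Rle_trans with (INR n0); [lra|apply le_INR; lia].
Qed.

Lemma is_locally_pos (t : R) : 0 < t -> locally t (fun s => 0 < s).
Proof. apply (open_gt 0 t). Qed.

(** Continuity is read off from [bessel_kernel_cct]: the kernels for the signs [(+, +)], [(-, -)]
    and [(+, -)] are [- PI Y0 -+ i PI J0] and [2 K0], and these can be solved for [Y0], [J0] and
    [K0]. *)
Lemma bessel_continuous (x y : R) (X : R -> R) (t : R) : 0 < x -> 0 < y ->
  (forall t, 0 < t -> 0 < X t /\ X t * X t / 4 = t * (x * y)) -> 0 < t ->
  Cct (fun t => RtoC (BesselY0 (X t))) t /\ Cct (fun t => RtoC (BesselJ0 (X t))) t /\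
  Cct (fun t => RtoC (BesselK0 (X t))) t.
Proof.
  intros Hx Hy HX Ht. pose proof PI_RGT_0 as HPI.
  set (k := fun x y => bessel_kernel (clog_imag x + clog_imag y) (RtoC (- (x * y)))).
  assert (Ck : forall x y, Cct (k x y) t) by (intros; now apply bessel_kernel_cct).
  assert (E1 : forall s, 0 < s -> k x y s = (RtoC (- PI * BesselY0 (X s)) - RtoC (1 * PI * BesselJ0 (X s)) * Ci)%C).
  { intros s Hs. destruct (HX s Hs) as [X1 X2]. unfold k. rewrite (bessel_kernel_JY x y s (X s)); try assumption; [|nra].
    now destruct (Rlt_dec 0 x). }
  assert (E2 : forall s, 0 < s -> k (- x) (- y) s = (RtoC (- PI * BesselY0 (X s)) - RtoC (- 1 * PI * BesselJ0 (X s)) * Ci)%C).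
  { intros s Hs. destruct (HX s Hs) as [X1 X2]. unfold k. rewrite (bessel_kernel_JY (- x) (- y) s (X s)); try assumption; try nra.
    destruct (Rlt_dec 0 (- x)); [lra|reflexivity]. }
  assert (E3 : forall s, 0 < s -> k x (- y) s = RtoC (2 * BesselK0 (X s))).
  { intros s Hs. destruct (HX s Hs) as [X1 X2]. unfold k. rewrite (bessel_kernel_K x (- y) s (X s)); try assumption; try nra.
    reflexivity. }
  split; [|split].
  - apply Cct_ext_loc with (fun s => RtoC (- / (2 * PI)) * (k x y s + k (- x)%R (- y)%R s)%C)%C.
    + eapply filter_imp; [|apply (is_locally_pos t Ht)]. intros s Hs. rewrite E1, E2 by assumption.
      apply C_ext; simpl; field; lra.
    + apply Cct_mult; [apply Cct_const|apply Cct_plus; apply Ck].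
  - apply Cct_ext_loc with (fun s => (0%R, (/ (2 * PI))%R) * (k x y s - k (- x)%R (- y)%R s)%C)%C.
    + eapply filter_imp; [|apply (is_locally_pos t Ht)]. intros s Hs. rewrite E1, E2 by assumption.
      apply C_ext; simpl; field; lra.
    + apply Cct_mult; [apply Cct_const|apply Cct_minus; apply Ck].
  - apply Cct_ext_loc with (fun s => RtoC (/ 2) * k x (- y)%R s)%C.
    + eapply filter_imp; [|apply (is_locally_pos t Ht)]. intros s Hs. rewrite E3 by assumption.
      apply C_ext; simpl; field; lra.
    + apply Cct_mult; [apply Cct_const|apply Ck].
Qed.

Lemma bessel_limit_JY (A B : R) (g : R -> C) (X : R -> R) (x y : R) : 0 < A <= B -> (forall t, Cct g t) ->
  (forall t, 0 < t -> Cct (fun t => RtoC (BesselY0 (X t))) t /\ Cct (fun t => RtoC (BesselJ0 (X t))) t) ->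
  0 < x * y -> (forall t, 0 < t -> 0 < X t /\ X t * X t / 4 = t * (x * y)) ->
  bessel_limit A B g x y = (RtoC (- PI) * CInt (fun t => g t * RtoC (BesselY0 (X t)))%C A B
    - RtoC ((if Rlt_dec 0 x then 1 else - 1) * PI) * Ci * CInt (fun t => g t * RtoC (BesselJ0 (X t)))%C A B)%C.
Proof.
  intros HAB Hg HB Hxy HX. unfold bessel_limit. set (sg := if Rlt_dec 0 x then 1 else - 1).
  transitivity (CInt (fun t => RtoC (- PI) * (g t * RtoC (BesselY0 (X t))) -
    RtoC (sg * PI) * Ci * (g t * RtoC (BesselJ0 (X t))))%C A B).
  - apply CInt_ext; [lra|]. intros t Ht. destruct (HX t ltac:(lra)) as [X1 X2].
    rewrite (bessel_kernel_JY x y t (X t)) by (assumption || lra). fold sg. rewrite !RtoC_mult. ring.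
  - assert (C1 : forall t, A <= t <= B -> Cct (fun t => g t * RtoC (BesselY0 (X t)))%C t).
    { intros t Ht. apply Cct_mult; [auto|apply HB; lra]. }
    assert (C2 : forall t, A <= t <= B -> Cct (fun t => g t * RtoC (BesselJ0 (X t)))%C t).
    { intros t Ht. apply Cct_mult; [auto|apply HB; lra]. }
    rewrite (CInt_minus (fun t => RtoC (- PI) * (g t * RtoC (BesselY0 (X t))))%C
      (fun t => RtoC (sg * PI) * Ci * (g t * RtoC (BesselJ0 (X t))))%C); [|lra| |].
    + rewrite (CInt_scal _ (fun t => g t * RtoC (BesselY0 (X t)))%C),
        (CInt_scal _ (fun t => g t * RtoC (BesselJ0 (X t)))%C) by (lra || assumption). reflexivity.
    + intros; apply Cct_mult; [apply Cct_const|auto].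
    + intros; apply Cct_mult; [apply Cct_const|auto].
Qed.

Lemma bessel_limit_K (A B : R) (g : R -> C) (X : R -> R) (x y : R) : 0 < A <= B -> (forall t, Cct g t) ->
  (forall t, 0 < t -> Cct (fun t => RtoC (BesselK0 (X t))) t) ->
  x * y < 0 -> (forall t, 0 < t -> 0 < X t /\ X t * X t / 4 = t * - (x * y)) ->
  bessel_limit A B g x y = (RtoC 2 * CInt (fun t => g t * RtoC (BesselK0 (X t)))%C A B)%C.
Proof.
  intros HAB Hg HB Hxy HX. unfold bessel_limit.
  rewrite <- (CInt_scal _ (fun t => g t * RtoC (BesselK0 (X t)))%C); [|lra|].
  - apply CInt_ext; [lra|]. intros t Ht. destruct (HX t ltac:(lra)) as [X1 X2].
    rewrite (bessel_kernel_K x y t (X t)) by (assumption || lra). rewrite !RtoC_mult. ring.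
  - intros t Ht. apply Cct_mult; [auto|apply HB; lra].
Qed.

(** With [w = 2 PI / (c sqrt(D1' D2'))] the argument [2 w sqrt(n x)] is [Z_n(x)]. *)
Definition bessel_integral (g : R -> C) (w : R) (Bf : R -> R) (n : nat) : C :=
  Cint0oo (fun x => g x * RtoC (Bf (2 * w * sqrt (INR n * x))%R))%C.

Lemma bessel_argument (w : R) (n : nat) (t : R) : 0 < w -> (0 < n)%nat -> 0 < t ->
  0 < 2 * w * sqrt (INR n * t) /\
  2 * w * sqrt (INR n * t) * (2 * w * sqrt (INR n * t)) / 4 = t * (w * (w * INR n)).
Proof.
  intros Hw Hn Ht. assert (Hn0 : 0 < INR n) by (apply lt_0_INR; lia).
  assert (P : 0 < INR n * t) by nra. split.
  - apply Rmult_lt_0_compat; [lra|now apply sqrt_lt_R0].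
  - replace (2 * w * sqrt (INR n * t) * (2 * w * sqrt (INR n * t)) / 4) with
      (w * w * (sqrt (INR n * t) * sqrt (INR n * t))) by field.
    rewrite sqrt_sqrt by lra. ring.
Qed.

(** Only the product [x y = +- w^2 n] matters, and for equal signs also the sign of [x]; so the four
    sign choices of a frequency pair lead to three integrals depending on [n] alone. *)
Lemma bessel_limit_integral (A B : R) (G : nat -> R -> C) (w : R) (n : nat) :
  0 < A <= B -> test_family A B G -> 0 < w -> (0 < n)%nat ->
  (forall x y, 0 < x -> x * y = w * (w * INR n) -> bessel_limit A B (G O) x y =
    (- RtoC PI * bessel_integral (G O) w BesselY0 n - RtoC PI * Ci * bessel_integral (G O) w BesselJ0 n)%C) /\
  (forall x y, x < 0 -> x * y = w * (w * INR n) -> bessel_limit A B (G O) x y =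
    (- RtoC PI * bessel_integral (G O) w BesselY0 n + RtoC PI * Ci * bessel_integral (G O) w BesselJ0 n)%C) /\
  (forall x y, - (x * y) = w * (w * INR n) -> bessel_limit A B (G O) x y =
    (2 * bessel_integral (G O) w BesselK0 n)%C).
Proof.
  intros HAB HG Hw Hn. assert (CG : forall t, Cct (G O) t) by (intros; eapply Cder_Cct, HG).
  assert (Hn0 : 0 < INR n) by (apply lt_0_INR; lia).
  assert (Hwn : 0 < w * INR n) by nra. assert (Hp : 0 < w * (w * INR n)) by nra.
  set (X := fun t => 2 * w * sqrt (INR n * t)).
  assert (HX : forall t, 0 < t -> 0 < X t /\ X t * X t / 4 = t * (w * (w * INR n)))
    by (intros; now apply bessel_argument).
  assert (HB := fun t Ht => bessel_continuous w (w * INR n) X t Hw Hwn HX Ht).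
  assert (HI : forall Bf, (forall t, 0 < t -> Cct (fun t => RtoC (Bf (X t))) t) ->
    bessel_integral (G O) w Bf n = CInt (fun t => G O t * RtoC (Bf (X t)))%C A B).
  { intros Bf HBf. apply Cint0oo_support; [lra| |].
    - intros t. apply (Cct_mult_support (G O) (fun t => RtoC (Bf (X t))) A); auto; [lra|].
      intros x Hx. apply HG. now left.
    - intros x Hx. destruct HG as [_ HZ]. rewrite HZ by assumption. ring. }
  rewrite !HI by (intros t Ht; apply (HB t Ht)).
  split; [|split].
  - intros x y Hx Hxy. rewrite (bessel_limit_JY A B (G O) X x y); auto.
    + destruct (Rlt_dec 0 x); [|lra]. rewrite Rmult_1_l, RtoC_opp. reflexivity.
    + intros t Ht. split; apply (HB t Ht).
    + now rewrite Hxy.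
    + now rewrite Hxy.
  - intros x y Hx Hxy. rewrite (bessel_limit_JY A B (G O) X x y); auto.
    + destruct (Rlt_dec 0 x); [lra|]. rewrite RtoC_mult, !RtoC_opp. ring.
    + intros t Ht. split; apply (HB t Ht).
    + now rewrite Hxy.
    + now rewrite Hxy.
  - intros x y Hxy. rewrite (bessel_limit_K A B (G O) X x y); auto.
    + intros t Ht. apply (HB t Ht).
    + lra.
    + now rewrite Hxy.
Qed.

(** The limits at [(w, w n)] and [(- w, - w n)] are [- PI Y -+ i PI J]; their sum and difference
    isolate the two integrals, which inherit the cubic decay. *)
Lemma bessel_integral_bound (A B : R) (G : nat -> R -> C) (w : R) :
  0 < A <= B -> test_family A B G -> 0 < w ->
  exists K, 0 <= K /\ forall n, (0 < n)%nat ->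
    Cmod (bessel_integral (G O) w BesselY0 n) <= K / INR n ^ 3 /\
    Cmod (bessel_integral (G O) w BesselJ0 n) <= K / INR n ^ 3 /\
    Cmod (bessel_integral (G O) w BesselK0 n) <= K / INR n ^ 3.
Proof.
  intros HAB HG Hw. destruct (bessel_limit_bound A B G w HAB HG Hw) as (K & HK & HB).
  pose proof PI_RGT_0 as HPI. pose proof PI_4. pose proof PI2_1.
  assert (W6 : 0 < w ^ 6) by now apply pow_lt.
  exists (K / w ^ 6). split; [apply Rdiv_le_0_compat; assumption|]. intros n Hn.
  assert (Hn0 : 1 <= INR n) by (apply (le_INR 1); lia).
  destruct (bessel_limit_integral A B G w n HAB HG Hw Hn) as (E1 & E2 & E3).
  specialize (E1 w (w * INR n) Hw eq_refl). specialize (E2 (- w) (- (w * INR n)) ltac:(lra) ltac:(ring)).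
  specialize (E3 w (- (w * INR n)) ltac:(ring)).
  assert (HH : forall x y, Rabs x = w -> Rabs y = w * INR n ->
    Cmod (bessel_limit A B (G O) x y) <= K / w ^ 6 / INR n ^ 3).
  { intros x y Hx Hy. eapply Rle_trans; [apply HB; rewrite ?Hx, ?Hy; nra|].
    rewrite Hx, Hy. right. field. split; lra. }
  assert (A1 : Rabs w = w) by (apply Rabs_pos_eq; lra).
  assert (A2 : Rabs (w * INR n) = w * INR n) by (apply Rabs_pos_eq; nra).
  assert (B1 := HH w (w * INR n) A1 A2). 
  assert (B2 := HH (- w) (- (w * INR n)) ltac:(now rewrite Rabs_Ropp) ltac:(now rewrite Rabs_Ropp)).
  assert (B3 := HH w (- (w * INR n)) A1 ltac:(now rewrite Rabs_Ropp)).
  set (KK := K / w ^ 6 / INR n ^ 3) in *.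
  set (Y := bessel_integral (G O) w BesselY0 n) in *. set (J := bessel_integral (G O) w BesselJ0 n) in *.
  set (Q := bessel_integral (G O) w BesselK0 n) in *.
  set (b1 := bessel_limit A B (G O) w (w * INR n)) in *.
  set (b2 := bessel_limit A B (G O) (- w) (- (w * INR n))) in *.
  set (b3 := bessel_limit A B (G O) w (- (w * INR n))) in *.
  clearbody KK Y J Q b1 b2 b3.
  assert (KK0 : 0 <= KK) by (eapply Rle_trans; [apply Cmod_ge_0|exact B1]).
  assert (T1 : 2 * PI * Cmod Y <= 2 * KK).
  { rewrite <- Cmod_RtoC_mult by lra.
    replace (RtoC (2 * PI) * Y)%C with (- b1 - b2)%C by (rewrite E1, E2, RtoC_mult; ring).
    eapply Rle_trans; [apply Cmod_minus_le|]. rewrite Cmod_opp. lra. }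
  assert (T2 : 2 * PI * Cmod J <= 2 * KK).
  { replace (Cmod J) with (Cmod (Ci * J)%C).
    2:{ rewrite Cmod_mult. replace (Cmod Ci) with 1; [ring|].
        unfold Cmod, Ci; simpl. replace (0 * (0 * 1) + 1 * (1 * 1)) with 1 by ring. now rewrite sqrt_1. }
    rewrite <- Cmod_RtoC_mult by lra.
    replace (RtoC (2 * PI) * (Ci * J))%C with (b2 - b1)%C by (rewrite E1, E2, RtoC_mult; ring).
    eapply Rle_trans; [apply Cmod_minus_le|]. lra. }
  assert (T3 : 2 * Cmod Q <= KK).
  { rewrite <- Cmod_RtoC_mult by lra. rewrite <- E3. exact B3. }
  pose proof (Cmod_ge_0 Y). pose proof (Cmod_ge_0 J). pose proof (Cmod_ge_0 Q).
  assert (1 <= PI) by lra.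
  repeat split; nra.
Qed.

(** * The two terms with [L(1, .)] *)

Lemma squarefree_cofactor (D c : Z) : (0 < D)%Z -> (0 < c)%Z -> squarefree D ->
  exists A r, (0 < A)%Z /\ (0 < r)%Z /\ (0 < Z.gcd c D)%Z /\ D = (A * Z.gcd c D)%Z /\
    (D / Z.gcd c D = A)%Z /\ c = (r * Z.gcd c D)%Z /\ Z.gcd A c = 1%Z.
Proof.
  intros HD Hc Hsf. set (E := Z.gcd c D).
  assert (HE : (0 < E)%Z).
  { pose proof (Z.gcd_nonneg c D). assert (E <> 0%Z); [|unfold E in *; lia].
    intros H0. apply Z.gcd_eq_0_r in H0. lia. }
  destruct (Z.gcd_divide_l c D) as [r Hr]. destruct (Z.gcd_divide_r c D) as [A HA]. fold E in Hr, HA.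
  exists A, r. assert (HA0 : (0 < A)%Z) by nia. assert (Hr0 : (0 < r)%Z) by nia.
  repeat split; auto.
  - rewrite HA. now apply Z.div_mul; lia.
  (* A common divisor of [A] and [c] also divides [gcd(c, D)], so its square divides [D]. *)
  - set (d := Z.gcd A c). pose proof (Z.gcd_nonneg A c).
    assert (dA : (d | A)%Z) by apply Z.gcd_divide_l. assert (dc : (d | c)%Z) by apply Z.gcd_divide_r.
    fold d in H. clearbody d.
    assert (dE : (d | E)%Z).
    { apply Z.gcd_greatest; [assumption|]. rewrite HA. now apply Z.divide_mul_l. }
    assert (dd : (d * d | D)%Z).
    { destruct dA as [u Hu]. destruct dE as [v Hv]. exists (u * v)%Z. rewrite HA, Hu, Hv. ring. }
    apply Hsf in dd. nia.
Qed.

Lemma Clim_subseq (u : nat -> C) (l : C) (phi : nat -> nat) : (forall n, (n <= phi n)%nat) ->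
  Clim u l -> Clim (fun n => u (phi n)) l.
Proof.
  intros Hphi H. apply (is_lim_seq_subseq (fun n => Cmod (u n - l)) 0 phi); [|exact H].
  intros P [N HN]. exists N. intros n Hn. apply HN. specialize (Hphi n). lia.
Qed.

Lemma csum_shift (f : nat -> C) (n : nat) : csum f (S n) = (f O + csum (fun k => f (S k)) n)%C.
Proof.
  change (S n) with (1 + n)%nat. rewrite csum_add. cbn [csum]. rewrite Cplus_0_l. reflexivity.
Qed.

(** The complete sum over [u] vanishes unless [r = c / gcd(c, D)] divides [l]; at [l = r m] it
    contains the conjugate of [chi(a m A)], which is [0] for [A > 1]. Hence the indicator of
    [D | c], and the sum over the remaining [m] is the [L]-series. *)
Lemma main_term_limit (D D' a c : Z) (chi th : Z -> C) (q : nat) :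
  primitive_char D chi -> primitive_char D' th -> Z.gcd D D' = 1%Z -> (1 < D * D')%Z -> squarefree D ->
  (0 < D)%Z -> (0 < D')%Z -> (0 < c)%Z -> Z.gcd a c = 1%Z -> (0 < q)%nat -> (c | Z.of_nat q)%Z ->
  Clim (fun N => csum (fun l => th (Z.of_nat l) *
      psum (c * (D / Z.gcd c D)) (fun u => chi u * ez (a * Z.of_nat l * u) c) * RtoC (/ INR l))%C (q * S N))
    (indic (Z.eqb (c mod D) 0) * gauss_sum D chi * Cconj (chi a) * th (c * invmod D D')%Z *
      L1 (fun x => Cconj (chi x) * th x))%C.
Proof.
  intros Hchi Hth Hcop HDD Hsf HD HD' Hc Hac Hq Hcq.
  destruct (squarefree_cofactor D c HD Hc Hsf) as (A & r & HA & Hr & HE & ED & EA & Ec & GA).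
  rewrite EA. set (E := Z.gcd c D) in *.
  pose proof (proj1 Hchi) as Dchi. pose proof (proj1 Hth) as Dth.
  set (P := fun l => psum (c * A) (fun u => chi u * ez (a * l * u) c)%C).
  set (f := fun l => (th l * P l * RtoC (/ IZR l))%C).
  assert (PA : primitive_char (A * E) chi) by (now rewrite <- ED).
  destruct Hcq as [t Ht].
  assert (Ht0 : (0 < t)%Z) by nia.
  set (rn := Z.to_nat r). set (Ln := Z.to_nat (E * t)).
  assert (Hrn : Z.of_nat rn = r) by (unfold rn; lia).
  assert (HLn : Z.of_nat Ln = (E * t)%Z) by (unfold Ln; nia).
  assert (Eq : q = (rn * Ln)%nat) by nia.
  assert (HLp : (0 < Ln)%nat) by nia. assert (Hrp : (0 < rn)%nat) by lia.
  assert (Pz : forall l, ~ (r | l)%Z -> f l = RtoC 0).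
  { intros l Hl. unfold f, P. rewrite (character_mean_zero A E a c r l chi) by assumption. ring. }
  assert (Pm : forall m, P (r * m)%Z = (RtoC (IZR r) * (Cconj (chi (a * m * A)%Z) * gauss_sum D chi))%C).
  { intros m. unfold P. rewrite (character_mean_multiple A E a c r m chi) by assumption. now rewrite <- ED. }
  assert (Hr0 : IZR r <> 0) by (apply not_0_IZR; lia).
  assert (Tm : forall k, f (r * Z.of_nat (S k))%Z = (th r * gauss_sum D chi * Cconj (chi (a * A)%Z) *
     (Cconj (chi (Z.of_nat (S k))) * th (Z.of_nat (S k)) * RtoC (/ INR (S k))))%C).
  { intros k. unfold f. rewrite Pm, (dc_mul _ _ Dth), mult_IZR, <- INR_IZR_INZ.
    replace (a * Z.of_nat (S k) * A)%Z with (a * A * Z.of_nat (S k))%Z by ring.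
    rewrite (dc_mul _ _ Dchi (a * A)%Z), Cmult_conj, Rinv_mult, !RtoC_mult.
    assert (H1 : (RtoC (IZR r) * RtoC (/ IZR r))%C = RtoC 1) by (rewrite <- RtoC_mult, Rinv_r by assumption; reflexivity).
    transitivity (th r * th (Z.of_nat (S k)) * (Cconj (chi (a * A)%Z) * Cconj (chi (Z.of_nat (S k))) *
      gauss_sum D chi) * RtoC (/ INR (S k)) * (RtoC (IZR r) * RtoC (/ IZR r)))%C; [ring|]. rewrite H1. ring. }
  assert (S1 : Clim (fun L => csum (fun k => f (r * Z.of_nat (S k))%Z) L)
    (th r * gauss_sum D chi * Cconj (chi (a * A)%Z) * L1 (fun x => Cconj (chi x) * th x))%C).
  { apply Clim_ext with (fun L => th r * gauss_sum D chi * Cconj (chi (a * A)%Z) *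
      csum (fun k => Cconj (chi (Z.of_nat (S k))) * th (Z.of_nat (S k)) * RtoC (/ INR (S k)))%C L)%C.
    - intros L. rewrite <- csum_scal. apply csum_ext. intros k _. now rewrite Tm.
    - apply Clim_scal. apply (L1_convergent (D * D') (fun x => Cconj (chi x) * th x)%C); [nia| | |].
      + intros x. replace (x + D * D')%Z with (x + D' * D)%Z at 1 by ring.
        rewrite (zperiodic_mul D chi D' x) by now apply char_zperiodic.
        now rewrite (zperiodic_mul D' th D x) by now apply char_zperiodic.
      + intros x. rewrite Cmod_mult, Cmod_conj.
        pose proof (char_bound _ _ x Dchi). pose proof (char_bound _ _ x Dth).
        pose proof (Cmod_ge_0 (chi x)). pose proof (Cmod_ge_0 (th x)).
        apply Rle_trans with (1 * 1); [apply Rmult_le_compat; assumption|lra].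
      + now apply product_char_sum_0. }
  replace (indic _ * _ * _ * _ * _)%C with
    (th r * gauss_sum D chi * Cconj (chi (a * A)%Z) * L1 (fun x => Cconj (chi x) * th x))%C.
  (* [A = 1] means [D | c], and then [r = c / D] is congruent to [c] times the inverse of [D] modulo
     [D']. If [A > 1], both sides vanish, as [chi] is [0] at multiples of [A]. *)
  2:{ destruct (Z.eq_dec A 1) as [A1|A1].
      - assert (DE : D = E) by nia.
        replace (c mod D)%Z with 0%Z by (rewrite Ec, DE, Z.mod_mul; lia). simpl indic.
        replace (a * A)%Z with a by (rewrite A1; ring).
        replace (th (c * invmod D D')%Z) with (th r); [ring|].
        apply (zperiodic_eqm D'); [now apply char_zperiodic|].
        destruct (invmod_spec D D' HD' Hcop) as [u Hu].
        exists (- (r * u))%Z. rewrite Ec at 1. rewrite <- DE.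
        transitivity (- r * (D * invmod D D' - 1))%Z; [ring|]. rewrite Hu. ring.
      - destruct (Z.eqb_spec (c mod D) 0) as [H|H].
        + exfalso. apply Z.mod_divide in H; [|lia]. apply A1.
          assert ((D | E)%Z) by (apply Z.gcd_greatest; [assumption|apply Z.divide_refl]).
          apply Z.divide_pos_le in H0; nia.
        + simpl indic. rewrite (dc_zero _ _ Dchi (a * A)%Z); [rewrite Cconj_0; ring|].
          intros G. assert (AD : (A | Z.gcd (a * A) D)%Z).
          { apply Z.gcd_greatest; [apply Z.divide_factor_r|]. exists E. lia. }
          rewrite G in AD. apply Z.divide_1_r in AD. lia. }
  set (M := fun N => (q * S N)%nat).
  (* The sum over [l < M N] contains the zero term [l = 0] and misses [l = M N], which the sum over
     multiples includes; that last term is [O(1 / M N)]. *)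
  apply Clim_ext with (fun N => csum (fun k => f (r * Z.of_nat (S k))%Z) (Ln * S N) - f (Z.of_nat (M N)))%C.
  - intros N. rewrite <- Hrn. rewrite <- (csum_multiples f rn) by (rewrite ?Hrn; assumption).
    replace (rn * (Ln * S N))%nat with (M N) by (unfold M; nia).
    rewrite (csum_ext (fun l => th (Z.of_nat l) * psum (c * A) (fun u => chi u * ez (a * Z.of_nat l * u) c) *
      RtoC (/ INR l))%C (fun l => f (Z.of_nat l))).
    2:{ intros l _. unfold f, P. now rewrite <- INR_IZR_INZ. }
    fold (M N).
    assert (HS := csum_shift (fun l => f (Z.of_nat l)) (M N)). cbn [csum] in HS.
    replace (f (Z.of_nat 0)) with (RtoC 0) in HS by (unfold f; simpl; rewrite Rinv_0; ring).
    rewrite Cplus_0_l in HS. rewrite <- HS. ring.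
  - match goal with |- Clim _ ?l => replace l with (l - 0)%C by ring end.
    apply Clim_minus.
    + apply (Clim_subseq (fun L => csum (fun k => f (r * Z.of_nat (S k))%Z) L)); [nia|exact S1].
    + apply Clim_squeeze with (fun N => INR (Z.to_nat (c * A)) / INR (S N)); [|apply is_lim_seq_scal_inv_S].
      intros N. replace (f (Z.of_nat (M N)) - 0)%C with (f (Z.of_nat (M N))) by ring.
      unfold f. rewrite !Cmod_mult, Cmod_R, <- INR_IZR_INZ.
      assert (HM : 0 < INR (S N)) by (apply lt_0_INR; lia).
      assert (HMN : INR (S N) <= INR (M N)) by (apply le_INR; unfold M; nia).
      assert (HI : 0 < / INR (M N)) by (apply Rinv_0_lt_compat; lra).
      rewrite Rabs_pos_eq by lra. unfold Rdiv.
      assert (HP : Cmod (P (Z.of_nat (M N))) <= INR (Z.to_nat (c * A))).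
      { rewrite <- (Rmult_1_r (INR _)), <- rsum_const. apply csum_bound. intros k _.
        unfold ez. rewrite Cmod_mult, Cmod_e, Rmult_1_r. now apply (char_bound D). }
      pose proof (char_bound _ _ (Z.of_nat (M N)) Dth).
      pose proof (Cmod_ge_0 (th (Z.of_nat (M N)))). pose proof (Cmod_ge_0 (P (Z.of_nat (M N)))).
      apply Rmult_le_compat; [now apply Rmult_le_pos|lra| |apply Rinv_le_contravar; lra].
      apply Rle_trans with (1 * INR (Z.to_nat (c * A))); [apply Rmult_le_compat; assumption|lra].
Qed.

Lemma CSeries1_ext (u v : nat -> C) : (forall n, u n = v n) -> CSeries1 u = CSeries1 v.
Proof.
  intros H. unfold CSeries1.
  f_equal; apply f_equal, Lim_seq_ext; intros N; apply f_equal, csum_ext; intros; apply H.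
Qed.

(** * The discrete transform of the coefficients and the assembly of the formula *)

Lemma dft_psum (m : Z) (phi : Z -> C) (k : Z) : (0 < m)%Z ->
  dft (Z.to_nat m) phi k = psum m (fun u => phi u * ez (u * k) m)%C.
Proof.
  intros Hm. unfold dft, psum, ez. apply csum_ext. intros u _. do 2 f_equal.
  rewrite mult_IZR, <- INR_IZR_INZ, (INR_IZR_INZ (Z.to_nat m)), Z2Nat.id by lia. unfold Rdiv. ring.
Qed.

Lemma double_dft_psum (m1 m2 : Z) (psi : Z -> Z -> C) (p k : Z) : (0 < m1)%Z -> (0 < m2)%Z ->
  double_dft (Z.to_nat m1) (Z.to_nat m2) psi p k =
  psum m1 (fun u => psum m2 (fun v => psi u v * ez (u * p) m1 * ez (v * k) m2))%C.
Proof.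
  intros H1 H2. unfold double_dft. rewrite dft_swap, dft_psum by assumption.
  apply psum_ext. intros u _. rewrite dft_psum by assumption.
  rewrite Cmult_comm, <- psum_scal. apply psum_ext. intros; ring.
Qed.

Lemma char_minus_1 (m : Z) (chi : Z -> C) : dirichlet_char m chi -> Cconj (chi (-1)%Z) = chi (-1)%Z.
Proof.
  intros H. symmetry. apply (char_conj_inverse m); [assumption|]. now exists 0%Z.
Qed.

Lemma char_opp (m : Z) (chi : Z -> C) (x : Z) : dirichlet_char m chi -> chi (- x)%Z = (chi (-1)%Z * chi x)%C.
Proof. intros H. now rewrite <- (dc_mul _ _ H). Qed.

Lemma char_0 (m : Z) (chi : Z -> C) : dirichlet_char m chi -> (1 < m)%Z -> chi 0%Z = RtoC 0.
Proof. intros H Hm. apply (dc_zero _ _ H). rewrite Z.gcd_0_l. lia. Qed.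

(** [inv] inverts [x A] and [v] inverts [x], so [A inv] and [v] are congruent modulo [E]. *)
Lemma char_times_inverse (E A x inv v : Z) (chi : Z -> C) : dirichlet_char E chi ->
  (E | x * A * inv - 1)%Z -> (E | x * v - 1)%Z -> (chi A * chi (- inv)%Z)%C = chi (- v)%Z.
Proof.
  intros H [s Hs] [t Ht]. rewrite <- (dc_mul _ _ H). apply (zperiodic_eqm E); [now apply char_zperiodic|].
  exists (A * inv * t - v * s)%Z.
  transitivity (A * inv * (x * v - 1) - v * (x * A * inv - 1))%Z; [ring|]. rewrite Hs, Ht. ring.
Qed.

Lemma coprime_product_divides (x y c : Z) : Z.gcd x y = 1%Z -> (x | c)%Z -> (y | c)%Z -> (x * y | c)%Z.
Proof.
  intros G [u ->] Hy. rewrite Z.mul_comm in Hy.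
  apply Z.gauss in Hy; [|now rewrite Z.gcd_comm]. destruct Hy as [v ->]. exists v. ring.
Qed.

(* The pairs [(p, k)] with [p k > 0] give [Y0] and [J0], those with [p k < 0] give [K0]. *)
Lemma quad_dual_term (A1 A2 c inv : Z) (psi : Z -> Z -> C) (al be : Z -> C) (kap : C)
  (A B : R) (G : nat -> R -> C) (i j : nat) :
  (0 < A1)%Z -> (0 < A2)%Z -> (0 < c)%Z -> 0 < A <= B -> test_family A B G ->
  (forall p k, double_dft (Z.to_nat (c * A1)) (Z.to_nat (c * A2)) psi p k =
    (kap * (al p * be k) * ez (- inv * p * k) c)%C) ->
  (forall x, al (- x)%Z = (al (-1)%Z * al x)%C) -> (forall x, be (- x)%Z = (be (-1)%Z * be x)%C) ->
  let w := 2 * PI / (IZR c * sqrt (IZR (A1 * A2))) in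
  let n := (S i * S j)%nat in
  let ab := (al (Z.of_nat (S i)) * be (Z.of_nat (S j)))%C in
  let s := (al (-1)%Z * be (-1)%Z)%C in
  quad (dual_term (Z.to_nat (c * A1)) (Z.to_nat (c * A2)) psi (bessel_limit A B (G O))) i j =
  (kap * (- ((1 + s) * RtoC PI) * (ab * (ez (- inv * Z.of_nat n) c * bessel_integral (G O) w BesselY0 n))
    - (1 - s) * Ci * RtoC PI * (ab * (ez (- inv * Z.of_nat n) c * bessel_integral (G O) w BesselJ0 n))
    + 2 * (al (-1)%Z + be (-1)%Z) * (ab * (ez (inv * Z.of_nat n) c * bessel_integral (G O) w BesselK0 n))))%C.
Proof.
  intros HA1 HA2 Hc HAB HG Hd Ha Hb w n ab s.
  assert (RA : 0 < IZR (A1 * A2)) by (apply IZR_lt; nia).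
  assert (R1 : 0 < IZR A1) by (apply IZR_lt; lia). assert (R2 : 0 < IZR A2) by (apply IZR_lt; lia).
  assert (Rc : 0 < IZR c) by (apply IZR_lt; lia).
  assert (HS := sqrt_lt_R0 _ RA). assert (HS2 := sqrt_sqrt _ (Rlt_le _ _ RA)).
  set (sq := sqrt (IZR (A1 * A2))) in *. rewrite mult_IZR in HS2.
  pose proof PI_RGT_0 as HPI.
  assert (Hw : 0 < w) by (apply Rdiv_lt_0_compat; nra).
  assert (Hn : (0 < n)%nat) by (unfold n; lia).
  destruct (bessel_limit_integral A B G w n HAB HG Hw Hn) as (L1 & L2 & L3).
  set (I := Z.of_nat (S i)) in *. set (J := Z.of_nat (S j)) in *.
  assert (HI : 0 < IZR I) by (apply IZR_lt; lia). assert (HJ : 0 < IZR J) by (apply IZR_lt; lia).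
  assert (En : Z.of_nat n = (I * J)%Z) by (unfold n; lia).
  assert (EN : INR n = IZR I * IZR J) by (now rewrite INR_IZR_INZ, En, mult_IZR).
  assert (Eq1 : INR (Z.to_nat (c * A1)) = IZR c * IZR A1).
  { rewrite INR_IZR_INZ, Z2Nat.id by nia. apply mult_IZR. }
  assert (Eq2 : INR (Z.to_nat (c * A2)) = IZR c * IZR A2).
  { rewrite INR_IZR_INZ, Z2Nat.id by nia. apply mult_IZR. }
  (* The product of the two frequencies is [p k w^2], so the Bessel integrals depend only on
     [n = |p k|]. *)
  assert (Hxy : forall p k, 2 * PI * IZR k / (IZR c * IZR A2) * (2 * PI * IZR p / (IZR c * IZR A1)) =
    IZR p * IZR k * (w * w)).
  { intros p k. unfold w. replace (2 * PI / (IZR c * sq) * (2 * PI / (IZR c * sq))) with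
      (4 * PI * PI / (IZR c * IZR c * (sq * sq))) by (field; lra). rewrite HS2. field. lra. }
  assert (Hsg : forall k, 0 < IZR k -> 0 < 2 * PI * IZR k / (IZR c * IZR A2)).
  { intros k Hk. apply Rdiv_lt_0_compat; [|nra]. apply Rmult_lt_0_compat; lra. }
  unfold quad, dual_term. fold I J. rewrite !Hd, Eq1, Eq2.
  rewrite (L1 (2 * PI * IZR J / (IZR c * IZR A2)) (2 * PI * IZR I / (IZR c * IZR A1))).
  2:{ now apply Hsg. }
  2:{ rewrite Hxy, EN. ring. }
  rewrite (L2 (2 * PI * IZR (- J) / (IZR c * IZR A2)) (2 * PI * IZR (- I) / (IZR c * IZR A1))).
  2:{ rewrite opp_IZR. specialize (Hsg J HJ). unfold Rdiv in *. lra. }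
  2:{ rewrite Hxy, EN, !opp_IZR. ring. }
  rewrite (L3 (2 * PI * IZR (- J) / (IZR c * IZR A2)) (2 * PI * IZR I / (IZR c * IZR A1))).
  2:{ rewrite Hxy, EN, !opp_IZR. ring. }
  rewrite (L3 (2 * PI * IZR J / (IZR c * IZR A2)) (2 * PI * IZR (- I) / (IZR c * IZR A1))).
  2:{ rewrite Hxy, EN, !opp_IZR. ring. }
  rewrite (Ha I), (Hb J), En.
  replace (- inv * I * J)%Z with (- inv * (I * J))%Z by ring.
  replace (- inv * - I * - J)%Z with (- inv * (I * J))%Z by ring.
  replace (- inv * I * - J)%Z with (inv * (I * J))%Z by ring.
  replace (- inv * - I * J)%Z with (inv * (I * J))%Z by ring.
  unfold ab, s. ring.
Qed.

Lemma double_sum_stable (f : nat -> nat -> C) (M0 M : nat) : (M0 <= M)%nat ->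
  (forall l m, (M0 <= m)%nat \/ (M0 <= l)%nat -> f l m = RtoC 0) ->
  csum (fun l => csum (f l) M) M = csum (fun l => csum (f l) M0) M0.
Proof.
  intros HM Hf. rewrite (csum_eventually_zero _ M0 M HM).
  - apply csum_ext. intros l _. apply csum_eventually_zero; auto.
  - intros l Hl. apply csum_zero. auto.
Qed.

Lemma three_limits (X r1 r2 r3 U V W : C) (u v w : nat -> C) (K : R) :
  Clim u U -> Clim v V -> Clim w W ->
  (forall n, Cmod (X - r1 * u n - r2 * v n - r3 * w n) <= K / INR (S n)) ->
  X = (r1 * U + r2 * V + r3 * W)%C.
Proof.
  intros HU HV HW H.
  apply (Clim_unique (fun n => r1 * u n + r2 * v n + r3 * w n)%C).
  - apply Clim_squeeze with (fun n => K / INR (S n)); [|apply is_lim_seq_scal_inv_S].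
    intros n. rewrite Cmod_minus_sym. replace (X - _)%C with (X - r1 * u n - r2 * v n - r3 * w n)%C by ring. apply H.
  - repeat apply Clim_plus; now apply Clim_scal.
Qed.

(** By compact support [g] satisfies the cubic bound of [dconv_series] with the constant [Kg B^3],
    and the square partial sums are constant once they exceed [M0]. *)
Lemma convolution_sum (A B : R) (g : R -> C) (M0 : nat) (chi1 chi2 : Z -> C) (a c : Z) :
  0 < A <= B -> (forall t, Cct g t) -> (forall x, x <= A \/ B <= x -> g x = RtoC 0) -> B <= INR M0 ->
  (forall x, Cmod (chi1 x) <= 1) -> (forall x, Cmod (chi2 x) <= 1) ->
  CSeries1 (fun n => dconv chi1 chi2 n * (ez (a * Z.of_nat n) c * g (INR n)))%C =
  csum (fun l => csum (fun m => chi1 (Z.of_nat m) * chi2 (Z.of_nat l) * ez (a * Z.of_nat m * Z.of_nat l) c *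
    g (INR m * INR l)%R)%C M0) M0.
Proof.
  intros HAB Cg Hz HM0 B1 B2.
  destruct (Cct_bounded g A B ltac:(lra) (fun t _ => Cg t)) as (Kg & HKg & BG).
  assert (B3 : 0 <= B ^ 3) by (apply pow_le; lra).
  assert (S1 := dconv_series chi1 chi2 (fun n => ez (a * Z.of_nat n) c * g (INR n))%C (Kg * B ^ 3) B1 B2
    ltac:(now apply Rmult_le_pos)).
  lapply S1; [clear S1; intros S1|].
  2:{ intros n Hn. assert (Hn0 : 0 < INR n) by (apply lt_0_INR; lia).
      assert (Hn3 : 0 < INR n ^ 3) by now apply pow_lt.
      unfold ez. rewrite Cmod_mult, Cmod_e, Rmult_1_l.
      assert (T : 0 <= Kg * B ^ 3 / INR n ^ 3) by (apply Rdiv_le_0_compat; [now apply Rmult_le_pos|assumption]).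
      destruct (Rle_dec (INR n) A) as [H|H]; [rewrite Hz, Cmod_0 by auto; exact T|].
      destruct (Rle_dec B (INR n)) as [H'|H']; [rewrite Hz, Cmod_0 by auto; exact T|].
      eapply Rle_trans; [apply BG; lra|]. apply Rmult_le_reg_r with (INR n ^ 3); [assumption|].
      unfold Rdiv. rewrite Rmult_assoc, Rinv_l, Rmult_1_r by lra.
      apply Rmult_le_compat_l; [assumption|]. apply pow_incr. lra. }
  symmetry. refine (Clim_unique _ _ _ _ (Clim_subseq _ _ (fun n => (n + M0)%nat) (fun n => Nat.le_add_r n M0) S1)).
  set (f := fun l m => (chi1 (Z.of_nat m) * chi2 (Z.of_nat l) * ez (a * Z.of_nat m * Z.of_nat l) c *
    g (INR m * INR l)%R)%C).
  assert (Zf : forall l m, INR m * INR l <= A \/ B <= INR m * INR l -> f l m = RtoC 0).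
  { intros l m H. unfold f. rewrite Hz by assumption. ring. }
  apply Clim_ext with (fun _ => csum (fun l => csum (f l) M0) M0); [|apply Clim_const].
  intros n. set (N := (n + M0)%nat).
  rewrite <- (double_sum_stable f M0 (S N)).
  - rewrite csum_shift, csum_zero, Cplus_0_l.
    2:{ intros m _. apply Zf. left. simpl (INR 0). lra. }
    rewrite (csum_ext _ (fun l => csum (fun m => f (S l) (S m)) N)).
    + rewrite csum_swap. unfold dsum. apply csum_ext. intros i _. apply csum_ext. intros j _.
      unfold f. rewrite mult_INR, Nat2Z.inj_mul, Z.mul_assoc. ring.
    + intros l _. rewrite csum_shift, Zf; [ring|]. left. simpl (INR 0). lra.
  - unfold N. lia.
  - intros l m H. apply Zf. destruct m as [|m]; [left; simpl (INR 0); lra|].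
    destruct l as [|l]; [left; simpl (INR 0); lra|].
    right. assert (1 <= INR (S m)) by (apply (le_INR 1); lia).
    assert (1 <= INR (S l)) by (apply (le_INR 1); lia).
    destruct H as [H|H]; apply le_INR in H; nra.
Qed.

Lemma sqrt_eps (D : Z) (chi : Z -> C) : (0 < D)%Z -> (RtoC (sqrt (IZR D)) * eps D chi)%C = gauss_sum D chi.
Proof.
  intros HD. assert (H : 0 < sqrt (IZR D)) by (apply sqrt_lt_R0, IZR_lt; lia).
  unfold eps. transitivity (gauss_sum D chi * (RtoC (sqrt (IZR D)) * RtoC (/ sqrt (IZR D))))%C; [ring|].
  rewrite <- RtoC_mult, Rinv_r by lra. ring.
Qed.

(** Poisson summation yields Gauss sums divided by the product of the moduli; half of that division
    sits in the [eps] factors, the other half in the square root in front of [T]. *)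
Lemma eps_mult (D1 D2 : Z) (chi1 chi2 : Z -> C) : (0 < D1)%Z -> (0 < D2)%Z ->
  (eps D1 chi1 * eps D2 chi2 * RtoC (/ sqrt (IZR (D1 * D2))))%C =
  (gauss_sum D1 chi1 * gauss_sum D2 chi2 * RtoC (/ IZR (D1 * D2)))%C.
Proof.
  intros H1 H2. assert (P1 : 0 < IZR D1) by (apply IZR_lt; lia). assert (P2 : 0 < IZR D2) by (apply IZR_lt; lia).
  unfold eps. transitivity (gauss_sum D1 chi1 * gauss_sum D2 chi2 *
    (RtoC (/ sqrt (IZR D1)) * RtoC (/ sqrt (IZR D2)) * RtoC (/ sqrt (IZR (D1 * D2)))))%C; [ring|].
  f_equal. rewrite <- !RtoC_mult, mult_IZR, sqrt_mult by lra. f_equal.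
  rewrite <- (sqrt_sqrt (IZR D1)) at 3 by lra. rewrite <- (sqrt_sqrt (IZR D2)) at 3 by lra.
  assert (0 < sqrt (IZR D1)) by now apply sqrt_lt_R0. assert (0 < sqrt (IZR D2)) by now apply sqrt_lt_R0.
  field. lra.
Qed.

Lemma L1_ext (f g : Z -> C) : (forall x, f x = g x) -> L1 f = L1 g.
Proof. intros H. apply CSeries1_ext. intros n. now rewrite H. Qed.

Definition bessel_series (f g : Z -> C) (h : R -> C) (w : R) (Bf : R -> R) (k c : Z) : C :=
  CSeries1 (fun n => dconv f g n * (ez (k * Z.of_nat n) c * bessel_integral h w Bf n))%C.

Lemma bessel_series_limit (f g : Z -> C) (h : R -> C) (w : R) (Bf : R -> R) (k c : Z) (K : R) :
  (forall x, Cmod (f x) <= 1) -> (forall x, Cmod (g x) <= 1) -> 0 <= K ->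
  (forall n, (0 < n)%nat -> Cmod (bessel_integral h w Bf n) <= K / INR n ^ 3) ->
  Clim (fun N => dsum (fun i j => f (Z.of_nat (S i)) * g (Z.of_nat (S j)) *
      (ez (k * Z.of_nat (S i * S j)) c * bessel_integral h w Bf (S i * S j)))%C N N)
    (bessel_series f g h w Bf k c).
Proof.
  intros Hf Hg HK HB.
  apply (dconv_series f g (fun n => ez (k * Z.of_nat n) c * bessel_integral h w Bf n)%C K); try assumption.
  intros n Hn. unfold ez. rewrite Cmod_mult, Cmod_e, Rmult_1_l. now apply HB.
Qed.

Lemma dsum_lincomb (x0 x y z : C) (F G H Q : nat -> nat -> C) (N : nat) :
  (forall i j, F i j = (x0 * (x * G i j - y * H i j + z * Q i j))%C) ->
  dsum F N N = (x0 * (x * dsum G N N - y * dsum H N N + z * dsum Q N N))%C.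
Proof.
  intros E. unfold dsum.
  rewrite (csum_ext _ (fun i => x0 * (x * csum (G i) N - y * csum (H i) N + z * csum (Q i) N))%C).
  - now rewrite csum_scal, csum_plus, csum_minus, !csum_scal.
  - intros i _. rewrite (csum_ext _ (fun j => x0 * (x * G i j - y * H i j + z * Q i j))%C) by (intros; apply E).
    now rewrite csum_scal, csum_plus, csum_minus, !csum_scal.
Qed.

(** [twisted_double_dft], with the values at [A1], [A2] and [- inv] merged into values at the
    inverses of [a A2] modulo [E1] and of [a A1] modulo [E2]. *)
Lemma double_dft_twist (c a inv : Z) (chi1' chi1'' chi2' chi2'' : Z -> C) (A1 E1 A2 E2 p k : Z) :
  primitive_char A1 chi1' -> dirichlet_char E1 chi1'' ->
  primitive_char A2 chi2' -> dirichlet_char E2 chi2'' ->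
  (0 < A1)%Z -> (0 < A2)%Z -> (0 < c)%Z -> Z.gcd A1 c = 1%Z -> Z.gcd A2 c = 1%Z ->
  (E1 | c)%Z -> (E2 | c)%Z -> Z.gcd E1 E2 = 1%Z -> Z.gcd a c = 1%Z ->
  (c | a * A1 * A2 * inv - 1)%Z ->
  double_dft (Z.to_nat (c * A1)) (Z.to_nat (c * A2))
    (fun m l => chi1' m * chi1'' m * (chi2' l * chi2'' l) * ez (a * m * l) c)%C p k =
  (gauss_sum A1 chi1' * gauss_sum A2 chi2' * chi1' c * chi2' c *
     chi1'' (- invmod (a * A2) E1)%Z * chi2'' (- invmod (a * A1) E2)%Z * RtoC (IZR c) *
   (cmul_fun (cconj_fun chi1') chi2'' p * cmul_fun chi1'' (cconj_fun chi2') k) * ez (- inv * p * k) c)%C.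
Proof.
  intros H1 H1' H2 H2' HA1 HA2 Hc G1 G2 HE1 HE2 GE Ga Hinv.
  rewrite double_dft_psum by nia.
  rewrite (twisted_double_dft A1 A2 E1 E2 a c inv p k) by (try assumption; now apply coprime_product_divides).
  pose proof (dc_pos _ _ H1') as PE1. pose proof (dc_pos _ _ H2') as PE2.
  assert (T : forall A' E', (0 < E')%Z -> (E' | c)%Z -> Z.gcd A' c = 1%Z -> (E' | a * A' * invmod (a * A') E' - 1)%Z).
  { intros A' E' HE HEc HG. apply invmod_spec; [assumption|].
    apply gcd_divisor_1 with c; [now apply gcd_mul_1|assumption]. }
  rewrite <- (char_times_inverse E1 A1 (a * A2) inv (invmod (a * A2) E1) chi1''); [|assumption| |now apply T].
  2:{ replace (a * A2 * A1 * inv - 1)%Z with (a * A1 * A2 * inv - 1)%Z by ring. now apply Z.divide_trans with c. }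
  rewrite <- (char_times_inverse E2 A2 (a * A1) inv (invmod (a * A1) E2) chi2''); [|assumption| |now apply T].
  2:{ now apply Z.divide_trans with c. }
  rewrite (dc_mul _ _ H1'), (dc_mul _ _ H2'). unfold cmul_fun, cconj_fun. ring.
Qed.

Lemma dft_0_psum (m : Z) (phi : Z -> C) : (0 < m)%Z -> dft (Z.to_nat m) phi 0 = psum m phi.
Proof.
  intros Hm. rewrite dft_psum by assumption. apply psum_ext. intros u _.
  rewrite Z.mul_0_r. unfold ez, Rdiv. rewrite Rmult_0_l, e_0. ring.
Qed.

(** If [D | c] the cofactor [A] is [1] and the period [c A] is just [c]; otherwise both sides
    vanish. *)
Lemma main_term_coefficient (D A c : Z) : (0 < c)%Z -> (0 < D)%Z -> D = (A * Z.gcd c D)%Z ->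
  (indic (Z.eqb (c mod D) 0) * RtoC (/ INR (Z.to_nat (c * A))))%C = (indic (Z.eqb (c mod D) 0) / RtoC (IZR c))%C.
Proof.
  intros Hc HD H. assert (Rc : 0 < IZR c) by (apply IZR_lt; lia).
  destruct (Z.eqb_spec (c mod D) 0) as [H0|H0]; simpl indic; [|unfold Cdiv; ring].
  apply Z.mod_divide in H0; [|lia].
  assert (HE : (D | Z.gcd c D)%Z) by (apply Z.gcd_greatest; [assumption|apply Z.divide_refl]).
  pose proof (Z.gcd_nonneg c D). assert (HG : Z.gcd c D <> 0%Z) by (intros G0; rewrite G0 in H; lia).
  apply Z.divide_pos_le in HE; [|lia].
  assert (A = 1%Z) by nia. subst A. rewrite Z.mul_1_r, INR_IZR_INZ, Z2Nat.id by lia.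
  rewrite RtoC_inv by lra. unfold Cdiv. reflexivity.
Qed.

Theorem theoremA1
  (D1 D2 : Z) (chi1 chi2 chi1' chi1'' chi2' chi2'' : Z -> C)
  (c a : Z) (g : R -> C)
  (hD1 : (1 <= D1)%Z) (hD2 : (1 <= D2)%Z)
  (hnontriv : (1 < D1 * D2)%Z)
  (hsf1 : squarefree D1) (hsf2 : squarefree D2)
  (hcop : Z.gcd D1 D2 = 1%Z)
  (hchi1 : primitive_char D1 chi1) (hchi2 : primitive_char D2 chi2)
  (hc : (1 <= c)%Z) (hac : Z.gcd a c = 1%Z)
  (hchi1' : primitive_char (D1 / Z.gcd c D1) chi1')
  (hchi1'' : primitive_char (Z.gcd c D1) chi1'')
  (hfac1 : forall x : Z, chi1 x = Cmult (chi1' x) (chi1'' x))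
  (hchi2' : primitive_char (D2 / Z.gcd c D2) chi2')
  (hchi2'' : primitive_char (Z.gcd c D2) chi2'')
  (hfac2 : forall x : Z, chi2 x = Cmult (chi2' x) (chi2'' x))
  (hg_smooth : smooth_C g) (hg_supp : compact_supp_pos g) :
  let E1 := Z.gcd c D1 in
  let E2 := Z.gcd c D2 in
  let D1' := (D1 / E1)%Z in
  let D2' := (D2 / E2)%Z in
  let cR := IZR c in
  let Ig := Cint0oo g in
  let rho := dconv (cmul_fun (cconj_fun chi1') chi2'')
                   (cmul_fun chi1'' (cconj_fun chi2')) in
  let Zn := fun (n : nat) (x : R) =>
      (4 * PI * sqrt (INR n * x) / (cR * sqrt (IZR (D1' * D2'))))%R in
  let inv := invmod (a * D1' * D2') c in
  let SB := fun (sgn : R) (B : R -> R) =>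
      CSeries1 (fun n =>
        (rho n * e (sgn * IZR inv * INR n / cR)
          * Cint0oo (fun x => g x * RtoC (B (Zn n x))))%C) in
  let s := (chi1 (-1)%Z * chi2 (-1)%Z)%C in
  let T :=
      (- ((1 + s) * RtoC PI) * SB (-1)%R BesselY0
       - ((1 - s) * Ci * RtoC PI) * SB (-1)%R BesselJ0
       + 2 * (Cconj (chi1' (-1)%Z) * chi2'' (-1)%Z
              + chi1'' (-1)%Z * Cconj (chi2' (-1)%Z)) * SB 1%R BesselK0)%C in
  CSeries1 (fun n => (dconv chi1 chi2 n * e (IZR a * INR n / cR) * g (INR n))%C)
  =
  (indic (Z.eqb (c mod D1) 0)
     * RtoC (sqrt (IZR D1)) * eps D1 chi1 * Cconj (chi1 a)
     * chi2 (c * invmod D1 D2)%Z / RtoC cR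
     * L1 (cmul_fun (cconj_fun chi1) chi2) * Ig
   + indic (Z.eqb (c mod D2) 0)
     * RtoC (sqrt (IZR D2)) * eps D2 chi2 * chi1 (c * invmod D2 D1)%Z
     * chi2 (invmod a D2) / RtoC cR
     * L1 (cmul_fun chi1 (cconj_fun chi2)) * Ig
   + eps D1' chi1' * eps D2' chi2' * chi1' c * chi2' c
     * chi1'' (- invmod (a * D2') E1)%Z * chi2'' (- invmod (a * D1') E2)%Z
     / (RtoC cR * RtoC (sqrt (IZR (D1' * D2')))) * T)%C.
Proof.
  intros E1 E2 D1' D2' cR Ig rho Zn inv SB s T.
  destruct (squarefree_cofactor D1 c ltac:(lia) ltac:(lia) hsf1) as (A1 & r1 & HA1 & Hr1 & HE1 & ED1 & EA1 & Ec1 & GA1).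
  destruct (squarefree_cofactor D2 c ltac:(lia) ltac:(lia) hsf2) as (A2 & r2 & HA2 & Hr2 & HE2 & ED2 & EA2 & Ec2 & GA2).
  assert (M1 := main_term_limit D1 D2 a c chi1 chi2 (Z.to_nat (c * A2)) hchi1 hchi2 hcop hnontriv hsf1
    ltac:(lia) ltac:(lia) ltac:(lia) hac ltac:(nia) ltac:(rewrite Z2Nat.id by nia; apply Z.divide_factor_l)).
  assert (M2 := main_term_limit D2 D1 a c chi2 chi1 (Z.to_nat (c * A1)) hchi2 hchi1
    ltac:(now rewrite Z.gcd_comm) ltac:(lia) hsf2
    ltac:(lia) ltac:(lia) ltac:(lia) hac ltac:(nia) ltac:(rewrite Z2Nat.id by nia; apply Z.divide_factor_l)).
  rewrite EA1 in M1, hchi1'. rewrite EA2 in M2, hchi2'.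
  fold E1 in EA1, HE1, ED1, Ec1, hchi1''. fold E2 in EA2, HE2, ED2, Ec2, hchi2''.
  assert (FD1 : D1' = A1) by exact EA1. assert (FD2 : D2' = A2) by exact EA2.
  clearbody D1' D2'. subst D1' D2'.
  assert (Hc : (0 < c)%Z) by lia.
  pose proof (proj1 hchi1) as d1. pose proof (proj1 hchi2) as d2.
  pose proof (proj1 hchi1') as d1'. pose proof (proj1 hchi2') as d2'.
  pose proof (proj1 hchi1'') as d1''. pose proof (proj1 hchi2'') as d2''.
  assert (GE : Z.gcd E1 E2 = 1%Z).
  { apply gcd_divisor_1 with D2; [|apply Z.gcd_divide_r]. rewrite Z.gcd_comm.
    apply gcd_divisor_1 with D1; [now rewrite Z.gcd_comm|apply Z.gcd_divide_r]. }
  assert (Hinv : (c | a * A1 * A2 * inv - 1)%Z).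
  { apply invmod_spec; [assumption|]. now repeat apply gcd_mul_1. }
  set (psi := fun m l => (chi1 m * chi2 l * ez (a * m * l) c)%C).
  set (al := cmul_fun (cconj_fun chi1') chi2''). set (be := cmul_fun chi1'' (cconj_fun chi2')).
  set (kap := (gauss_sum A1 chi1' * gauss_sum A2 chi2' * chi1' c * chi2' c *
     chi1'' (- invmod (a * A2) E1)%Z * chi2'' (- invmod (a * A1) E2)%Z * RtoC (IZR c))%C).
  assert (HD : forall p k, double_dft (Z.to_nat (c * A1)) (Z.to_nat (c * A2)) psi p k =
    (kap * (al p * be k) * ez (- inv * p * k) c)%C).
  { intros p k. unfold kap, al, be. rewrite <- (double_dft_twist c a inv chi1' chi1'' chi2' chi2'' A1 E1 A2 E2 p k); try assumption.
    - rewrite !double_dft_psum by nia. apply psum_ext. intros u _. apply psum_ext. intros v _.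
      unfold psi. now rewrite hfac1, hfac2.
    - apply Z.gcd_divide_l.
    - apply Z.gcd_divide_l. }
  assert (Bal : forall x, Cmod (al x) <= 1).
  { intros x. unfold al, cmul_fun, cconj_fun. rewrite Cmod_mult, Cmod_conj.
    pose proof (char_bound _ _ x d1'). pose proof (char_bound _ _ x d2'').
    pose proof (Cmod_ge_0 (chi1' x)). pose proof (Cmod_ge_0 (chi2'' x)).
    apply Rle_trans with (1 * 1); [apply Rmult_le_compat; assumption|lra]. }
  assert (Bbe : forall x, Cmod (be x) <= 1).
  { intros x. unfold be, cmul_fun, cconj_fun. rewrite Cmod_mult, Cmod_conj.
    pose proof (char_bound _ _ x d2'). pose proof (char_bound _ _ x d1'').
    pose proof (Cmod_ge_0 (chi2' x)). pose proof (Cmod_ge_0 (chi1'' x)).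
    apply Rle_trans with (1 * 1); [apply Rmult_le_compat; assumption|lra]. }
  assert (Nal : forall x, al (- x)%Z = (al (-1)%Z * al x)%C).
  { intros x. unfold al, cmul_fun, cconj_fun. rewrite (char_opp _ _ x d1'), (char_opp _ _ x d2''), Cmult_conj. ring. }
  assert (Nbe : forall x, be (- x)%Z = (be (-1)%Z * be x)%C).
  { intros x. unfold be, cmul_fun, cconj_fun. rewrite (char_opp _ _ x d2'), (char_opp _ _ x d1''), Cmult_conj. ring. }
  assert (Es : (al (-1)%Z * be (-1)%Z)%C = s).
  { unfold s, al, be, cmul_fun, cconj_fun. rewrite hfac1, hfac2, (char_minus_1 _ _ d1'), (char_minus_1 _ _ d2'). ring. }
  (* The value at [(0, 0)] contains each of the four characters at [0]; it could be nonzero only if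
     all four moduli were [1], that is [D1 D2 = 1]. *)
  assert (Z00 : double_dft (Z.to_nat (c * A1)) (Z.to_nat (c * A2)) psi 0 0 = RtoC 0).
  { rewrite HD. unfold al, be, cmul_fun, cconj_fun.
    destruct (Z.eq_dec A1 1); [|rewrite (char_0 A1 chi1' d1') by lia; rewrite Cconj_0; ring].
    destruct (Z.eq_dec A2 1); [|rewrite (char_0 A2 chi2' d2') by lia; rewrite Cconj_0; ring].
    destruct (Z.eq_dec E1 1); [|rewrite (char_0 E1 chi1'' d1'') by lia; ring].
    destruct (Z.eq_dec E2 1); [|rewrite (char_0 E2 chi2'' d2'') by lia; ring].
    exfalso. nia. }
  destruct hg_supp as (A & B & HA & HAB & Hg0).
  destruct (smooth_test_family g A B hg_smooth HA Hg0) as (G & EG & HG).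
  set (A' := A / 2) in *. set (B' := B + 1) in *.
  assert (HAB' : 0 < A' <= B') by (unfold A', B'; lra).
  destruct (INR_unbounded B') as [M0 HM0].
  assert (Cg : forall t, Cct g t) by (intros t; rewrite <- EG; eapply Cder_Cct, HG).
  assert (Zg : forall x, x <= A' \/ B' <= x -> g x = RtoC 0) by (intros x Hx; rewrite <- EG; now apply HG).
  (* [c A1 = r1 D1] is a common period of [chi1] and of the exponential. *)
  assert (P1 : forall l, periodic (Z.to_nat (c * A1)) (fun m => psi m l)).
  { intros l m. unfold psi. rewrite Z2Nat.id by nia. f_equal; [f_equal|].
    - replace (c * A1)%Z with (r1 * D1)%Z by (rewrite Ec1 at 1; rewrite ED1 at 1; ring).
      apply zperiodic_mul. now apply char_zperiodic.
    - apply ez_eqm; [lia|]. exists (a * A1 * l)%Z. ring. }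
  assert (P2 : forall m, periodic (Z.to_nat (c * A2)) (psi m)).
  { intros m l. unfold psi. rewrite Z2Nat.id by nia. f_equal; [f_equal|].
    - replace (c * A2)%Z with (r2 * D2)%Z by (rewrite Ec2 at 1; rewrite ED2 at 1; ring).
      apply zperiodic_mul. now apply char_zperiodic.
    - apply ez_eqm; [lia|]. exists (a * A2 * m)%Z. ring. }
  assert (Bpsi : forall m l, Cmod (psi m l) <= 1).
  { intros m l. unfold psi, ez. rewrite !Cmod_mult, Cmod_e, Rmult_1_r.
    pose proof (char_bound _ _ m d1). pose proof (char_bound _ _ l d2).
    pose proof (Cmod_ge_0 (chi1 m)). pose proof (Cmod_ge_0 (chi2 l)).
    apply Rle_trans with (1 * 1); [apply Rmult_le_compat; assumption|lra]. }
  destruct (double_poisson A' B' G (Z.to_nat (c * A1)) (Z.to_nat (c * A2)) M0 psi ltac:(nia) ltac:(nia) HAB' HG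
    ltac:(lra) P1 P2 Bpsi Z00) as (K & HK & HP).
  rewrite EG in HP.
  set (w := 2 * PI / (IZR c * sqrt (IZR (A1 * A2)))).
  assert (RA1 : 0 < IZR A1) by (apply IZR_lt; lia). assert (RA2 : 0 < IZR A2) by (apply IZR_lt; lia).
  assert (Rc : 0 < IZR c) by (apply IZR_lt; lia).
  assert (RA : 0 < IZR (A1 * A2)) by (apply IZR_lt; nia).
  assert (HS := sqrt_lt_R0 _ RA).
  assert (Hw : 0 < w) by (apply Rdiv_lt_0_compat; [pose proof PI_RGT_0; lra|now apply Rmult_lt_0_compat]).
  destruct (bessel_integral_bound A' B' G w HAB' HG Hw) as (Kb & HKb & HB). rewrite EG in HB.
  assert (LY := bessel_series_limit al be g w BesselY0 (- inv) c Kb Bal Bbe HKb (fun n Hn => proj1 (HB n Hn))).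
  assert (LJ := bessel_series_limit al be g w BesselJ0 (- inv) c Kb Bal Bbe HKb (fun n Hn => proj1 (proj2 (HB n Hn)))).
  assert (LK := bessel_series_limit al be g w BesselK0 inv c Kb Bal Bbe HKb (fun n Hn => proj2 (proj2 (HB n Hn)))).
  set (SY := bessel_series al be g w BesselY0 (- inv) c) in *.
  set (SJ := bessel_series al be g w BesselJ0 (- inv) c) in *.
  set (SK := bessel_series al be g w BesselK0 inv c) in *.
  assert (LD : Clim (fun N => dsum (quad (dual_term (Z.to_nat (c * A1)) (Z.to_nat (c * A2)) psi (bessel_limit A' B' g))) N N)
    (kap * (- ((1 + s) * RtoC PI) * SY - (1 - s) * Ci * RtoC PI * SJ + 2 * (al (-1)%Z + be (-1)%Z) * SK))%C).
  { assert (HQ := fun i j => quad_dual_term A1 A2 c inv psi al be kap A' B' G i j HA1 HA2 Hc HAB' HG HD Nal Nbe).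
    cbv zeta in HQ. fold w in HQ. rewrite EG, Es in HQ. eapply Clim_ext.
    - intros N. symmetry. apply dsum_lincomb. intros i j. apply HQ.
    - apply Clim_scal, Clim_plus; [apply Clim_minus|]; now apply Clim_scal. }
  assert (HSB : forall (sgn : Z) Bf, SB (IZR sgn) Bf = bessel_series al be g w Bf (sgn * inv) c).
  { intros sgn Bf. unfold SB, bessel_series, rho. apply CSeries1_ext. intros n. fold al be.
    rewrite <- Cmult_assoc. f_equal. f_equal.
    - unfold ez, cR. f_equal. rewrite !mult_IZR, <- INR_IZR_INZ. reflexivity.
    - unfold bessel_integral. apply Cint0oo_ext. intros x.
      replace (Zn n x) with (2 * w * sqrt (INR n * x)); [reflexivity|].
      unfold Zn, w, cR. field. lra. }
  set (r1' := RtoC (/ INR (Z.to_nat (c * A1)))). set (r2' := RtoC (/ INR (Z.to_nat (c * A2)))).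
  assert (EIg : CInt g A' B' = Ig).
  { symmetry. apply Cint0oo_support; [lra|assumption|assumption]. }
  assert (ER : forall N, csum (fun l => dft (Z.to_nat (c * A1)) (fun m => psi m (Z.of_nat l)) 0 *
      (RtoC (/ INR l) * CInt g A' B'))%C N =
    (Ig * csum (fun l => chi2 (Z.of_nat l) * psum (c * A1) (fun u => chi1 u * ez (a * Z.of_nat l * u) c) *
      RtoC (/ INR l))%C N)%C).
  { intros N. rewrite <- csum_scal. apply csum_ext. intros l _. rewrite EIg, dft_0_psum by nia.
    rewrite <- psum_scal.
    rewrite (psum_ext _ _ (fun u => chi2 (Z.of_nat l) * (chi1 u * ez (a * Z.of_nat l * u) c))%C); [ring|].
    intros u _. unfold psi. replace (a * u * Z.of_nat l)%Z with (a * Z.of_nat l * u)%Z by ring. ring. }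
  assert (EC : forall N, csum (fun m => dft (Z.to_nat (c * A2)) (psi (Z.of_nat m)) 0 *
      (RtoC (/ INR m) * CInt g A' B'))%C N =
    (Ig * csum (fun l => chi1 (Z.of_nat l) * psum (c * A2) (fun u => chi2 u * ez (a * Z.of_nat l * u) c) *
      RtoC (/ INR l))%C N)%C).
  { intros N. rewrite <- csum_scal. apply csum_ext. intros l _. rewrite EIg, dft_0_psum by nia.
    rewrite <- psum_scal.
    rewrite (psum_ext _ _ (fun u => chi1 (Z.of_nat l) * (chi2 u * ez (a * Z.of_nat l * u) c))%C); [ring|].
    intros u _. unfold psi. ring. }
  (* The truncation is [S n], because [double_poisson] is stated for positive [N]. *)
  assert (HX := three_limits
    (csum (fun l => csum (fun m => psi (Z.of_nat m) (Z.of_nat l) * g (INR m * INR l)%R)%C M0) M0)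
    r1' r2' (RtoC (/ INR (Z.to_nat (c * A1)) * / INR (Z.to_nat (c * A2)))) _ _ _ _ _ _ K
    (Clim_scal Ig _ _ M1) (Clim_scal Ig _ _ M2) (Clim_subseq _ _ S Nat.le_succ_diag_r LD)).
  lapply HX; [clear HX; intros HX|].
  2:{ intros n. specialize (HP (S n) ltac:(lia)). rewrite ER, EC in HP. exact HP. }
  transitivity (CSeries1 (fun n => dconv chi1 chi2 n * (ez (a * Z.of_nat n) c * g (INR n)))%C).
  { apply CSeries1_ext. intros n. rewrite <- Cmult_assoc. f_equal. f_equal.
    unfold ez, cR. now rewrite mult_IZR, <- INR_IZR_INZ. }
  rewrite (convolution_sum A' B' g M0 chi1 chi2 a c HAB' Cg Zg ltac:(lra)
    (fun x => char_bound _ _ x d1) (fun x => char_bound _ _ x d2)).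
  etransitivity; [exact HX|]. clear HX.
  assert (I1 := main_term_coefficient D1 A1 c Hc ltac:(lia) ED1). fold r1' cR in I1.
  assert (I2 := main_term_coefficient D2 A2 c Hc ltac:(lia) ED2). fold r2' cR in I2.
  f_equal; [f_equal|].
  - rewrite <- (sqrt_eps D1 chi1) by lia.
    transitivity (indic (c mod D1 =? 0)%Z * r1' * (RtoC (sqrt (IZR D1)) * eps D1 chi1 * Cconj (chi1 a)
      * chi2 (c * invmod D1 D2)%Z * L1 (cmul_fun (cconj_fun chi1) chi2) * Ig))%C.
    + unfold cmul_fun, cconj_fun. ring.
    + rewrite I1. unfold Cdiv. ring.
  - rewrite <- (sqrt_eps D2 chi2) by lia.
    rewrite (L1_ext _ (cmul_fun chi1 (cconj_fun chi2))) by (intros x; unfold cmul_fun, cconj_fun; ring).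
    transitivity (indic (c mod D2 =? 0)%Z * r2' * (RtoC (sqrt (IZR D2)) * eps D2 chi2 * chi1 (c * invmod D2 D1)%Z
      * Cconj (chi2 a) * L1 (cmul_fun chi1 (cconj_fun chi2)) * Ig))%C; [ring|].
    (* When [D2 | c], the integer [a] is a unit modulo [D2], and the conjugate of [chi2 a] is the
       value at the inverse of [a]; otherwise the indicator removes the term. *)
    rewrite I2. destruct (Z.eqb_spec (c mod D2) 0) as [H0|H0]; simpl indic; [|unfold Cdiv; ring].
    rewrite (char_conj_inverse D2 chi2 a (invmod a D2) d2).
    + unfold Cdiv. ring.
    + apply invmod_spec; [lia|]. apply gcd_divisor_1 with c; [assumption|].
      apply Z.mod_divide; [lia|assumption].
  - unfold T. rewrite (HSB (-1)%Z BesselY0), (HSB (-1)%Z BesselJ0), (HSB 1%Z BesselK0).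
    change (-1 * inv)%Z with (- inv)%Z. rewrite Z.mul_1_l. fold SY SJ SK.
    change (Cconj (chi1' (-1)%Z) * chi2'' (-1)%Z + chi1'' (-1)%Z * Cconj (chi2' (-1)%Z))%C with
      (al (-1)%Z + be (-1)%Z)%C.
    rewrite Cmult_assoc. f_equal.
    assert (EE := eps_mult A1 A2 chi1' chi2' HA1 HA2).
    set (P := (chi1' c * chi2' c * chi1'' (- invmod (a * A2) E1)%Z * chi2'' (- invmod (a * A1) E2)%Z)%C).
    transitivity (eps A1 chi1' * eps A2 chi2' * RtoC (/ sqrt (IZR (A1 * A2))) * (P * RtoC (/ cR)))%C.
    (* The factor [c] inside [kap] cancels one of the two factors [1 / c] coming from the periods
       [c A1] and [c A2]. *)
    + rewrite EE, !INR_IZR_INZ, !Z2Nat.id, !mult_IZR by nia.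
      transitivity (gauss_sum A1 chi1' * gauss_sum A2 chi2' * P *
        (RtoC (/ (IZR c * IZR A1) * / (IZR c * IZR A2)) * RtoC (IZR c)))%C; [unfold kap, P; ring|].
      transitivity (gauss_sum A1 chi1' * gauss_sum A2 chi2' * P *
        (RtoC (/ (IZR A1 * IZR A2)) * RtoC (/ cR)))%C; [|ring].
      f_equal. rewrite <- !RtoC_mult. f_equal. unfold cR. field. lra.
    + assert (cR <> 0) by (unfold cR; lra).
      rewrite (RtoC_inv cR), (RtoC_inv (sqrt _)) by lra. unfold P. field.
      split; intros H0; apply RtoC_inj in H0; lra.
Qed.
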